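(* Let $\mathcal{A}=(\mathcal{A}_1,\dots,\mathcal{A}_n)$ be a family of finite sets in $(\mathbb{Z}_{\ge 0})^n$ such that (H1) $0\notin\mathcal{A}_j$ for every $1\le j\le n$; (H2) for all $I\subset\{1,\dots,n\}$, if $J_I:=\{j\in\{1,\dots,n\}\mid\exists a\in\mathcal{A}_j:\ a_i=0\ \forall i\in I\}$, then $\#I+\#J_I\ge n$. Let $\mathbf{f}=(f_1,\dots,f_n)$ be a system of generic sparse polynomials in $\mathbb{C}[x_1,\dots,x_n]$ supported on $\mathcal{A}$. For $M\in\mathbb{Z}_{>0}$ let $\Delta_M:=\{Me_i\}_{i=1}^n$ and, for $1\le j\le n$, $\mathcal{A}_j^{\Delta_M}:=\mathcal{A}_j\cup\Delta_M$ and $\mathcal{A}_j^{\Delta_M,0}:=\mathcal{A}_j^{\Delta_M}\cup\{0\}$; set $\mathcal{A}^{\Delta_M}:=(\mathcal{A}_1^{\Delta_M},\dots,\mathcal{A}_n^{\Delta_M})$ and $\mathcal{A}^{\Delta_M,0}:=(\mathcal{A}_1^{\Delta_M,0},\dots,\mathcal{A}_n^{\Delta_M,0})$. Then $0$ is an isolated common zero of $\mathbf{f}$ and, for every $M\gg 0$, its multiplicity is $$\mathrm{mult}_0(\mathbf{f})=MV_n(\mathcal{A}^{\Delta_M,0})-MV_n(\mathcal{A}^{\Delta_M}).$$ Moreover, the identity holds for every $M>\mathrm{mult}_0(\mathbf{f})$. In particular, it suffices to take $M=MV_n(\mathcal{A}^0)-MV_n(\mathcal{A})+1$, where $\mathc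al{A}^0=(\mathcal{A}_1\cup\{0\},\dots,\mathcal{A}_n\cup\{0\})$.
   Context: $e_i$ is the $i$th canonical basis vector. A system supported on $\mathcal{A}$ is $\mathbf{f}=(f_1,\dots,f_n)$ with $f_j=\sum_{a\in\mathcal{A}_j}c_{j,a}x^a$ and all $c_{j,a}\in\mathbb{C}\setminus\{0\}$. A statement holds for a generic system supported on $\mathcal{A}$ if it holds for all coefficient vectors in some non-empty Zariski open subset of $\mathbb{C}^{\#\mathcal{A}_1}\times\dots\times\mathbb{C}^{\#\mathcal{A}_n}$. For an isolated zero $\zeta$ of $\mathbf{f}$, $\mathrm{mult}_\zeta(\mathbf{f})=\dim_{\mathbb{C}}\mathbb{C}[x]_{\mathfrak{m}_\zeta}/(f_1,\dots,f_n)\mathbb{C}[x]_{\mathfrak{m}_\zeta}$, with $\mathfrak{m}_\zeta=(x_1-\zeta_1,\dots,x_n-\zeta_n)$. Mixed volume: $MV_n(\mathcal{A}_1,\dots,\mathcal{A}_n)=\sum_{J\subset\{1,\dots,n\}}(-1)^{n-\#J}\mathrm{Vol}_n\big(\sum_{j\in J}\mathrm{conv}(\mathcal{A}_j)\big)$, with Minkowski sums (the empty $J$ contributes $0$). *)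

(* Defs.v *)
From mathcomp Require Import all_boot all_order all_algebra.
From mathcomp Require Import finmap.
From mathcomp Require Import all_classical all_reals all_analysis.
From mathcomp Require Import complex.
(* The notations of mpoly clash with those of MathComp-Analysis. *)
From mathcomp Require Import -(notations) mpoly.

Set Implicit Arguments.
Unset Strict Implicit.
Unset Printing Implicit Defensive.

Import Order.TTheory GRing.Theory Num.Theory.
Import numFieldNormedType.Exports.

Local Open Scope classical_set_scope.
Local Open Scope ring_scope.

Notation "''NN^' n" := (multinom n)
  (at level 8, n at level 2, format "''NN^' n") : type_scope.
Notation "{ 'mpol' K [ n ] }" := (mpoly n K)
  (at level 0, K at level 2, n at level 2, format "{ 'mpol'  K [ n ] }")
  : type_scope.

Section Supports.
Variable n : nat.
Implicit Types (A : 'I_n -> {fset 'NN^n}) (I : {set 'I_n}).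

Definition J_ A I : {set 'I_n} :=
  finset (fun j => [exists a : A j, [forall i in I, val a i == 0%N]]).

Definition H1 A : Prop := forall j, mnm0 \notin A j.

Definition H2 A : Prop := forall I, (n <= #|I| + #|J_ A I|)%N.

Definition Delta (M : nat) : {fset 'NN^n} :=
  [fset mnm_muln (mnm1 i) M | i in 'I_n]%fset.

Definition add_Delta M A : 'I_n -> {fset 'NN^n} :=
  fun j => (A j `|` Delta M)%fset.

Definition add_zero A : 'I_n -> {fset 'NN^n} :=
  fun j => (A j `|` [fset mnm0])%fset.

End Supports.

Section MixedVolume.
Variable R : realType.

(* Lebesgue measure on R^n, as the n-fold product of the Lebesgue measure of
   the line: each step is the formula by which the library defines the product
   of two measures, namely integrating the measures of the sections.  It is
   applied below to polytopes only. *)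
Fixpoint Vol n : set 'rV[R]_n -> \bar R :=
  if n is n'.+1 then
    fun K => (\int[lebesgue_measure]_x
      Vol [set v : 'rV[R]_n' | K (row_mx (x%:M : 'rV[R]_1) v)])%E
  else fun K => (\1_K (0 : 'rV[R]_0))%:E.

Variable n : nat.

Definition point (a : 'NN^n) : 'rV[R]_n := \row_i (a i)%:R.

Definition conv (S : {fset 'NN^n}) : set 'rV[R]_n :=
  [set \sum_(a : S) w a *: point (val a) | w in
    [set w : S -> R | (forall a, 0 <= w a) /\ \sum_(a : S) w a = 1]].

Definition minkowski_sum (J : {set 'I_n}) (K : 'I_n -> set 'rV[R]_n) :
    set 'rV[R]_n :=
  [set \sum_(j in J) p j | p in
    [set p : 'I_n -> 'rV[R]_n | forall j, j \in J -> K j (p j)]].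

Definition MV (A : 'I_n -> {fset 'NN^n}) : R :=
  \sum_(J : {set 'I_n} | (0 < #|J|)%N) (-1) ^+ (n - #|J|) *
    fine (Vol (minkowski_sum J (fun j => conv (A j)))).

End MixedVolume.

Section Multiplicity.

Definition ideal_gen (B : comNzRingType) (m : nat) (g : 'I_m -> B) : set B :=
  [set \sum_i h i * g i | h in [set: 'I_m -> B]].

Variables (K : numFieldType) (n : nat).

Definition common_zeros (f : 'I_n -> {mpol K[n]}) : set 'rV[K]_n :=
  [set z | forall j, meval (fun i => z 0 i) (f j) = 0].

Definition isolated_zero (f : 'I_n -> {mpol K[n]}) (z : 'rV[K]_n) : Prop :=
  isolated (common_zeros f) z.

Definition max_ideal (z : 'rV[K]_n) : set {mpol K[n]} :=
  ideal_gen (fun i => mpolyX K (mnm1 i) - mpolyC n (z 0 i)).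

(* The localization at max_ideal z, inside the field of rational functions. *)
Definition local_ring (z : 'rV[K]_n) : set {fraction {mpol K[n]}} :=
  [set tofrac pq.1 / tofrac pq.2 | pq in
    [set pq : {mpol K[n]} * {mpol K[n]} | ~ max_ideal z pq.2]].

Definition local_ideal (f : 'I_n -> {mpol K[n]}) (z : 'rV[K]_n) :
    set {fraction {mpol K[n]}} :=
  [set \sum_j h j * tofrac (f j) | h in
    [set h : 'I_n -> {fraction {mpol K[n]}} | forall j, local_ring z (h j)]].

(* dim_K (V / W) = d: the classes of the e i form a basis of V / W. *)
Definition quotient_dim (V W : set {fraction {mpol K[n]}}) (d : nat) : Prop :=
  let lin (e : 'I_d -> {fraction {mpol K[n]}}) (c : 'I_d -> K) :=
    \sum_i tofrac (mpolyC n (c i)) * e i in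
  exists e : 'I_d -> {fraction {mpol K[n]}},
    [/\ forall i, V (e i),
        forall v, V v -> exists c, W (v - lin e c)
      & forall c, W (lin e c) -> forall i, c i = 0].

(* A relation rather than a function, so that it asserts finite dimension. *)
Definition has_mult (f : 'I_n -> {mpol K[n]}) (z : 'rV[K]_n) (m : nat) : Prop :=
  quotient_dim (local_ring z) (local_ideal f z) m.

End Multiplicity.

Section Generic.
Variable K : fieldType.

Definition zariski_open (T : finType) (U : set (T -> K)) : Prop :=
  exists S : set {mpol K[#|T|]},
    U = ~` [set c | forall p, S p ->
                    meval (fun k => c (enum_val k)) p = 0].

Variables (n : nat) (A : 'I_n -> {fset 'NN^n}).

(* Index set of the coefficients: pairs (j, a) with a in A j. *)
Definition coef_index : finType := {j : 'I_n & A j}.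

Definition sparse_system (c : coef_index -> K) (j : 'I_n) : {mpol K[n]} :=
  \sum_(a : A j) c (Tagged (fun j => A j) a) *: mpolyX K (val a).

Definition for_generic_system (P : ('I_n -> {mpol K[n]}) -> Prop) : Prop :=
  exists U : set (coef_index -> K),
    [/\ zariski_open U, U !=set0
      & forall c, U c -> (forall t, c t != 0) /\ P (sparse_system c)].

End Generic.

(* Main.v *)
Require Import Defs.
From mathcomp Require Import all_boot all_order all_algebra.
From mathcomp Require Import finmap.
From mathcomp Require Import all_classical all_reals all_analysis.
From mathcomp Require Import measurable_realfun.
From mathcomp Require Import complex.
From mathcomp Require Import -(notations) mpoly.
From mathcomp Require Import zify ring lra.

Set Implicit Arguments.
Unset Strict Implicit.
Unset Printing Implicit Defensive.

Import Order.TTheory GRing.Theory Num.Theory.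
Import numFieldNormedType.Exports.

Local Open Scope classical_set_scope.
Local Open Scope ring_scope.

(* Bernstein's theorem is proved through Hilbert functions. The coefficients are put
   on monomial curves u |-> u^(N^k), and "generic" means: for all but countably many
   u in the uncountable field C, one parameter per polynomial. By McCoy's theorem a
   generic polynomial is a nonzerodivisor as soon as its support admits one, so each
   of them lowers the growth of the spaces spanned by the monomials in the dilates
   k P by one degree. A product of Minkowski sums has n! Vol P zeros in the torus,
   and additivity in each factor with inclusion-exclusion turns this into MV.

   Adding constants to f deforms the zeros at the origin and in the torus into zeros
   in the torus, whence mult_0(f) + MV(A) <= MV(A^0). After adding Delta_M the origin
   is the only zero outside the torus and equality holds. With m = mult_0(f), every
   x_l^m lies in the local ideal at the origin; hence for M > m the power x_l^M lies in
   the maximal ideal times it, and adding x_l^M to f leaves it unchanged. Finiteness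
   at the origin follows from (H2), one coordinate stratum at a time. *)

(** Parameters outside countable sets are used because injectivity in all degrees of a filtration is
    a countable conjunction, for which no single polynomial need suffice. The Zariski open set is
    recovered at the end: a bound on the multiplicity follows from a nonvanishing minor, so its
    least value holds on a nonempty open set, and the curves, with powers of a large N as exponents,
    leave the zero set of any given polynomial. As the identities involve only the number m and
    mixed volumes, one point of the curves proves them.

    The origin and the torus are treated alike, through saturations [sat S J], and every count of
    zeros is the dimension of such a quotient. Families in t are compared at both ends. Where the
    member at t = 0 is a regular sequence, t is a nonzerodivisor and classes survive for generic t;
    at t = 1 the dimension must be computed in a fixed finite-dimensional space from multiples of
    bounded support, and stabilization provides this description. At the origin, regularity is
    proved for the perturbed system and carried back to f by the matrix relating the two sets of
    generators. *)

Section RelativeDimension.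
Variable K : fieldType.
Implicit Types E : lmodType K.

(** * Dimension of one subspace modulo another *)

Definition subspace E (W : set E) :=
  W 0 /\ forall a x y, W x -> W y -> W (a *: x + y).

Definition comb E d (e : 'I_d -> E) (c : 'I_d -> K) : E := \sum_i c i *: e i.

(* The dimension of V / W is at least d, resp. at most d; W need not lie in V. *)
Definition dge E (V W : set E) d :=
  exists2 e : 'I_d -> E, forall i, V (e i)
    & forall c, W (comb e c) -> forall i, c i = 0.

Definition dle E (V W : set E) d :=
  exists2 e : 'I_d -> E, forall i, V (e i)
    & forall v, V v -> exists c, W (v - comb e c).

Definition qdim E (V W : set E) d := dge V W d /\ dle V W d.

Section Subspace.
Variables (E : lmodType K) (W : set E).
Hypothesis sW : subspace W.

Lemma sub0 : W 0. Proof. by case: sW. Qed.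

Lemma subD x y : W x -> W y -> W (x + y).
Proof. by case: sW => _ h Wx Wy; rewrite -[x]scale1r; apply: h. Qed.

Lemma subZ a x : W x -> W (a *: x).
Proof. by case: sW => W0 h Wx; rewrite -[_ *: _]addr0; apply: h. Qed.

Lemma subN x : W x -> W (- x).
Proof. by rewrite -scaleN1r; exact: subZ. Qed.

Lemma subB x y : W x -> W y -> W (x - y).
Proof. by move=> Wx /subN; exact: subD. Qed.

Lemma sub_sum I (r : seq I) (P : pred I) (F : I -> E) :
  (forall i, P i -> W (F i)) -> W (\sum_(i <- r | P i) F i).
Proof. by move=> WF; elim/big_ind: _ => //; [exact: sub0|exact: subD]. Qed.

Lemma sub_comb d (e : 'I_d -> E) c : (forall i, W (e i)) -> W (comb e c).
Proof. by move=> We; apply: sub_sum => i _; apply: subZ. Qed.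

Lemma subC x y : W (x - y) -> W y -> W x.
Proof. by move=> h Wy; rewrite -[x](subrK y); apply: subD. Qed.

Lemma subDr x y : W (x + y) -> W y -> W x.
Proof. by move=> h /(subB h); rewrite addrK. Qed.

End Subspace.

Lemma combZ E d (e : 'I_d -> E) a c : a *: comb e c = comb e (fun i => a * c i).
Proof. by rewrite /comb scaler_sumr; apply: eq_bigr => i _; rewrite scalerA. Qed.

Lemma comb_linear E E' (phi : E -> E') d (e : 'I_d -> E) c : linear phi ->
  phi (comb e c) = comb (phi \o e) c.
Proof.
move=> lphi; have phi0 : phi 0 = 0.
  by have := lphi (-1) 0 0; rewrite scaler0 add0r scaleN1r addNr.
rewrite /comb; elim/big_rec2: _ => // i y1 y2 _ <-; by rewrite lphi.
Qed.

Lemma steinitz E (V W : set E) a b : subspace W -> dge V W a -> dle V W b ->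
  (a <= b)%N.
Proof.
move=> sW [e Ve ie] [g Vg sg]; rewrite leqNgt; apply/negP => ab.
have /choice[M MP] i : exists c, W (e i - comb g c) by apply: sg.
pose A := \matrix_(i, j) M i j.
(* With more rows than columns the coefficient matrix has a nonzero left kernel, and a kernel vector
   is a relation modulo [W]. *)
have : kermx A != 0.
  rewrite -mxrank_eq0 mxrank_ker subn_eq0 -ltnNge.
  exact: leq_ltn_trans (rank_leq_col _) ab.
case/rowV0Pn => c /sub_kermxP cA /eqP; apply; apply/rowP => i; rewrite mxE.
apply: (ie (fun i => c 0 i)).
have -> : comb e (fun i => c 0 i) = \sum_i c 0 i *: (e i - comb g (M i)).
  under [in RHS]eq_bigr do rewrite scalerBr.
  rewrite sumrB [X in _ - X](_ : _ = 0) ?subr0//.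
  under eq_bigr do rewrite /comb scaler_sumr.
  rewrite exchange_big big1//= => j _.
  under eq_bigr do rewrite scalerA; rewrite -scaler_suml.
  have /rowP/(_ j) := cA; rewrite !mxE.
  by under eq_bigr do rewrite mxE; move=> ->; rewrite scale0r.
by apply: sub_sum => // j _; apply: subZ.
Qed.

(** Induction on the size of a spanning family: if it is dependent modulo [W], a vector with nonzero
    coefficient is expressed by the others, which still span. *)
Lemma dim_exists E (V W : set E) b : subspace W -> dle V W b ->
  exists2 d, (d <= b)%N & qdim V W d.
Proof.
move=> sW; elim: b => [|b IH] lb; first by exists 0%N => //; split=> //;
  exists (fun i : 'I_0 => 0) => [[]|c _ []].
have [/IH[d db dd]|dd] := pselect (dle V W b).
  by exists d => //; apply: leqW.
have [ge|ng] := pselect (dge V W b.+1); first by exists b.+1.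
have [g Vg sg] := lb; case: ng; exists g => // c Wc k; apply/eqP/negP => /negP ck.
apply: dd => {IH}; exists (g \o lift k) => [i|v Vv]; first exact: Vg.
have [c' Wc'] := sg _ Vv; exists (fun i => c' (lift k i) - c' k / c k * c (lift k i)).
have -> : v - comb (g \o lift k)
    (fun i => c' (lift k i) - c' k / c k * c (lift k i)) =
    (v - comb g c') + (c' k / c k) *: comb g c.
  rewrite [comb g c'](bigD1_ord k) //= [comb g c](bigD1_ord k) //=.
  rewrite scalerDr scalerA divfK// opprD !addrA [_ - c' k *: _ - _]addrAC.
  rewrite subrK -addrA; congr (_ + _); rewrite /comb scaler_sumr.
  rewrite -!sumrN -big_split /=; apply: eq_bigr => i _.
  by rewrite scalerBl opprB addrC scalerA.
by apply: subD => //; exact: subZ.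
Qed.

Lemma dge_le E (V W : set E) a b : (a <= b)%N -> dge V W b -> dge V W a.
Proof.
move=> ab [e Ve ie]; exists (e \o widen_ord ab) => [i|c Wc i]; first exact: Ve.
pose c' (j : 'I_b) := if insub (val j) is Some k then c k else 0.
have c'E k : c' (widen_ord ab k) = c k.
  by rewrite /c' /=; case: insubP => [k' _ /val_inj->//|]; rewrite ltn_ord.
rewrite -c'E; apply: ie; suff -> : comb e c' = comb (e \o widen_ord ab) c by [].
rewrite /comb (bigID (fun j : 'I_b => (j < a)%N)) /= [X in _ + X]big1 ?addr0.
  rewrite (big_ord_narrow ab); apply: eq_bigr => k _.
  by rewrite c'E.
by move=> j ja; rewrite /c'; case: insubP => [k kj _|_]; [rewrite kj in ja|rewrite scale0r].
Qed.

Lemma maximal_spanning E (V W : set E) d (e : 'I_d -> E) : subspace W ->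
  (forall i, V (e i)) -> (forall c, W (comb e c) -> forall i, c i = 0) ->
  ~ dge V W d.+1 -> forall v, V v -> exists c, W (v - comb e c).
Proof.
move=> sW Ve ie nd v Vv; apply: contrapT => nv; apply: nd.
exists (fun i => oapp e v (unlift ord0 i)) => [i|c]; first by case: unlift.
rewrite /comb big_ord_recl unlift_none /=.
under eq_bigr do rewrite liftK /=.
move=> Wc; have [c0|c0] := eqVneq (c ord0) 0.
  move=> i; case: (unliftP ord0 i) => [j|] -> //.
  move: Wc; rewrite c0 scale0r add0r.
  by move=> /(ie (fun i => c (lift ord0 i))).
case: nv; exists (fun i => - (c ord0)^-1 * c (lift ord0 i)).
have := subZ sW (c ord0)^-1 Wc; rewrite scalerDr scalerA mulVf// scale1r.
congr (W (_ + _)); rewrite /comb scaler_sumr -sumrN; apply: eq_bigr => i _.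
by rewrite scalerA mulNr scaleNr opprK.
Qed.

Lemma dge_max E (V W : set E) b : subspace W -> (forall a, dge V W a -> (a <= b)%N) ->
  exists2 d, (d <= b)%N & qdim V W d.
Proof.
move=> sW hb.
have ex0 : exists a, `[< dge V W a >].
  by exists 0%N; apply/asboolP; exists (fun _ => 0) => [[]|c _ []].
have ub a : `[< dge V W a >] -> (a <= b)%N by move/asboolP/hb.
case: (ex_maxnP ex0 ub) => d /asboolP dd dmax; exists d; first exact: hb.
split => //; case: (dd) => e Ve ie; exists e => //.
by apply: maximal_spanning => // /asboolP/dmax; rewrite ltnn.
Qed.

Lemma qdim_basis E (V W : set E) d : subspace W -> qdim V W d ->
  exists e : 'I_d -> E, [/\ forall i, V (e i),
    forall c, W (comb e c) -> forall i, c i = 0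
  & forall v, V v -> exists c, W (v - comb e c)].
Proof.
move=> sW [[e Ve ie] ld]; exists e; split => //.
by apply: maximal_spanning => // gd; have := steinitz sW gd ld; rewrite ltnn.
Qed.

Definition glue T a b (e : 'I_a -> T) (g : 'I_b -> T) (i : 'I_(a + b)) : T :=
  match fintype.split i with inl j => e j | inr j => g j end.

Lemma glueP T (P : T -> Prop) a b (e : 'I_a -> T) (g : 'I_b -> T) :
  (forall i, P (e i)) -> (forall i, P (g i)) -> forall i, P (glue e g i).
Proof. by move=> Pe Pg i; rewrite /glue; case: fintype.split. Qed.

Lemma comb_glue E a b (e : 'I_a -> E) (g : 'I_b -> E) c :
  comb (glue e g) c =
  comb e (fun i => c (lshift b i)) + comb g (fun i => c (rshift a i)).
Proof.
rewrite /comb big_split_ord /=; congr (_ + _); apply: eq_bigr => i _.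
  by rewrite /glue (unsplitK (inl i)).
by rewrite /glue (unsplitK (inr i)).
Qed.

Lemma comb_glue2 E a b (e : 'I_a -> E) (g : 'I_b -> E) c c' :
  comb (glue e g) (glue c c') = comb e c + comb g c'.
Proof.
rewrite comb_glue /comb; congr (_ + _); apply: eq_bigr => i _.
  by rewrite /glue (unsplitK (inl i)).
by rewrite /glue (unsplitK (inr i)).
Qed.

Lemma comb0 E d (c : 'I_d -> K) : comb (fun _ => 0 : E) c = 0.
Proof. by rewrite /comb big1// => i _; rewrite scaler0. Qed.

Lemma dle_le E (V W : set E) a b : V 0 -> (a <= b)%N -> dle V W a -> dle V W b.
Proof.
move=> V0 /subnKC <-; move: (b - a)%N => k [e Ve se].
exists (glue e (fun _ : 'I_k => 0)); first exact: glueP.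
move=> v /se[c Wc]; exists (glue c (fun _ => 0)).
by rewrite comb_glue2 comb0 addr0.
Qed.

Lemma dge_trans E (V V' W : set E) a b : subspace V' -> W `<=` V' -> V' `<=` V ->
  dge V V' a -> dge V' W b -> dge V W (a + b).
Proof.
move=> sV' WV' V'V [e Ve ie] [g Vg ig].
exists (glue e g) => [|c]; first by apply: glueP => // i; apply: V'V.
rewrite comb_glue => Wc.
have cl : forall i, c (lshift b i) = 0.
  apply: (ie (fun i => c (lshift b i))).
  move: (WV' _ Wc) => /subB => /(_ sV' _ (sub_comb sV' (fun j => c (rshift a j)) Vg)).
  by rewrite addrK.
have cr : forall i, c (rshift a i) = 0.
  apply: (ig (fun i => c (rshift a i))); move: Wc.
  by rewrite [X in X + _]/comb big1 ?add0r// => i _; rewrite cl scale0r.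
by move=> i; rewrite -(fintype.splitK i); case: fintype.split => j /=; [apply: cl|apply: cr].
Qed.

Lemma dle_trans E (V V' W : set E) a b : V' `<=` V ->
  dle V V' a -> dle V' W b -> dle V W (a + b).
Proof.
move=> V'V [e Ve se] [g Vg sg].
exists (glue e g); first by apply: glueP => // i; apply: V'V.
move=> v /se[c /sg[c' Wc']]; exists (glue c c').
by rewrite comb_glue2 opprD addrA.
Qed.

Lemma dge_map E E' (phi : E -> E') (V W : set E) (V' W' : set E') a : linear phi ->
  subspace V -> (forall v, V v -> V' (phi v)) ->
  (forall v, V v -> W' (phi v) -> W v) -> dge V W a -> dge V' W' a.
Proof.
move=> lphi sV hV hW [e Ve ie]; exists (phi \o e) => [i|c]; first exact/hV/Ve.
by rewrite -comb_linear// => Wc; apply/ie/hW => //; apply: sub_comb.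
Qed.

Lemma dge_mono E (V V' W W' : set E) a : subspace V -> V `<=` V' ->
  (forall v, V v -> W' v -> W v) -> dge V W a -> dge V' W' a.
Proof. by move=> sV VV' WW'; apply: (@dge_map _ _ idfun). Qed.

Lemma dle_map E E' (phi : E -> E') (V W : set E) (V' W' : set E') a : linear phi ->
  subspace W' -> (forall v, V v -> V' (phi v)) -> (forall v, W v -> W' (phi v)) ->
  (forall v', V' v' -> exists2 v, V v & W' (v' - phi v)) -> dle V W a -> dle V' W' a.
Proof.
move=> lphi sW' hV hW hs [e Ve se]; exists (phi \o e) => [i|v' Vv'].
  exact/hV/Ve.
have [v Vv h] := hs _ Vv'; have [c Wc] := se _ Vv; exists c.
rewrite -comb_linear// -[v'](subrK (phi v)) -addrA; apply: subD => //.
have := hW _ Wc; congr (W' _).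
by rewrite -[v - _]addrC -scaleN1r lphi scaleN1r addrC.
Qed.

Lemma dle_mono E (V W W' : set E) a : W `<=` W' -> dle V W a -> dle V W' a.
Proof.
by move=> WW' [e Ve se]; exists e => // v /se[c Wc]; exists c; apply: WW'.
Qed.

Lemma qdim_uniq E (V W : set E) a b : subspace W -> qdim V W a -> qdim V W b -> a = b.
Proof.
move=> sW [a1 a2] [b1 b2]; apply/eqP; rewrite eqn_leq.
by rewrite (steinitz sW a1 b2) (steinitz sW b1 a2).
Qed.

Lemma dle_sub E (V V' W : set E) a : subspace W -> subspace V -> V `<=` V' ->
  dle V' W a -> dle V W a.
Proof.
move=> sW sV VV' lV'.
have [|d da [_ dd]] := @dge_max _ V W a sW.
  by move=> b gb; apply: (steinitz sW _ lV'); apply: dge_mono gb.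
by apply: dle_le dd => //; exact: sub0.
Qed.

Lemma dge0 E (V W : set E) : dge V W 0.
Proof. by exists (fun _ => 0) => [[]|c _ []]. Qed.

Lemma dge1 E (V W : set E) v : subspace W -> V v -> ~ W v -> dge V W 1.
Proof.
move=> sW Vv nWv; exists (fun _ => v) => // c.
rewrite /comb big_ord1 => Wc i; rewrite (ord1 i); apply/eqP/negP => /negP c0.
by apply: nWv; rewrite -[v]scale1r -(mulVf c0) -scalerA; apply: subZ.
Qed.

End RelativeDimension.

(** * Ranks of polynomial matrices under specialization *)

Section PolynomialMatrices.
Local Open Scope quotient_scope.
Variable K : fieldType.

Lemma mxrank_mxsub (F : fieldType) p q r s (f : 'I_r -> 'I_p) (g : 'I_s -> 'I_q)
  (A : 'M[F]_(p, q)) : (\rank (mxsub f g A) <= \rank A)%N.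
Proof.
rewrite mxsubrc; apply: leq_trans (mxrankS (rowsub_sub _ _)) _.
rewrite -mxrank_tr -[leqRHS]mxrank_tr trmx_mxsub; exact: mxrankS (rowsub_sub _ _).
Qed.

Lemma minor_exists (F : fieldType) p q (A : 'M[F]_(p, q)) :
  exists f : 'I_(\rank A) -> 'I_p, exists g : 'I_(\rank A) -> 'I_q,
    \det (mxsub f g A) != 0.
Proof.
set B := rowsub (maxrankfun A) A.
have fB : row_full B^T.
  by rewrite /row_full mxrank_tr; apply: maxrowsub_free.
exists (maxrankfun A), (fullrankfun fB).
have := fullrowsub_unit fB; rewrite unitmxE unitfE -det_tr trmx_mxsub trmxK.
by rewrite -mxsub_comp.
Qed.

Lemma rank_minor (F : fieldType) p q r (f : 'I_r -> 'I_p) (g : 'I_r -> 'I_q)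
  (A : 'M[F]_(p, q)) : \det (mxsub f g A) != 0 -> (r <= \rank A)%N.
Proof.
move=> dA; apply: leq_trans (mxrank_mxsub f g A).
by rewrite mxrank_unit// unitmxE unitfE.
Qed.

Definition evmx (t : K) p q (A : 'M[{poly K}]_(p, q)) : 'M[K]_(p, q) :=
  map_mx (horner_eval t) A.

Definition fracmx p q (A : 'M[{poly K}]_(p, q)) : 'M[{fraction {poly K}}]_(p, q) :=
  map_mx (@FracField.tofrac _) A.

Lemma rank_ev_le t p q (A : 'M[{poly K}]_(p, q)) :
  (\rank (evmx t A) <= \rank (fracmx A))%N.
Proof.
have [f [g dA]] := minor_exists (evmx t A); apply: (@rank_minor _ _ _ _ f g).
rewrite /fracmx -map_mxsub det_map_mx tofrac_eq0.
by move: dA; rewrite /evmx -map_mxsub det_map_mx; apply: contraNneq => ->; rewrite rmorph0.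
Qed.

Lemma rank_ev_generic p q (A : 'M[{poly K}]_(p, q)) :
  exists2 D : {poly K}, D != 0
    & forall t, ~~ root D t -> \rank (evmx t A) = \rank (fracmx A).
Proof.
have [f [g dA]] := minor_exists (fracmx A).
exists (\det (mxsub f g A)) => [|t Dt].
  by move: dA; rewrite /fracmx -map_mxsub det_map_mx tofrac_eq0.
apply/eqP; rewrite eqn_leq rank_ev_le; apply: (@rank_minor _ _ _ _ f g).
by rewrite /evmx -map_mxsub det_map_mx.
Qed.

Lemma clear_denominators q (v : 'rV[{fraction {poly K}}]_q) :
  exists2 d : {poly K}, d != 0
    & exists v' : 'rV[{poly K}]_q, (FracField.tofrac d) *: v = fracmx v'.
Proof.
have fr (x : {fraction {poly K}}) :
    exists d y : {poly K}, d != 0 /\ FracField.tofrac d * x = FracField.tofrac y.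
  elim/quotW: x => x; exists (fraction.frac x).2, (fraction.frac x).1; split; first exact: denom_ratioP.
  have -> : FracField.tofrac (fraction.frac x).2 * \pi_(FracField.type {poly K}) x =
    \pi_(FracField.type {poly K}) (FracField.mulf (Ratio (fraction.frac x).2 1) x).
    by rewrite !piE.
  rewrite !piE; apply/eqmodP.
  rewrite /= FracField.equivfE /FracField.mulf !numden_Ratio ?mul1r ?oner_neq0 ?denom_ratioP//.
  by rewrite mulr1.
have [d /choice[y dy]] := choice (fun i => fr (v 0 i)).
have dn0 i : d i != 0 by have [] := dy i.
exists (\prod_i d i); first by apply/prodf_neq0.
exists (\row_i ((\prod_(j | j != i) d j) * y i)); apply/rowP => i; rewrite !mxE.
have [_ e] := dy i.
by rewrite (bigD1 i)//= !rmorphM /= mulrAC e mulrC.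
Qed.

(** If a nontrivial combination of the rows of [A] lies in the row space of [B] over the fraction
    field, clearing denominators gives the first case. Otherwise the stacked matrix has rank a +
    rank [B]. Neither block gains rank under specialization, so wherever the stacked rank is kept,
    the rows of [A] stay independent modulo those of [B]. *)
Lemma poly_relation a b q (A : 'M[{poly K}]_(a, q)) (B : 'M[{poly K}]_(b, q)) :
  (exists2 c : 'rV[{poly K}]_a, c != 0 & exists h : 'rV_b, c *m A + h *m B = 0) \/
  (exists2 D : {poly K}, D != 0 & forall t, ~~ root D t ->
     forall (c : 'rV_a) (h : 'rV_b), c *m evmx t A + h *m evmx t B = 0 -> c = 0).
Proof.
have [h|nh] := pselect (exists2 c : 'rV_a, c != 0 & (c *m fracmx A <= fracmx B)%MS).
  left; have [c c0 /submxP[m e]] := h.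
  have [d d0 [v ve]] := clear_denominators (row_mx c m).
  exists (lsubmx v).
    move: c0; apply: contra_neq => v0.
    have := congr1 lsubmx ve; rewrite linearZ /= row_mxKl -map_lsubmx v0 map_mx0.
    by move/eqP; rewrite scaler_eq0 tofrac_eq0 (negPf d0) => /eqP.
  exists (- rsubmx v).
  suff inj : forall m n (M N : 'M[{poly K}]_(m, n)), fracmx M = fracmx N -> M = N.
    apply: inj; rewrite /fracmx.
    rewrite map_mxD !map_mxM map_mxN map_lsubmx map_rsubmx -/(fracmx v) -ve.
    rewrite !linearZ /= row_mxKl row_mxKr -!scalemxAl map_mx0 -/(fracmx A) -/(fracmx B).
    by rewrite e mulNmx scalerN addrN.
  move=> m' n' M N /matrixP MN; apply/matrixP => i j; have := MN i j.
  by rewrite !mxE => /eqP; rewrite tofrac_eq => /eqP.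
right; have [D D0 DP] := rank_ev_generic (col_mx A B); exists D => // t Dt.
have rk : \rank (fracmx (col_mx A B)) = (a + \rank (fracmx B))%N.
  rewrite /fracmx map_col_mx -addsmxE -/(fracmx A) -/(fracmx B).
  have inj (c : 'rV_a) : (c *m fracmx A <= fracmx B)%MS -> c = 0.
    by move=> cAB; apply/eqP/negP => /negP c0; apply: nh; exists c.
  have ra : \rank (fracmx A) = a.
    apply/eqP; rewrite -[_ == _]/(row_free _) -kermx_eq0.
    apply/rowV0P => c /sub_kermxP cA; apply: inj; by rewrite cA sub0mx.
  rewrite -[X in (X + _)%N]ra -mxrank_sum_cap -[LHS]addn0; congr (_ + _)%N; apply/esym/eqP.
  rewrite mxrank_eq0; apply/rowV0P => c; rewrite sub_capmx => /andP[/submxP[c' ->]].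
  by move=> /inj ->; rewrite mul0mx.
move: (DP t Dt); rewrite rk {1}/evmx map_col_mx -addsmxE -/(evmx t A) -/(evmx t B).
have := mxrank_sum_cap (evmx t A) (evmx t B).
have := rank_ev_le t B; have := rank_leq_row (evmx t A).
move: (\rank (evmx t A + evmx t B)) (\rank (fracmx B)) (\rank (evmx t B)) => r1 r2 r3.
move rA: (\rank (evmx t A)) => r4; move rC: (\rank (_ :&: _)) => r5 l1 l2 l3 l4.
have fA : row_free (evmx t A) by apply/eqP; rewrite rA; lia.
have C0 : (evmx t A :&: evmx t B)%MS = 0 by apply/eqP; rewrite -mxrank_eq0 rC; lia.
move=> c h /eqP; rewrite addr_eq0 => /eqP e.
apply: (row_free_inj fA); rewrite mul0mx; apply/eqP; rewrite -submx0 -C0.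
by rewrite sub_capmx submxMl e -mulNmx submxMl.
Qed.

End PolynomialMatrices.

(** * Parameters outside countable exceptional sets *)

Section VeryGeneric.
Variable K : fieldType.
Implicit Types P Q : K -> Prop.

Definition cocountable P := countable [set u | ~ P u].

Lemma cocountable_mono P Q : (forall u, P u -> Q u) -> cocountable P -> cocountable Q.
Proof.
move=> PQ; apply: sub_countable; apply: subset_card_le => u /= nQ /PQ.
exact: nQ.
Qed.

Lemma cocountable_forall (I : countType) (P : I -> K -> Prop) :
  (forall i, cocountable (P i)) -> cocountable (fun u => forall i, P i u).
Proof.
move=> cP; apply: (@sub_countable _ _ _ (\bigcup_i [set u | ~ P i u])).
  apply: subset_card_le => u /= /existsNP[i nP]; by exists i.
by apply: bigcup_countable => // i _; apply: cP.
Qed.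

Lemma cocountable_and P Q : cocountable P -> cocountable Q ->
  cocountable (fun u => P u /\ Q u).
Proof.
move=> cP cQ; have h : cocountable (fun u => forall b : bool, if b then P u else Q u).
  by apply: cocountable_forall; case.
by apply: cocountable_mono h => u h; split; [apply: (h true)|apply: (h false)].
Qed.

Lemma cocountableT P : (forall u, P u) -> cocountable P.
Proof.
move=> hP; rewrite /cocountable.
have -> : [set u | ~ P u] = set0 by apply/seteqP; split => u //=; apply.
exact: countable0.
Qed.

Lemma cocountable_root (D : {poly K}) : D != 0 -> cocountable (fun t => ~~ root D t).
Proof.
move=> D0; have [s rs] : exists s : seq K, forall t, root D t -> t \in s.
  suff : forall m (D : {poly K}), (size D <= m)%N -> D != 0 ->
      exists s : seq K, forall t, root D t -> t \in s by apply; [exact: leqnn|].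
  elim=> [|m IH] {}D sD {}D0.
    by rewrite -size_poly_eq0 -leqn0 sD in D0.
  have [[t rt]|nr] := pselect (exists t, root D t); last first.
    by exists [::] => t rt; case: nr; exists t.
  have /factor_theorem[q Dq] := rt.
  have q0 : q != 0 by apply: contra_neq D0 => q0; rewrite Dq q0 mul0r.
  have [|s sq] := IH q _ q0.
    by move: sD; rewrite Dq size_Mmonic ?monicXsubC// size_XsubC addn2.
  exists (t :: s) => u; rewrite Dq rootM root_XsubC inE => /orP[/sq ->|->//].
  by rewrite orbT.
apply: (@sub_countable _ _ _ [set` s]).
  by apply: subset_card_le => t /= /negP; rewrite negbK => /rs.
by apply/finite_set_countable/finite_seqP; exists s.
Qed.

(** The exceptional set of a parameter may depend on the earlier ones: each parameter is chosen once
    the ideal of its predecessors is known. The iterated form is stable under countable conjunction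
    and still yields a point over an uncountable field. *)
Fixpoint VG n (P : seq K -> Prop) : Prop :=
  if n is n'.+1 then cocountable (fun u => VG n' (fun s => P (u :: s))) else P [::].

Lemma VG_mono n (P Q : seq K -> Prop) : (forall s, size s = n -> P s -> Q s) ->
  VG n P -> VG n Q.
Proof.
elim: n P Q => [|n IH] P Q PQ /=; first exact: PQ.
apply: cocountable_mono => u; apply: IH => s ss; apply: PQ; by rewrite /= ss.
Qed.

Lemma VG_forall (I : countType) n (P : I -> seq K -> Prop) :
  (forall i, VG n (P i)) -> VG n (fun s => forall i, P i s).
Proof.
elim: n P => [|n IH] P //= hP; move: (cocountable_forall hP).
by apply: cocountable_mono => u; apply: IH.
Qed.

Lemma VG_and n (P Q : seq K -> Prop) : VG n P -> VG n Q -> VG n (fun s => P s /\ Q s).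
Proof.
move=> hP hQ; have h : VG n (fun s => forall b : bool, if b then P s else Q s).
  by apply: VG_forall; case.
by apply: VG_mono h => u _ h; split; [apply: (h true)|apply: (h false)].
Qed.

Lemma VGT n (P : seq K -> Prop) : (forall s, size s = n -> P s) -> VG n P.
Proof.
elim: n P => [|n IH] P hP /=; first exact: hP.
by apply: cocountableT => u; apply: IH => s ss; apply: hP; rewrite /= ss.
Qed.

Lemma VG_rcons n (P : seq K -> Prop) :
  VG n (fun s => cocountable (fun u => P (rcons s u))) -> VG n.+1 P.
Proof.
elim: n P => [|n IH] P //= h; move: h; apply: cocountable_mono => u h.
exact: (IH (fun s => P (u :: s))).
Qed.

Hypothesis ncK : ~ countable [set: K].

Lemma cocountable_ex P : cocountable P -> exists u, P u.
Proof.
move=> cP; apply: contrapT => nP; apply: ncK.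
suff <- : [set u | ~ P u] = setT by [].
by apply/seteqP; split => u //= _ Pu; apply: nP; exists u.
Qed.

Lemma VG_ex n (P : seq K -> Prop) : VG n P -> exists2 s, size s = n & P s.
Proof.
elim: n P => [|n IH] P /=; first by exists [::].
by case/cocountable_ex => u /IH[s ss Ps]; exists (u :: s); rewrite //= ss.
Qed.

End VeryGeneric.

(** * Families of polynomials in one parameter *)

Section PolynomialFamilies.
Variables (K : fieldType) (n : nat).
Local Notation R := {mpol K[n]}.
Implicit Types r g : {poly R}.

Definition spec (t : K) r : R := r.[mpolyC n t].
Definition liftc (c : {poly K}) : {poly R} := map_poly (@mpolyC n K) c.
(** A family lies in K[x][u]; read in K[u][x], it becomes a row of polynomials in the parameter, to
    which the rank argument applies. *)
Definition coefm (m : 'NN^n) r : {poly K} := map_poly (mcoeff m) r.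

Lemma coefmE m r k : (coefm m r)`_k = mcoeff m r`_k.
Proof. by rewrite coef_map. Qed.

Lemma coefmP r g : (forall m, coefm m r = coefm m g) -> r = g.
Proof.
move=> rg; apply/polyP => k; apply/mpolyP => m.
by have /polyP/(_ k) := rg m; rewrite !coefmE.
Qed.

Lemma coefmD m r g : coefm m (r + g) = coefm m r + coefm m g.
Proof. exact: raddfD. Qed.

Lemma coefm_sum m (I : finType) (F : I -> {poly R}) :
  coefm m (\sum_i F i) = \sum_i coefm m (F i).
Proof. exact: raddf_sum. Qed.

Lemma coefm_lift m c r : coefm m (liftc c * r) = c * coefm m r.
Proof.
apply/polyP => k; rewrite coefmE !coefM raddf_sum; apply: eq_bigr => i _ /=.
by rewrite coef_map mcoeffCM coefmE.
Qed.

Lemma spec_coefm m t r : mcoeff m (spec t r) = (coefm m r).[t].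
Proof.
rewrite /spec horner_coef raddf_sum /= (@horner_coef_wide _ (size r)); last first.
  exact: size_poly.
apply: eq_bigr => i _; rewrite coefmE -rmorphXn /= mulrC mcoeffCM.
by rewrite mulrC.
Qed.

Lemma mcoeff_msize m (p : R) D : (msize p <= D)%N -> (D <= mdeg m)%N -> mcoeff m p = 0.
Proof.
move=> pD Dm; apply/eqP; rewrite mcoeff_eq0; apply: msize_mdeg_ge.
exact: leq_trans Dm.
Qed.

(** This is [poly_relation] for the rows of coefficients: the size in x is bounded by a common [D],
    so finitely many monomials carry all the information. *)
Lemma poly_family a b (r : 'I_a -> {poly R}) (g : 'I_b -> {poly R}) :
  (exists c : 'I_a -> {poly K}, (exists i, c i != 0) /\ exists h : 'I_b -> {poly K},
     \sum_i liftc (c i) * r i + \sum_l liftc (h l) * g l = 0) \/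
  (exists2 D : {poly K}, D != 0 & forall t, ~~ root D t ->
     forall (c : 'I_a -> K) (h : 'I_b -> K),
       comb (fun i => spec t (r i)) c + comb (fun l => spec t (g l)) h = 0 ->
       forall i, c i = 0).
Proof.
pose D := maxn (\max_i \max_(k < size (r i)) msize (r i)`_k)
  (\max_i \max_(k < size (g i)) msize (g i)`_k).
have rD i k : (msize (r i)`_k <= D)%N.
  have [ks|ks] := ltnP k (size (r i)); last by rewrite nth_default// msize0.
  rewrite leq_max; apply/orP; left.
  by apply: leq_trans (leq_bigmax i); apply: (leq_bigmax (Ordinal ks)).
have gD i k : (msize (g i)`_k <= D)%N.
  have [ks|ks] := ltnP k (size (g i)); last by rewrite nth_default// msize0.
  rewrite leq_max; apply/orP; right.
  by apply: leq_trans (leq_bigmax i); apply: (leq_bigmax (Ordinal ks)).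
pose q := #|{: bmultinom n D}|.
pose A := \matrix_(i < a, j < q) coefm (bmnm (enum_val j)) (r i).
pose B := \matrix_(i < b, j < q) coefm (bmnm (enum_val j)) (g i).
case: (poly_relation A B) => [[c c0 [h e]]|[Q Q0 QP]]; [left|right].
  exists (fun i => c 0 i); split.
    by have /rV0Pn[i ci] := c0; exists i.
  exists (fun i => h 0 i); apply: coefmP => m; rewrite coefmD !coefm_sum [RHS]raddf0.
  under eq_bigr do rewrite coefm_lift.
  under [X in _ + X]eq_bigr do rewrite coefm_lift.
  have [mD|mD] := ltnP (mdeg m) D.
    have /rowP/(_ (enum_rank (BMultinom mD))) := e; rewrite !mxE.
    by move=> e0; rewrite -[RHS]e0; congr (_ + _); apply: eq_bigr => j _; rewrite !mxE enum_rankK.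
  rewrite !big1 ?addr0// => i _.
    suff -> : coefm m (g i) = 0 by rewrite mulr0.
    by apply/polyP => k; rewrite coefmE coef0 (mcoeff_msize (gD i k)).
  suff -> : coefm m (r i) = 0 by rewrite mulr0.
  by apply/polyP => k; rewrite coefmE coef0 (mcoeff_msize (rD i k)).
exists Q => // t Qt c h e i.
have /rowP/(_ i) : \row_i c i = 0; last by rewrite !mxE.
apply: (QP t Qt _ (\row_l h l)); apply/rowP => j; rewrite !mxE.
have /mpolyP/(_ (bmnm (enum_val j))) := e.
rewrite mcoeffD mcoeff0 /comb !raddf_sum /= => e0; rewrite -[RHS]e0; congr (_ + _).
  by apply: eq_bigr => k _; rewrite !mxE /horner_eval -spec_coefm mcoeffZ.
by apply: eq_bigr => k _; rewrite !mxE /horner_eval -spec_coefm mcoeffZ.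
Qed.

End PolynomialFamilies.

(** * McCoy's theorem for graded subspaces *)

Section McCoy.
Variables (K : fieldType) (n : nat).
Local Notation R := {mpol K[n]}.

Lemma coef_liftcM (c : {poly K}) (v : R) j : (liftc n c * v%:P)`_j = c`_j *: v.
Proof. by rewrite coefMC coef_map /= mul_mpolyC. Qed.

Lemma specM t (p q : {poly R}) : spec t (p * q) = spec t p * spec t q.
Proof. exact: hornerM. Qed.

Lemma specC t (v : R) : spec t v%:P = v.
Proof. exact: hornerC. Qed.

Definition size_below D : set R := [set p | (msize p <= D)%N].

Lemma subspace_size D : subspace (size_below D).
Proof.
split=> [|a x y]; rewrite /size_below /= ?msize0// => xD yD.
apply: leq_trans (msizeD_le _ _) _; rewrite geq_max yD andbT.
exact: leq_trans (msizeZ_le _ _) xD.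
Qed.

Lemma dle_size D : dle (size_below D) [set 0] #|{: bmultinom n D}|.
Proof.
exists (fun j => mpolyX K (bmnm (enum_val j))) => [j|p pD].
  by rewrite /size_below /= msizeX; exact: bmdeg.
exists (fun j => mcoeff (bmnm (enum_val j)) p) => /=; apply/eqP; rewrite subr_eq0.
rewrite {1}(mpolywE pD) /comb.
rewrite (reindex_onto (@enum_val _ _) enum_rank) /=; last first.
  by move=> i _; rewrite enum_rankK.
by apply/eqP/eq_bigl => j; rewrite enum_valK eqxx.
Qed.

Lemma subspaceI (V W : set R) : subspace V -> subspace W -> subspace (V `&` W).
Proof.
move=> sV sW; split; first by split; apply: sub0.
by move=> a x y [Vx Wx] [Vy Wy]; split; apply: subD => //; apply: subZ.
Qed.

Lemma subspace_set0 : subspace ([set 0] : set R).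
Proof. by split=> // a x y -> ->; rewrite scaler0 addr0. Qed.

Lemma dle_size_sub (V : set R) D (W : set R) : subspace W -> subspace V ->
  exists b, dle (V `&` size_below D) W b.
Proof.
move=> sW sV; exists #|{: bmultinom n D}|.
apply: (@dle_mono _ _ _ [set 0]); first by move=> x ->; apply: sub0.
apply: dle_sub (dle_size D) => //; first exact: subspace_set0.
by apply: subspaceI => //; exact: subspace_size.
Qed.

Variables (phi : {poly R}) (V U : nat -> set R).
Hypothesis sV : forall k, subspace (V k).
Hypothesis sU : forall k, subspace (U k).
Hypothesis phiV : forall k t v, V k v -> V k.+1 (phi`_t * v).
Hypothesis phiU : forall k t v, U k v -> U k.+1 (phi`_t * v).
Hypothesis torsion_free : forall k v, V k v ->
  (forall t, U k.+1 (phi`_t * v)) -> U k v.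

(** Induction on the degree of [g] and, inside it, descending induction on t, to show that every
    coefficient of [g] is carried into [U] by the t-th coefficient of [phi]. Once this holds above
    t, the coefficient of index t + d of [phi * g] isolates the product with the top coefficient of
    [g]. *)
Lemma mccoy_poly d k (g : {poly R}) : (size g <= d)%N -> (forall i, V k g`_i) ->
  (forall i, U k.+1 (phi * g)`_i) -> forall i, U k g`_i.
Proof.
elim: d k g => [|d IH] k g sg Vg Ug.
  by move=> i; rewrite nth_default; [exact: sub0|exact: leq_trans sg _].
suff h t i : U k.+1 (phi`_t * g`_i) by move=> i; apply: torsion_free.
have [N tN] : exists N, (size phi <= t + N)%N by exists (size phi); rewrite leq_addl.
elim: N t tN i => [|N IHN] t tN i.
  rewrite nth_default ?mul0r; first exact: sub0.
  by rewrite addn0 in tN.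
have IHt t' j : (t < t')%N -> U k.+1 (phi`_t' * g`_j).
  by move=> tt; apply: IHN; apply: leq_trans tN _; rewrite addnS -addSn leq_add2r.
have top : U k.+1 (phi`_t * g`_d).
  have := Ug (t + d)%N; rewrite coefM (bigD1 (inord t)) //= inordK ?ltnS ?leq_addr//.
  rewrite addKn => h; apply: (subDr (sU _) h).
  apply: sub_sum => // -[j jtd] /=; rewrite -val_eqE /= inordK ?ltnS ?leq_addr// => jt.
  have [tj|tj] := ltnP t j; first exact: IHt.
  rewrite [g`__]nth_default ?mulr0; first exact: sub0.
  by apply: leq_trans sg _; lia.
(* Without its top term, the product of the t-th coefficient of [phi] with [g] is shorter and lives
   one degree higher; its product with [phi] still has coefficients in [U]. *)
pose g' := \poly_(j < d) (phi`_t * g`_j).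
have g'E : g' = phi`_t *: (g - g`_d *: 'X^d).
  apply/polyP => j; rewrite coef_poly coefZ coefB coefZ coefXn.
  case: ltngtP => [jd|jd|->]; rewrite ?mulr0 ?subr0// ?mulr1 ?subrr ?mulr0//.
  by rewrite [g`_j]nth_default ?mulr0//; exact: leq_trans sg jd.
have [id|id|->//] := ltngtP i d; last first.
  by rewrite [g`__]nth_default ?mulr0; [exact: sub0|exact: leq_trans sg _].
have := IH k.+1 g' (size_poly _ _) _ _ i; rewrite coef_poly id; apply.
  by move=> j; rewrite coef_poly; case: ifP => _; [apply: phiV|apply: sub0].
move=> j; rewrite g'E -scalerAr coefZ mulrBr coefB mulrBr; apply: subB => //.
  exact: phiU.
rewrite -scalerAr coefZ coefMXn; case: ifP => _.
  by rewrite !mulr0; apply: sub0.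
by rewrite mulrA mulrC; apply: phiU.
Qed.

(** For a fixed degree [k] and size [D] the question is finite-dimensional, and by [poly_family] a
    failure at too many parameters would give a relation with polynomial coefficients, which
    contradicts [mccoy_poly]. There are countably many pairs (k, D). *)
Lemma mccoy : cocountable (fun u : K => forall k v, V k v ->
  U k.+1 (spec u phi * v) -> U k v).
Proof.
suff h k D : cocountable (fun u : K => forall v, V k v -> size_below D v ->
    U k.+1 (spec u phi * v) -> U k v).
  apply: (@cocountable_mono _ (fun u : K => forall kD : nat * nat, forall v, V kD.1 v ->
    size_below kD.2 v -> U kD.1.+1 (spec u phi * v) -> U kD.1 v)).
    by move=> u hu k v Vv Uv; apply: (hu (k, msize v)) => //; rewrite /size_below /=.
  by apply: cocountable_forall => -[k D]; apply: h.
pose Vk := V k `&` size_below D.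
have sVk : subspace Vk by apply: subspaceI => //; exact: subspace_size.
have [b lb] := dle_size_sub D (sU k) (sV k).
have [d _ /(qdim_basis (sU k))[v [Vv iv sv]]] := dim_exists (sU k) lb.
pose D' := (D + \max_(j < size phi) msize phi`_j).+3.
have specD u w : size_below D w -> size_below D' (spec u phi * w).
  move=> wD; rewrite /spec horner_coef mulr_suml.
  apply: sub_sum; first exact: subspace_size.
  move=> i _; move: wD; rewrite /size_below /= => wD.
  have := msizeM_le (phi`_i * mpolyC n u ^+ i) w; have := msizeM_le phi`_i (mpolyC n u ^+ i).
  have : (msize (mpolyC n u ^+ i) <= 1)%N.
    by rewrite -rmorphXn /= msizeC; case: (_ == _).
  have : (msize phi`_i <= \max_(j < size phi) msize phi`_j)%N.
    exact: (leq_bigmax (F := fun j : 'I_(size phi) => msize phi`_j) i).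
  rewrite /D'; move: (\max_(j < _) _)%N (msize (_ * w)) (msize (phi`_i * _)) => x1 x2 x3.
  by lia.
have [b' lb'] := dle_size_sub D' subspace_set0 (sU k.+1).
have [g Ug sg] := lb'.
case: (poly_family (fun i => phi * (v i)%:P) (fun l => (g l)%:P)); last first.
  move=> [Q Q0 QP]; apply: cocountable_mono (cocountable_root Q0) => u /QP {}QP.
  move=> w Vw wD Uw; have [c Uc] := sv w (conj Vw wD).
  suff c0 : forall i, c i = 0.
    move: Uc; rewrite /comb big1 ?subr0// => i _; by rewrite c0 scale0r.
  have lin : linear (fun x => spec u phi * x).
    by move=> a x y; rewrite mulrDr scalerAr.
  have : (U k.+1 `&` size_below D') (comb (fun i => spec u phi * v i) c).
    split.
      rewrite -(comb_linear _ _ lin) -[comb v c](subKr w) mulrBr; apply: subB => //.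
      rewrite /spec horner_coef mulr_suml; apply: sub_sum => // i _.
      rewrite -rmorphXn /= mulrAC [X in U _ X]mulrC mul_mpolyC; apply: subZ => //.
      exact: phiU.
    apply: sub_comb; first exact: subspace_size.
    by move=> i; apply: specD; case: (Vv i).
  move=> /sg[h /eqP]; rewrite subr_eq0 => /eqP eh.
  apply: (QP c (fun l => - h l)).
  under [X in comb X c]funext do rewrite specM specC.
  under [X in _ + comb X _]funext do rewrite specC.
  rewrite eh; apply/eqP; rewrite addr_eq0 /comb -sumrN; apply/eqP/eq_bigr => l _.
  by rewrite scaleNr opprK.
move=> [c [[i0 ci0] [h e]]]; exfalso.
pose G := \sum_i liftc n (c i) * (v i)%:P.
have Gj j : G`_j = comb v (fun i => (c i)`_j).
  by rewrite /G coef_sum; apply: eq_bigr => i _; rewrite coef_liftcM.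
have phiG : phi * G = - \sum_l liftc n (h l) * (g l)%:P.
  apply/eqP; rewrite -addr_eq0 -[X in _ == X]e /G mulr_sumr; apply/eqP; congr (_ + _).
  by apply: eq_bigr => i _; rewrite mulrCA.
have := @mccoy_poly (size G) k G (leqnn _).
have VG j : V k G`_j by rewrite Gj; apply: sub_comb => // i; case: (Vv i).
move=> /(_ VG) UG; have {}UG : forall i, U k G`_i.
  apply: UG => j.
  rewrite phiG coefN; apply: subN => //; rewrite coef_sum; apply: sub_sum => // l _.
  by rewrite coef_liftcM; apply: subZ => //; case: (Ug l).
move/negP: ci0; apply; apply/eqP/polyP => j; rewrite coef0.
by apply: (iv (fun i => (c i)`_j)); rewrite -Gj.
Qed.

End McCoy.

(** * Saturations and regular sequences *)

Section Ideals.
Variable A : comNzRingType.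
Implicit Types (J S : set A) (f g r x : A) (fs : seq A).

Definition ideal J := [/\ J 0, forall x y, J x -> J y -> J (x + y)
  & forall a x, J x -> J (a * x)].

Definition mulset S := S 1 /\ forall x y, S x -> S y -> S (x * y).

Definition addI J f : set A := [set r | exists j h, J j /\ r = j + h * f].

Definition gens J fs : set A := foldl addI J fs.

(** The contraction of the ideal that [J] generates in the localization at [S]; with it the local
    ring and the torus are handled inside the polynomial ring. *)
Definition sat S J : set A := [set r | exists2 q, S q & J (q * r)].

Definition nzd S J f := forall r, sat S J (f * r) -> sat S J r.

Fixpoint reg S J fs : Prop :=
  if fs is f :: fs' then nzd S J f /\ reg S (addI J f) fs' else True.

Lemma idealN J x : ideal J -> J x -> J (- x).
Proof. by case=> _ _ M Jx; rewrite -mulN1r; apply: M. Qed.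

Lemma idealMr J x a : ideal J -> J x -> J (x * a).
Proof. by case=> _ _ M Jx; rewrite mulrC; apply: M. Qed.

Lemma ideal_sum J (I : Type) (s : seq I) (P : pred I) F : ideal J ->
  (forall i, P i -> J (F i)) -> J (\sum_(i <- s | P i) F i).
Proof. by case=> J0 D _ JF; elim/big_ind: _. Qed.

Lemma ideal0 : ideal ([set 0] : set A).
Proof. by split=> // [x y -> ->|a x ->]; rewrite ?addr0 ?mulr0. Qed.

Lemma ideal_addI J f : ideal J -> ideal (addI J f).
Proof.
case=> J0 D M; split.
- by exists 0, 0; rewrite mul0r addr0.
- move=> _ _ [j [h [Jj ->]]] [j' [h' [Jj' ->]]].
  by exists (j + j'), (h + h'); split; [exact: D|ring].
move=> a _ [j [h [Jj ->]]]; exists (a * j), (a * h); split; [exact: M|ring].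
Qed.

Lemma sub_addI J f : J `<=` addI J f.
Proof. by move=> j Jj; exists j, 0; rewrite mul0r addr0. Qed.

Lemma addI_mem J f : ideal J -> addI J f f.
Proof. by case=> J0 _ _; exists 0, 1; rewrite mul1r add0r. Qed.

Lemma addI_min J f I : ideal I -> J `<=` I -> I f -> addI J f `<=` I.
Proof.
by case=> _ D M JI If _ [j [h [Jj ->]]]; apply: D; [apply: JI|apply: M].
Qed.

Lemma ideal_gens J fs : ideal J -> ideal (gens J fs).
Proof. by elim: fs J => //= f fs IH J iJ; apply/IH/ideal_addI. Qed.

Lemma sub_gens J fs : J `<=` gens J fs.
Proof.
by elim: fs J => [|f fs IH] J x Jx //=; apply/IH/sub_addI.
Qed.

Lemma gens_mem J fs f : ideal J -> f \in fs -> gens J fs f.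
Proof.
elim: fs J => //= g fs IH J iJ; rewrite inE => /orP[/eqP ->|ffs].
  by apply: sub_gens; apply: addI_mem.
by apply: IH => //; apply: ideal_addI.
Qed.

Lemma gens_min J fs I : ideal I -> J `<=` I -> (forall f, f \in fs -> I f) ->
  gens J fs `<=` I.
Proof.
move=> iI; elim: fs J => //= f fs IH J JI fI; apply: IH.
  by apply: addI_min => //; apply: fI; rewrite inE eqxx.
by move=> g gfs; apply: fI; rewrite inE gfs orbT.
Qed.

Lemma addIC J f g : addI (addI J f) g = addI (addI J g) f.
Proof.
apply/seteqP; split => _ [_ [h [[j [h' [Jj ->]]] ->]]].
  by exists (j + h * g), h'; split; [exists j, h|ring].
by exists (j + h * f), h'; split; [exists j, h|ring].
Qed.

Lemma gens_addI J f fs : gens (addI J f) fs = addI (gens J fs) f.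
Proof. by elim: fs J => //= g fs IH J; rewrite addIC IH. Qed.

Lemma gens_cat J fs gs : gens J (fs ++ gs) = gens (gens J fs) gs.
Proof. by rewrite /gens foldl_cat. Qed.

Lemma ideal_sat S J : mulset S -> ideal J -> ideal (sat S J).
Proof.
move=> [S1 SM] [J0 D M]; split.
- by exists 1 => //; rewrite mulr0.
- move=> x y [q Sq Jx] [q' Sq' Jy]; exists (q * q'); first exact: SM.
  rewrite (_ : _ * (x + y) = q' * (q * x) + q * (q' * y)); last by ring.
  by apply: D; apply: M.
move=> a x [q Sq Jx]; exists q => //; rewrite mulrCA; exact: M.
Qed.

Lemma sub_sat S J : mulset S -> ideal J -> J `<=` sat S J.
Proof. by move=> [S1 _] [_ _ M] x Jx; exists 1 => //; rewrite mul1r. Qed.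

Lemma sat_mono S J J' : J `<=` J' -> sat S J `<=` sat S J'.
Proof. by move=> JJ x [q Sq Jx]; exists q => //; apply: JJ. Qed.

Lemma sat_unit S J q r : mulset S -> ideal J -> S q -> sat S J (q * r) -> sat S J r.
Proof.
move=> [_ SM] iJ Sq [q' Sq' Jr]; exists (q' * q); first exact: SM.
by rewrite -mulrA.
Qed.

Lemma sat_sat S J : mulset S -> ideal J -> sat S (sat S J) `<=` sat S J.
Proof. by move=> mS iJ r [q Sq]; apply: sat_unit. Qed.

Lemma mulset1 : mulset ([set 1] : set A).
Proof. by split=> // x y -> ->; rewrite mulr1. Qed.

Lemma sat1 J : sat [set 1] J = J.
Proof.
apply/seteqP; split => r; first by case=> q ->; rewrite mul1r.
by move=> Jr; exists 1 => //; rewrite mul1r.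
Qed.

Lemma nzd1 S J f : nzd [set 1] J f -> nzd S J f.
Proof.
move=> h r [q Sq Jr]; exists q => //; have := h (q * r); rewrite !sat1.
by apply; rewrite mulrCA.
Qed.

Lemma reg1 S J fs : reg [set 1] J fs -> reg S J fs.
Proof. by elim: fs J => //= f fs IH J [/nzd1 h /IH]. Qed.

Lemma nzdM S J f g : nzd S J f -> nzd S J g -> nzd S J (f * g).
Proof. by move=> hf hg r; rewrite -mulrA => /hf/hg. Qed.

(* A syzygy of x and fs modulo J can be divided by x, because the last
   coefficient of a syzygy of fs modulo J + (x) lies in the ideal of the rest. *)
Lemma nzd_gens S J x fs : mulset S -> ideal J -> nzd S J x -> reg S (addI J x) fs ->
  nzd S (gens J fs) x.
Proof.
move=> mS; elim: fs J => //= f fs IH J iJ nx [nf rfs].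
apply: IH; rewrite 1?addIC//; first exact: ideal_addI.
move=> r [q Sq [j [h [Jj e]]]].
have : sat S (addI J x) (f * h).
  exists 1; first by case: mS.
  by exists (- j), (q * r); split; [exact: idealN|rewrite mul1r; ring: e].
move=> /nf[q' Sq' [j' [h' [Jj' e']]]].
have : sat S J (x * (q' * q * r - h' * f)).
  exists 1; first by case: mS.
  have -> : 1 * (x * (q' * q * r - h' * f)) = q' * j + j' * f.
    transitivity (q' * (q * (x * r)) - x * h' * f); first by ring.
    by rewrite e mulrDr [q' * (h * f)]mulrA e'; ring.
  by case: iJ => _ D M; apply: D; [apply: M|rewrite mulrC; apply: M].
move=> /nx[q'' Sq'' Jr]; exists (q'' * (q' * q)).
  by case: mS => _ SM; apply: (SM _ _ Sq''); apply: SM.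
exists (q'' * (q' * q * r - h' * f)), (q'' * h'); split => //; ring.
Qed.

Lemma gensP fs r : gens [set 0] fs r <->
  exists h : 'I_(size fs) -> A, r = \sum_i h i * fs`_i.
Proof.
suff gP J : gens J fs r <-> exists2 j, J j &
    exists h : 'I_(size fs) -> A, r = j + \sum_i h i * fs`_i.
  rewrite gP; split=> [[_ -> [h ->]]|[h ->]]; first by exists h; rewrite add0r.
  by exists 0 => //; exists h; rewrite add0r.
elim: fs J => [|f fs IH] J /=.
  split=> [Jr|[j Jj [h ->]]]; last by rewrite big_ord0 addr0.
  by exists r => //; exists (fun _ => 0); rewrite big_ord0 addr0.
rewrite IH; split.
  move=> [_ [j [h [Jj ->]]] [h' ->]]; exists j => //.
  exists (fun i => oapp h' h (unlift ord0 i)); rewrite big_ord_recl unlift_none /=.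
  rewrite addrA; congr (_ + _); apply: eq_bigr => i _; by rewrite liftK.
move=> [j Jj [h ->]]; rewrite big_ord_recl addrA.
exists (j + h ord0 * f); first by exists j, (h ord0).
by exists (fun i => h (lift ord0 i)).
Qed.

End Ideals.

(** * Deformations of regular sequences *)

Section Deformation.
Variables (K : fieldType) (n : nat).
Local Notation R := {mpol K[n]}.

Lemma subspace_ideal (J : set R) : ideal J -> subspace J.
Proof.
case=> J0 D M; split=> // a x y Jx Jy; apply: D => //.
by rewrite -mul_mpolyC; apply: M.
Qed.

Definition specs (us : seq K) (phis : seq {poly R}) : seq R :=
  [seq spec up.1 up.2 | up <- zip us phis].

(** McCoy's theorem for a constant grading: [V] is the whole ring and [U] the saturation in every
    degree. *)
Lemma cocountable_nzd (S J : set R) (phi : {poly R}) t : mulset S -> ideal J ->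
  nzd S J phi`_t -> cocountable (fun u => nzd S J (spec u phi)).
Proof.
move=> mS iJ nt.
have sJ : subspace (sat S J) by apply/subspace_ideal/ideal_sat.
apply: cocountable_mono (@mccoy _ _ phi (fun _ => setT) (fun _ => sat S J) _ _ _ _ _).
- by move=> u h r; apply: (h 0%N).
- by move=> _; split.
- by move=> _.
- by move=> *.
- by move=> _ k v; case: (ideal_sat mS iJ) => _ _; apply.
by move=> _ v _ /(_ t); apply: nt.
Qed.

(** A coefficient in [S] is a unit after localization, hence a nonzerodivisor modulo whatever ideal
    the earlier parameters have produced. *)
Lemma VG_reg (S J : set R) (phis : seq {poly R}) : mulset S -> ideal J ->
  (forall phi, phi \in phis -> exists t, S phi`_t) ->
  VG (size phis) (fun us => reg S J (specs us phis)).
Proof.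
move=> mS; elim: phis J => //= phi phis IH J iJ hphi.
have [t St] : exists t, S phi`_t by apply: hphi; rewrite inE eqxx.
have : cocountable (fun u => nzd S J (spec u phi)).
  by apply: (cocountable_nzd (t := t)) => // r; apply: sat_unit.
apply: cocountable_mono => u hu.
have : VG (size phis) (fun us => reg S (addI J (spec u phi)) (specs us phis)).
  apply: IH; first exact: ideal_addI.
  by move=> psi hpsi; apply: hphi; rewrite inE hpsi orbT.
by apply: VG_mono => us _ h /=; split.
Qed.

Definition constS (S : set R) : set {poly R} := [set q%:P | q in S].
(** The ideal generated by [J] and the parameter; modulo it, a family is the same as its member at
    0. *)
Definition pull0 (J : set R) : set {poly R} := [set p | J p.[0]].
Definition at0 (phis : seq {poly R}) : seq R := [seq p.[0] | p : {poly R} <- phis].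

Lemma mulset_const S : mulset S -> mulset (constS S).
Proof.
case=> S1 SM; split; first by exists 1.
by move=> _ _ [x Sx <-] [y Sy <-]; exists (x * y); [exact: SM|rewrite polyCM].
Qed.

Lemma addI_pull0 J phi : addI (pull0 J) phi = pull0 (addI J phi.[0]).
Proof.
apply/seteqP; split => [_ [p [h [Jp ->]]]|r [j [h [Jj e]]]].
  by exists p.[0], h.[0]; rewrite hornerD hornerM.
exists (r - h%:P * phi), h%:P; split; last by rewrite subrK.
by rewrite /pull0 /= hornerD hornerN hornerM hornerC e addrK.
Qed.

Lemma reg_pull0 S J phis : reg S J (at0 phis) -> reg (constS S) (pull0 J) phis.
Proof.
elim: phis J => //= phi phis IH J [nphi /IH]; rewrite -addI_pull0; split => //.
move=> r [_ [q Sq <-]]; rewrite /pull0 /= !hornerM hornerC => Jr.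
have [|q' Sq' Jq'] := nphi r.[0]; first by exists q.
by exists q'%:P; [exists q'|rewrite /pull0 /= hornerM hornerC].
Qed.

(** The parameter is a nonzerodivisor modulo 0, and modulo the parameter the family is the regular
    sequence at 0; [nzd_gens] exchanges the order. *)
Lemma nzd_deformation S phis : mulset S -> reg S [set 0] (at0 phis) ->
  nzd (constS S) (gens [set 0] phis) 'X.
Proof.
move=> mS rp; apply: nzd_gens; [exact: mulset_const|exact: ideal0| |].
  move=> r [_ [q Sq <-]] e; exists q%:P; first by exists q.
  have e' : q%:P * r * 'X = 0 by rewrite -mulrA [r * _]mulrC.
  by apply/polyP => i; have /polyP/(_ i.+1) := e'; rewrite coefMX /= !coef0.
have -> : addI [set 0] 'X = pull0 [set 0] :> set {poly R}.
  apply/seteqP; split => [_ [_ [h [-> ->]]]|p /= /eqP p0].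
    by rewrite /pull0 /= add0r hornerMX mulr0.
  by have /factor_theorem[h ->] : root p 0 by []; exists 0, h; rewrite subr0 add0r.
exact: reg_pull0.
Qed.

Lemma ideal_pull0 J : ideal J -> ideal (pull0 J).
Proof.
case=> J0 D M; split; rewrite /pull0 /=; first by rewrite horner0.
  by move=> p q; rewrite hornerD; apply: D.
by move=> a p; rewrite hornerM; apply: M.
Qed.

Lemma gens_at0 phis p : gens [set 0] phis p -> gens [set 0] (at0 phis) p.[0].
Proof.
apply: (@gens_min _ _ _ (pull0 _)); first exact/ideal_pull0/ideal_gens/ideal0.
  by move=> _ ->; rewrite /pull0 /= horner0; case: (ideal_gens (at0 phis) (ideal0 R)).
move=> phi hphi; apply: gens_mem; first exact: ideal0.
by apply/mapP; exists phi.
Qed.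

Definition mult_index (phis : seq {poly R}) D : finType :=
  ('I_(size phis) * bmultinom n D)%type.

Definition multiple phis D (x : mult_index phis D) : {poly R} :=
  (mpolyX K (bmnm x.2))%:P * phis`_x.1.

Lemma gens_monomials phis t r :
  gens [set 0] [seq spec t p | p <- phis] r -> exists D : nat,
  exists h : 'I_#|{: mult_index phis D}| -> K,
  r = comb (fun k => spec t (multiple (enum_val k))) h.
Proof.
move=> /gensP; rewrite size_map => -[h ->].
pose D := \max_i msize (h i); exists D.
exists (fun k => mcoeff (bmnm (enum_val k).2) (h (enum_val k).1)).
rewrite /comb (reindex_onto (@enum_rank {: mult_index phis D})
  (@enum_val _ _)) /=; last by move=> i _; rewrite enum_valK.
under [RHS]eq_bigl do rewrite enum_rankK eqxx.
under [RHS]eq_bigr do rewrite enum_rankK.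
rewrite -(pair_bigA _ (fun i m => mcoeff (bmnm m) (h i) *:
  spec t (@multiple phis D (i, m)))) /=.
apply: eq_bigr => i _; rewrite (nth_map 0)//.
have hD : (msize (h i) <= D)%N by apply: (leq_bigmax (F := fun i => msize (h i))).
rewrite {1}(mpolywE hD) mulr_suml; apply: eq_bigr => m _.
by rewrite /multiple specM specC scalerAl.
Qed.

(* A relation among the e i modulo phis(t), for too many t, comes from one with
   coefficients polynomial in t; regularity allows dividing it by t until it
   does not vanish at t = 0. *)
Lemma deformation S S' phis d (e : 'I_d -> R) : mulset S -> mulset S' ->
  nzd (constS S) (gens [set 0] phis) 'X -> nzd (constS S') (gens [set 0] phis) 'X ->
  (forall c, sat S (gens [set 0] (at0 phis)) (comb e c) ->
     sat S' (gens [set 0] (at0 phis)) (comb e c) -> forall i, c i = 0) ->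
  cocountable (fun t => forall c,
    gens [set 0] [seq spec t p | p <- phis] (comb e c) -> forall i, c i = 0).
Proof.
move=> mS mS' nX nX' ie.
(* Both saturations are carried along, because independence at t = 0 is known only modulo their
   intersection. *)
have key N (c : 'I_d -> {poly K}) : (forall i, (size (c i) <= N)%N) ->
    sat (constS S) (gens [set 0] phis) (\sum_i liftc n (c i) * (e i)%:P) ->
    sat (constS S') (gens [set 0] phis) (\sum_i liftc n (c i) * (e i)%:P) ->
    forall i, c i = 0.
  elim: N c => [|N IH] c sc.
    by move=> _ _ i; apply/eqP; rewrite -size_poly_eq0 -leqn0.
  move=> hc hc'.
  have e0 : (\sum_i liftc n (c i) * (e i)%:P).[0] = comb e (fun i => (c i)`_0).
    rewrite horner_sum; apply: eq_bigr => i _.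
    by rewrite horner_coef0 coef_liftcM.
  have hq S1 : sat (constS S1) (gens [set 0] phis) (\sum_i liftc n (c i) * (e i)%:P) ->
      sat S1 (gens [set 0] (at0 phis)) (comb e (fun i => (c i)`_0)).
    move=> [_ [q Sq <-] /gens_at0]; rewrite hornerM hornerC e0 => he; by exists q.
  have c0 : forall i, (c i)`_0 = 0 by apply: ie; apply: hq.
  pose c' i := \poly_(j < N) (c i)`_j.+1.
  have cE i : c i = c' i * 'X.
    apply/polyP => -[|j]; rewrite coefMX /= ?c0// coef_poly; case: ltnP => // Nj.
    by rewrite nth_default//; apply: leq_trans (sc i) _.
  suff c'0 : forall i, c' i = 0 by move=> i; rewrite cE c'0 mul0r.
  have eX : \sum_i liftc n (c i) * (e i)%:P = 'X * \sum_i liftc n (c' i) * (e i)%:P.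
    rewrite mulr_sumr; apply: eq_bigr => i _.
    by rewrite cE /liftc rmorphM /= map_polyX; ring.
  rewrite eX in hc hc'; apply: IH => [i||]; [exact: size_poly|exact: nX|exact: nX'].
have h D : cocountable (fun t => forall c
    (h : 'I_#|{: mult_index phis D}| -> K),
    comb e c + comb (fun k => spec t (multiple (enum_val k))) h = 0 -> forall i, c i = 0).
  case: (poly_family (fun i => (e i)%:P) (fun k : 'I_#|{: mult_index phis D}| =>
    multiple (enum_val k))).
    move=> [c [[i ci] [h eh]]]; exfalso; move/eqP: ci; apply.
    have gc : gens [set 0] phis (\sum_i liftc n (c i) * (e i)%:P).
      move/eqP: eh; rewrite addr_eq0 => /eqP ->.
      have iG := ideal_gens phis (ideal0 {poly R}); have [_ _ M] := iG.
      apply: idealN => //; apply: ideal_sum => // k _.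
      apply: (M); apply: (M); apply: gens_mem; first exact: ideal0.
      exact: mem_nth.
    by apply: (key (\max_i size (c i)) c (fun j => leq_bigmax j)); apply: sub_sat gc => //;
      do ?[exact: mulset_const|exact/ideal_gens/ideal0].
  move=> [Q Q0 QP]; apply: cocountable_mono (cocountable_root Q0) => t Qt c h eh.
  apply: (QP t Qt _ h); under [X in comb X c]funext do rewrite specC.
  exact: eh.
apply: cocountable_mono (cocountable_forall h) => t ht c /gens_monomials[D [H eH]].
apply: (ht D c (fun k => - H k)); rewrite eH; apply/eqP; rewrite addr_eq0 /comb -sumrN.
by apply/eqP/eq_bigr => k _; rewrite scaleNr opprK.
Qed.

End Deformation.

(** * Reduction of graded spaces by generic forms *)

Section GradedReduction.
Variables (K : fieldType) (n : nat).
Local Notation R := {mpol K[n]}.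
Hypothesis ncK : ~ countable [set: K].
Variables (V : nat -> set R) (B : seq R).
Hypothesis sV : forall k, subspace (V k).
Hypothesis BV : forall k b v, b \in B -> V k v -> V k.+1 (b * v).
Implicit Types U : nat -> set R.

Definition graded U := [/\ forall k, subspace (U k), forall k, U k `<=` V k
  & forall k b v, b \in B -> U k v -> U k.+1 (b * v)].

(** Analogue of the saturation by the irrelevant ideal: elements that all words in [B] of some
    length carry into [U]. Passing to it makes the quotient torsion-free, as McCoy's theorem
    requires. *)
Definition satB U k : set R := [set v | V k v /\ exists l, forall w : seq R,
  size w = l -> {subset w <= B} -> U (k + l)%N ((\prod_(b <- w) b) * v)].

Definition Uadd U (f : R) k : set R := [set r | exists u w, U k u /\
  if k is k'.+1 then V k' w /\ r = u + f * w else r = u].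

Definition Ugens U fs := foldl Uadd U fs.

Lemma satB_le U k v l l' : graded U -> (l <= l')%N ->
  (forall w : seq R, size w = l -> {subset w <= B} ->
    U (k + l)%N ((\prod_(b <- w) b) * v)) ->
  forall w : seq R, size w = l' -> {subset w <= B} ->
    U (k + l')%N ((\prod_(b <- w) b) * v).
Proof.
move=> [_ _ UB] /subnK <-; move: (l' - l)%N => j; elim: j => [//|j IH] h.
case=> // b w [sw] wB; rewrite big_cons -mulrA addSn addnS; apply: UB.
  by apply: wB; rewrite inE eqxx.
by apply: IH => // c cw; apply: wB; rewrite inE cw orbT.
Qed.

Lemma sub_satB U k : graded U -> U k `<=` satB U k.
Proof.
case=> sU UV _ v Uv; split; first exact: UV.
by exists 0%N => -[] // _ _; rewrite big_nil mul1r addn0.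
Qed.

Lemma graded_satB U : graded U -> graded (satB U).
Proof.
move=> gU; have [sU UV UB] := gU; split=> [k|k v []//|k b v bB [Vv [l hl]]].
  split.
    split; first exact: sub0.
    by exists 0%N => w _ _; rewrite mulr0; apply: sub0.
  move=> a x y [Vx [l hl]] [Vy [l' hl']]; split; first by apply: subD => //; apply: subZ.
  exists (maxn l l') => w sw wB; rewrite mulrDr -scalerAr; apply: subD => //.
    by apply: subZ => //; apply: (satB_le gU _ hl) => //; apply: leq_maxl.
  by apply: (satB_le gU _ hl') => //; apply: leq_maxr.
split; first exact: BV.
by exists l => w sw wB; rewrite mulrCA addSn; apply: UB => //; apply: hl.
Qed.

Lemma satB_torsion_free U k v : graded U -> V k v ->
  (forall b, b \in B -> satB U k.+1 (b * v)) -> satB U k v.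
Proof.
move=> gU Vv h; split => //.
have /choice[l hl] b : exists l, b \in B -> forall w : seq R,
    size w = l -> {subset w <= B} -> U (k.+1 + l)%N ((\prod_(b <- w) b) * (b * v)).
  have [bB|_] := boolP (b \in B); last by exists 0%N.
  by have [_ [l hl]] := h _ bB; exists l.
exists (\max_(b <- B) l b).+1 => -[//|b w [sw] wB].
have bB : b \in B by apply: wB; rewrite inE eqxx.
rewrite big_cons addnS -addSn (mulrC b) -mulrA.
apply: (satB_le gU _ (hl b bB)) => //; first exact: leq_bigmax_seq.
by move=> c cw; apply: wB; rewrite inE cw orbT.
Qed.

Lemma graded_Uadd U f : graded U -> (forall k v, V k v -> V k.+1 (f * v)) ->
  graded (Uadd U f).
Proof.
move=> [sU UV UB] fV; split=> [k|k r [u [w [Uu]]]|k b r bB [u [w [Uu]]]].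
- split.
    exists 0, 0; split; first exact: sub0.
    by case: k => // k; split; [exact: sub0|rewrite mulr0 addr0].
  move=> a x y [u [w [Uu h]]] [u' [w' [Uu' h']]].
  exists (a *: u + u'), (a *: w + w'); split.
    by apply: subD => //; apply: subZ.
  case: k Uu h Uu' h' => [|k] Uu; first by move=> -> _ ->.
  move=> [Vw ->] Uu' [Vw' ->]; split; first by apply: subD => //; apply: subZ.
  by rewrite mulrDr scalerDr -scalerAr addrACA.
- case: k Uu => [|k] Uu; first by move=> ->; apply: UV.
  by move=> [Vw ->]; apply: subD; [exact: sV|exact: UV|exact: fV].
case: k Uu => [|k] Uu.
  move=> ->; exists (b * u), 0; split; first exact: UB.
  by split; [exact: sub0|rewrite mulr0 addr0].
move=> [Vw ->]; exists (b * u), (b * w); split; first exact: UB.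
by split; [exact: BV|rewrite mulrDr mulrCA].
Qed.

Lemma sub_Uadd U f k : (forall k, subspace (V k)) -> U k `<=` Uadd U f k.
Proof.
move=> _ u Uu; exists u, 0; split => //.
by case: k Uu => // k _; split; [exact: sub0|rewrite mulr0 addr0].
Qed.

Lemma Uadd_mem U f k v : subspace (U k.+1) -> V k v -> Uadd U f k.+1 (f * v).
Proof. by move=> sU Vv; exists 0, v; split; [exact: sub0|rewrite add0r]. Qed.

Definition B_curve (phi : {poly R}) :=
  (forall t, phi`_t = 0 \/ phi`_t \in B) /\ forall b, b \in B -> exists t, phi`_t = b.

Lemma B_curveV phi W : B_curve phi -> (forall k, subspace (W k)) ->
  (forall k b v, b \in B -> W k v -> W k.+1 (b * v)) ->
  forall k t v, W k v -> W k.+1 (phi`_t * v).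
Proof.
move=> [hphi _] sW WB k t v Wv; case: (hphi t) => [->|bB].
  by rewrite mul0r; apply: sub0.
exact: WB.
Qed.

Lemma spec_V phi u : B_curve phi -> forall k v, V k v -> V k.+1 (spec u phi * v).
Proof.
move=> bp k v Vv; rewrite /spec horner_coef mulr_suml; apply: sub_sum => // i _.
rewrite -rmorphXn /= mulrAC [X in V _ X]mulrC mul_mpolyC; apply: subZ => //.
exact: B_curveV.
Qed.

Lemma generic_injective U phi : graded U -> B_curve phi ->
  cocountable (fun u => forall k v, V k v ->
    satB U k.+1 (spec u phi * v) -> satB U k v).
Proof.
move=> gU bp; have [sU' UV' UB'] := graded_satB gU.
apply: mccoy => //; first exact: B_curveV.
  exact: B_curveV.
move=> k v Vv h; apply: satB_torsion_free => // b bB.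
by have [_ /(_ b bB)[t <-]] := bp.
Qed.

Lemma dge_step U phi u k a b : graded U -> B_curve phi ->
  (forall k v, V k v -> satB U k.+1 (spec u phi * v) -> satB U k v) ->
  dge (V k) (satB U k) b -> dge (V k.+1) (satB (Uadd U (spec u phi)) k.+1) a ->
  dge (V k.+1) (satB U k.+1) (a + b).
Proof.
move=> gU bp inj gb ga.
have gU' : graded (Uadd U (spec u phi)) by apply: graded_Uadd => //; exact: spec_V.
have [sU _ _] := gU; have [ss sv _] := graded_satB gU'.
apply: (dge_trans _ _ _ ga); [exact: ss| |exact: sv|].
  move=> v [Vv [l hl]]; split => //; exists l => w sw wB.
  by apply: sub_Uadd => //; apply: hl.
apply: (dge_map (phi := fun v => spec u phi * v)) gb => //.
- by move=> c x y; rewrite mulrDr scalerAr.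
- by move=> v Vv; apply: sub_satB => //; apply: Uadd_mem.
exact: inj.
Qed.

(** A generic form, chosen for this purpose only, embeds each degree of the quotient into the
    next. *)
Lemma dge_shift U phi k t a : graded U -> B_curve phi ->
  dge (V k) (satB U k) a -> dge (V (k + t)%N) (satB U (k + t)%N) a.
Proof.
move=> gU bp ga; elim: t => [|t IH]; first by rewrite addn0.
have [u inj] := cocountable_ex ncK (generic_injective gU bp).
rewrite addnS; apply: dge_map IH => //; last exact: inj.
  by move=> c x y; rewrite mulrDr scalerAr.
exact: spec_V.
Qed.

(** Each further degree contributes [a] new dimensions. Read backwards: a growth bound of degree p +
    1 before adding the form gives one of degree p afterwards. *)
Lemma dge_growth U phi u k t a : graded U -> B_curve phi ->
  (forall k v, V k v -> satB U k.+1 (spec u phi * v) -> satB U k v) ->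
  dge (V k) (satB (Uadd U (spec u phi)) k) a ->
  dge (V (k + t)%N) (satB U (k + t)%N) (a * t.+1).
Proof.
move=> gU bp inj ga.
have gU' : graded (Uadd U (spec u phi)) by apply: graded_Uadd => //; exact: spec_V.
elim: t => [|t IH]; last first.
  rewrite addnS mulnS; apply: (dge_step gU bp inj IH).
  by rewrite -addnS; apply: (dge_shift _ gU' bp).
rewrite addn0 muln1; apply: dge_mono ga => // v _ [Vv [l hl]]; split => //.
by exists l => w sw wB; apply: sub_Uadd => //; apply: hl.
Qed.

Definition generated U k0 := forall k, (k0 <= k)%N -> forall v, V k.+1 v ->
  exists w : R -> R, (forall b, V k (w b)) /\ U k.+1 (v - \sum_(b <- B) b * w b).

(** Modulo [U], degree [k0] is spanned by finitely many elements, so one word length [L] serves all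
    of them. Since higher degrees are generated by [B], the words are used up [L] degrees later. *)
Lemma unwind_saturation U k0 c : graded U -> generated U k0 ->
  dle (V k0) (U k0) c -> (forall k, V k `<=` satB U k) ->
  exists k1, forall k, (k1 <= k)%N -> V k `<=` U k.
Proof.
move=> gU gen [e Ve se] VU; have [sU UV UB] := gU.
have /choice[l hl] i : exists l, forall w : seq R, size w = l -> {subset w <= B} ->
    U (k0 + l)%N ((\prod_(b <- w) b) * e i).
  by have [_] := VU _ _ (Ve i).
pose L := \max_i l i.
have U0 v : U k0 v -> forall w : seq R, size w = L -> {subset w <= B} ->
    U (k0 + L)%N ((\prod_(b <- w) b) * v).
  move=> Uv; apply: (satB_le gU (leq0n L)) => -[]// _ _.
  by rewrite big_nil mul1r addn0.
have h0 v : V k0 v -> forall w : seq R, size w = L -> {subset w <= B} ->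
    U (k0 + L)%N ((\prod_(b <- w) b) * v).
  move=> /se[x Ux] w sw wB; rewrite -[v](subrK (comb e x)) mulrDr; apply: subD => //.
    exact: U0.
  rewrite /comb mulr_sumr; apply: sub_sum => // i _; rewrite -scalerAr; apply: subZ => //.
  by apply: (satB_le gU _ (hl i)) => //; apply: leq_bigmax.
(* An element [j] degrees above [k0] has already spent [j] of the [L] letters on its generators. *)
have h j : (j <= L)%N -> forall v, V (k0 + j)%N v -> forall w : seq R,
    size w = (L - j)%N -> {subset w <= B} -> U (k0 + L)%N ((\prod_(b <- w) b) * v).
  elim: j => [|j IH] jL v; first by rewrite addn0 subn0; apply: h0.
  rewrite addnS => /(gen _ (leq_addr _ _))[x [Vx Ux]] w sw wB.
  rewrite -[v](subrK (\sum_(b <- B) b * x b)) mulrDr; apply: subD => //.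
    have -> : (k0 + L = (k0 + j).+1 + size w)%N by rewrite sw; lia.
    apply: (satB_le gU (leq0n (size w)) (l := 0)) => // -[]// _ _.
    by rewrite big_nil mul1r addn0.
  rewrite mulr_sumr big_seq; apply: sub_sum => // b bB; rewrite mulrA (mulrC _ b).
  have -> : b * \prod_(y <- w) y = \prod_(y <- b :: w) y by rewrite big_cons.
  apply: IH => //; first exact: ltnW.
    by rewrite /= sw -subSn.
  by move=> y; rewrite inE => /orP[/eqP ->|/wB].
exists (k0 + L)%N => k /subnK <-; move: (k - _)%N => j; elim: j => [|j IH] v.
  rewrite add0n => Vv; have := h L (leqnn _) v Vv [::].
  by rewrite subnn big_nil mul1r; apply.
rewrite addSn => /gen[|x [Vx Ux]]; first by lia.
rewrite -[v](subrK (\sum_(b <- B) b * x b)); apply: subD => //.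
by rewrite big_seq; apply: sub_sum => // b bB; apply: UB => //; apply: IH.
Qed.

(* Each generic form lowers the degree of growth of V / sat U by one, so that
   p + 1 of them exhaust it. *)
Lemma generic_reduction (phis : seq {poly R}) p C U k0 c : graded U ->
  generated U k0 -> dle (V k0) (U k0) c ->
  size phis = p.+1 -> (forall phi, phi \in phis -> B_curve phi) ->
  (forall k a, dge (V k) (satB U k) a -> (a <= C * k.+1 ^ p)%N) ->
  VG (size phis) (fun us => exists k1, forall k, (k1 <= k)%N ->
    V k `<=` Ugens U (specs us phis) k).
Proof.
elim: p C phis U => [|p IH] C [//|phi phis] U gU gen fU [sp] hphi growth.
  move: sp hphi => /size0nil -> hphi /=.
  have bp : B_curve phi by apply: hphi; rewrite inE.
  apply: cocountable_mono (generic_injective gU bp) => u inj.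
  have gU' : graded (Uadd U (spec u phi)) by apply: graded_Uadd => //; exact: spec_V.
  apply: (unwind_saturation (k0 := k0) (c := c) gU').
  - move=> k hk v /(gen _ hk)[w [Vw Uw]]; exists w; split => //; exact: sub_Uadd.
  - apply: dle_mono fU; exact: sub_Uadd.
  move=> k v Vv; apply: contrapT => nv; have [ss _ _] := graded_satB gU'.
  have /(dge_growth C gU bp inj)/growth := dge1 (ss k) Vv nv.
  by rewrite expn0 muln1 mul1n ltnn.
have bp : B_curve phi by apply: hphi; rewrite inE eqxx.
rewrite /=; apply: cocountable_mono (generic_injective gU bp) => u inj.
have gU' : graded (Uadd U (spec u phi)) by apply: graded_Uadd => //; exact: spec_V.
apply: (IH (C * 2 ^ p.+1)%N phis (Uadd U (spec u phi))) => //.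
- move=> k hk v /(gen _ hk)[w [Vw Uw]]; exists w; split => //; exact: sub_Uadd.
- apply: dle_mono fU; exact: sub_Uadd.
- by move=> psi hpsi; apply: hphi; rewrite inE hpsi orbT.
move=> k a /(dge_growth k gU bp inj)/growth h.
rewrite -(@leq_pmul2r k.+1)//; apply: leq_trans h _.
rewrite -!mulnA leq_mul2l -expnSr -expnMn leq_exp2r//; apply/orP; right; lia.
Qed.

End GradedReduction.

(** * Stable dimension of graded quotients *)

Section Stabilization.
Variables (K : fieldType) (n : nat).
Local Notation R := {mpol K[n]}.
Variables (V N : nat -> set R) (B : seq R) (b0 : R) (k1 c : nat).
Hypothesis sV : forall k, subspace (V k).
Hypothesis sN : forall k, subspace (N k).
Hypothesis NV : forall k, N k `<=` V k.
Hypothesis b0B : b0 \in B.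
Hypothesis BV : forall k b v, b \in B -> V k v -> V k.+1 (b * v).
Hypothesis BN : forall k b v, b \in B -> N k v -> N k.+1 (b * v).
Hypothesis surj : forall k, (k1 <= k)%N -> forall b, b \in B -> forall v, V k.+1 v ->
  exists2 w, V k w & N k.+1 (v - b * w).
Hypothesis fin : dle (V k1) (N k1) c.

Lemma linear_mul (b : R) : linear (fun v : R => b * v).
Proof. by move=> a x y; rewrite mulrDr scalerAr. Qed.

Lemma word_V k v (w : seq R) : {subset w <= B} -> V k v ->
  V (k + size w)%N ((\prod_(b <- w) b) * v).
Proof.
elim: w v k => [|b w IH] v k wB Vv; first by rewrite big_nil mul1r addn0.
rewrite big_cons -mulrA addnS; apply: BV; first by apply: wB; rewrite inE eqxx.
by apply: IH => // x xw; apply: wB; rewrite inE xw orbT.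
Qed.

Lemma word_surj k v (w : seq R) : (k1 <= k)%N -> {subset w <= B} ->
  V (k + size w)%N v -> exists2 v', V k v' & N (k + size w)%N (v - (\prod_(b <- w) b) * v').
Proof.
move=> hk; elim: w v => [|b w IH] v wB Vv.
  rewrite addn0 in Vv *; exists v => //; rewrite big_nil mul1r subrr; exact: sub0.
have bB : b \in B by apply: wB; rewrite inE eqxx.
have wB' : {subset w <= B} by move=> x xw; apply: wB; rewrite inE xw orbT.
have hk' : (k1 <= k + size w)%N by apply: leq_trans hk (leq_addr _ _).
rewrite /= addnS in Vv *; have [v1 Vv1 Nv1] := surj hk' bB Vv.
have [v2 Vv2 Nv2] := IH _ wB' Vv1; exists v2 => //.
rewrite big_cons -mulrA -[v](subrK (b * v1)) -addrA -mulrBr; apply: subD => //.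
exact: BN.
Qed.

Lemma dle_succ k a : (k1 <= k)%N -> dle (V k) (N k) a -> dle (V k.+1) (N k.+1) a.
Proof.
move=> hk; apply: (dle_map (phi := fun v => b0 * v)).
- exact: linear_mul.
- exact: sN.
- by move=> v; apply: BV.
- by move=> v; apply: BN.
by move=> v /(surj hk b0B).
Qed.

(** Multiplication by [b0] is surjective from degree [k1] on, so the dimension of [V k] modulo [N k]
    does not increase. Once it is minimal, a nonzero class killed by some [b] would make the next
    dimension smaller still. *)
Lemma stabilization : exists k2 d, (k1 <= k2)%N /\ forall k, (k2 <= k)%N ->
  qdim (V k) (N k) d /\
  forall b v, b \in B -> V k v -> N k.+1 (b * v) -> N k v.
Proof.
pose P d := `[< exists2 k, (k1 <= k)%N & dle (V k) (N k) d >].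
have exP : exists d, P d by exists c; apply/asboolP; exists k1.
case: (ex_minnP exP) => d /asboolP[k2 hk2 ld] dmin; exists k2, d; split=> // k hk.
have lek j : (k2 <= j)%N -> dle (V j) (N j) d.
  move=> /subnKC <-; elim: (j - k2)%N => [|i IH]; first by rewrite addn0.
  by rewrite addnS; apply: dle_succ => //; apply: leq_trans (leq_addr _ _).
have hk1 : (k1 <= k)%N by apply: leq_trans hk.
have [d' d'd qd'] := dim_exists (sN k) (lek k hk).
have dd' : d' = d.
  apply/eqP; rewrite eqn_leq d'd; apply: dmin; apply/asboolP; exists k => //.
  by case: qd'.
rewrite dd' {d' d'd dd'} in qd'; split=> // b v bB Vv Nbv; apply: contrapT => nv.
pose N' : set R := [set x | exists a, N k (x - a *: v)].
have sN' : subspace N'.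
  split; first by exists 0; rewrite scale0r subrr; apply: sub0.
  move=> a x y [ax Nx] [ay Ny]; exists (a * ax + ay).
  have -> : a *: x + y - (a * ax + ay) *: v = a *: (x - ax *: v) + (y - ay *: v).
    by rewrite scalerBr scalerA scalerDl opprD addrACA.
  by apply: subD => //; apply: subZ.
have NN' : N k `<=` N' by move=> x Nx; exists 0; rewrite scale0r subr0.
have [d' _ [gd' ld']] := dim_exists sN' (dle_mono NN' (lek k hk)).
have : (d' + 1 <= d)%N.
  apply: (steinitz (sN k) _ (lek k hk)); apply: (dge_trans sN' NN' _ gd').
    move=> x [a Nx]; rewrite -[x](subrK (a *: v)); apply: subD => //; first exact: NV.
    exact: subZ.
  by apply: (@dge1 _ _ N' (N k) v) => //; exists 1; rewrite scale1r subrr; apply: sub0.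
suff : (d <= d')%N by lia.
apply: dmin; apply/asboolP; exists k.+1; first exact: leqW.
apply: (dle_map (phi := fun v => b * v)) ld'; [exact: linear_mul|exact: sN| | |].
- by move=> x; apply: BV.
- move=> x [a Nx]; rewrite -[x](subrK (a *: v)) mulrDr; apply: subD => //.
    exact: BN.
  by rewrite -scalerAr; apply: subZ.
by move=> x /(surj hk1 bB).
Qed.

Variables (X J : set R).
Hypothesis mX : mulset X.
Hypothesis BX : forall b, b \in B -> X b.
Hypothesis iJ : ideal J.
Hypothesis NJ : forall k, N k `<=` J.
Hypothesis deepN : forall k r, V k r -> sat X J r ->
  exists2 w : seq R, {subset w <= B} & N (k + size w)%N ((\prod_(b <- w) b) * r).
Hypothesis deepV : forall r, exists2 w : seq R, {subset w <= B}
  & V (size w) ((\prod_(b <- w) b) * r).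

Lemma word_X (w : seq R) : {subset w <= B} -> X (\prod_(b <- w) b).
Proof.
move=> wB; rewrite big_seq; elim/big_ind: _ => [|x y|b bw]; [by case: mX| |].
  by case: mX => _; apply.
exact/BX/wB.
Qed.

(** Each [b] acts bijectively between the stable degrees, so a single degree already represents the
    whole localization. *)
Lemma torus_dimension : exists k2 d, qdim setT (sat X J) d /\
  forall k, (k2 <= k)%N -> qdim (V k) (N k) d /\ forall v, V k v -> sat X J v -> N k v.
Proof.
have [k2 [d [hk2 st]]] := stabilization.
have inj k w v : (k2 <= k)%N -> {subset w <= B} -> V k v ->
    N (k + size w)%N ((\prod_(b <- w) b) * v) -> N k v.
  move=> hk; elim: w => [|b w IH] wB Vv; first by rewrite big_nil mul1r addn0.
  have wB' : {subset w <= B} by move=> x xw; apply: wB; rewrite inE xw orbT.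
  rewrite big_cons -mulrA addnS => Nv; apply: IH => //.
  have [|_ /(_ b)] := st (k + size w)%N; first by apply: leq_trans hk (leq_addr _ _).
  by apply=> //; [apply: wB; rewrite inE eqxx|apply: word_V].
have VN k v : (k2 <= k)%N -> V k v -> sat X J v -> N k v.
  by move=> hk Vv /(deepN Vv)[w wB]; apply: inj.
exists k2, d; split; last first.
  by move=> k hk; split; [case: (st k hk)|move=> v; apply: VN].
have ssat : subspace (sat X J) by apply/subspace_ideal/ideal_sat.
have [q2 _] := st k2 (leqnn _).
have gd : dge setT (sat X J) d.
  by case: q2 => g _; apply: dge_mono g => // v Vv; apply: VN.
pose b0k : R := \prod_(b <- nseq k2 b0) b.
have b0kB : {subset nseq k2 b0 <= B} by move=> x; rewrite mem_nseq => /andP[_ /eqP ->].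
(* A word [w] brings [r] into the filtration; the factor [b0k] raises the degree by [k2], so that
   dividing by [w] again ends exactly in degree [k2]. *)
have red r : exists v, V k2 v /\ sat X J (b0k * r - v).
  have [w wB Vr] := deepV r.
  have := word_V b0kB Vr; rewrite size_nseq addnC => /(word_surj hk2 wB)[v Vv Nv].
  exists v; split => //; apply: (sat_unit mX iJ (word_X wB)).
  apply: sub_sat => //; apply: NJ; move: Nv; congr (N _ _).
  by rewrite mulrBr mulrCA.
have bd a : dge setT (sat X J) a -> (a <= d)%N.
  move=> [e _ ie]; case: q2 => _ l2; apply: (steinitz (sN k2) _ l2).
  have /choice[v hv] i := red (e i); exists v; first by move=> i; case: (hv i).
  move=> x Nx; apply: ie; apply: (sat_unit mX iJ (word_X b0kB)).
  rewrite (comb_linear _ _ (linear_mul _)).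
  rewrite -[X in sat _ _ X](subrK (comb v x)); apply: subD => //; last first.
    by apply: sub_sat => //; apply: NJ Nx.
  rewrite /comb -sumrB; apply: sub_sum => // i _; rewrite -scalerBr; apply: subZ => //.
  by case: (hv i).
have [d' d'd qd'] := dge_max ssat bd.
suff -> : d = d' by [].
by apply/eqP; rewrite eqn_leq d'd; case: qd' => _ l; rewrite (steinitz ssat gd l).
Qed.

End Stabilization.

Notation "a +m b" := (mnm_add a b) (at level 50, left associativity).
Notation "0m" := (mnm0) (at level 0).

(** * Spaces spanned by monomials *)

Section MonomialSpans.
Variables (K : fieldType) (n : nat).
Local Notation R := {mpol K[n]}.
Local Notation M := 'NN^n.
Local Notation "'X^' m" := (mpolyX K m) (at level 2, m at level 1).
Implicit Types (S Y : set M) (p : R) (a b c m : M).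

Definition supp_in S : set R := [set p | forall m, mcoeff m p != 0 -> S m].

Lemma subspace_supp S : subspace (supp_in S).
Proof.
split=> [m|x p q hp hq m]; first by rewrite mcoeff0 eqxx.
rewrite mcoeffD mcoeffZ; have [p0|/hp//] := eqVneq (mcoeff m p) 0; rewrite ?p0.
by rewrite mulr0 add0r; apply: hq.
Qed.

Lemma supp_inX S m : S m -> supp_in S X^m.
Proof.
by move=> Sm k; rewrite mcoeffX; have [<-//|_] := eqVneq m k; rewrite eqxx.
Qed.

Lemma supp_in_min S (W : set R) : subspace W -> (forall m, S m -> W X^m) ->
  supp_in S `<=` W.
Proof.
move=> sW SW p hp; rewrite [p]mpolyE big_seq; apply: sub_sum => // m mp.
by apply: subZ => //; apply/SW/hp; rewrite -mcoeff_msupp.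
Qed.

Lemma supp_in_sub S Y : S `<=` Y -> supp_in S `<=` supp_in Y.
Proof. by move=> SY p hp m /hp/SY. Qed.

Lemma mcoeffXM b p m : mcoeff (b +m m) (X^b * p) = mcoeff m p.
Proof. by rewrite mulrC mcoeffMX. Qed.

Lemma supp_in_XM S Y b p : supp_in S p -> (forall m, S m -> Y (b +m m)) ->
  supp_in Y (X^b * p).
Proof.
move=> hp SY; apply: (supp_in_min (W := [set q | supp_in Y (X^b * q)])) hp.
  split=> [|x q r hq hr]; rewrite /mkset.
    by rewrite mulr0; apply: sub0 (subspace_supp Y).
  by rewrite mulrDr -scalerAr; apply: (subspace_supp Y).2.
by move=> m Sm; rewrite /mkset -mpolyXD; apply: supp_inX; apply: SY.
Qed.

Lemma supp_in_M S T Y p q : supp_in S p -> supp_in T q ->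
  (forall a b, S a -> T b -> Y (a +m b)) -> supp_in Y (p * q).
Proof.
move=> hp hq STY; apply: (supp_in_min (W := [set p | supp_in Y (p * q)])) hp.
  split=> [|x r s hr hs]; rewrite /mkset.
    by rewrite mul0r; apply: sub0 (subspace_supp Y).
  by rewrite mulrDl -scalerAl; apply: (subspace_supp Y).2.
by move=> m Sm; rewrite /mkset; apply: (supp_in_XM hq) => m'; apply: STY.
Qed.

Lemma dge_supp S Y (s : seq M) : uniq s ->
  (forall m, m \in s -> S m) -> (forall m, m \in s -> ~ Y m) ->
  dge (supp_in S) (supp_in Y) (size s).
Proof.
move=> us sS sY; exists (fun i : 'I_(size s) => X^(nth 0m s i)).
  by move=> i; apply: supp_inX; apply: sS; apply: mem_nth.
move=> c hc i; apply/eqP/negP => /negP ci.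
apply: (sY (nth 0m s i)); first exact: mem_nth.
apply: hc; rewrite /comb raddf_sum (bigD1 i) //= mcoeffZ mcoeffX eqxx mulr1 big1 ?addr0//.
move=> j ji; rewrite mcoeffZ mcoeffX nth_uniq// -[(j == i :> nat)]/(j == i) (negPf ji).
by rewrite mulr0.
Qed.

Lemma dle_supp S Y (s : seq M) :
  (forall m, S m -> ~ Y m -> m \in s) -> dle (supp_in S) (supp_in Y) (size s).
Proof.
move=> Ss; exists (fun i : 'I_(size s) => if `[< S (nth 0m s i) >] then X^(nth 0m s i) else 0).
  move=> i; case: ifP => [/asboolP Sm|_]; first exact: supp_inX.
  exact: sub0 (subspace_supp S).
move=> v Sv; move: v Sv; apply: supp_in_min.
  split; first by exists (fun _ => 0); rewrite /comb big1 ?subr0;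
    [exact: sub0 (subspace_supp Y)|move=> i _; rewrite scale0r].
  move=> a x y [c hc] [c' hc']; exists (fun i => a * c i + c' i).
  set e := (X in comb X _); have -> : comb e (fun i => a * c i + c' i) =
      a *: comb e c + comb e c'.
    rewrite combZ /comb -big_split; apply: eq_bigr => i _; by rewrite scalerDl.
  rewrite opprD addrACA -scalerBr; apply: (subspace_supp Y).2 => //.
move=> m Sm; have [Ym|nY] := pselect (Y m).
  exists (fun _ => 0); rewrite /comb big1 ?subr0; first exact: supp_inX.
  by move=> i _; rewrite scale0r.
have ms := Ss m Sm nY; have im : (index m s < size s)%N by rewrite index_mem.
exists (fun i => (i == Ordinal im)%:R); rewrite /comb (bigD1 (Ordinal im)) //= eqxx scale1r.
rewrite nth_index//; case: asboolP => // _; rewrite big1 ?addr0 ?subrr.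
  exact: sub0 (subspace_supp Y).
by move=> i /negPf ->; rewrite scale0r.
Qed.

Lemma mpolyX_inj : injective (fun m : M => X^m).
Proof.
move=> a b /mpolyP/(_ a)/eqP; rewrite !mcoeffX eqxx; case: (b =P a) => // _.
by rewrite oner_eq0.
Qed.

Lemma Ugens_succ (V U : nat -> set R) (fs : seq R) k r : (forall k, subspace (V k)) ->
  Ugens V U fs k.+1 r ->
  exists u (w : nat -> R), [/\ U k.+1 u, forall i, V k (w i)
    & r = u + \sum_(i < size fs) fs`_i * w i].
Proof.
move=> sV; elim: fs U r => [|f fs IH] U r /=.
  move=> Ur; exists r, (fun _ => 0); split=> //; first by move=> i; apply: sub0.
  by rewrite big_ord0 addr0.
move=> /IH[_ [w [[u [v [Uu [Vv ->]]]] Vw ->]]].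
exists u, (fun i => if i is i'.+1 then w i' else v); split=> //; first by case.
by rewrite big_ord_recl addrA.
Qed.

(** The conditions of [generic_reduction] are checked on exponents; its growth bound becomes a count
    of the points of [S k] outside [Y k]. *)
Lemma monomial_reduction (S Y : nat -> set M) (Bm : seq M) k0 C (p : nat)
  (phis : seq {poly R}) : ~ countable [set: K] -> uniq Bm ->
  (forall k b m, b \in Bm -> S k m -> S k.+1 (b +m m)) ->
  (forall k b m, b \in Bm -> Y k m -> Y k.+1 (b +m m)) ->
  (forall k, Y k `<=` S k) ->
  (forall k, (k0 <= k)%N -> forall m, S k.+1 m -> Y k.+1 m \/
     exists b s, [/\ b \in Bm, S k s & m = b +m s]) ->
  (forall k, exists2 s : seq M, (size s <= C * k.+1 ^ p)%N
     & forall m, S k m -> ~ Y k m -> m \in s) ->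
  size phis = p.+1 ->
  (forall phi, phi \in phis -> B_curve [seq X^b | b <- Bm] phi) ->
  VG (size phis) (fun us => exists k1, forall k, (k1 <= k)%N -> forall m, S k.+1 m ->
    exists u (w : nat -> R), [/\ supp_in (Y k.+1) u, forall i, supp_in (S k) (w i)
      & X^m = u + \sum_(i < size phis) (specs us phis)`_i * w i]).
Proof.
move=> ncK uB BS BY YS gen cnt sp hphi.
pose V k := supp_in (S k); pose U k := supp_in (Y k).
have sV k : subspace (V k) by apply: subspace_supp.
have gU : graded V [seq X^b | b <- Bm] U.
  split=> [k|k|k _ v /mapP[b bB ->] Uv]; first exact: subspace_supp.
    by apply: supp_in_sub; apply: YS.
  by apply: supp_in_XM Uv _ => m; apply: BY.
have BV k (b v : R) : b \in [seq X^b | b <- Bm] -> V k v -> V k.+1 (b * v).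
  by case/mapP=> b' bB -> Vv; apply: supp_in_XM Vv _ => m; apply: BS.
have [s0 _ hs0] := cnt k0.
have gen' : generated V [seq X^b | b <- Bm] U k0.
  move=> k hk; apply: supp_in_min.
    split; first by exists (fun _ => 0); split=> [b|]; [exact: sub0|];
      rewrite big1 ?subr0; [exact: sub0 (subspace_supp _)|move=> b _; rewrite mulr0].
    move=> a x y [w [Vw Uw]] [w' [Vw' Uw']]; exists (fun g : R => a *: w g + w' g); split.
      by move=> b; apply: (sV k).2.
    have -> : a *: x + y - \sum_(g <- [seq X^b | b <- Bm]) g * (a *: w g + w' g) =
      a *: (x - \sum_(g <- [seq X^b | b <- Bm]) g * w g) +
      (y - \sum_(g <- [seq X^b | b <- Bm]) g * w' g).
      rewrite scalerBr addrACA -opprD; congr (_ - _).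
      rewrite scaler_sumr -big_split; apply: eq_bigr => b _ /=.
      by rewrite mulrDr scalerAr.
    exact: (subspace_supp _).2.
  move=> m /(gen k hk)[Ym|[b [s [bB Ss ->]]]].
    exists (fun _ => 0); split; first by move=> b; apply: sub0.
    by rewrite big1 ?subr0; [exact: supp_inX|move=> b _; rewrite mulr0].
  exists (fun x => if x == X^b then X^s else 0); split.
    by move=> x; case: ifP => _; [exact: supp_inX|exact: sub0].
  rewrite big_map (bigD1_seq b) //= eqxx big1 ?addr0.
    by rewrite mpolyXD subrr; exact: sub0 (subspace_supp _).
  by move=> c /negPf cb; rewrite (inj_eq mpolyX_inj) cb mulr0.
have dl : dle (V k0) (U k0) (size s0) by apply: dle_supp.
have gr k (a : nat) : dge (V k) (satB V [seq X^b | b <- Bm] U k) a -> (a <= C * k.+1 ^ p)%N.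
  move=> ga; have [s ss hs] := cnt k; apply: leq_trans ss.
  apply: steinitz (subspace_supp (Y k)) _ (dle_supp hs).
  by apply: dge_mono ga => // v _ Uv; apply: sub_satB.
have := generic_reduction ncK sV BV gU gen' dl sp hphi gr.
apply: VG_mono => us sus [k1 hk1]; exists k1 => k hk m Sm.
have [|u [w [Uu Vw e]]] := @Ugens_succ V U (specs us phis) k X^m sV.
  by apply: hk1; [exact: leqW|exact: supp_inX].
exists u, w; split=> //; rewrite e; congr (_ + _).
by rewrite {1}/specs size_map size_zip sus minnn.
Qed.

End MonomialSpans.

(** * Stable dimension for monomial filtrations *)

Section MonomialTorus.
Variables (K : fieldType) (n : nat).
Local Notation R := {mpol K[n]}.
Local Notation M := 'NN^n.
Local Notation "'X^' m" := (mpolyX K m) (at level 2, m at level 1).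

Definition sumM (w : seq M) : M := foldr (@mnm_add n) 0m w.

Lemma prod_monomials (w : seq M) : \prod_(b <- [seq X^b | b <- w]) b = X^(sumM w) :> R.
Proof.
elim: w => [|b w IH] /=; first by rewrite big_nil mpolyX0.
by rewrite big_cons IH mpolyXD.
Qed.

Definition monomials (Xc : set M) : set R := [set X^c | c in Xc].

Lemma mulset_monomials (Xc : set M) : Xc 0m ->
  (forall a b, Xc a -> Xc b -> Xc (a +m b)) -> mulset (monomials Xc).
Proof.
move=> X0 XD; split; first by exists 0m => //; rewrite mpolyX0.
by move=> _ _ [a Xa <-] [b Xb <-]; exists (a +m b); [exact: XD|rewrite mpolyXD].
Qed.

(** With multipliers confined to prescribed supports this may be smaller than the part of the ideal
    in degree [k]; for large [k] the difference disappears, which makes dimensions computable in a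
    fixed finite-dimensional space. *)
Definition span_multiples (fs : seq R) (T : nat -> nat -> set M) k : set R :=
  [set r | exists w : nat -> R, (forall i, supp_in (T i k) (w i)) /\
    r = \sum_(i < size fs) fs`_i * w i].

Lemma subspace_span_multiples fs T k : subspace (span_multiples fs T k).
Proof.
split.
  exists (fun _ => 0); split; first by move=> i; exact: (sub0 (subspace_supp _ _)).
  by rewrite big1// => i _; rewrite mulr0.
move=> a x y [w [Tw ->]] [w' [Tw' ->]]; exists (fun i => a *: w i + w' i); split.
  by move=> i; apply: (subspace_supp _ _).2.
rewrite scaler_sumr -big_split; apply: eq_bigr => i _ /=.
by rewrite mulrDr scalerAr.
Qed.

Lemma span_multiples_gens fs T k : span_multiples fs T k `<=` gens [set 0] fs.
Proof.
move=> _ [w [_ ->]]; apply/gensP; exists (fun i => w i).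
by apply: eq_bigr => i _; rewrite mulrC.
Qed.

Lemma span_multiples_mono fs T k l (c : M) r :
  (forall i m, T i k m -> T i l (c +m m)) -> span_multiples fs T k r ->
  span_multiples fs T l (X^c * r).
Proof.
move=> Tc [w [Tw ->]]; exists (fun i => X^c * w i); split.
  by move=> i; apply: supp_in_XM (Tw i) _ => m; apply: Tc.
by rewrite mulr_sumr; apply: eq_bigr => i _; rewrite mulrCA.
Qed.

Variables (S : nat -> set M) (Bm : seq M) (b0 : M) (fs : seq R)
  (T : nat -> nat -> set M) (Xc : set M) (k1 : nat).
Hypothesis b0B : b0 \in Bm.
Hypothesis BS : forall k b m, b \in Bm -> S k m -> S k.+1 (b +m m).
Hypothesis finS : forall k, exists s : seq M, forall m, S k m -> m \in s.
Hypothesis BT : forall i k b m, b \in Bm -> T i k m -> T i k.+1 (b +m m).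
Hypothesis TS : forall i k m c, (i < size fs)%N -> T i k m -> mcoeff c fs`_i != 0 ->
  S k (c +m m).
Hypothesis X0 : Xc 0m.
Hypothesis XD : forall a b, Xc a -> Xc b -> Xc (a +m b).
Hypothesis BX : forall b, b \in Bm -> Xc b.
Hypothesis deepT : forall k c (L : seq M), Xc c -> exists2 w : seq M,
  {subset w <= Bm} & forall m, m \in L -> exists s,
    sumM w +m m = c +m s /\ forall i, T i (k + size w)%N s.
Hypothesis deepS : forall L : seq M, exists2 w : seq M,
  {subset w <= Bm} & forall m, m \in L -> S (size w) (sumM w +m m).
Hypothesis surj : forall k, (k1 <= k)%N -> forall b, b \in Bm -> forall m, S k.+1 m ->
  exists2 w, supp_in (S k) w & span_multiples fs T k.+1 (X^m - X^b * w).

Lemma monomial_torus_dimension : exists k2 d,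
  qdim setT (sat (monomials Xc) (gens [set 0] fs)) d /\
  forall k, (k2 <= k)%N -> qdim (supp_in (S k)) (span_multiples fs T k) d /\
    forall v, supp_in (S k) v -> sat (monomials Xc) (gens [set 0] fs) v ->
      span_multiples fs T k v.
Proof.
have [s0 hs0] := finS k1.
have X0w (w : seq M) : {subset w <= Bm} ->
    {subset [seq X^b | b <- w] <= [seq X^b | b <- Bm] : seq R}.
  by move=> wB _ /mapP[b bw ->]; apply: map_f; apply: wB.
apply: (@torus_dimension _ _ (fun k => supp_in (S k)) (span_multiples fs T)
  [seq X^b | b <- Bm] X^b0 k1 (size s0)).
- by move=> k; apply: subspace_supp.
- by move=> k; apply: subspace_span_multiples.
- move=> k _ [w [Tw ->]]; apply: (sub_sum (subspace_supp _ _)) => i _.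
  apply: (@supp_in_M _ _ [set c | mcoeff c fs`_i != 0] (T i k)) => //.
  by move=> a b ha hb; apply: TS hb ha.
- exact: map_f.
- move=> k _ v /mapP[b bB ->] Sv; apply: supp_in_XM Sv _ => m; exact: BS.
- move=> k _ v /mapP[b bB ->]; apply: span_multiples_mono => i m; exact: BT.
- move=> k hk _ /mapP[b bB ->]; apply: supp_in_min.
    split; first by exists 0; [exact: sub0 (subspace_supp _ _)|
      rewrite mulr0 subr0; exact: sub0 (subspace_span_multiples _ _ _)].
    move=> a x y [w Sw Nw] [w' Sw' Nw']; exists (a *: w + w').
      exact: (subspace_supp _ _).2.
    have -> : a *: x + y - X^b * (a *: w + w') = a *: (x - X^b * w) + (y - X^b * w').
      by rewrite mulrDr opprD addrACA scalerBr scalerAr.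
    exact: (subspace_span_multiples _ _ _).2.
  by move=> m; apply: surj.
- apply: (@dle_mono _ _ _ (supp_in set0)).
    move=> v v0; suff -> : v = 0 by exact: sub0 (subspace_span_multiples _ _ _).
    apply/mpolyP => m; rewrite mcoeff0; apply/eqP/negP => /negP; exact: v0.
  by apply: dle_supp => m Sm _; apply: hs0.
- exact: mulset_monomials.
- by move=> _ /mapP[b bB ->]; exists b => //; apply: BX.
- exact/ideal_gens/ideal0.
- by move=> k; apply: span_multiples_gens.
- move=> k r Sr [_ [c Xcc <-] /gensP[h e]].
  pose L := flatten [seq msupp (h i) | i <- enum 'I_(size fs)].
  (* The entry [0m] makes the word itself a multiple of [c], with quotient [e0]; the same word
     serves all exponents of the multipliers. *)
  have [w wB hw] := deepT k (0m :: L) Xcc.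
  have [e0 [ew Te0]] := hw _ (mem_head _ _).
  exists [seq X^b | b <- w]; first exact: X0w.
  rewrite size_map prod_monomials.
  have -> : sumM w = c +m e0 by rewrite -ew addm0.
  rewrite addm0 in ew.
  exists (fun i => X^e0 * (if insub i is Some j then h j else 0)); split.
    move=> i; case: insubP => [j _ _|_]; last by rewrite mulr0; exact: (sub0 (subspace_supp _ _)).
    apply: (@supp_in_XM _ _ [set m | m \in msupp (h j)]).
      by move=> m; rewrite /= mcoeff_msupp.
    move=> m /= mh; have [|s [es Ts]] := hw m.
      rewrite inE; apply/orP; right; apply/flattenP; exists (msupp (h j)) => //.
      by apply: map_f; rewrite mem_enum.
    suff -> : e0 +m m = s by [].
    move: es; rewrite ew -addmA => /addmI; exact.
  rewrite mpolyXD [X^c * _]mulrC -mulrA e mulr_sumr.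
  apply: eq_bigr => i _; rewrite valK; ring.
move=> r; have [w wB hw] := deepS (msupp r).
exists [seq X^b | b <- w]; first exact: X0w.
rewrite size_map prod_monomials.
apply: (@supp_in_XM _ _ [set m | m \in msupp r]); last exact: hw.
by move=> m; rewrite /= mcoeff_msupp.
Qed.

End MonomialTorus.

(** * Lattice points deep inside the cone *)

Section DeepPoints.
Variable n : nat.
Local Notation M := 'NN^n.
Variables (S : nat -> set M) (Bm : seq M).
Hypothesis S0 : S 0%N 0m.
Hypothesis SD : forall k l a b, S k a -> S l b -> S (k + l)%N (a +m b).
Hypothesis BS1 : forall b, b \in Bm -> S 1%N b.
Hypothesis full : forall i, exists k p, S k p /\ S k (p +m mnm1 i).
Hypothesis cancel : forall k s, S k s -> exists w s',
  [/\ {subset w <= Bm}, s +m s' = sumM w, (k <= size w)%N & S (size w - k)%N s'].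

Lemma sumM_cat (w w' : seq M) : sumM (w ++ w') = sumM w +m sumM w'.
Proof. by elim: w => [|b w IH] /=; rewrite ?add0m// IH addmA. Qed.

Lemma S_sumM (w : seq M) : {subset w <= Bm} -> S (size w) (sumM w).
Proof.
elim: w => [//|b w IH] wB /=; rewrite -add1n; apply: SD.
  by apply: BS1; apply: wB; rewrite inE eqxx.
by apply: IH => x xw; apply: wB; rewrite inE xw orbT.
Qed.

Lemma subset_cat (w w' : seq M) : {subset w <= Bm} -> {subset w' <= Bm} ->
  {subset w ++ w' <= Bm}.
Proof. by move=> wB wB' x; rewrite mem_cat => /orP[/wB|/wB']. Qed.

(** The vector sum(w) + p - q lies in [S (size w)], expressed without subtraction. *)
Definition deepens (w : seq M) (p q : M) := exists s,
  sumM w +m p = q +m s /\ S (size w) s.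

Lemma deepens_cat w w' p q : {subset w' <= Bm} -> deepens w p q ->
  deepens (w ++ w') p q.
Proof.
move=> wB [s [es Ss]]; exists (s +m sumM w'); rewrite sumM_cat size_cat.
split; last by apply: SD => //; apply: S_sumM.
by apply/mnmP => i; move/mnmP/(_ i): es; rewrite !mnmDE; lia.
Qed.

Lemma deepens_catl w w' p q : {subset w <= Bm} -> deepens w' p q ->
  deepens (w ++ w') p q.
Proof.
move=> wB /(deepens_cat wB)[s]; rewrite sumM_cat size_cat => -[es Ss].
by exists s; rewrite sumM_cat size_cat addmC [sumM w +m _]addmC addmC addnC.
Qed.

(** Two neighbours in direction i, each completed to a word by [cancel], show that a word can absorb
    the unit vector of index i or its opposite; [p] and [q] are built up one unit at a time. *)
Lemma deep1 (p q : M) : exists2 w, {subset w <= Bm} & deepens w p q.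
Proof.
have step p' q' i : (exists2 w, {subset w <= Bm} & deepens w p' q') ->
    (exists2 w, {subset w <= Bm} & deepens w (p' +m mnm1 i) q') /\
    (exists2 w, {subset w <= Bm} & deepens w p' (q' +m mnm1 i)).
  move=> [w wB [s [es Ss]]]; have [k [P [SP SPi]]] := full i; split.
    have [w' [P' [wB' eP kw SP']]] := cancel SP.
    exists (w ++ w'); first exact: subset_cat.
    exists (s +m ((P +m mnm1 i) +m P')); rewrite sumM_cat size_cat.
    split; last by apply: SD => //; have := SD SPi SP'; rewrite subnKC.
    apply/mnmP => j; move/mnmP/(_ j): es; move/mnmP/(_ j): eP; rewrite !mnmDE; lia.
  have [w' [P' [wB' eP kw SP']]] := cancel SPi.
  exists (w ++ w'); first exact: subset_cat.
  exists (s +m (P +m P')); rewrite sumM_cat size_cat.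
  split; last by apply: SD => //; have := SD SP SP'; rewrite subnKC.
  apply/mnmP => j; move/mnmP/(_ j): es; move/mnmP/(_ j): eP; rewrite !mnmDE; lia.
have dec (a : M) : a != 0m -> exists a' i, a = a' +m mnm1 i /\ (mdeg a = (mdeg a').+1)%N.
  move=> a0; have [i ai] : exists i, a i != 0%N.
    apply: contrapT => na; move/eqP: a0; apply; apply/mnmP => i; rewrite mnm0E.
    by apply/eqP/negP => /negP ai; apply: na; exists i.
  have e : a = (mnm_sub a (mnm1 i)) +m mnm1 i.
    by rewrite submK//; rewrite lep1mP.
  by exists (mnm_sub a (mnm1 i)), i; split=> //; rewrite {1}e mdegD mdeg1 addn1.
have hq : forall e (q : M), mdeg q = e -> exists2 w, {subset w <= Bm} & deepens w 0m q.
  elim=> [|e IH] q'.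
    move/eqP; rewrite mdeg_eq0 => /eqP ->; exists [::] => //.
    by exists 0m; split=> //; rewrite !addm0.
  move=> dq; have [|a [i [ea da]]] := dec q'; first by rewrite -mdeg_eq0 dq.
  have ad : mdeg a = e by rewrite dq in da; case: da.
  by rewrite ea; have [_] := step 0m a i (IH a ad).
have hp : forall e (p : M), mdeg p = e -> exists2 w, {subset w <= Bm} & deepens w p q.
  elim=> [|e IH] p'.
    by move/eqP; rewrite mdeg_eq0 => /eqP ->; apply: hq erefl.
  move=> dp; have [|a [i [ea da]]] := dec p'; first by rewrite -mdeg_eq0 dp.
  have ad : mdeg a = e by rewrite dp in da; case: da.
  by rewrite ea; have [] := step a q i (IH a ad).
exact: hp erefl.
Qed.

Lemma deep (L : seq (M * M)) : exists2 w : seq M, {subset w <= Bm} &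
  forall p q, (p, q) \in L -> deepens w p q.
Proof.
elim: L => [|[p q] L [w wB IH]]; first by exists [::].
have [w' wB' h] := deep1 p q; exists (w ++ w'); first exact: subset_cat.
move=> p' q'; rewrite inE => /orP[/eqP[-> ->]|/IH]; first exact: deepens_catl.
exact: deepens_cat.
Qed.

End DeepPoints.

(** * Volume and lattice points of convex sets *)

Section LatticePoints.
Variable R : realType.
Local Notation mu := (@lebesgue_measure R).

Lemma measure_between (I : set R) (a b : R) : is_interval I -> a <= b ->
  (forall x, I x -> a <= x <= b) -> (mu I <= (b - a)%:E)%E.
Proof.
move=> iI ab Iab; have mI := is_interval_measurable iI.
apply: (@le_trans _ _ (mu [set` `[a, b]])).
  apply: le_measure; [exact/mem_set|by apply/mem_set; exact: measurable_itv|].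
  by move=> x /Iab; rewrite /= in_itv.
rewrite lebesgue_measure_itv /=; case: ifPn => //.
by rewrite lee_fin subr_ge0.
Qed.

Lemma measure_contains (I : set R) (a b : R) : is_interval I -> a <= b ->
  I a -> I b -> ((b - a)%:E <= mu I)%E.
Proof.
move=> iI ab Ia Ib; have mI := is_interval_measurable iI.
apply: (@le_trans _ _ (mu [set` `[a, b]])).
  rewrite lebesgue_measure_itv /=; case: ifPn => //.
  by rewrite lte_fin -leNgt => ba; rewrite lee_fin subr_le0.
apply: le_measure; [by apply/mem_set; exact: measurable_itv|exact/mem_set|].
by move=> x; rewrite /= in_itv /=; apply: iI.
Qed.

Lemma indicatorE (I : set R) x : \1_I x = (`[< I x >])%:R :> R.
Proof. by rewrite indicE. Qed.

Lemma interval_count (I : set R) (D t : nat) : (0 < t)%N -> is_interval I ->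
  (forall x, I x -> 0 <= x <= D%:R) ->
  exists2 l : R, mu I = l%:E & 0 <= l <= D%:R /\
   `|l - (\sum_(x < (t * D).+1) \1_I (x%:R / t%:R)) / t%:R| <= t%:R^-1.
Proof.
move=> t0 iI ID.
have t0' : 0 < t%:R :> R by rewrite ltr0n.
have muD : (mu I <= D%:R%:E)%E.
  by have := measure_between iI (ler0n R D) ID; rewrite subr0.
have fin : mu I \is a fin_num.
  by rewrite ge0_fin_numE ?measure_ge0//; apply: le_lt_trans muD (ltry _).
exists (fine (mu I)); first by rewrite fineK.
split.
  by rewrite fine_ge0 ?measure_ge0//= -lee_fin fineK.
set T := (t * D)%N.
pose P x := `[< I (x%:R / t%:R) >].
have PT x : P x -> (x <= T)%N.
  move=> /asboolP/ID/andP[_]; rewrite ler_pdivrMr// -natrM ler_nat mulnC; exact.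
have Pconv x y z : P x -> P z -> (x <= y <= z)%N -> P y.
  move=> /asboolP Px /asboolP Pz /andP[xy yz]; apply/asboolP; apply: iI Px Pz _ _.
  by rewrite !ler_pM2r ?invr_gt0// !ler_nat xy yz.
have -> : \sum_(x < T.+1) \1_I (x%:R / t%:R) = (\sum_(x < T.+1) P x)%N%:R :> R.
  by rewrite natr_sum; apply: eq_bigr => x _; rewrite indicatorE.
(* With c points on the grid of mesh 1/t, the interval fits into a length (c + 1)/t and, unless c =
   0, contains two grid points at distance at least (c - 1)/t. *)
have bound (c : nat) (a b : R) : (forall x, I x -> a <= x <= b) -> a <= b ->
    b - a <= c.+1%:R / t%:R -> (c = 0%N \/ exists p q : nat,
      [/\ P p, P q & (c%:R - 1) <= q%:R - p%:R :> R /\ (p <= q)%N]) ->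
    `|fine (mu I) - c%:R / t%:R| <= t%:R^-1.
  move=> Iab ab bac hc; rewrite ler_norml; apply/andP; split; last first.
    have : fine (mu I) <= c.+1%:R / t%:R.
      by apply: le_trans bac; rewrite -lee_fin fineK//; apply: measure_between.
    by rewrite -natr1 mulrDl mul1r lerBlDl.
  case: hc => [->|[p [q [/asboolP Pp /asboolP Pq [cpq pq]]]]].
    rewrite mul0r subr0; apply: (@le_trans _ _ 0); first by rewrite oppr_le0 invr_ge0 ltW.
    by rewrite fine_ge0// measure_ge0.
  rewrite lerBrDr addrC -[X in _ - X]mul1r -mulrBl.
  apply: (@le_trans _ _ (q%:R / t%:R - p%:R / t%:R)).
    by rewrite -mulrBl ler_pM2r ?invr_gt0.
  rewrite -lee_fin fineK//; apply: measure_contains => //.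
  by rewrite ler_pM2r ?invr_gt0// ler_nat.
(* Without grid points, a nonempty interval lies between two consecutive ones. *)
have [[p0 Pp0]|nP] := pselect (exists p, P p); last first.
  rewrite big1; last by move=> x _; case Px : (P x) => //; case: nP; exists x.
  have [[y Iy]|nI] := pselect (exists y, I y); last first.
    apply: (bound 0%N 0 0); rewrite ?subrr// ?divr_ge0 ?ler0n//; last by left.
    by move=> x Ix; case: nI; exists x.
  have [y0 yD] := andP (ID y Iy).
  set m := Num.truncn (y * t%:R).
  have /truncn_itv/andP[my ym] : 0 <= y * t%:R by rewrite mulr_ge0// ltW.
  have my' : m%:R / t%:R <= y by rewrite ler_pdivrMr.
  have ym' : y < m.+1%:R / t%:R by rewrite ltr_pdivlMr.
  apply: (bound 0%N (m%:R / t%:R) (m.+1%:R / t%:R)); last by left.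
  - move=> x Ix; apply/andP; split; rewrite leNgt; apply/negP => hx.
      apply: nP; exists m; apply/asboolP; apply: iI Ix Iy _ _.
      by rewrite (ltW hx) my'.
    apply: nP; exists m.+1; apply/asboolP; apply: iI Iy Ix _ _.
    by rewrite (ltW hx) (ltW ym').
  - by rewrite ler_pM2r ?invr_gt0// ler_nat.
  by rewrite -mulrBl -natrB// subSnn.
have exP : exists p, P p by exists p0.
case: (ex_minnP exP) => p Pp pmin; case: (ex_maxnP exP PT) => q Pq qmax.
have pq : (p <= q)%N by apply: pmin.
have -> : (\sum_(x < T.+1) P x = q.+1 - p)%N.
  transitivity (\sum_(0 <= x < T.+1 | (p <= x < q.+1)%N) 1)%N.
    rewrite [RHS]big_mkcond /= [RHS]big_mkord; apply: eq_bigr => x _.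
    have -> : P x = (p <= x < q.+1)%N.
      apply/idP/idP => [Px|/andP[px xq]]; first by rewrite pmin//= ltnS qmax.
      by apply: Pconv Pp Pq _; rewrite px -ltnS.
    by case: ifP.
  transitivity (\sum_(p <= x < q.+1) 1)%N; last by rewrite sum_nat_const_nat muln1.
  rewrite (@big_nat_widenl _ _ _ p 0)// (@big_nat_widen _ _ _ 0 q.+1 T.+1); last first.
    by rewrite ltnS PT.
  by apply: eq_bigl.
have q0 : I (q%:R / t%:R) by apply/asboolP.
have p0' : I (p%:R / t%:R) by apply/asboolP.
apply: (bound (q.+1 - p)%N ((p%:R - 1) / t%:R) (q.+1%:R / t%:R)).
- move=> x Ix; apply/andP; split; rewrite leNgt; apply/negP => hx.
    case: (posnP p) => [pz|pp].
      have /andP[x0 _] := ID _ Ix; move: hx; rewrite pz sub0r mulNr mul1r ltNge => /negP; apply.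
      by apply: le_trans x0; rewrite oppr_le0 invr_ge0 ltW.
    have : P p.-1.
      apply/asboolP; apply: iI Ix p0' _ _.
      by rewrite -subn1 natrB// (ltW hx) ler_pM2r ?invr_gt0// lerBlDr lerDl ler01.
    by move=> /pmin; rewrite leqNgt ltn_predL pp.
  have : P q.+1.
    apply/asboolP; apply: iI q0 Ix _ _.
    by rewrite (ltW hx) ler_pM2r ?invr_gt0// ler_nat leqnSn.
  by move=> /qmax; rewrite ltnn.
- rewrite ler_pM2r ?invr_gt0//; apply: (@le_trans _ _ p%:R).
    by rewrite lerBlDr lerDl.
  by rewrite ler_nat leqW.
- rewrite -mulrBl ler_pM2r ?invr_gt0//.
  by rewrite -[leRHS]natr1 natrB ?leqW//; lra.
right; exists p, q; split=> //; split=> //.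
by rewrite natrB ?leqW// -natr1; lra.
Qed.

(** The recursion peels off the same coordinate as [Vol], so that slices can be compared one by
    one. *)
Fixpoint cnt (t D n : nat) : set 'rV[R]_n -> R :=
  if n is n'.+1 then fun K =>
    \sum_(x < (t * D).+1) cnt t D [set v : 'rV_n' | K (row_mx ((x%:R / t%:R)%:M : 'rV_1) v)]
  else fun K => (`[< K 0 >])%:R.

Definition convexs n (K : set 'rV[R]_n) := forall x y, K x -> K y ->
  forall l, 0 <= l <= 1 -> K (l *: x + (1 - l) *: y).

Definition inbox (D : nat) n (K : set 'rV[R]_n) :=
  forall v, K v -> forall i, 0 <= v 0 i <= D%:R.

Definition slice n (K : set 'rV[R]_n.+1) (y : R) : set 'rV[R]_n :=
  [set v | K (row_mx (y%:M : 'rV_1) v : 'rV_(1 + n))].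

Lemma cnt_ge0 t D n (K : set 'rV[R]_n) : 0 <= cnt t D K.
Proof.
elim: n K => [|n IH] K /=; first exact: ler0n.
by apply: sumr_ge0 => x _; apply: IH.
Qed.

(** For each fixed grid point the parameters y whose set contains it form an interval; replacing its
    length by a grid count costs 1/t, and at most (tD + 1)^n grid points are involved. *)
Lemma cnt_family t D n (F : R -> set 'rV[R]_n) : (0 < t)%N ->
  (forall v, is_interval [set y | F y v]) ->
  (forall y v, F y v -> 0 <= y <= D%:R) ->
  measurable_fun setT (fun y => cnt t D (F y)) /\
  exists2 I : R, (\int[mu]_y (cnt t D (F y))%:E = I%:E)%E &
   `|I - (\sum_(x < (t * D).+1) cnt t D (F (x%:R / t%:R))) / t%:R|
     <= (t * D).+1%:R ^+ n / t%:R.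
Proof.
move=> t0; elim: n F => [|n IH] F iF bF.
  have E y : cnt t D (F y) = \1_[set y | F y 0] y by rewrite indicatorE.
  have mF := is_interval_measurable (iF 0).
  split.
    under eq_fun do rewrite E; exact: measurable_indic.
  under eq_integral do rewrite E.
  rewrite integral_indic// setIT.
  have [l el [_ h]] := interval_count t0 (iF 0) (fun y => @bF y 0).
  exists l; first exact: el.
  by rewrite expr0 mul1r; under eq_bigr do rewrite E.
have H (z : 'I_(t * D).+1) := IH (fun y => slice (F y) (z%:R / t%:R)) (fun v => iF _)
  (fun y v => @bF y _).
have mH (z : 'I_(t * D).+1) : measurable_fun setT (fun y => cnt t D (slice (F y) (z%:R / t%:R))).
  by case: (H z).
split.
  by apply: measurable_sum => z; exact: mH.
have -> : (\int[mu]_y (cnt t D (F y))%:E = \int[mu]_y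
    \sum_(z < (t * D).+1) (cnt t D (slice (F y) (z%:R / t%:R)))%:E)%E.
  by apply: eq_integral => y _; rewrite sumEFin.
rewrite ge0_integral_sum//=; first last.
- by move=> z y _; rewrite lee_fin cnt_ge0.
- by move=> z; apply/measurable_EFinP; exact: mH.
have /choice[I hI] (z : 'I_(t * D).+1) : exists I, (\int[mu]_y (cnt t D (slice (F y) (z%:R / t%:R)))%:E = I%:E)%E /\
   `|I - (\sum_(x < (t * D).+1) cnt t D (slice (F (x%:R / t%:R)) (z%:R / t%:R))) / t%:R|
     <= (t * D).+1%:R ^+ n / t%:R.
  by case: (H z) => _ [I h1 h2]; exists I.
exists (\sum_z I z).
  by rewrite -sumEFin; apply: eq_bigr => z _; case: (hI z).
have -> : \sum_(x < (t * D).+1) cnt t D (F (x%:R / t%:R)) = \sum_(z < (t * D).+1)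
    \sum_(x < (t * D).+1) cnt t D (slice (F (x%:R / t%:R)) (z%:R / t%:R)).
  by rewrite exchange_big.
rewrite mulr_suml -sumrB.
apply: le_trans (ler_norm_sum _ _ _) _.
apply: (@le_trans _ _ (\sum_(z < (t * D).+1) (t * D).+1%:R ^+ n / t%:R)).
  by apply: ler_sum => z _; case: (hI z).
by rewrite sumr_const card_ord exprS -mulrA mulr_natl.
Qed.

Lemma row_mx_comb n (a b l : R) (u v : 'rV[R]_n) :
  l *: (row_mx (a%:M : 'rV_1) u : 'rV_(1 + n)) + (1 - l) *: row_mx (b%:M : 'rV_1) v =
  row_mx ((l * a + (1 - l) * b)%:M : 'rV_1) (l *: u + (1 - l) *: v).
Proof. by rewrite !scale_row_mx add_row_mx !scale_scalar_mx -raddfD. Qed.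

Lemma convexs_slice n (K : set 'rV[R]_n.+1) y : convexs K -> convexs (slice K y).
Proof.
move=> cK u v Ku Kv l hl; rewrite /slice /=.
have := cK _ _ Ku Kv l hl; congr (K _); rewrite [LHS]row_mx_comb.
by congr (row_mx _%:M _); ring.
Qed.

Lemma inbox_slice D n (K : set 'rV[R]_n.+1) y : inbox D K -> inbox D (slice K y).
Proof.
move=> bK v Kv i.
by rewrite -(row_mxEr (y%:M : 'rV_1) v 0 i : _ = v 0 i); apply: (bK _ Kv (rshift 1 i)).
Qed.

Lemma slice_range D n (K : set 'rV[R]_n.+1) y v : inbox D K -> slice K y v ->
  0 <= y <= D%:R.
Proof.
move=> bK Kv; have e : (row_mx (y%:M : 'rV_1) v) 0 (lshift n (0 : 'I_1)) = y.
  by rewrite row_mxEl !mxE eqxx mulr1n.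
suff : 0 <= (row_mx (y%:M : 'rV_1) v) 0 (lshift n (0 : 'I_1)) <= D%:R by rewrite e.
exact: (bK _ Kv (lshift n (0 : 'I_1))).
Qed.

Lemma slice_interval n (K : set 'rV[R]_n.+1) v : convexs K ->
  is_interval [set y | slice K y v].
Proof.
move=> cK a b /= Ka Kb y /andP[ay yb].
have [ab|ab] := eqVneq a b.
  by have -> : y = a by apply/eqP; rewrite eq_le ay ab yb.
have ba : 0 < b - a by rewrite subr_gt0 lt_neqAle ab (le_trans ay yb).
pose l := (b - y) / (b - a).
have hl : 0 <= l <= 1.
  rewrite /l divr_ge0 ?subr_ge0 ?(le_trans ay yb)//=.
  by rewrite ler_pdivrMr// mul1r lerB.
have := cK _ _ Ka Kb l hl; rewrite /slice; congr (K _); rewrite [LHS]row_mx_comb.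
rewrite -scalerDl addrCA subrr addr0 scale1r; congr (row_mx _%:M _).
by rewrite /l; field; apply/lt0r_neq0.
Qed.

(** The volume of the slices is measurable as a pointwise limit of counts, which are finite sums of
    indicators of intervals. *)
Lemma measurable_limit_cnt D n (F : R -> set 'rV[R]_n) (v : R -> R) (C : R) :
  (forall v, is_interval [set y | F y v]) ->
  (forall y v, F y v -> 0 <= y <= D%:R) ->
  (forall y t, (0 < t)%N -> `|v y - cnt t D (F y) / t%:R ^+ n| <= C / t%:R) ->
  measurable_fun setT v.
Proof.
move=> iF bF h.
apply: (@measurable_fun_cvg _ _ _ _ (fun t y => cnt t.+1 D (F y) / t.+1%:R ^+ n)).
  move=> t; apply: measurable_funM; last exact: measurable_cst.
  by have [] := @cnt_family t.+1 D n F isT iF bF.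
move=> y _; apply/cvgrPdist_le => e e0; near=> t.
apply: le_trans (h y t.+1 isT) _.
have [C0|C0] := leP C 0.
  by apply: (@le_trans _ _ 0); [rewrite mulr_le0_ge0 ?invr_ge0|exact: ltW].
rewrite ler_pdivrMr// -ler_pdivrMl// mulrC.
near: t; exists (Num.truncn (C / e)).+1 => // t /= ht.
apply: ltW; apply: lt_le_trans (truncnS_gt _) _; rewrite ler_nat; exact: leqW.
Unshelve. all: by end_near. Qed.

(** Induction on the dimension by slicing. The error C/t of the slices is integrated over [0, D],
    and passing from the integral in y to a grid sum adds (D + 1)^n/t; the recursion for the
    constant is the sum of the two. Convexity enters through the intervals cut out by lines. *)
Lemma vol_lattice (D n : nat) : exists2 C : R, 0 <= C &
  forall K : set 'rV[R]_n, convexs K -> inbox D K ->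
    exists v : R, [/\ Vol K = v%:E, 0 <= v &
      forall t, (0 < t)%N -> `|v - cnt t D K / t%:R ^+ n| <= C / t%:R].
Proof.
elim: n => [|n [C C0 IH]].
  exists 0 => // K _ _; exists (`[< K 0 >])%:R; split=> [//||t t0]; first exact: ler0n.
  by rewrite expr0 divr1 subrr normr0 mul0r.
exists (C * D%:R + D.+1%:R ^+ n) => [|K cK bK].
  by rewrite addr_ge0 ?mulr_ge0// exprn_ge0.
have /choice[v hv] y := IH _ (convexs_slice (y := y) cK) (inbox_slice (y := y) bK).
have iF w := slice_interval (v := w) cK.
have bF y w := @slice_range D n K y w bK.
have mv : measurable_fun setT v.
  by apply: (measurable_limit_cnt iF bF (C := C)) => y t t0; case: (hv y) => _ _; apply.
have v0 y : 0 <= v y by case: (hv y).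
have VE : Vol K = (\int[mu]_y (v y)%:E)%E.
  by rewrite /=; apply: eq_integral => y _; case: (hv y).
pose B : set R := [set` `[0, D%:R]].
have mB : measurable B by exact: measurable_itv.
have muB : mu B = D%:R%:E.
  rewrite lebesgue_measure_itv /= lte_fin; case: ifPn => [_|]; first by rewrite sube0.
  by rewrite -leNgt => D0; congr (_%:E); apply/eqP; rewrite eq_le D0 ler0n.
(* Outside [0, D] the slices are empty, and the estimate for all t forces their volume to be 0. *)
have out y : ~ B y -> v y = 0 /\ forall t, cnt t D (slice K y) = 0.
  move=> nB; have sl0 : slice K y = set0.
    apply/seteqP; split=> w //= Kw; apply: nB; rewrite /B /= in_itv /=; exact: bF Kw.
  have c0 t : cnt t D (slice K y) = 0.
    rewrite sl0; elim: n {IH sl0 cK bK iF bF hv K v mv v0 VE} => [|m IHm] /=.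
      by case: asboolP.
    by rewrite big1.
  split => //; apply/eqP; rewrite eq_le v0 andbT leNgt; apply/negP => vy.
  have [_ _ h] := hv y.
  have := h (Num.truncn (C / v y)).+1 isT; rewrite c0 mul0r subr0 ger0_norm//.
  rewrite ler_pdivlMr// mulrC -ler_pdivlMr// leNgt => /negP; apply.
  exact: truncnS_gt.
have key t : (0 < t)%N -> exists2 V : R, (\int[mu]_y (v y)%:E)%E = V%:E &
   `|V - cnt t D K / t%:R ^+ n.+1| <= (C * D%:R + D.+1%:R ^+ n) / t%:R.
  move=> t0; have t0' : 0 < t%:R :> R by rewrite ltr0n.
  have tn0 : 0 < t%:R ^+ n :> R by rewrite exprn_gt0.
  have [mf [I intI hI]] := cnt_family t0 iF bF.
  pose f y := cnt t D (slice K y) / t%:R ^+ n.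
  have mf' : measurable_fun setT f by apply: measurable_funM => //; exact: measurable_cst.
  have f0 y : 0 <= f y by rewrite divr_ge0 ?cnt_ge0// ltW.
  have intf : (\int[mu]_y (f y)%:E)%E = (I / t%:R ^+ n)%:E.
    under eq_integral do rewrite /f mulrC EFinM.
    rewrite ge0_integralZl_EFin//; do ?[by rewrite invr_ge0 ltW
      |exact/measurable_EFinP|by move=> y _; rewrite lee_fin cnt_ge0].
    by rewrite intI mulrC.
  have intB : (\int[mu]_y (C / t%:R * \1_B y)%:E)%E = (C / t%:R * D%:R)%:E.
    under eq_integral do rewrite EFinM.
    rewrite ge0_integralZl_EFin//; do ?[by rewrite divr_ge0// ltW
      |by apply/measurable_EFinP; exact: measurable_indic].
    by rewrite integral_indic// setIT [X in (_ * X)%E]muB.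
  have close y : `|v y - f y| <= C / t%:R * \1_B y.
    rewrite indicatorE; case: asboolP => [_|nB]; last first.
      by have [-> c0] := out y nB; rewrite /f c0 mul0r subrr normr0 mulr0.
    by rewrite mulr1; case: (hv y) => _ _; apply.
  have B0 y : 0 <= C / t%:R * \1_B y by rewrite mulr_ge0 ?indicatorE// divr_ge0// ltW.
  have mBi : measurable_fun setT (fun y => (C / t%:R * \1_B y)%:E).
    apply/measurable_EFinP; apply: measurable_funM; first exact: measurable_cst.
    exact: measurable_indic.
  have up (g h : R -> R) : measurable_fun setT g -> measurable_fun setT h ->
      (forall y, 0 <= g y) -> (forall y, 0 <= h y) ->
      (forall y, `|g y - h y| <= C / t%:R * \1_B y) ->
      (\int[mu]_y (g y)%:E <= \int[mu]_y (h y)%:E + (C / t%:R * D%:R)%:E)%E.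
    move=> mg mh g0 h0 gh; rewrite -intB -ge0_integralD//;
      do ?[by move=> y _; rewrite lee_fin|exact/measurable_EFinP].
    apply: ge0_le_integral => //.
    - by move=> y _; rewrite lee_fin.
    - exact/measurable_EFinP.
    - by apply: emeasurable_funD => //; exact/measurable_EFinP.
    by move=> y _; rewrite -EFinD lee_fin -lerBlDl; apply: le_trans (ler_norm _) (gh y).
  have h1 := up v f mv mf' v0 f0 close.
  have h2 : (\int[mu]_y (f y)%:E <= \int[mu]_y (v y)%:E + (C / t%:R * D%:R)%:E)%E.
    by apply: up => // y; rewrite distrC.
  rewrite intf in h1 h2.
  have fin : (\int[mu]_y (v y)%:E)%E \is a fin_num.
    rewrite ge0_fin_numE; last by apply: integral_ge0 => y _; rewrite lee_fin.
    by apply: le_lt_trans h1 _; rewrite -EFinD ltry.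
  exists (fine (\int[mu]_y (v y)%:E)%E); first by rewrite fineK.
  move: h1 h2; rewrite -(fineK fin) -!EFinD !lee_fin; move: (fine _) => V h1 h2.
  have cK' : \sum_(x < (t * D).+1) cnt t D (slice K (x%:R / t%:R)) = cnt t D K by [].
  rewrite cK' in hI.
  have hI' : `|I / t%:R ^+ n - cnt t D K / t%:R ^+ n.+1| <= D.+1%:R ^+ n / t%:R.
    have -> : I / t%:R ^+ n - cnt t D K / t%:R ^+ n.+1 =
        (I - cnt t D K / t%:R) / t%:R ^+ n.
      by rewrite exprS; field; rewrite ?lt0r_neq0.
    rewrite normrM normfV (ger0_norm (ltW tn0)) ler_pdivrMr//.
    apply: le_trans hI _; rewrite mulrAC ler_pM2r ?invr_gt0// -exprMn -natrM.
    by rewrite lerXn2r ?nnegrE// ler_nat; nia.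
  have -> : (C * D%:R + D.+1%:R ^+ n) / t%:R = C / t%:R * D%:R + D.+1%:R ^+ n / t%:R.
    by rewrite mulrDl mulrAC.
  have -> : V - cnt t D K / t%:R ^+ n.+1 =
    (V - I / t%:R ^+ n) + (I / t%:R ^+ n - cnt t D K / t%:R ^+ n.+1).
    by rewrite addrA subrK.
  apply: le_trans (ler_normD _ _) _; apply: lerD => //.
  by rewrite ler_norml; apply/andP; split; lra.
have [V VV _] := key 1%N isT; exists V; split; first by rewrite VE.
  by rewrite -lee_fin -VV; apply: integral_ge0 => y _; rewrite lee_fin.
by move=> t /key[V']; rewrite VV => -[->].
Qed.

End LatticePoints.

(** * Lattice points of dilated Minkowski sums *)

Section Dilates.
Variables (R : realType) (n : nat).
Local Notation M := 'NN^n.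
Implicit Types (A : 'I_n -> {fset M}) (J : {set 'I_n}) (k : nat) (m : M).

(* The lattice points of k times the Minkowski sum of the conv (A j), j in J. *)
Definition dil A J k : set M := [set y | exists w : 'I_n -> M -> R,
  [/\ forall j a, 0 <= w j a,
      forall j, j \in J -> \sum_(a <- A j) w j a = k%:R
    & forall i, (y i)%:R = \sum_(j in J) \sum_(a <- A j) w j a * (a i)%:R]].

Lemma dil0 A J : dil A J 0 0m.
Proof.
exists (fun _ _ => 0); split=> // [j _|i]; first by rewrite big1.
by rewrite mnm0E big1// => j _; rewrite big1// => a _; rewrite mul0r.
Qed.

Lemma dilD A J k l a b : dil A J k a -> dil A J l b -> dil A J (k + l) (a +m b).
Proof.
move=> [w [w0 w1 w2]] [v [v0 v1 v2]]; exists (fun j a => w j a + v j a); split.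
- by move=> j c; rewrite addr_ge0.
- by move=> j jJ; rewrite big_split /= w1// v1// natrD.
move=> i; rewrite mnmDE natrD w2 v2 -big_split; apply: eq_bigr => j _ /=.
by rewrite -big_split; apply: eq_bigr => c _ /=; rewrite mulrDl.
Qed.

Lemma dil0P A J m : dil A J 0 m -> m = 0m.
Proof.
move=> [w [w0 w1 w2]]; apply/mnmP => i; rewrite mnm0E; apply/eqP.
rewrite -(eqr_nat R) w2 big1// => j jJ; rewrite big_seq big1// => a aA.
have : \sum_(a <- A j) w j a == 0 by rewrite w1.
by rewrite psumr_eq0// => /allP/(_ a aA)/= /eqP ->; rewrite mul0r.
Qed.

Definition msum J (g : 'I_n -> M) : M := \big[@mnm_add n/0m]_(j in J) g j.

Lemma msumE J g i : msum J g i = (\sum_(j in J) g j i)%N.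
Proof. by rewrite /msum mnm_sumE. Qed.

Lemma sum_at (A0 : {fset M}) (b : M) (F : M -> R) : b \in A0 ->
  \sum_(a <- A0) (a == b)%:R * F a = F b.
Proof.
move=> bA; rewrite (bigD1_seq b bA (fset_uniq A0)) /= eqxx mul1r big1 ?addr0// => a /negPf ->.
by rewrite mul0r.
Qed.

Lemma dil_msum A J g : (forall j, j \in J -> g j \in A j) -> dil A J 1 (msum J g).
Proof.
move=> gA; exists (fun j a => (a == g j)%:R); split=> [j a|j jJ|i].
- exact: ler0n.
- by have := sum_at (fun=> 1) (gA j jJ); under eq_bigr do rewrite mulr1.
rewrite msumE natr_sum; apply: eq_bigr => j jJ.
by rewrite (sum_at (fun a => (a i)%:R) (gA j jJ)).
Qed.

(** The weights over each [A j] sum to k + 1, more than the number of its points; so some weight is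
    at least 1 and its point can be split off. *)
Lemma dil_generated A J k m : (forall j, j \in J -> (#|` A j| <= k)%N) ->
  dil A J k.+1 m -> exists g s, [/\ forall j, j \in J -> g j \in A j, dil A J k s
    & m = msum J g +m s].
Proof.
move=> Ak [w [w0 w1 w2]].
have /choice[g hg] j : exists a, j \in J -> a \in A j /\ 1 <= w j a.
  have [jJ|] := boolP (j \in J); last by exists 0m.
  apply: contrapT => ng.
  have : \sum_(a <- A j) w j a <= \sum_(a <- A j) 1.
    rewrite big_seq [leRHS]big_seq; apply: ler_sum => a aA; rewrite leNgt.
    by apply/negP => wa; apply: ng; exists a => _; split=> //; apply: ltW.
  rewrite w1// leNgt => /negP; apply.
  by rewrite big_const_seq count_predT iter_addr addr0 ltr_nat ltnS Ak.
pose w' j a := w j a - (a == g j)%:R.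
have sum_w' j (F : M -> R) : j \in J ->
    \sum_(a <- A j) w' j a * F a = \sum_(a <- A j) w j a * F a - F (g j).
  move=> jJ; have [gA _] := hg j jJ; rewrite -[F (g j)](sum_at F gA) -sumrB.
  by apply: eq_bigr => a _; rewrite mulrBl.
have E i : (m i)%:R - (msum J g i)%:R = \sum_(j in J) \sum_(a <- A j) w' j a * (a i)%:R :> R.
  rewrite msumE natr_sum w2 -sumrB; apply: eq_bigr => j jJ.
  by rewrite (sum_w' j (fun a => (a i)%:R)).
have w'0 j a : j \in J -> 0 <= w' j a.
  move=> jJ; have [_ g1] := hg j jJ; rewrite /w'; case: eqP => [->|_]; last by rewrite subr0.
  by rewrite subr_ge0.
have le i : (msum J g i <= m i)%N.
  rewrite -(ler_nat R) -subr_ge0 E; apply: sumr_ge0 => j jJ; apply: sumr_ge0 => a _.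
  by rewrite mulr_ge0// w'0.
exists g, (mnm_sub m (msum J g)); split; first by move=> j /hg[].
  exists (fun j a => if j \in J then w' j a else 0); split.
  - by move=> j a; case: ifP => // jJ; apply: w'0.
  - move=> j jJ; rewrite jJ; have := sum_w' j (fun=> 1) jJ.
    under eq_bigr do rewrite mulr1; move=> ->; under eq_bigr do rewrite mulr1.
    by rewrite w1// -natr1 addrK.
  move=> i; rewrite mnmBE natrB// E; apply: eq_bigr => j jJ.
  by rewrite jJ.
by apply/mnmP => i; rewrite mnmDE mnmBE subnKC.
Qed.

Lemma dil_coord A J k m i (d : nat) : (forall j a, a \in A j -> (a i <= d)%N) ->
  dil A J k m -> (m i <= k * (n * d))%N.
Proof.
move=> Ad [w [w0 w1 w2]]; rewrite -(ler_nat R) w2.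
apply: (@le_trans _ _ (\sum_(j in J) (k * d)%:R)).
  apply: ler_sum => j jJ; rewrite natrM -(w1 j jJ) mulr_suml.
  rewrite big_seq [leRHS]big_seq; apply: ler_sum => a aA.
  by rewrite ler_wpM2l// ler_nat; apply: Ad aA.
rewrite sumr_const -mulrnA ler_nat.
have : (#|J| <= n)%N by rewrite -[X in (_ <= X)%N]card_ord max_card.
by move=> Jn; rewrite -mulnA [(d * _)%N]mulnC; do 2?apply: leq_mul.
Qed.

(** Convexity: the neighbour of [m] lies on the segment between the two given points. *)
Lemma dil_segment A J k m i l : dil A J k m -> dil A J k (m +m mnm_muln (mnm1 i) l) ->
  (0 < l)%N -> dil A J k (m +m mnm1 i).
Proof.
move=> [w [w0 w1 w2]] [v [v0 v1 v2]] l0.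
have l0' : 0 < l%:R :> R by rewrite ltr0n.
pose t : R := l%:R^-1.
have t1 : 0 <= t <= 1.
  by rewrite invr_ge0 ltW//= invf_le1// ler1n.
have [t0 t1'] := andP t1.
exists (fun j a => (1 - t) * w j a + t * v j a); split.
- by move=> j a; rewrite addr_ge0// mulr_ge0// subr_ge0.
- move=> j jJ; rewrite big_split /= -!mulr_sumr w1// v1//; ring.
move=> h; rewrite mnmDE natrD.
transitivity ((1 - t) * (m h)%:R + t * ((m +m mnm_muln (mnm1 i) l) h)%:R).
  rewrite mnmDE natrD mulmnE natrM /t; field; exact/lt0r_neq0.
rewrite w2 v2 !mulr_sumr -big_split; apply: eq_bigr => j _ /=.
rewrite !mulr_sumr -big_split; apply: eq_bigr => a _ /=; ring.
Qed.

Variables (d : nat) (t0 : bmultinom n d).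
Local Notation T := (bmultinom n d).

(** Points are encoded in the finite type of exponents of degree below [d]; outside [J] a choice is
    fixed to [t0], so that different choices differ on [J]. *)
Definition choices A J : pred {ffun 'I_n -> T} :=
  pfamily t0 (mem J) (fun j => [pred t : T | bmnm t \in A j]).

Lemma choicesP A J (g : {ffun 'I_n -> T}) : g \in choices A J ->
  forall j, j \in J -> bmnm (g j) \in A j.
Proof. by move=> /pfamilyP[_ h] j /h. Qed.

Definition ms J (g : {ffun 'I_n -> T}) : M := msum J (fun j => bmnm (g j)).

Definition base A J : seq M := undup [seq ms J g | g in choices A J].

Lemma baseP A J b : reflect (exists2 g, g \in choices A J & b = ms J g) (b \in base A J).
Proof.
rewrite mem_undup; apply: (iffP mapP) => -[g gA ->]; exists g => //.
  by rewrite mem_enum in gA.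
by rewrite mem_enum.
Qed.

Lemma bmnm_insubd (a : M) : (mdeg a < d)%N -> bmnm (insubd t0 a) = a.
Proof. by move=> ad; rewrite -[bmnm _]/(val _) insubdK. Qed.

Lemma choices_ex A J (h : 'I_n -> M) : (forall j a, a \in A j -> (mdeg a < d)%N) ->
  (forall j, j \in J -> h j \in A j) ->
  exists2 g, g \in choices A J & forall j, j \in J -> bmnm (g j) = h j.
Proof.
move=> hd hA; pose g := [ffun j => if j \in J then insubd t0 (h j) else t0].
have gh j : j \in J -> bmnm (g j) = h j.
  by move=> jJ; rewrite ffunE jJ bmnm_insubd// (hd j) ?hA.
exists g => //; apply/pfamilyP; split=> [|j jJ].
  by apply/supportP => j /negPf jJ; rewrite ffunE jJ.
by rewrite inE gh// hA.
Qed.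

Lemma base_dil A J b : b \in base A J -> dil A J 1 b.
Proof. by case/baseP => g /choicesP gA ->; apply: dil_msum. Qed.

Lemma dil_step A J k b m : b \in base A J -> dil A J k m -> dil A J k.+1 (b +m m).
Proof. by move=> /base_dil h1 h2; rewrite -add1n; apply: dilD. Qed.

Lemma dil_base_generated A J k m : (forall j a, a \in A j -> (mdeg a < d)%N) ->
  (forall j, j \in J -> (#|` A j| <= k)%N) -> dil A J k.+1 m ->
  exists b s, [/\ b \in base A J, dil A J k s & m = b +m s].
Proof.
move=> hd Ak /(dil_generated Ak)[h [s [hA Ss ->]]].
have [g gA gh] := choices_ex hd hA; exists (ms J g), s; split=> //.
  by apply/baseP; exists g.
by congr (_ +m _); apply: eq_bigr => j jJ; rewrite gh.
Qed.

Lemma sumME (w : seq M) i : sumM w i = (\sum_(m <- w) m i)%N.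
Proof.
elim: w => [|m w IH] /=; first by rewrite mnm0E big_nil.
by rewrite mnmDE big_cons IH.
Qed.

(** Take [N] copies of every choice. Each point of each [A j] occurs in some choice, so for [N]
    above the total weight the copies outweigh the weights of [m]; the nonnegative difference
    represents the complement [s]. *)
Lemma dil_cancel A J k m : (forall j a, a \in A j -> (mdeg a < d)%N) ->
  (forall j, j \in J -> exists a, a \in A j) -> (0 < #|J|)%N -> dil A J k m ->
  exists w s, [/\ {subset w <= base A J}, m +m s = sumM w, (k <= size w)%N
    & dil A J (size w - k)%N s].
Proof.
move=> hd hne /card_gt0P[j0 j0J] [w [w0 w1 w2]].
pose N := (Num.truncn (\sum_(j in J) \sum_(a <- A j) w j a)).+1.
pose G := enum (choices A J).
pose W := flatten (nseq N [seq ms J g | g <- G]).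
have sumW (F : M -> nat) : (\sum_(x <- W) F x = N * \sum_(g <- G) F (ms J g))%N.
  rewrite /W; elim: (N) => [|l IH]; first by rewrite /= big_nil mul0n.
  by rewrite /= big_cat IH big_map mulSn.
have sizeW : size W = (N * size G)%N.
  have := sumW (fun=> 1%N); rewrite !sum1_size; exact.
pose c j a : R := N%:R * \sum_(g <- G) (bmnm (g j) == a)%:R.
have cw j a : j \in J -> a \in A j -> w j a <= c j a.
  move=> jJ aA; have /choice[h hh] l : exists a, l \in J -> a \in A l.
    have [/hne[b bA]|] := boolP (l \in J); first by exists b.
    by exists 0m.
  have [l lJ|g gA gh] := @choices_ex A J (fun l => if l == j then a else h l) hd.
    by case: eqP => [->//|_]; apply: hh.
  have gG : g \in G by rewrite mem_enum.
  apply: (@le_trans _ _ N%:R).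
    apply: (@le_trans _ _ (\sum_(j in J) \sum_(a <- A j) w j a)).
      rewrite (bigD1 j)//= (bigD1_seq a aA (fset_uniq _))/= -addrA lerDl.
      by rewrite addr_ge0// sumr_ge0// => *; rewrite sumr_ge0.
    by apply: ltW; apply: truncnS_gt.
  rewrite -[X in X <= _]mulr1 ler_wpM2l//.
  rewrite (bigD1_seq g gG (enum_uniq _))/= gh// eqxx eqxx lerDl.
  by apply: sumr_ge0 => *; rewrite ler0n.
have sum_c j (F : M -> R) : j \in J -> \sum_(a <- A j) c j a * F a =
    N%:R * \sum_(g <- G) F (bmnm (g j)).
  move=> jJ; under eq_bigr do rewrite -mulrA mulr_suml.
  rewrite -mulr_sumr exchange_big /=; congr (_ * _).
  rewrite big_seq [RHS]big_seq; apply: eq_bigr => g; rewrite mem_enum => /choicesP gA.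
  by under eq_bigr do rewrite eq_sym; rewrite sum_at ?gA.
have s1 : \sum_(g <- G) 1 = (size G)%:R :> R.
  by rewrite big_const_seq count_predT iter_addr addr0.
have kW : (k <= size W)%N.
  rewrite -(ler_nat R) -(w1 _ j0J) sizeW natrM.
  have := sum_c _ (fun=> 1) j0J; rewrite s1 => <-.
  rewrite big_seq [leRHS]big_seq; apply: ler_sum => a aA; rewrite mulr1; exact: cw.
have E i : (sumM W i)%:R - (m i)%:R =
    \sum_(j in J) \sum_(a <- A j) (c j a - w j a) * (a i)%:R :> R.
  rewrite w2 sumME (sumW (fun m => m i)) natrM natr_sum.
  under [RHS]eq_bigr do under eq_bigr do rewrite mulrBl.
  under [RHS]eq_bigr do rewrite sumrB.
  rewrite sumrB; congr (_ - _).
  rewrite (eq_bigr (fun j => N%:R * \sum_(g <- G) ((bmnm (g j)) i)%:R)); last first.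
    by move=> j jJ; rewrite (sum_c j (fun a => (a i)%:R)).
  rewrite -mulr_sumr exchange_big /=; congr (_ * _); apply: eq_bigr => g _.
  by rewrite msumE natr_sum.
have v0 j a : j \in J -> a \in A j -> 0 <= c j a - w j a.
  by move=> jJ aA; rewrite subr_ge0 cw.
have le i : (m i <= sumM W i)%N.
  rewrite -(ler_nat R) -subr_ge0 E; apply: sumr_ge0 => j jJ.
  rewrite big_seq; apply: sumr_ge0 => a aA.
  by rewrite mulr_ge0// v0.
exists W, (mnm_sub (sumM W) m); split=> //.
- move=> x /flattenP[y]; rewrite mem_nseq => /andP[_ /eqP ->] /mapP[g].
  by rewrite mem_enum => gA ->; apply/baseP; exists g.
- by apply/mnmP => i; rewrite mnmDE mnmBE subnKC.
exists (fun j a => if (j \in J) && (a \in A j) then c j a - w j a else 0); split.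
- by move=> j a; case: ifP => // /andP[jJ aA]; apply: v0.
- move=> j jJ; rewrite big_seq (eq_bigr (fun a => c j a * 1 - w j a)); last first.
    by move=> a aA; rewrite jJ aA mulr1.
  rewrite -big_seq sumrB w1// (sum_c j (fun=> 1))// s1.
  by rewrite natrB// sizeW natrM.
move=> i; rewrite mnmBE natrB// E; apply: eq_bigr => j jJ.
rewrite big_seq [RHS]big_seq; apply: eq_bigr => a aA; by rewrite jJ aA.
Qed.

End Dilates.

(** * Counting lattice points of the polytopes *)

Section Counting.
Variable R : realType.
Local Notation "''NN^' n" := (multinom n) : type_scope.

Definition consM n (x : nat) (m : 'NN^n) : 'NN^n.+1 :=
  Multinom [tuple if unlift ord0 i is Some j then m j else x | i < n.+1].

Lemma consM0 n x (m : 'NN^n) : consM x m ord0 = x.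
Proof. by rewrite mnmE unlift_none. Qed.

Lemma consMS n x (m : 'NN^n) j : consM x m (lift ord0 j) = m j.
Proof. by rewrite mnmE liftK. Qed.

Definition tailM n (m : 'NN^n.+1) : 'NN^n := Multinom [tuple m (lift ord0 j) | j < n].

Lemma consM_tail n (m : 'NN^n.+1) : consM (m ord0) (tailM m) = m.
Proof.
apply/mnmP => i; case: (unliftP ord0 i) => [j|] ->; last by rewrite consM0.
by rewrite consMS mnmE.
Qed.

Definition scaled n (t : nat) (m : 'NN^n) : 'rV[R]_n := \row_i ((m i)%:R / t%:R).

Lemma scaled_cons n t x (m : 'NN^n) :
  scaled t (consM x m) = row_mx ((x%:R / t%:R)%:M : 'rV_1) (scaled t m) :> 'rV_(1 + n).
Proof.
apply/rowP => i; rewrite mxE; case: (fintype.split_ordP i) => j ->.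
  rewrite row_mxEl !mxE (ord1 j) eqxx mulr1n; congr (_%:R / _).
  by rewrite -[RHS](consM0 x m); congr (fun_of_multinom _ _); apply: val_inj; case: j => -[].
rewrite row_mxEr !mxE; congr (_%:R / _).
by rewrite -[RHS](consMS x m); congr (fun_of_multinom _ _); apply: val_inj.
Qed.

Lemma consM_inj n x x' (m m' : 'NN^n) : consM x m = consM x' m' -> x = x' /\ m = m'.
Proof.
move=> e; split; first by rewrite -(consM0 x m) e consM0.
by apply/mnmP => j; rewrite -(consMS x m) e consMS.
Qed.

Lemma enum_cnt n t D (K : set 'rV[R]_n) : exists s : seq 'NN^n,
  [/\ uniq s, forall m, m \in s <-> (forall i, m i <= t * D)%N /\ K (scaled t m)
  & (size s)%:R = cnt t D K].
Proof.
elim: n K => [|n IH] K.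
  have z (m : 'NN^0) : m = 0m by apply/mnmP => -[].
  have z' (v : 'rV[R]_0) : v = 0 by apply/rowP => -[].
  exists (if `[< K 0 >] then [:: 0m] else [::]); split.
  - by case: ifP.
  - move=> m; rewrite (z m) (z' (scaled _ _)); case: asboolP => K0.
      by rewrite inE eqxx; split=> // _; split=> // -[].
    by split => // -[_ /K0].
  by rewrite /=; case: asboolP.
have /choice[s hs] (x : nat) := IH (slice K (x%:R / t%:R)).
exists [seq consM x m | x <- iota 0 (t * D).+1, m <- s x]; split.
- apply: allpairs_uniq_dep; first exact: iota_uniq.
    by move=> x _; case: (hs x).
  by move=> [x m] [x' m'] _ _ /= /consM_inj[-> ->].
- move=> m; split.
    move=> /allpairsPdep[x [m' [xD m's ->]]]; have [_ /(_ m')[h _] _] := hs x.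
    have [md Km] := h m's; split; last by rewrite scaled_cons.
    move=> i; case: (unliftP ord0 i) => [j|] ->; first by rewrite consMS.
    by rewrite consM0; rewrite mem_iota add0n ltnS in xD.
  move=> [md Km]; apply/allpairsPdep; exists (m ord0), (tailM m).
  rewrite consM_tail mem_iota add0n ltnS md; split=> //.
  have [_ /(_ (tailM m))[_ h] _] := hs (m ord0); apply: h; split.
    by move=> i; rewrite mnmE.
  by rewrite /slice /= -scaled_cons consM_tail.
have -> : iota 0 (t * D).+1 = index_iota 0 (t * D).+1 by rewrite /index_iota subn0.
rewrite size_allpairs_dep sumnE big_map natr_sum.
by rewrite big_mkord; apply: eq_bigr => x _; case: (hs x).
Qed.

Variables (n : nat) (A : 'I_n -> {fset 'NN^n}) (d : nat).
Hypothesis Ad : forall j a, a \in A j -> (mdeg a < d)%N.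
Implicit Types (J : {set 'I_n}).

Definition polytope J : set 'rV[R]_n := minkowski_sum J (fun j => Defs.conv (A j)).

Lemma polytopeP J v : polytope J v <-> exists w : 'I_n -> 'NN^n -> R,
  [/\ forall j a, 0 <= w j a, forall j, j \in J -> \sum_(a <- A j) w j a = 1
    & v = \sum_(j in J) \sum_(a <- A j) w j a *: Defs.point R a].
Proof.
split.
  move=> [p hp <-]; have /choice[w hw] j : exists w : 'NN^n -> R, (forall a, 0 <= w a) /\
      (j \in J -> \sum_(a <- A j) w a = 1 /\ p j = \sum_(a <- A j) w a *: Defs.point R a).
    have [/hp[w [w0 w1] <-]|_] := boolP (j \in J); last by exists (fun _ => 0).
    exists (fun a => oapp w 0 (insub a)); split.
      by move=> a; case: insub => //= *; apply: w0.
    move=> _; rewrite !big_seq_fsetE -w1; split; apply: eq_bigr => a _; by rewrite valK.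
  exists w; split.
  - by move=> j; case: (hw j).
  - by move=> j jJ; have [_ /(_ jJ)[]] := hw j.
  by apply: eq_bigr => j jJ; have [_ /(_ jJ)[_ ->]] := hw j.
move=> [w [w0 w1 ->]]; exists (fun j => \sum_(a <- A j) w j a *: Defs.point R a) => // j jJ.
exists (fun a => w j (val a)); first by split=> //; rewrite -(w1 j jJ) big_seq_fsetE.
by rewrite big_seq_fsetE.
Qed.

Lemma polytope_convex J : convexs (polytope J).
Proof.
move=> x y /polytopeP[w [w0 w1 ->]] /polytopeP[v [v0 v1 ->]] l /andP[l0 l1].
apply/polytopeP; exists (fun j a => l * w j a + (1 - l) * v j a); split.
- by move=> j a; rewrite addr_ge0// mulr_ge0// subr_ge0.
- by move=> j jJ; rewrite big_split /= -!mulr_sumr w1// v1//; ring.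
rewrite !scaler_sumr -big_split; apply: eq_bigr => j _ /=.
rewrite !scaler_sumr -big_split; apply: eq_bigr => a _ /=.
by rewrite !scalerA scalerDl.
Qed.

Lemma dil_polytope J k m : (0 < k)%N -> dil R A J k m <-> polytope J (scaled k m).
Proof.
move=> k0; have k0' : k%:R != 0 :> R by rewrite pnatr_eq0 -lt0n.
split.
  move=> [w [w0 w1 w2]]; apply/polytopeP; exists (fun j a => w j a / k%:R); split.
  - by move=> j a; rewrite divr_ge0.
  - by move=> j jJ; rewrite -mulr_suml w1// divff.
  apply/rowP => i; rewrite mxE w2 mulr_suml summxE; apply: eq_bigr => j _.
  rewrite mulr_suml summxE; apply: eq_bigr => a _; rewrite !mxE; by rewrite mulrAC.
move=> /polytopeP[w [w0 w1 /rowP e]]; exists (fun j a => k%:R * w j a); split.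
- by move=> j a; rewrite mulr_ge0.
- by move=> j jJ; rewrite -mulr_sumr w1// mulr1.
move=> i; have := e i; rewrite mxE => /(congr1 (fun x => k%:R * x)).
rewrite mulrCA divff// mulr1 => ->; rewrite summxE mulr_sumr; apply: eq_bigr => j _.
rewrite summxE mulr_sumr; apply: eq_bigr => a _; by rewrite !mxE mulrA.
Qed.

Lemma coord_bound j a i : a \in A j -> (a i <= d)%N.
Proof.
move=> /Ad ad; apply: leq_trans (ltnW ad); rewrite mdegE (bigD1 i)//=.
exact: leq_addr.
Qed.

Lemma polytope_inbox J : inbox (n * d) (polytope J).
Proof.
move=> v /polytopeP[w [w0 w1 ->]] i; rewrite summxE.
under eq_bigr do rewrite summxE.
under eq_bigr do under eq_bigr do rewrite !mxE.
apply/andP; split.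
  by apply: sumr_ge0 => j _; apply: sumr_ge0 => a _; rewrite mulr_ge0.
apply: (@le_trans _ _ (\sum_(j in J) d%:R)).
  apply: ler_sum => j jJ; rewrite [leRHS](_ : _ = \sum_(a <- A j) w j a * d%:R); last first.
    by rewrite -mulr_suml w1// mul1r.
  rewrite big_seq [leRHS]big_seq; apply: ler_sum => a aA.
  by rewrite ler_wpM2l// ler_nat (coord_bound _ aA).
rewrite sumr_const -mulrnA ler_nat mulnC leq_mul//.
by rewrite -[X in (_ <= X)%N]card_ord max_card.
Qed.

(** The leading term of the Ehrhart count, with an error of order k^(n - 1). *)
Lemma dil_count J : exists v C : R, [/\ 0 <= v, 0 <= C, Vol (polytope J) = v%:E
  & forall k, (0 < k)%N -> exists s : seq 'NN^n, [/\ uniq s,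
      forall m, m \in s <-> dil R A J k m
    & `|(size s)%:R - v * k%:R ^+ n| <= C * k%:R ^+ n / k%:R]].
Proof.
have [C C0 hC] := vol_lattice R (n * d) n.
have [v [vE v0 h]] := hC _ (@polytope_convex J) (@polytope_inbox J).
exists v, C; split=> // k k0; have k0' : 0 < k%:R :> R by rewrite ltr0n.
have kn0 : 0 < k%:R ^+ n :> R by rewrite exprn_gt0.
have [s [us ms cs]] := enum_cnt k (n * d) (polytope J); exists s; split=> //.
  move=> m; rewrite ms dil_polytope//; split=> [[]//|Pm]; split=> // i.
  by apply: (@dil_coord R n A J k m i d _); [move=> j a; apply: coord_bound|apply/dil_polytope].
have := h k k0; rewrite -cs distrC.
have -> : (size s)%:R / k%:R ^+ n - v = ((size s)%:R - v * k%:R ^+ n) / k%:R ^+ n.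
  by field; rewrite lt0r_neq0.
rewrite normrM normfV (ger0_norm (ltW kn0)) ler_pdivrMr//.
by rewrite mulrAC.
Qed.

End Counting.

(** * Growth of sets of lattice points *)

Section Growth.
Variables (R : realType) (n : nat) (A : 'I_n -> {fset 'NN^n}) (d : nat).
Variable t0 : bmultinom n d.
Hypothesis n0 : (0 < n)%N.
Hypothesis Ad : forall j a, a \in A j -> (mdeg a < d)%N.
Local Notation M := 'NN^n.
Implicit Types (J : {set 'I_n}).

Lemma count_drop (s : seq M) (i : 'I_n) B : uniq s ->
  (forall m, m \in s -> forall j, (m j <= B)%N) ->
  (forall m m', m \in s -> m' \in s -> (forall j, j != i -> m j = m' j) -> m = m') ->
  (size s <= B.+1 ^ n.-1)%N.
Proof.
move=> us sB inj; pose f (m : M) : {ffun 'I_n.-1 -> 'I_B.+1} := [ffun j => inord (m (lift i j))].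
have uf : uniq [seq f m | m <- s].
  rewrite map_inj_in_uniq// => m m' ms m's /ffunP e; apply: inj => // j ji.
  case: (unliftP i j) => [l jl|jl]; last by rewrite jl eqxx in ji.
  have := e l; rewrite !ffunE -jl => /(congr1 val); by rewrite /= !inordK ?ltnS ?sB.
have := card_uniqP uf; rewrite size_map => <-.
by rewrite -[X in (_ <= X ^ _)%N]card_ord -[n.-1 in leqRHS]card_ord -card_ffun max_card.
Qed.

Lemma dil_bound J k m : dil R A J k m -> forall j, (m j <= k * (n * d))%N.
Proof.
by move=> h j; apply: dil_coord h => l a; apply: (@coord_bound n A d Ad).
Qed.

Lemma dil_enum J k : exists s : seq M, uniq s /\ forall m, m \in s <-> dil R A J k m.
Proof.
case: k => [|k].
  exists [:: 0m]; split=> // m; rewrite inE; split=> [/eqP ->|/dil0P ->//].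
  exact: dil0.
by have [v [C [_ _ _ /(_ k.+1 isT)[s [us ms _]]]]] := dil_count R Ad J; exists s.
Qed.

Definition full_at J i := exists k p, dil R A J k p /\ dil R A J k (p +m mnm1 i).

Lemma small_growth J i (P : nat -> set M) : (forall k, P k `<=` dil R A J k) ->
  (forall k m m', P k m -> P k m' -> (forall j, j != i -> m j = m' j) -> m = m') ->
  forall k, exists2 s : seq M, (size s <= (n * d).+1 ^ n.-1 * k.+1 ^ n.-1)%N
    & forall m, m \in s <-> P k m.
Proof.
move=> PS inj k; have [s [us ms]] := dil_enum J k.
pose s' := [seq m <- s | `[< P k m >]].
have s'P m : m \in s' <-> P k m.
  rewrite mem_filter; split=> [/andP[/asboolP Pm _]//|Pm].
  by apply/andP; split; [exact/asboolP|apply/ms; apply: PS].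
exists s' => //; apply: leq_trans (count_drop (i := i) (B := (k * (n * d))%N) _ _ _) _.
- exact: filter_uniq.
- by move=> m /s'P/PS; apply: dil_bound.
- by move=> m m' /s'P Pm /s'P; apply: inj.
rewrite -expnMn; case: (n.-1) => [|e]; first by rewrite !expn0.
by rewrite leq_exp2r//; nia.
Qed.

(** Without neighbours in direction [i], convexity leaves at most one point on each line in that
    direction, so forgetting the coordinate [i] is injective. *)
Lemma not_full_growth J i : ~ full_at J i -> forall k, exists2 s : seq M,
  (size s <= (n * d).+1 ^ n.-1 * k.+1 ^ n.-1)%N & forall m, m \in s <-> dil R A J k m.
Proof.
move=> nf; apply: (@small_growth J i (dil R A J)); first by move=> k m.
move=> k m m' Sm Sm' e.
have key (x y : M) : dil R A J k x -> dil R A J k y -> (forall j, j != i -> x j = y j) ->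
    (x i < y i)%N -> False.
  move=> Sx Sy xy lt; apply: nf; exists k, x; split=> //.
  apply: (dil_segment Sx (l := (y i - x i)%N)); last by rewrite subn_gt0.
  suff -> : x +m mnm_muln (mnm1 i) (y i - x i) = y by [].
  apply/mnmP => j; rewrite mnmDE mulmnE mnm1E; have [->|ji] := eqVneq j i.
    by rewrite mul1n subnKC// ltnW.
  by rewrite mul0n addn0 xy.
apply/mnmP => j; have [->|/e//] := eqVneq j i.
have [lt|lt|//] := ltngtP (m i) (m' i); first by case: (key _ _ Sm Sm' e lt).
by case: (key _ _ Sm' Sm _ lt) => l /e.
Qed.

Lemma expr_divn (k : nat) : (0 < k)%N -> k%:R ^+ n / k%:R = k%:R ^+ n.-1 :> R.
Proof.
move=> k0; have k0' : k%:R != 0 :> R by rewrite pnatr_eq0 -lt0n.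
by rewrite -[in LHS](prednK n0) exprSr mulfK.
Qed.

Lemma linear_le0 (v C : R) : (forall k : nat, (0 < k)%N -> v * k%:R <= C) -> v <= 0.
Proof.
move=> h; rewrite leNgt; apply/negP => v0.
have := h (Num.truncn (C / v)).+1 isT; rewrite leNgt => /negP; apply.
by rewrite mulrC -ltr_pdivrMr//; apply: truncnS_gt.
Qed.

Lemma small_growth_volume J C v : Vol (@polytope R n A J) = v%:E ->
  (forall k, exists2 s : seq M, (size s <= C * k.+1 ^ n.-1)%N
    & forall m, dil R A J k m -> m \in s) -> v = 0.
Proof.
have [v' [C' [v0 C0 -> hc]]] := dil_count R Ad J; case=> <- h.
apply/eqP; rewrite eq_le v0 andbT; apply: (@linear_le0 _ (C%:R * 2%:R ^+ n.-1 + C')).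
move=> k k0; have [s [us ms]] := hc k k0; have [s' ss' ms'] := h k.
have k0' : 0 < k%:R :> R by rewrite ltr0n.
have kn : 0 < k%:R ^+ n.-1 :> R by rewrite exprn_gt0.
rewrite -mulrA expr_divn// ler_norml => /andP[h1 _].
have sle : (size s <= C * k.+1 ^ n.-1)%N.
  by apply: leq_trans ss'; apply: uniq_leq_size => // m /ms/ms'.
have : (size s)%:R <= C%:R * 2%:R ^+ n.-1 * k%:R ^+ n.-1 :> R.
  apply: (@le_trans _ _ (C * k.+1 ^ n.-1)%:R); first by rewrite ler_nat.
  rewrite natrM -mulrA ler_wpM2l// natrX -exprMn -natrM lerXn2r ?nnegrE// ler_nat; lia.
have kE : k%:R ^+ n = k%:R * k%:R ^+ n.-1 :> R by rewrite -exprS prednK.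
move: h1; rewrite kE -(ler_pM2r kn (v' * _)) mulrA; lra.
Qed.

Definition translates J (b : M) k : set M := [set m | if k is k'.+1 then
  exists2 m', dil R A J k' m' & m = b +m m' else False].

Lemma expr_succ_diff (k : nat) : k.+1%:R ^+ n - k%:R ^+ n <= n%:R * k.+1%:R ^+ n.-1 :> R.
Proof.
have h e : k.+1%:R ^+ e.+1 - k%:R ^+ e.+1 <= e.+1%:R * k.+1%:R ^+ e :> R.
  elim: e => [|e IH]; first by rewrite !expr1 expr0 mulr1 -natr1; lra.
  have -> : k.+1%:R ^+ e.+2 - k%:R ^+ e.+2 =
    k.+1%:R * (k.+1%:R ^+ e.+1 - k%:R ^+ e.+1) + k%:R ^+ e.+1 :> R.
    by rewrite (exprS _ e.+1) (exprS k%:R e.+1) -[k.+1%:R]natr1; ring.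
  rewrite -[e.+2%:R]natr1 mulrDl mul1r; apply: lerD.
    by apply: le_trans (ler_wpM2l _ IH) _ => //; rewrite exprS mulrCA.
  by rewrite lerXn2r ?nnegrE// ler_nat.
by have := h n.-1; rewrite prednK.
Qed.

(** The points outside the translate are counted by the difference for k and k - 1: the leading
    terms differ by at most n v k^(n - 1), and two errors C k^(n - 1) are added. *)
Lemma step_growth J : exists C : nat, forall b, dil R A J 1 b -> forall k,
  exists2 s : seq M, (size s <= C * k.+1 ^ n.-1)%N
    & forall m, dil R A J k m -> ~ translates J b k m -> m \in s.
Proof.
have [v [C [v0 C0 _ hc]]] := dil_count R Ad J.
have [s1 [us1 hs1]] := dil_enum J 1.
(* The three summands serve k >= 2, k = 1 and k = 0, in this order. *)
pose C' := ((Num.truncn (v * n%:R + 2%:R * C)).+1 + size s1 + 1)%N.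
exists C' => b Sb k; have [s [us hs]] := dil_enum J k.
pose s' l (r : seq M) := [seq m <- r | ~~ `[< translates J b l m >]].
exists (s' k s); last first.
  move=> m Sm nT; rewrite mem_filter; apply/andP; split; last exact/hs.
  by apply/negP => /asboolP.
case: k s us hs => [|[|k]] s us hs.
- have : (size s <= 1)%N.
    apply: (@leq_trans (size [:: 0m : M])) => //; apply: uniq_leq_size => // m /hs/dil0P ->.
    by rewrite inE.
  rewrite /s' size_filter exp1n muln1 /C' => h; apply: leq_trans (count_size _ _) _; lia.
- have : (size s <= size s1)%N by apply: uniq_leq_size => // m /hs/hs1.
  rewrite /s' size_filter => h; apply: leq_trans (count_size _ _) _.
  rewrite -[size s]muln1; apply: leq_mul; first by rewrite /C'; lia.
  by rewrite expn_gt0.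
have [r [ur hr]] := dil_enum J k.+1.
have : (size (s' k.+2 s) + size r = size s)%N.
  have -> : size r = count (fun m => `[< translates J b k.+2 m >]) s.
    rewrite -size_filter -(size_map (mnm_add b)); apply: perm_size; apply: uniq_perm.
    - by rewrite map_inj_uniq//; apply: addmI.
    - exact: filter_uniq.
    move=> m; rewrite mem_filter; apply/mapP/andP => [[m' /hr Sm' ->]|[/asboolP[m' Sm' ->]]].
      split; first by apply/asboolP; exists m'.
      by apply/hs; rewrite -add1n; apply: dilD.
    by move=> _; exists m' => //; apply/hr.
  by rewrite /s' size_filter addnC count_predC.
move=> /(congr1 (fun x => x%:R : R)); rewrite natrD => e.
have [s2 [us2 ms2]] := hc k.+2 isT; have [r2 [ur2 mr2]] := hc k.+1 isT.
have -> : size s2 = size s.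
  by apply: perm_size; apply: uniq_perm => // m; apply/idP/idP => [/ms2/hs|/hs/ms2].
have -> : size r2 = size r.
  by apply: perm_size; apply: uniq_perm => // m; apply/idP/idP => [/mr2/hr|/hr/mr2].
rewrite -!mulrA !expr_divn// !ler_norml => /andP[h1 h2] /andP[h3 h4].
have kk : k.+1%:R ^+ n.-1 <= k.+2%:R ^+ n.-1 :> R by rewrite lerXn2r ?nnegrE// ler_nat.
have h5 := expr_succ_diff k.+1.
have h6 : (size (s' k.+2 s))%:R <= (v * n%:R + 2%:R * C) * k.+2%:R ^+ n.-1 :> R.
  have h7 := ler_wpM2l v0 h5; have h8 := ler_wpM2l C0 kk.
  rewrite mulrDl -!mulrA.
  move: h1 h2 h3 h4 e h7 h8; rewrite mulrBr.
  set x1 := v * (_ * _); set x2 := C * _; set x3 := C * _; set x4 := v * _; set x5 := v * _.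
  lra.
rewrite -(ler_nat R); apply: le_trans h6 _; rewrite natrM natrX.
apply: ler_pM.
- by rewrite addr_ge0 ?mulr_ge0.
- by rewrite exprn_ge0.
- by apply: ltW; apply: lt_le_trans (truncnS_gt _) _; rewrite ler_nat /C' -addnA leq_addr.
by rewrite lerXn2r ?nnegrE// ler_nat.
Qed.

End Growth.

(** * Coefficients on monomial curves *)

Lemma base_digits N k (c c' : 'I_k -> nat) : (forall i, c i < N)%N ->
  (forall i, c' i < N)%N -> (\sum_i c i * N ^ i = \sum_i c' i * N ^ i)%N -> c =1 c'.
Proof.
elim: k c c' => [|k IH] c c' hc hc'; first by move=> _ [].
rewrite !big_ord_recl /= expn0 !muln1.
have sh (x : 'I_k.+1 -> nat) : (\sum_(i < k) x (lift ord0 i) * N ^ bump 0 i =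
    (\sum_(i < k) x (lift ord0 i) * N ^ i) * N)%N.
  by rewrite big_distrl /=; apply: eq_bigr => i _; rewrite /bump add1n expnSr mulnA.
rewrite !sh => e; have e0 : c ord0 = c' ord0.
  have := congr1 (fun x => x %% N)%N e.
  by rewrite ![(_ + _ * N)%N]addnC !modnMDl !modn_small.
have N0 : (0 < N)%N by apply: leq_ltn_trans (hc ord0).
move: e; rewrite e0 => /addnI/eqP; rewrite eqn_pmul2r// => /eqP.
move=> /(IH _ _ (fun i => hc _) (fun i => hc' _)) h i.
by case: (unliftP ord0 i) => [j|] ->; [apply: h|].
Qed.

Section Curves.
Variables (K : fieldType) (n d : nat) (t0 : bmultinom n d) (N : nat).
Hypothesis N1 : (1 < N)%N.
Local Notation R := {mpol K[n]}.
Local Notation M := 'NN^n.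
Local Notation T := (bmultinom n d).
Local Notation "'X^' m" := (mpolyX K m) (at level 2, m at level 1).
Implicit Types (A : 'I_n -> {fset M}) (J : {set 'I_n}).

Definition expo (j : 'I_n) (t : T) : nat := (N ^ @enum_rank ('I_n * T)%type (j, t))%N.

(* The coefficient of x^a in the j-th polynomial is u^(expo j a); the exponents are
   powers of N, so that they can be read off their sums. *)
Definition curve A j : {poly R} :=
  \sum_(t : T | bmnm t \in A j) (X^(bmnm t))%:P * 'X^(expo j t).

Definition prodc A J : {poly R} := \prod_(j in J) curve A j.

Definition expoJ J (g : {ffun 'I_n -> T}) : nat := (\sum_(j in J) expo j (g j))%N.

(** Each pair (j, t) has its own power of [N], occurring at most once in the sum; the digits 0 and 1
    recover the choice. *)
Lemma expoJ_inj A J (g h : {ffun 'I_n -> T}) : g \in choices t0 A J -> h \in choices t0 A J ->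
  expoJ J g = expoJ J h -> g = h.
Proof.
move=> /pfamilyP[/supportP sg _] /pfamilyP[/supportP sh _] e.
pose c (g : {ffun 'I_n -> T}) (x : 'I_#|{: 'I_n * T}|) : nat :=
  ((enum_val x).1 \in J) && ((enum_val x).2 == g (enum_val x).1).
have cE f : expoJ J f = (\sum_x c f x * N ^ x)%N.
  rewrite /expoJ [RHS](reindex (@enum_rank ('I_n * T)%type)) /=; last first.
    by exists enum_val => x _; [exact: enum_rankK|exact: enum_valK].
  transitivity (\sum_j \sum_t ((j \in J) && (t == f j)) *
    N ^ @enum_rank ('I_n * T)%type (j, t))%N; last first.
    by rewrite pair_bigA; apply: eq_bigr => -[j t] _; rewrite /c enum_rankK.
  rewrite [LHS]big_mkcond /=.
  apply: eq_bigr => j _; case: (j \in J) => /=; last by rewrite big1.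
  rewrite (bigD1 (f j))//= eqxx mul1n big1 ?addn0// => t /negPf ->.
  by rewrite mul0n.
apply/ffunP => j; have [jJ|jJ] := boolP (j \in J); last by rewrite sg// sh.
have := @base_digits N _ (c g) (c h) _ _ _ (enum_rank (j, g j)).
rewrite /c enum_rankK /= jJ eqxx /= => H; apply/eqP; case: (g j == h j) H => // H.
by have : 1%N = 0%N by apply: H => [i|i|]; rewrite ?(leq_ltn_trans (leq_b1 _))// -!cE.
Qed.

Lemma prodc_choices A J :
  prodc A J = \sum_(g in choices t0 A J) (X^(ms J g))%:P * 'X^(expoJ J g).
Proof.
rewrite /prodc /curve.
rewrite (big_distr_big_dep t0) /=.
apply: eq_bigr => g _; rewrite big_split /= -rmorph_prod; congr (_%:P * _).
  by rewrite /ms /msum -(big_morph _ (@mpolyXD n K) (@mpolyX0 n K)).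
by rewrite /expoJ -(big_morph (fun k => 'X^k : {poly R}) (exprD _) (expr0 _)).
Qed.

Lemma coef_prodc A J g : g \in choices t0 A J -> (prodc A J)`_(expoJ J g) = X^(ms J g).
Proof.
move=> gA; rewrite prodc_choices coef_sum (bigD1 g)//= coefCM coefXn eqxx mulr1.
rewrite big1 ?addr0// => h /andP[hA hg]; rewrite coefCM coefXn.
case: eqP => [e|_]; last by rewrite mulr0.
by case/eqP: hg; apply/esym/(expoJ_inj gA hA).
Qed.

(** Choices with the same sum of points still differ in their exponent of u, so nothing is added up
    or cancelled: every coefficient of the product is 0 or a single monomial of the base. *)
Lemma prodc_B_curve A J : B_curve [seq X^b | b <- base t0 A J] (prodc A J).
Proof.
split=> [k|_ /mapP[b /baseP[g gA ->] ->]]; last by exists (expoJ J g); apply: coef_prodc.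
have [[g gA <-]|ng] := pselect (exists2 g, g \in choices t0 A J & expoJ J g = k).
  by right; rewrite coef_prodc//; apply: map_f; apply/baseP; exists g.
left; rewrite prodc_choices coef_sum big1// => g gA; rewrite coefCM coefXn.
by case: eqP => [e|_]; [case: ng; exists g|rewrite mulr0].
Qed.

Lemma coef_curve A j (t : T) : bmnm t \in A j -> (curve A j)`_(expo j t) = X^(bmnm t).
Proof.
move=> tA; rewrite /curve coef_sum (bigD1 t)//= coefCM coefXn eqxx mulr1.
rewrite big1 ?addr0// => s /andP[sA st]; rewrite coefCM coefXn.
case: eqP => [/eqP|_]; last by rewrite mulr0.
rewrite eqn_exp2l// => /eqP/val_inj/enum_rank_inj[e].
by rewrite e eqxx in st.
Qed.

Lemma spec_curve A j u : (forall a, a \in A j -> mdeg a < d)%N ->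
  spec u (curve A j) = \sum_(t : T | bmnm t \in A j) u ^+ expo j t *: X^(bmnm t).
Proof.
move=> _; rewrite /spec /curve horner_sum; apply: eq_bigr => t _.
by rewrite hornerM hornerC hornerXn -rmorphXn /= mulrC mul_mpolyC.
Qed.

Lemma spec_prodc A J u : spec u (prodc A J) = \prod_(j in J) spec u (curve A j).
Proof. by rewrite /spec /prodc horner_prod. Qed.

Lemma supp_spec_curve A j u m : mcoeff m (spec u (curve A j)) != 0 -> m \in A j.
Proof.
rewrite /spec /curve horner_sum raddf_sum /= => h; apply: contraNT h => mA.
apply/eqP; rewrite big1// => t tA.
rewrite hornerM hornerC hornerXn -rmorphXn /= mulrC mcoeffCM mcoeffX.
by case: eqP => [e|_]; [rewrite -e tA in mA|rewrite mulr0].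
Qed.

End Curves.

(** * Hilbert functions modulo a sequence *)

Section HilbertBounds.
Variables (K : fieldType) (n : nat).
Local Notation R := {mpol K[n]}.
Variables (V : nat -> set R) (S : set R).
Hypothesis sV : forall k, subspace (V k).
Hypothesis mS : mulset S.

(** Along a regular sequence, multiplication by [f] embeds one degree of the quotient into the next,
    with cokernel the quotient by one more element; Pascal's rule does the rest. It bounds [a] from
    above by the growth of [V]. *)
Lemma hilbert_upper (fs : seq R) (J : set R) k0 a : ideal J -> reg S J fs ->
  (forall f, f \in fs -> forall k v, V k v -> V k.+1 (f * v)) ->
  (forall k, (k0 <= k)%N -> dge (V k) (sat S (gens J fs)) a) ->
  forall m, dge (V (k0 + m)%N) (sat S J) (a * 'C(m, size fs)).
Proof.
elim: fs J => [|f fs IH] J iJ /= rfs fV h m.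
  by rewrite bin0 muln1; apply: h; apply: leq_addr.
have [nf rf] := rfs.
have fV' g : g \in fs -> forall k v, V k v -> V k.+1 (g * v).
  by move=> gfs; apply: fV; rewrite inE gfs orbT.
have {}IH := IH _ (ideal_addI f iJ) rf fV' h.
have ss I : ideal I -> subspace (sat S I) by move=> iI; apply/subspace_ideal/ideal_sat.
elim: m => [|m IHm]; first by rewrite bin0n muln0; apply: dge0.
rewrite addnS binS mulnDr [(a * _ + _)%N]addnC.
pose W := V (k0 + m).+1 `&` sat S (addI J f).
have sW : subspace W by apply: subspaceI => //; apply/ss/ideal_addI.
have sJ : sat S J `<=` sat S (addI J f) by apply/sat_mono/sub_addI.
have h1 : dge (V (k0 + m).+1) W (a * 'C(m, size fs)).
  apply: (@dge_mono _ _ (V (k0 + m).+1) _ (sat S (addI J f))) => //.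
    by move=> v _ [].
  by apply: (@dge_le _ _ _ _ _ (a * 'C(m.+1, size fs))); [rewrite leq_mul2l leq_bin2l ?orbT|rewrite -addnS; apply: IH].
have h2 : dge W (W `&` sat S J) (a * 'C(m, (size fs).+1)).
  apply: (dge_map (phi := fun v => f * v)) IHm => //; first exact: linear_mul.
    move=> v Vv; split; first by apply: fV; rewrite ?inE ?eqxx.
    apply: sub_sat => //; first exact: ideal_addI.
    by rewrite mulrC; have [_ _ M] := ideal_addI f iJ; apply: M; apply: addI_mem.
  by move=> v Vv [_]; apply: nf.
apply: (@dge_mono _ _ (V (k0 + m).+1) _ (W `&` sat S J)) => //.
  by move=> v Vv Jv; split=> //; split=> //; apply: sJ.
by apply: (dge_trans sW _ _ h1 h2); move=> v [].
Qed.

(** Conversely, a degree of the quotient is covered by its quotient modulo [f] and the image of the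
    previous degree. The term with [c] pays for the starting degree [k0] at every level of the
    recursion. *)
Lemma hilbert_lower (fs : seq R) (U : nat -> set R) k0 a c :
  (forall k, subspace (U k)) -> (forall k, U k `<=` V k) ->
  (forall f, f \in fs -> forall k v, V k v -> V k.+1 (f * v)) ->
  (forall f, f \in fs -> forall k v, U k v -> U k.+1 (f * v)) ->
  (forall k, (k0 <= k)%N -> dle (V k) (Ugens V U fs k) a) ->
  dle (V k0) [set 0] c ->
  forall m, dle (V (k0 + m)%N) (U (k0 + m)%N) (a * 'C(m + size fs, size fs) +
    c * (if size fs is p.+1 then 'C(m + size fs, p) else 0)).
Proof.
elim: fs U => [|f fs IH] U sU UV fV fU h hc m /=.
  by rewrite bin0 muln1 muln0 addn0; apply: h; apply: leq_addr.
have fV' g : g \in fs -> forall k v, V k v -> V k.+1 (g * v).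
  by move=> gfs; apply: fV; rewrite inE gfs orbT.
have f1 : f \in f :: fs by rewrite inE eqxx.
have fVf := fV f f1; have fUf := fU f f1.
have sU' k : subspace (Uadd V U f k).
  split.
    exists 0, 0; split; first exact: sub0.
    by case: k => // k; split; [exact: sub0|rewrite mulr0 addr0].
  move=> x y z [u [w [Uu e]]] [u' [w' [Uu' e']]].
  exists (x *: u + u'), (x *: w + w'); split; first exact: (sU k).2.
  case: k Uu e Uu' e' => [|k] Uu; first by move=> -> _ ->.
  move=> [Vw ->] Uu' [Vw' ->]; split; first exact: (sV k).2.
  by rewrite mulrDr scalerDr -scalerAr addrACA.
have U'V k : Uadd V U f k `<=` V k.
  move=> r [u [w [Uu]]]; case: k Uu => [|k] Uu; first by move=> ->; apply: UV.
  by move=> [Vw ->]; apply: subD; [exact: sV|exact: UV|exact: fVf].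
have gU' g : g \in fs -> forall k v, Uadd V U f k v -> Uadd V U f k.+1 (g * v).
  move=> gfs k v [u [w [Uu e]]].
  have gU : U k.+1 (g * u) by apply: fU => //; rewrite inE gfs orbT.
  case: k Uu e gU => [|k] Uu.
    move=> -> gU; exists (g * u), 0; split=> //; split; first exact: sub0.
    by rewrite mulr0 addr0.
  move=> [Vw ->] gU; exists (g * u), (g * w); split=> //; split; first exact: fV'.
  by rewrite mulrDr mulrCA.
have {}IH := IH _ sU' U'V fV' gU' h hc.
elim: m => [|m IHm].
  rewrite addn0; apply: (@dle_le _ _ _ _ c); first exact: sub0.
    apply: leq_trans (leq_addl _ _); rewrite -[leqLHS]muln1 leq_mul2l.
    by rewrite bin_gt0 leqnSn orbT.
  by apply: dle_mono hc => x ->; apply: sub0.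
rewrite addnS.
have step : dle (Uadd V U f (k0 + m).+1) (U (k0 + m).+1) (a * 'C(m + (size fs).+1, (size fs).+1) +
    c * 'C(m + (size fs).+1, size fs)).
  apply: (dle_map (phi := fun v => f * v)) IHm; [exact: linear_mul|exact: sU| | |].
  - by move=> v Vv; apply: Uadd_mem.
  - exact: fUf.
  by move=> _ [u [w [Uu [Vw ->]]]]; exists w => //; rewrite addrK.
have := IH m.+1; rewrite addnS => IHm1.
apply: (dle_le _ _ (dle_trans (@U'V _) IHm1 step)).
  exact: sub0.
rewrite !addSn !addnS [('C(_.+2, (size fs).+1))%N]binS.
case: (size fs) => [|p]; first by rewrite !bin0; lia.
rewrite [('C(_.+2, p.+1))%N]binS.
move: ('C(_, _))%N ('C(_, _))%N ('C(_, _))%N => x1 x2 x3; nia.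
Qed.

End HilbertBounds.

(** * Binomial growth against volume *)

Section Asymptotics.
Variable R : realType.

Lemma ffact_le m n : (m ^_ n <= m ^ n)%N.
Proof.
elim: n => [|n IH]; first by rewrite ffactn0.
by rewrite ffactnSr expnSr leq_mul// leq_subr.
Qed.

Lemma ffact_ge m n : ((m - n) ^ n <= m ^_ n)%N.
Proof.
suff h p : (p <= n)%N -> ((m - n) ^ p <= m ^_ p)%N by apply: h.
elim: p => [|p IH] pn; first by rewrite ffactn0.
by rewrite ffactnSr expnSr leq_mul ?IH ?(ltnW pn)//; lia.
Qed.

Lemma exp_diff_le (x y : R) n : 0 <= y <= x ->
  x ^+ n.+1 - y ^+ n.+1 <= n.+1%:R * (x - y) * x ^+ n.
Proof.
move=> /andP[y0 yx]; have x0 := le_trans y0 yx.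
elim: n => [|n IH]; first by rewrite !expr1 expr0 mul1r mulr1.
have -> : x ^+ n.+2 - y ^+ n.+2 = x * (x ^+ n.+1 - y ^+ n.+1) + (x - y) * y ^+ n.+1.
  by rewrite (exprS x n.+1) (exprS y n.+1); ring.
have h1 := ler_wpM2l x0 IH.
have h2 : (x - y) * y ^+ n.+1 <= (x - y) * x ^+ n.+1.
  by rewrite ler_wpM2l ?subr_ge0// lerXn2r// nnegrE.
have -> : n.+2%:R * (x - y) * x ^+ n.+1 =
    x * (n.+1%:R * (x - y) * x ^+ n) + (x - y) * x ^+ n.+1.
  by rewrite -[n.+2%:R]natr1 (exprS x n); ring.
exact: lerD.
Qed.

Variables (v C : R) (n : nat) (del c : nat).
Hypothesis v0 : 0 <= v.
Hypothesis C0 : 0 <= C.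

(** Leading coefficients are compared: both sides have degree n + 1, the binomial with leading
    coefficient 1/(n + 1)!. After division by k^n a bounded linear function of k remains, to which
    [linear_le0] applies. *)
Lemma volume_upper :
  (forall m, (del * 'C(m, n.+1))%:R <= v * (c + m)%:R ^+ n.+1 + C * (c + m)%:R ^+ n) ->
  del%:R <= n.+1`!%:R * v.
Proof.
(* The falling factorial of k - c with n + 1 factors is at least (k - e)^(n + 1). *)
move=> h; pose e := (c + n.+1)%N.
rewrite -subr_le0; apply: (@linear_le0 _ _ (n.+1`!%:R * C + del%:R * (n.+1%:R * e%:R))).
move=> k k0; have k0' : 0 < k%:R :> R by rewrite ltr0n.
have kn : 0 < k%:R ^+ n :> R by rewrite exprn_gt0.
have hk : del%:R * (k - e)%:R ^+ n.+1 <= n.+1`!%:R * (v * k%:R ^+ n.+1 + C * k%:R ^+ n).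
  have [ke|ek] := leqP k e.
    have -> : (k - e)%N = 0%N by apply/eqP.
    rewrite expr0n mulr0 mulr_ge0// addr_ge0// mulr_ge0// exprn_ge0//.
  have := h (k - c)%N; have -> : (c + (k - c) = k)%N by rewrite /e in ek; lia.
  move=> h'; apply: le_trans (ler_wpM2l _ h') => //.
  rewrite -natrX -!natrM ler_nat mulnCA leq_mul2l mulnC bin_ffact; apply/orP; right.
  by rewrite subnDA ffact_ge.
have ek : k%:R - e%:R <= (k - e)%:R :> R.
  have [ke|ek] := leqP k e; last by rewrite natrB// ltnW.
  by apply: (@le_trans _ _ 0); rewrite ?subr_le0 ?ler_nat.
have hd : k%:R ^+ n.+1 - (k - e)%:R ^+ n.+1 <= n.+1%:R * e%:R * k%:R ^+ n :> R.
  apply: le_trans (@exp_diff_le _ (k - e)%:R _ _) _.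
    by rewrite ler0n ler_nat leq_subr.
  rewrite ler_wpM2r ?(ltW kn)// ler_wpM2l//; lra.
have hd' := ler_wpM2l (ler0n R del) hd.
rewrite -(ler_pM2r kn) mulrBl mulrBl -!mulrA -exprS mulrDl.
move: hk hd'; rewrite mulrDr mulrBr.
rewrite -!mulrA; lra.
Qed.

Lemma volume_lower (c0 : nat) :
  (forall m, v * (c + m)%:R ^+ n.+1 - C * (c + m)%:R ^+ n <=
    (del * 'C(m + n.+1, n.+1) + c0 * 'C(m + n.+1, n))%:R) ->
  n.+1`!%:R * v <= del%:R.
Proof.
move=> h; pose e := n.+1.
rewrite -subr_le0; apply: (@linear_le0 _ _ (n.+1`!%:R * (C * (c + 1)%:R ^+ n) +
  del%:R * (n.+1%:R * e%:R * (e + 1)%:R ^+ n) + (n.+1 * c0)%:R * (e + 1)%:R ^+ n)).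
move=> k k0; have k0' : 0 < k%:R :> R by rewrite ltr0n.
have kn : 0 < k%:R ^+ n :> R by rewrite exprn_gt0.
have ck (b : nat) : (k + b)%:R ^+ n <= (b + 1)%:R ^+ n * k%:R ^+ n :> R.
  by rewrite -exprMn -natrM lerXn2r ?nnegrE// ler_nat; nia.
have h1 := ler_wpM2l (ler0n R n.+1`!) (h k).
have h2 : n.+1`!%:R * (v * k%:R ^+ n.+1) <= n.+1`!%:R * (v * (c + k)%:R ^+ n.+1).
  by rewrite !ler_wpM2l// lerXn2r ?nnegrE// ler_nat leq_addl.
have h3 : n.+1`!%:R * (C * (c + k)%:R ^+ n) <= n.+1`!%:R * (C * (c + 1)%:R ^+ n) * k%:R ^+ n.
  rewrite -mulrA ler_wpM2l// -mulrA ler_wpM2l// addnC; exact: ck.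
have h4 : n.+1`!%:R * (del * 'C(k + n.+1, n.+1))%:R <= del%:R * (k + e)%:R ^+ n.+1 :> R.
  rewrite -natrX -!natrM ler_nat mulnCA leq_mul2l mulnC bin_ffact ffact_le; exact: orbT.
have h5 : n.+1`!%:R * (c0 * 'C(k + n.+1, n))%:R <= (n.+1 * c0)%:R * (e + 1)%:R ^+ n * k%:R ^+ n :> R.
  rewrite -mulrA; apply: (@le_trans _ _ ((n.+1 * c0)%:R * (k + e)%:R ^+ n)); last first.
    by rewrite ler_wpM2l.
  rewrite -natrX -!natrM ler_nat factS -mulnA [(n`! * _)%N]mulnCA mulnA leq_mul2l.
  by rewrite [(n`! * _)%N]mulnC bin_ffact ffact_le orbT.
have h6 : (k + e)%:R ^+ n.+1 - k%:R ^+ n.+1 <= n.+1%:R * e%:R * (e + 1)%:R ^+ n * k%:R ^+ n :> R.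
  apply: le_trans (@exp_diff_le _ k%:R _ _) _.
    by rewrite ler0n ler_nat leq_addr.
  rewrite -[leRHS]mulrA natrD addrAC subrr add0r ler_wpM2l ?mulr_ge0// -natrD; exact: ck.
have h7 := ler_wpM2l (ler0n R del) h6.
have kE : k%:R ^+ n.+1 = k%:R * k%:R ^+ n :> R by rewrite exprS.
rewrite -(ler_pM2r kn) mulrBl mulrBl -[_ * k%:R * _]mulrA -[del%:R * k%:R * _]mulrA -kE.
rewrite !mulrDl.
move: h1; rewrite [X in _ <= _ * X -> _]natrD mulrBr mulrDr.
move: h2 h3 h4 h5 h7; rewrite mulrBr.
rewrite -[_ * v * _]mulrA -[del%:R * _ * _]mulrA.
lra.
Qed.

End Asymptotics.

(** * Generic systems on the torus *)

Section Torus.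
Variables (R : realType) (K : fieldType) (n d : nat) (t0 : bmultinom n d) (N : nat).
Hypothesis ncK : ~ countable [set: K].
Hypothesis N1 : (1 < N)%N.
Hypothesis n0 : (0 < n)%N.
Variable A : 'I_n -> {fset 'NN^n}.
Hypothesis Ad : forall j a, a \in A j -> (mdeg a < d)%N.
Hypothesis Ane : forall j, exists a, a \in A j.
Local Notation P := {mpol K[n]}.
Local Notation M := 'NN^n.
Local Notation "'X^' m" := (mpolyX K m) (at level 2, m at level 1).
Local Notation dil := (dil R A).
Local Notation base := (base t0 A).
Implicit Types (J : {set 'I_n}) (us : seq K).

Definition tori : set P := monomials [set: M].

Lemma mulset_tori : mulset tori.
Proof. exact: mulset_monomials. Qed.

(** All members share the polytope of [J], so that Hilbert functions count their zeros; expanding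
    the products then leads to the systems [mixed s]. *)
Definition rows J us : seq P := specs us (nseq n (prodc K d N A J)).

Definition mixed (s : {ffun 'I_n -> 'I_n}) us : seq P :=
  specs us [seq curve K d N A (s i) | i <- enum 'I_n].

Lemma nth_specs us (phis : seq {poly P}) i : size us = size phis -> (i < size phis)%N ->
  (specs us phis)`_i = spec us`_i phis`_i.
Proof.
by move=> e il; rewrite (nth_map (0, 0)) ?nth_zip// size_zip e minnn.
Qed.

Lemma size_specs us (phis : seq {poly P}) : size us = size phis ->
  size (specs us phis) = size phis.
Proof. by move=> e; rewrite size_map size_zip e minnn. Qed.

Lemma nth_rows J us i : size us = n -> (i < n)%N -> (rows J us)`_i = spec us`_i (prodc K d N A J).
Proof. by move=> e il; rewrite nth_specs ?size_nseq// nth_nseq il. Qed.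

Lemma nth_mixed s us (i : 'I_n) : size us = n -> (mixed s us)`_i = spec us`_i (curve K d N A (s i)).
Proof.
move=> e; have sE : size [seq curve K d N A (s i) | i <- enum 'I_n] = n.
  by rewrite size_map size_enum_ord.
rewrite nth_specs ?sE// (nth_map i) ?size_enum_ord//.
by rewrite nth_ord_enum.
Qed.

Lemma size_rows J us : size us = n -> size (rows J us) = n.
Proof. by move=> e; rewrite size_specs ?size_nseq. Qed.

Lemma size_mixed s us : size us = n -> size (mixed s us) = n.
Proof.
move=> e; have sE : size [seq curve K d N A (s i) | i <- enum 'I_n] = n.
  by rewrite size_map size_enum_ord.
by rewrite size_specs sE.
Qed.

Lemma base_ex J : exists b, b \in base J.
Proof.
have /choice[h hA] := Ane.
have [|g gA _] := @choices_ex n d t0 A J h Ad; first by move=> j _; apply: hA.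
by exists (ms J g); apply/baseP; exists g.
Qed.

Definition reduces (Y : nat -> set M) J us := exists k1, forall k, (k1 <= k)%N ->
  forall m, dil J k.+1 m -> exists u (w : nat -> P), [/\ supp_in (Y k.+1) u,
    forall i, supp_in (dil J k) (w i)
  & X^m = u + \sum_(i < n) (rows J us)`_i * w i].

Lemma VG_reduces (Y : nat -> set M) C J :
  (forall k b m, b \in base J -> Y k m -> Y k.+1 (b +m m)) ->
  (forall k, Y k `<=` dil J k) ->
  (forall k, exists2 s : seq M, (size s <= C * k.+1 ^ n.-1)%N
     & forall m, dil J k m -> ~ Y k m -> m \in s) ->
  VG n (reduces Y J).
Proof.
move=> BY YS cnt.
have := @monomial_reduction K n (dil J) Y (base J) (\max_j #|` A j|)%N C n.-1
  (nseq n (prodc K d N A J)) ncK (undup_uniq _) _ BY YS _ cnt.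
rewrite size_nseq => H; apply: H.
- by move=> k b m; apply: dil_step.
- move=> k hk m /(dil_base_generated t0 Ad) []; last by move=> b [s h]; right; exists b, s.
  by move=> j _; apply: leq_trans hk; apply: (leq_bigmax (F := fun j => #|` A j|)).
- by rewrite prednK.
by move=> phi; rewrite mem_nseq => /andP[_ /eqP ->]; apply: prodc_B_curve.
Qed.

(** Reduction to the translate by [b] means divisibility by [b] modulo the rows in high degree: this
    is the surjectivity needed for stabilization. It is available because the translate omits only
    O(k^(n - 1)) points. *)
Lemma VG_translates J : (0 < #|J|)%N ->
  VG n (fun us => forall b, b \in base J -> reduces (translates R A J b) J us).
Proof.
move=> J0; have [C hC] := step_growth R n0 Ad J.
apply: VG_forall => b.
have [bB|bB] := boolP (b \in base J); last by apply: VGT.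
apply: (@VG_mono _ _ (reduces (translates R A J b) J)); first by move=> us _ h _.
apply: (@VG_reduces _ C).
- move=> [//|k] c m cB [m' Sm' ->]; exists (c +m m'); first by apply: dil_step cB Sm'.
  by apply/mnmP => i; rewrite !mnmDE; lia.
- by move=> [//|k] _ [m Sm ->]; apply: dil_step bB Sm.
by move=> k; apply: hC; apply: base_dil bB.
Qed.

Lemma supp_translates J b k u : supp_in (translates R A J b k.+1) u ->
  exists2 w, supp_in (dil J k) w & u = X^b * w.
Proof.
move: u; apply: supp_in_min.
  split; first by exists 0; [exact: sub0 (subspace_supp _ _)|rewrite mulr0].
  move=> a x y [w Sw ->] [w' Sw' ->]; exists (a *: w + w').
    exact: (subspace_supp _ _).2.
  by rewrite mulrDr scalerAr.
by move=> _ [m Sm ->]; exists X^m; [exact: supp_inX|rewrite mpolyXD].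
Qed.

Lemma dil_deep J (L : seq (M * M)) : (0 < #|J|)%N -> (forall i, full_at R A J i) ->
  exists2 w : seq M, {subset w <= base J} &
  forall p q, (p, q) \in L -> deepens (dil J) w p q.
Proof.
move=> J0 full; apply: deep.
- exact: dil0.
- by move=> k l a b; apply: dilD.
- by move=> b; apply: base_dil.
- exact: full.
by move=> k s; apply: dil_cancel => // j _; apply: Ane.
Qed.

Definition pred_dil J (i k : nat) : set M := [set m | if k is k'.+1 then dil J k' m else False].

(** The largest support of a multiplier whose products with the exponents in [L i] stay in degree
    [k]. *)
Definition colon_dil J (L : nat -> seq M) (i k : nat) : set M :=
  [set m | forall c, c \in L i -> dil J k (c +m m)].

Section Stable.
Variables (J : {set 'I_n}) (fs : seq P) (T : nat -> nat -> set M) (b0 : M).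
Hypothesis J0 : (0 < #|J|)%N.
Hypothesis full : forall i, full_at R A J i.
Hypothesis b0B : b0 \in base J.
Hypothesis BT : forall i k b m, b \in base J -> T i k m -> T i k.+1 (b +m m).
Hypothesis TS : forall i k m c, (i < size fs)%N -> T i k m -> mcoeff c fs`_i != 0 ->
  dil J k (c +m m).
Hypothesis deepT : forall k c (L : seq M), exists2 w : seq M,
  {subset w <= base J} & forall m, m \in L -> exists s,
    sumM w +m m = c +m s /\ forall i, T i (k + size w)%N s.
Hypothesis surj : forall b, b \in base J -> exists k1, forall k, (k1 <= k)%N ->
  forall m, dil J k.+1 m ->
  exists2 w, supp_in (dil J k) w & span_multiples fs T k.+1 (X^m - X^b * w).

Lemma stable_dimension : exists k2 d,
  qdim setT (sat tori (gens [set 0] fs)) d /\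
  forall k, (k2 <= k)%N -> qdim (supp_in (dil J k)) (span_multiples fs T k) d /\
    forall v, supp_in (dil J k) v -> sat tori (gens [set 0] fs) v ->
      span_multiples fs T k v.
Proof.
have /choice[k1 hk1] b : exists k1, b \in base J -> forall k, (k1 <= k)%N ->
    forall m, dil J k.+1 m ->
    exists2 w, supp_in (dil J k) w & span_multiples fs T k.+1 (X^m - X^b * w).
  have [/surj[k h]|_] := boolP (b \in base J); last by exists 0%N.
  by exists k.
apply: (@monomial_torus_dimension _ _ (dil J) (base J) b0 fs T setT (\max_(b <- base J) k1 b)) => //.
- by move=> k b m; apply: dil_step.
- by move=> k; have [s [_ hs]] := dil_enum R Ad J k; exists s => m /hs.
- move=> L; have [w wB hw] := dil_deep [seq (m, 0m : M) | m <- L] J0 full.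
  exists w => // m mL; have [|s [es Ss]] := hw m 0m; first by apply/mapP; exists m.
  by rewrite es add0m.
move=> k hk b bB; apply: hk1 => //.
by apply: leq_trans hk; apply: leq_bigmax_seq.
Qed.

End Stable.

Lemma deep_pred J b0 k c (L : seq M) : (0 < #|J|)%N -> (forall i, full_at R A J i) ->
  b0 \in base J -> exists2 w : seq M, {subset w <= base J} & forall m, m \in L -> exists s,
    sumM w +m m = c +m s /\ forall i, pred_dil J i (k + size w)%N s.
Proof.
(* Translation by k times [b0] supplies the extra degree [k]. *)
move=> J0 full bB; pose e := mnm_muln b0 k.
have Se : dil J k e.
  rewrite /e; elim: k {e} => [|k IH]; first by rewrite mulm0n; apply: dil0.
  by rewrite mulmS; apply: dil_step bB IH.
have [w wB hw] := dil_deep [seq (b0 +m m, c +m e) | m <- L] J0 full.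
exists (b0 :: w) => [x|m mL]; first by rewrite inE => /orP[/eqP ->|/wB].
have [|s [es Ss]] := hw (b0 +m m) (c +m e); first by apply/mapP; exists m.
exists (e +m s); split; last by move=> i; rewrite /= addnS; apply: dilD.
apply/mnmP => i; move/mnmP/(_ i): es => /=; rewrite !mnmDE; lia.
Qed.

Lemma deep_colon J L0 (La : seq M) b0 k c (L : seq M) : (0 < #|J|)%N ->
  (forall i, full_at R A J i) -> b0 \in base J -> (forall i, {subset L0 i <= La}) ->
  exists2 w : seq M, {subset w <= base J} & forall m, m \in L -> exists s,
    sumM w +m m = c +m s /\ forall i, colon_dil J L0 i (k + size w)%N s.
Proof.
move=> J0 full bB sL; pose e := mnm_muln b0 k.
have Se : dil J k e.
  rewrite /e; elim: k {e} => [|k IH]; first by rewrite mulm0n; apply: dil0.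
  by rewrite mulmS; apply: dil_step bB IH.
have [w wB hw] := dil_deep ([seq (m, c) | m <- L] ++
  [seq (x +m m, c +m e) | m <- L, x <- La]) J0 full.
exists w => // m mL.
have [|s [es Ss]] := hw m c.
  by rewrite mem_cat; apply/orP; left; apply/mapP; exists m.
exists s; split=> // i x /sL xL; have [|s' [es' Ss']] := hw (x +m m) (c +m e).
  rewrite mem_cat; apply/orP; right; apply/allpairsP; by exists (m, x).
suff -> : x +m s = e +m s' by apply: dilD.
apply/mnmP => i'; move/mnmP/(_ i'): es'; move/mnmP/(_ i'): es; rewrite !mnmDE; lia.
Qed.

End Torus.

(** * Zeros of unmixed systems *)

Section BKK.
Variables (R : realType) (K : fieldType) (n d : nat) (t0 : bmultinom n d) (N : nat).
Hypothesis ncK : ~ countable [set: K].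
Hypothesis N1 : (1 < N)%N.
Hypothesis n0 : (0 < n)%N.
Variable A : 'I_n -> {fset 'NN^n}.
Hypothesis Ad : forall j a, a \in A j -> (mdeg a < d)%N.
Hypothesis Ane : forall j, exists a, a \in A j.
Local Notation P := {mpol K[n]}.
Local Notation M := 'NN^n.
Local Notation "'X^' m" := (mpolyX K m) (at level 2, m at level 1).
Local Notation dil := (dil R A).
Local Notation base := (base t0 A).
Local Notation tori := (@tori K n).
Local Notation rows := (rows d N A).
Implicit Types (J : {set 'I_n}) (us : seq K).

Lemma dle_count J k : exists2 s : seq M, uniq s /\ (forall m, m \in s <-> dil J k m)
  & dle (supp_in (dil J k) : set P) [set 0] (size s).
Proof.
have [s [us hs]] := dil_enum R Ad J k; exists s => //.
apply: (@dle_mono _ _ _ (supp_in set0)).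
  move=> v v0; apply/mpolyP => m; rewrite mcoeff0; apply/eqP/negP => /negP; exact: v0.
by apply: dle_supp => m Sm _; apply/hs.
Qed.

Lemma dge_count J k (s : seq M) : uniq s -> (forall m, m \in s <-> dil J k m) ->
  dge (supp_in (dil J k) : set P) [set 0] (size s).
Proof.
move=> us hs; apply: (@dge_mono _ _ (supp_in (dil J k)) _ (supp_in set0)) => //.
- exact: subspace_supp.
- by move=> v _ -> m; rewrite mcoeff0 eqxx.
by apply: dge_supp => // m; [move=> /hs|move=> _ []].
Qed.

Lemma rows_V J us f : size us = n -> f \in rows J us ->
  forall k v, supp_in (dil J k) v -> supp_in (dil J k.+1) (f * v).
Proof.
move=> su /(nthP 0) [i il <-] k v; rewrite size_rows// in il; rewrite nth_rows//.
apply: (@spec_V K n (fun k => supp_in (dil J k)) [seq X^b | b <- base J]).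
- by move=> l; apply: subspace_supp.
- move=> l _ w /mapP[b bB ->] Sw; by apply: supp_in_XM Sw _ => m; apply: dil_step bB.
exact: prodc_B_curve.
Qed.

Lemma Ugens_mem (V U : nat -> set P) (fs : seq P) k (w : nat -> P) :
  (forall k, subspace (V k)) -> (forall k, subspace (U k)) -> (forall i, V k (w i)) ->
  Ugens V U fs k.+1 (\sum_(i < size fs) fs`_i * w i).
Proof.
move=> sV sU Vw; suff h u : U k.+1 u -> Ugens V U fs k.+1 (u + \sum_(i < size fs) fs`_i * w i).
  by rewrite -[X in Ugens _ _ _ _ X]add0r; apply: h; apply: sub0.
elim: fs U sU w Vw u => [|f fs IH] U sU w Vw u Uu; first by rewrite big_ord0 addr0.
rewrite big_ord_recl addrA /=.
apply: (IH (Uadd V U f) _ (fun i => w i.+1)) => //; last by exists u, (w 0%N).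
move=> l; split.
  exists 0, 0; split; first exact: sub0.
  by case: l => // l; split; [exact: sub0|rewrite mulr0 addr0].
move=> a x y [x1 [x2 [Ux e]]] [y1 [y2 [Uy e']]].
exists (a *: x1 + y1), (a *: x2 + y2); split; first exact: (sU l).2.
case: l Ux e Uy e' => [|l] Ux; first by move=> -> _ ->.
move=> [Vx ->] Uy [Vy ->]; split; first exact: (sV l).2.
by rewrite mulrDr scalerDr -scalerAr addrACA.
Qed.

Lemma exists_dil J k : exists m, dil J k m.
Proof.
have [b bB] := base_ex t0 Ad Ane J; exists (mnm_muln b k).
elim: k => [|k IH]; first by rewrite mulm0n; apply: dil0.
by rewrite mulmS; apply: dil_step bB IH.
Qed.

Lemma VG_rows_reg J : VG n (fun us => reg tori [set 0] (rows J us)).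
Proof.
have := @VG_reg K n tori [set 0] (nseq n (prodc K d N A J)) (@mulset_tori K n) (ideal0 _).
rewrite size_nseq; apply=> phi; rewrite mem_nseq => /andP[_ /eqP ->].
have /choice[h hA] := Ane.
have [|g gA _] := @choices_ex n d t0 A J h Ad; first by move=> j _; apply: hA.
exists (expoJ N J g); rewrite (coef_prodc K N1 gA); by exists (ms J g).
Qed.

Lemma surj_rows J us : size us = n ->
  (forall b, b \in base J -> reduces R d N A (translates R A J b) J us) ->
  forall b, b \in base J -> exists k1, forall k, (k1 <= k)%N -> forall m, dil J k.+1 m ->
  exists2 w, supp_in (dil J k) w &
    span_multiples (rows J us) (pred_dil R A J) k.+1 (X^m - X^b * w).
Proof.
move=> su red b bB; have [k1 h] := red b bB; exists k1 => k hk m Sm.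
have [u [w [Tu Sw e]]] := h k hk m Sm.
have [v Sv ev] := supp_translates Tu; exists v => //.
exists w; split=> //; rewrite e ev addrAC subrr add0r size_rows//.
Qed.

(** If every direction has lattice neighbours, the stable dimension is squeezed between the two
    Hilbert estimates. Otherwise the points grow with degree n - 1 only: the volume is 0, and some
    monomial lies in the ideal, so there are no zeros in the torus. *)
Lemma bkk_rows J : (0 < #|J|)%N -> VG n (fun us => exists2 del : nat,
  qdim setT (sat tori (gens [set 0] (rows J us))) del
  & del%:R = n`!%:R * fine (Vol (@polytope R n A J))).
Proof.
move=> J0; have [full|/existsNP[i nf]] := pselect (forall i, full_at R A J i); last first.
  have cnt := not_full_growth n0 Ad nf.
  have [v [C [v0 C0 vE _]]] := dil_count R Ad J.
  have z : v = 0.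
    apply: (small_growth_volume n0 Ad vE (C := ((n * d).+1 ^ n.-1)%N)) => k.
    by have [s ss hs] := cnt k; exists s => // m /hs.
  have red : VG n (@reduces R K n d N A (fun _ => set0) J).
    apply: (@VG_reduces R K n d t0 N ncK N1 n0 A Ad _ ((n * d).+1 ^ n.-1)%N J) => //.
      by move=> k x.
    by move=> k; have [s ss hs] := cnt k; exists s; [exact: ss|move=> m /hs].
  apply: VG_mono red => us su [k1 h]; exists 0%N; last by rewrite vE z mulr0.
  have [m Sm] := exists_dil J k1.+1.
  have [u [w [u0 _ e]]] := h k1 (leqnn _) m Sm.
  have {}u0 : u = 0.
    by apply/mpolyP => c; rewrite mcoeff0; apply/eqP/negP => /negP /u0.
  have all r : sat tori (gens [set 0] (rows J us)) r.
    exists X^m; first by exists m.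
    apply: idealMr; first exact/ideal_gens/ideal0.
    apply/gensP; rewrite (size_rows d N A J su); exists (fun l => w l); rewrite e u0 add0r.
    by apply: eq_bigr => l _; rewrite mulrC.
  split; first exact: dge0.
  by exists (fun _ => 0) => // r _; exists (fun _ => 0); apply: all.
have [b0 b0B] := base_ex t0 Ad Ane J.
have := VG_and (VG_translates R t0 ncK N1 n0 Ad J0) (VG_rows_reg J).
apply: VG_mono => us su [red rg].
have sz := size_rows d N A J su.
have sV k : subspace (supp_in (dil J k) : set P) by apply: subspace_supp.
have [||||k2 [del [qd st]]] := @stable_dimension R K n d t0 A Ad Ane J (rows J us)
  (pred_dil R A J) b0 J0 full b0B.
- by move=> i [|k] b m bB; [case|apply: dil_step bB].
- move=> i [|k] m c; rewrite sz => il; [by case|move=> Sm hc].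
  have il' : (i < size (rows J us))%N by rewrite sz.
  have Sm' : supp_in (dil J k) (X^m : P) by apply: supp_inX.
  by apply: (rows_V su (mem_nth 0 il') Sm'); rewrite mulrC addmC mcoeffXM.
- by move=> k c L; apply: (@deep_pred R K n d t0 N ncK N1 n0 A Ad Ane J b0 k c L J0 full b0B).
- exact: surj_rows.
have ss : subspace (sat tori (gens [set 0] (rows J us))).
  by apply/subspace_ideal/ideal_sat; [exact: mulset_tori|apply/ideal_gens/ideal0].
have ss0 : subspace (sat tori ([set 0] : set P)).
  by apply/subspace_ideal/ideal_sat; [exact: mulset_tori|exact: ideal0].
have [v [C [v0 C0 vE cnt]]] := dil_count R Ad J.
have countE k : (0 < k)%N -> exists s : seq M, [/\ uniq s, (forall m, m \in s <-> dil J k m),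
    (size s)%:R <= v * k%:R ^+ n + C * k%:R ^+ n.-1
  & v * k%:R ^+ n - C * k%:R ^+ n.-1 <= (size s)%:R].
  move=> k0; have [s [us' hs]] := cnt k k0; rewrite -mulrA expr_divn// ler_norml => /andP[h1 h2].
  by exists s; split=> //; lra.
have fV f : f \in rows J us -> forall k v, supp_in (dil J k) v -> supp_in (dil J k.+1) (f * v).
  by move=> fr; apply: rows_V su fr.
exists del => //; rewrite vE /=; apply/eqP; rewrite eq_le; apply/andP; split.
  have up := hilbert_upper (k0 := k2.+1) (a := del) sV (@mulset_tori K n) (ideal0 _) rg fV.
  rewrite -[X in X`!](prednK n0).
  apply: (volume_upper (C := C) (c := k2.+1)) => // m; rewrite prednK//.
  have [s [us' hs h1 _]] := countE (k2.+1 + m)%N isT; apply: le_trans h1; rewrite ler_nat.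
  have [s' [us'' hs'] le] := dle_count J (k2.+1 + m).
  have e : size s = size s'.
    apply/eqP; rewrite eq_sym -(uniq_size_uniq us' (s2 := s'))// => x; apply/idP/idP.
      by move=> /hs/hs'.
    by move=> /hs'/hs.
  rewrite e; apply: (steinitz ss0); last by apply: dle_mono le => x ->; apply: sub0.
  rewrite -[in 'C(_, _)]sz; apply: up => k hk.
  have [[ge _] co] := st k (ltnW hk); by apply: (dge_mono (sV k) _ co ge).
have fU f : f \in rows J us -> forall (k : nat) v, [set 0 : P] v -> [set 0] (f * v).
  by move=> _ l x ->; rewrite /= mulr0.
have s00 (l : nat) : subspace ([set 0] : set P) by apply: subspace_set0.
have [s0 _ c0] := dle_count J k2.+1.
have lo := hilbert_lower (U := fun _ => [set 0]) (k0 := k2.+1) (a := del) sV s00 _ fV fU _ c0.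
rewrite -[X in X`!](prednK n0).
apply: (@volume_lower _ _ C _ _ k2.+1 v0 C0 (size s0)) => m; rewrite prednK//.
have [s [us' hs _ h1]] := countE (k2.+1 + m)%N isT; apply: le_trans h1 _; rewrite ler_nat.
apply: (steinitz (s00 0%N) (dge_count us' hs)).
have {}lo := lo _ _ m; rewrite sz in lo.
have -> : 'C(m + n, n.-1) = (if n is p.+1 then 'C(m + n, p) else 0)%N by case: n n0.
apply: lo; first by move=> k x ->; apply: sub0.
move=> [//|k] hk; have [[_ le] _] := st k.+1 (ltnW hk); apply: dle_mono le => x [w [hw ->]].
apply: (@Ugens_mem (fun k => supp_in (dil J k))) => //.
Qed.

End BKK.

(** * Additivity of dimensions in products *)

Section Product.
Variables (K : fieldType) (n : nat).
Local Notation P := {mpol K[n]}.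

Lemma finite_surj (E : lmodType K) (W : set E) d (phi : E -> E) : linear phi ->
  subspace W -> (forall v, W (phi v) -> W v) -> qdim setT W d ->
  forall a, exists v, W (a - phi v).
Proof.
move=> lphi sW inj qd a; have [e [_ ie _]] := qdim_basis sW qd.
have h c : W (comb (phi \o e) c) -> forall i, c i = 0.
  by rewrite -comb_linear// => /inj/ie.
have nge : ~ dge setT W d.+1 by move=> ge; have := steinitz sW ge qd.2; rewrite ltnn.
have [c Wc] := maximal_spanning (V := setT) sW (fun _ => Logic.I) h nge (Logic.I : setT a).
by exists (comb e c); rewrite comb_linear.
Qed.

Lemma qdim0 (W : set P) : ideal W -> W 1 -> qdim setT W 0.
Proof.
move=> [_ _ M] W1; split; first exact: dge0.
exists (fun _ => 0) => // v _; exists (fun _ => 0); rewrite -[X in W X]mulr1; exact: M.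
Qed.

(** Multiplication by [g] embeds the quotient for [h] into the one for [g * h], with cokernel the
    quotient for [g]. That its image is the whole kernel requires dividing by some [q] in [S], which
    acts bijectively on the finite-dimensional quotient for [h]. *)
Lemma qdim_product (S I : set P) (g h : P) a b : mulset S -> ideal I -> nzd S I g ->
  qdim setT (sat S (addI I g)) a -> qdim setT (sat S (addI I h)) b ->
  qdim setT (sat S (addI I (g * h))) (a + b).
Proof.
move=> mS iI ng [ga la] qb; have [gb lb] := qb.
have iW f : ideal (sat S (addI I f)) by apply/ideal_sat => //; apply: ideal_addI.
have sW f : subspace (sat S (addI I f)) by apply: subspace_ideal.
have gV v : sat S (addI I g) (g * v).
  apply: sub_sat => //; first exact: ideal_addI.
  by rewrite mulrC; have [_ _ M] := ideal_addI g iI; apply: (M); apply: addI_mem.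
have gW v : sat S (addI I h) v -> sat S (addI I (g * h)) (g * v).
  move=> [q Sq [j [c [Ij e]]]]; exists q => //; exists (g * j), c; split.
    by case: iI => _ _; apply.
  by rewrite mulrCA e; ring.
have gW' v : sat S (addI I (g * h)) (g * v) -> sat S (addI I h) v.
  move=> [q Sq [j [c [Ij e]]]].
  have [|q' Sq' Iq] := ng (q * v - c * h).
    apply: sub_sat => //; rewrite (_ : g * _ = j) //.
    by rewrite mulrBr mulrCA e; ring.
  exists (q' * q); first by case: mS => _; apply.
  by exists (q' * (q * v - c * h)), (q' * c); split=> //; ring.
have sub : sat S (addI I (g * h)) `<=` sat S (addI I g).
  apply: sat_mono; apply: addI_min; [exact: ideal_addI|exact: sub_addI|].
  by have [_ _ M] := ideal_addI g iI; rewrite mulrC; apply: (M); apply: addI_mem.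
split.
  apply: (dge_trans (sW g) sub) ga _ => //.
  apply: (dge_map (linear_mul g) _ _ _ gb) => [|v _|v _]; [by []|exact: gV|exact: gW'].
apply: dle_trans la _ => //.
apply: (dle_map (linear_mul g) (sW _) _ gW _ lb) => [v _|]; first exact: gV.
move=> x [q Sq [j [c [Ij e]]]].
have [|v Wv] := @finite_surj _ _ b (fun v => q * v) (linear_mul q) (sW h) _ qb c.
  by move=> v; apply: sat_unit => //; apply: ideal_addI.
exists v => //; apply: (@sat_unit _ _ _ q) => //; first exact: ideal_addI.
rewrite mulrBr e (_ : _ - _ = j + g * (c - q * v)); last by ring.
have [_ D _] := iW (g * h); apply: D; last exact: gW.
by apply: sub_sat; [|exact: ideal_addI|exact: sub_addI].
Qed.

Lemma reg_cat (S J : set P) a b : reg S J (a ++ b) -> reg S J a /\ reg S (gens J a) b.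
Proof. by elim: a J => //= f a IH J [nf /IH[ra rb]]. Qed.

Lemma gens_middle (J : set P) a f b :
  gens J (a ++ f :: b) = addI (gens (gens J a) b) f.
Proof. by rewrite gens_cat /= gens_addI. Qed.

Lemma spec_in (W : set P) u (phi : {poly P}) : subspace W -> (forall t, W phi`_t) ->
  W (spec u phi).
Proof.
move=> sW h; rewrite /spec horner_coef; apply: sub_sum => // i _.
by rewrite -rmorphXn /= mulrC mul_mpolyC; apply: subZ.
Qed.

End Product.

(** * Expansion over systems of factors *)

Section Family.
Variables (K : fieldType) (n d : nat) (t0 : bmultinom n d) (N : nat).
Hypothesis N1 : (1 < N)%N.
Variable A : 'I_n -> {fset 'NN^n}.
Hypothesis Ad : forall j a, a \in A j -> (mdeg a < d)%N.
Hypothesis Ane : forall j, exists a, a \in A j.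
Local Notation P := {mpol K[n]}.
Local Notation tori := (@tori K n).
Local Notation rows := (rows d N A).
Local Notation mixed := (mixed d N A).
Implicit Types (J : {set 'I_n}) (us : seq K) (Js : {ffun 'I_n -> {set 'I_n}})
  (s : {ffun 'I_n -> 'I_n}).

Definition famrows Js us : seq P :=
  specs us [seq prodc K d N A (Js i) | i <- enum 'I_n].

Lemma famrows_rows J us : rows J us = famrows [ffun=> J] us.
Proof.
rewrite /rows /famrows; congr specs; move: (size_enum_ord n); move: (prodc _ _ _ _) => F.
suff h (l : seq 'I_n) : nseq (size l) (F J) = [seq F ([ffun=> J] i : {set 'I_n}) | i <- l].
  by move=> e; have := h (enum 'I_n); rewrite e.
by elim: l => //= i l ->; rewrite ffunE.
Qed.

Lemma famrows_mixed s us : mixed s us = famrows [ffun i => [set s i]%SET] us.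
Proof.
rewrite /mixed /famrows; congr specs; apply: eq_map => i.
by rewrite ffunE /prodc big_set1.
Qed.

Lemma famrowsE Js us : size us = n ->
  famrows Js us = [seq spec us`_i (prodc K d N A (Js i)) | i : 'I_n <- enum 'I_n].
Proof.
move=> su; have sE : size [seq prodc K d N A (Js i) | i <- enum 'I_n] = n.
  by rewrite size_map size_enum_ord.
have s1 : size (famrows Js us) = n by rewrite /famrows size_specs sE.
have s2 : size [seq spec us`_i (prodc K d N A (Js i)) | i : 'I_n <- enum 'I_n] = n.
  by rewrite size_map size_enum_ord.
apply: (@eq_from_nth _ 0); rewrite s1 ?s2// => i il; rewrite /famrows.
pose oi := Ordinal il; have e : nth oi (enum 'I_n) i = oi := nth_ord_enum oi oi.
rewrite nth_specs ?sE// (nth_map oi) ?size_enum_ord//.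
rewrite (nth_map oi) ?size_enum_ord//.
rewrite -enumT e [RHS](nth_map oi) ?size_enum_ord//.
  by rewrite -?enumT e.
by rewrite -enumT size_enum_ord.
Qed.

Lemma VG_fam_reg : VG n (fun us => forall Js, reg tori [set 0] (famrows Js us)).
Proof.
apply: VG_forall => Js.
have := @VG_reg K n tori [set 0] [seq prodc K d N A (Js i) | i <- enum 'I_n]
  (@mulset_tori K n) (ideal0 _).
rewrite size_map size_enum_ord; apply=> phi /mapP[i _ ->].
have /choice[h hA] := Ane.
have [|g gA _] := @choices_ex n d t0 A (Js i) h Ad; first by move=> j _; apply: hA.
by exists (expoJ N (Js i) g); rewrite (coef_prodc K N1 gA); exists (ms (Js i) g).
Qed.

Definition upd Js i J : {ffun 'I_n -> {set 'I_n}} :=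
  [ffun l => if l == i then J else Js l].

Lemma fam_split us (i : 'I_n) : size us = n -> exists a b : {ffun 'I_n -> {set 'I_n}} -> seq P,
  (forall Js, famrows Js us = a Js ++ spec us`_i (prodc K d N A (Js i)) :: b Js) /\
  forall Js J, a (upd Js i J) = a Js /\ b (upd Js i J) = b Js.
Proof.
move=> su; have : i \in enum 'I_n by rewrite mem_enum.
have := enum_uniq 'I_n; move=> + iE; case/splitPr ab: _ / iE => [p1 p2].
rewrite cat_uniq /= => /and3P[_ /norP[ip1 _] /andP[ip2 _]].
pose F Js (l : 'I_n) := spec us`_l (prodc K d N A (Js l)).
exists (fun Js => map (F Js) p1), (fun Js => map (F Js) p2); split.
  by move=> Js; rewrite famrowsE// ab map_cat.
move=> Js J; split; apply/eq_in_map => l lp; rewrite /F ffunE;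
  case: eqVneq => // e; by rewrite e ?(negPf ip1) ?(negPf ip2) in lp.
Qed.

(** Induction on the total size of the sets: from a set with two or more elements one factor is
    split off by [qdim_product]. An empty set gives the member 1 and an empty sum; singletons give
    the systems [mixed s]. *)
Lemma fam_dim us (delta : {ffun 'I_n -> 'I_n} -> nat) : size us = n ->
  (forall Js, reg tori [set 0] (famrows Js us)) ->
  (forall s, qdim setT (sat tori (gens [set 0] (mixed s us))) (delta s)) ->
  forall Js, qdim setT (sat tori (gens [set 0] (famrows Js us)))
    (\sum_(s : {ffun 'I_n -> 'I_n} | [forall i, s i \in Js i]) delta s).
Proof.
move=> su rg hs Js; have mT := @mulset_tori K n.
have [m] := ubnP (\sum_i #|Js i|)%N; elim: m => // m IH in Js *; rewrite ltnS => hm.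
have [/existsP[i /eqP e]|ne] := boolP [exists i, Js i == finset.set0].
  rewrite big_pred0; last by move=> s; apply/negP => /forallP/(_ i); rewrite e inE.
  apply: qdim0; first by apply/ideal_sat/ideal_gens/ideal0.
  apply: sub_sat => //; first exact/ideal_gens/ideal0.
  apply: gens_mem; first exact: ideal0.
  rewrite famrowsE//; apply/mapP; exists i; first by rewrite mem_enum.
  by rewrite e /prodc big_set0 /spec hornerC.
have [/existsP[i c1]|le1] := boolP [exists i, (1 < #|Js i|)%N]; last first.
  have /fin_all_exists[f fE] i : exists j, Js i = [set j]%SET.
    apply/cards1P; rewrite eqn_leq leqNgt card_gt0.
    rewrite negb_exists in le1; rewrite negb_exists in ne.
    by rewrite (forallP le1 i) (forallP ne i).
  pose s : {ffun 'I_n -> 'I_n} := finfun f.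
  have -> : Js = [ffun i => [set s i]%SET] by apply/ffunP => i; rewrite !ffunE.
  rewrite (big_pred1 s); first by rewrite -famrows_mixed.
  move=> s'; apply/forallP/eqP => [h|-> i]; last by rewrite !ffunE finset.set11.
  by apply/ffunP => i; have := h i; rewrite !ffunE finset.in_set1 => /eqP.
have [j jJ] : exists j, j \in Js i by apply/set0Pn; rewrite -card_gt0 ltnW.
have [a [b [fE hu]]] := fam_split i su.
pose Js1 := upd Js i [set j]%SET; pose Js2 := upd Js i (Js i :\ j).
have smaller J : (#|J| < #|Js i|)%N -> (\sum_l #|upd Js i J l| < m)%N.
  move=> lt; apply: leq_trans hm; rewrite [X in (_ < X)%N](bigD1 i)//= (bigD1 i)//=.
  rewrite ffunE eqxx -addSn leq_add// leq_eqVlt; apply/orP; left; apply/eqP.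
  by apply: eq_bigr => l /negPf li; rewrite ffunE li.
have q1 := IH Js1 (smaller _ _); rewrite cards1 in q1; have {}q1 := q1 c1.
have q2 := IH Js2 (smaller _ _); rewrite [X in (_ < X)%N -> _](cardsD1 j (Js i)) jJ in q2.
have {}q2 := q2 (leqnn _).
move: q1 q2; rewrite !fE !gens_middle !(hu _ _).1 !(hu _ _).2 /Js1 /Js2 !ffunE eqxx => q1 q2.
have iI : ideal (gens (gens [set 0] (a Js)) (b Js)) by apply/ideal_gens/ideal_gens/ideal0.
have ng : nzd tori (gens (gens [set 0] (a Js)) (b Js)) (spec us`_i (prodc K d N A [set j]%SET)).
  have := rg Js1; rewrite fE (hu _ _).1 (hu _ _).2 ffunE eqxx => /reg_cat[_ /= [ng rb]].
  by apply: nzd_gens => //; apply/ideal_gens/ideal0.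
have -> : spec us`_i (prodc K d N A (Js i)) =
    spec us`_i (prodc K d N A [set j]%SET) * spec us`_i (prodc K d N A (Js i :\ j)).
  by rewrite !spec_prodc big_set1 (big_setD1 j).
have := qdim_product mT iI ng q1 q2; congr (qdim _ _ _).
rewrite [RHS](bigID (fun s : {ffun _} => s i == j)) /=; congr (_ + _)%N; apply: eq_bigl => s.
  apply/forallP/andP => [h|[/forallP h /eqP e] l].
    have si := h i; rewrite ffunE eqxx inE in si; split=> //; apply/forallP => l.
    by have := h l; rewrite ffunE; case: eqP => // ->; rewrite (eqP si).
  by rewrite ffunE; case: eqP => // ->; rewrite e inE.
apply/forallP/andP => [h|[/forallP h e] l].
  have si := h i; rewrite ffunE eqxx !inE in si; have /andP[sj sJ] := si.
  split=> //; apply/forallP => l.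
  by have := h l; rewrite ffunE; case: eqP => // ->.
by rewrite ffunE; case: eqP => // ->; rewrite !inE e h.
Qed.

(** If [B] misses some x, adding or removing x pairs the sets into terms of opposite sign. *)
Lemma alternating_sum (R : pzRingType) (B : {set 'I_n}) :
  \sum_(J : {set 'I_n} | B \subset J) (-1) ^+ (n - #|J|) = (B == [set: 'I_n]%SET)%:R :> R.
Proof.
have [->|] := eqVneq B [set: 'I_n]%SET.
  rewrite (big_pred1 [set: 'I_n]%SET); first by rewrite cardsT card_ord subnn.
  by move=> J; rewrite finset.subTset.
rewrite -finset.properT => /properP[_ [x _ xB]].
rewrite (bigID (fun J : {set 'I_n} => x \in J)) /=.
rewrite (reindex_onto (fun J : {set 'I_n} => x |: J) (fun J => J :\ x)) /=; last first.
  by move=> J /andP[_ xJ]; rewrite finset.setD1K.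
rewrite (eq_bigl (fun J : {set 'I_n} => (B \subset J) && (x \notin J))); last first.
  move=> J; rewrite finset.setU11 andbT; have [xJ|xJ] := boolP (x \in J).
    rewrite andbF; apply/negP => /andP[_ /eqP e]; by rewrite -e !inE eqxx in xJ.
  rewrite finset.setU1K// eqxx !andbT; apply/idP/idP; last first.
    by move=> h; apply: fintype.subset_trans h (finset.subsetUr _ _).
  move=> /fintype.subsetP h; apply/fintype.subsetP => y yB; have := h y yB.
  rewrite !inE => /orP[/eqP e|//]; by rewrite -e yB in xB.
rewrite -big_split big1 //= => J /andP[_ xJ].
have lt : (#|J| < n)%N.
  rewrite -[X in (_ < X)%N]card_ord -cardsT; apply: proper_card.
  by rewrite finset.properT; apply: contraNneq xJ => ->; rewrite inE.
rewrite cardsU1 xJ /= (_ : n - #|J| = (n - (1 + #|J|)).+1)%N; last by lia.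
by rewrite exprS mulN1r subrr.
Qed.

(** After exchanging the sums, the signs keep exactly the maps whose image is everything, that is,
    the permutations. *)
Lemma MV_sum (R : realType) (delta : {ffun 'I_n -> 'I_n} -> nat) : (0 < n)%N ->
  (forall J, (0 < #|J|)%N ->
    (\sum_(s : {ffun 'I_n -> 'I_n} | [forall i, s i \in J]) delta s)%:R =
    n`!%:R * fine (Vol (@polytope R n A J))) ->
  n`!%:R * MV R A = (\sum_(s : {ffun 'I_n -> 'I_n} | injectiveb s) delta s)%:R.
Proof.
move=> n0 h; rewrite /MV mulr_sumr.
transitivity (\sum_(J : {set 'I_n} | (0 < #|J|)%N) \sum_(s : {ffun 'I_n -> 'I_n})
    (if [forall i, s i \in J] then (-1) ^+ (n - #|J|) else 0) * (delta s)%:R : R).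
  apply: eq_bigr => J J0; rewrite mulrCA -h// natr_sum mulr_sumr [LHS]big_mkcond /=.
  by apply: eq_bigr => s _; case: ifP => _; rewrite ?mul0r.
rewrite exchange_big natr_sum [RHS]big_mkcond /=; apply: eq_bigr => s _.
rewrite -mulr_suml -big_mkcondr /=.
rewrite (eq_bigl (fun J : {set 'I_n} => s @: [set: 'I_n]%SET \subset J)); last first.
  move=> J; apply/andP/fintype.subsetP => [[_ /forallP hJ] _ /imsetP[i _ ->]//|hJ].
  have hs : forall i, s i \in J by move=> i; apply: hJ; apply: imset_f; rewrite inE.
  split; last exact/forallP.
  by rewrite card_gt0; apply/set0Pn; exists (s (Ordinal n0)).
rewrite alternating_sum.
have -> : (s @: [set: 'I_n]%SET == [set: 'I_n]%SET) = injectiveb s.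
  apply/eqP/injectiveP => [e|inj].
    have /imset_injP si : #|s @: [set: 'I_n]%SET| == #|[set: 'I_n]%SET| by rewrite e.
    by move=> x y; apply: si; rewrite inE.
  by apply/eqP; rewrite eqEcard finset.subsetT card_imset//=.
by case: ifP => _; rewrite ?mul1r ?mul0r.
Qed.

End Family.

(** * Stable dimension of mixed systems *)

Section Colon.
Variables (R : realType) (n : nat) (A : 'I_n -> {fset 'NN^n}).
Local Notation M := 'NN^n.
Implicit Types (s : {ffun 'I_n -> 'I_n}).

Definition mixed_supp s (i : nat) : seq M :=
  oapp (fun o : 'I_n => enum_fset (A (s o))) [::] (insub i).

Lemma mixed_suppE s (i : 'I_n) : mixed_supp s i = enum_fset (A (s i)).
Proof. by rewrite /mixed_supp valK. Qed.

Definition colon s := colon_dil R A [set: 'I_n]%SET (mixed_supp s).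

End Colon.

Section StableMixed.
Variables (R : realType) (K : fieldType) (n d : nat) (t0 : bmultinom n d) (N : nat).
Hypothesis ncK : ~ countable [set: K].
Hypothesis N1 : (1 < N)%N.
Hypothesis n0 : (0 < n)%N.
Variable A : 'I_n -> {fset 'NN^n}.
Hypothesis Ad : forall j a, a \in A j -> (mdeg a < d)%N.
Hypothesis Ane : forall j, exists a, a \in A j.
Local Notation P := {mpol K[n]}.
Local Notation "'X^' m" := (mpolyX K m) (at level 2, m at level 1).
Local Notation V k := (supp_in (dil R A [set: 'I_n]%SET k) : set P).
Local Notation tori := (@tori K n).
Local Notation colon_of := (colon R).
Local Notation colon := (colon R A).
Local Notation mixed_supp := (mixed_supp A).
Local Notation rows := (rows d N A [set: 'I_n]%SET).
Local Notation mixed := (mixed d N A).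
Implicit Types (us : seq K) (s : {ffun 'I_n -> 'I_n}).

Definition rest s us (i : 'I_n) : P := spec us`_i (prodc K d N A ([set: 'I_n]%SET :\ s i)).

Lemma rows_rest s us (i : 'I_n) : size us = n ->
  (rows us)`_i = (mixed s us)`_i * rest s us i.
Proof.
move=> su; rewrite nth_rows// nth_mixed// /rest !spec_prodc.
by rewrite (big_setD1 (s i)) ?inE.
Qed.

Section Larger.
Variable B : 'I_n -> {fset 'NN^n}.
Hypothesis AB : forall j a, a \in A j -> a \in B j.

Lemma supp_rest s us (i : 'I_n) :
  supp_in [set m | forall c, c \in B (s i) -> dil R B [set: 'I_n]%SET 1 (c +m m)] (rest s us i).
Proof.
apply: spec_in => [|t]; first exact: subspace_supp.
have [h _] := prodc_B_curve K t0 N1 A ([set: 'I_n]%SET :\ s i).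
have [->|/mapP[b /baseP[g gA ->] ->]] := h t; first exact: sub0 (subspace_supp _ _).
apply: supp_inX => c cA.
have -> : c +m ms ([set: 'I_n]%SET :\ s i) g =
    msum [set: 'I_n]%SET (fun l => if l == s i then c else bmnm (g l)).
  rewrite /ms /msum [RHS](bigD1 (s i)) ?inE//= eqxx; congr (_ +m _).
  apply: eq_big => [l|l]; first by rewrite !inE andbT.
  by rewrite !inE => /andP[/negPf ->].
apply: dil_msum => l _; case: eqVneq => [->//|ne].
by apply: AB; apply: choicesP gA _ _; rewrite !inE ne.
Qed.

(** A row is a member of the mixed system times its remaining factors, so a reduction by rows is one
    by the mixed system. The multipliers are measured in a larger family [B], since the perturbed
    system will be filtered by the polytopes with 0 added. *)
Lemma rows_mixed s us k (w : nat -> P) : size us = n ->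
  (forall i, supp_in (dil R B [set: 'I_n]%SET k) (w i)) ->
  span_multiples (mixed s us) (colon_of B s) k.+1 (\sum_(i < n) (rows us)`_i * w i).
Proof.
move=> su Vw; exists (fun i => if insub i is Some o then rest s us o * w i else 0); split.
  move=> i; case: insubP => [j _ oi|_]; last exact: sub0 (subspace_supp _ _).
  apply: supp_in_M (@supp_rest s us j) (Vw i) _ => a b ha Sb c.
  rewrite -oi mixed_suppE => cA; rewrite addmA -add1n; apply: dilD => //; exact: ha.
rewrite size_mixed//; apply: eq_bigr => i _; rewrite valK (rows_rest s)//.
by rewrite -mulrA.
Qed.

End Larger.

(** The reduction comes from the rows over the full index set, and one choice of parameters serves
    all [s] at once. *)
Lemma stable_mixed : VG n (fun us => forall s, exists k2 delta,
  qdim setT (sat tori (gens [set 0] (mixed s us))) delta /\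
  forall k, (k2 <= k)%N -> qdim (V k) (span_multiples (mixed s us) (colon s) k) delta /\
    forall v, V k v -> sat tori (gens [set 0] (mixed s us)) v ->
      span_multiples (mixed s us) (colon s) k v).
Proof.
have cT : (0 < #|[set: 'I_n]%SET|)%N by rewrite cardsT card_ord.
have [full|/existsNP[i nf]] := pselect (forall i, full_at R A [set: 'I_n]%SET i); last first.
  have cnt := not_full_growth n0 Ad nf.
  have red : VG n (@reduces R K n d N A (fun _ => set0) [set: 'I_n]%SET).
    apply: (@VG_reduces R K n d t0 N ncK N1 n0 A Ad _ ((n * d).+1 ^ n.-1)%N) => //.
      by move=> k x.
    by move=> k; have [l ss hs] := cnt k; exists l; [exact: ss|move=> m /hs].
  apply: VG_mono red => us su [k1 h] s.
  have VN k : (k1 < k)%N -> V k `<=` span_multiples (mixed s us) (colon s) k.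
    case: k => // k hk; apply: supp_in_min; first exact: subspace_span_multiples.
    move=> m Sm; have [u [w [u0 Vw ->]]] := h k hk m Sm.
    have -> : u = 0.
      by apply/mpolyP => c; rewrite mcoeff0; apply/eqP/negP => /negP /u0.
    by rewrite add0r; apply: rows_mixed.
  have [m Sm] := exists_dil R t0 Ad Ane [set: 'I_n]%SET k1.+1.
  have all r : sat tori (gens [set 0] (mixed s us)) r.
    exists X^m; first by exists m.
    apply: idealMr; first exact/ideal_gens/ideal0.
    by apply: span_multiples_gens; apply: (VN k1.+1 (leqnn _)); apply: supp_inX.
  exists k1.+1, 0%N; split.
    split; first exact: dge0.
    by exists (fun _ => 0) => // r _; exists (fun _ => 0); apply: all.
  move=> k hk; split; last by move=> v Vv _; apply: VN.
  split; first exact: dge0.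
  exists (fun _ => 0) => [[]//|v Vv]; exists (fun _ => 0); rewrite /comb big_ord0 subr0.
  exact: VN.
have [b0 b0B] := base_ex t0 Ad Ane [set: 'I_n]%SET.
apply: VG_mono (VG_translates R t0 ncK N1 n0 Ad cT) => us su red s.
apply: (@stable_dimension R K n d t0 A Ad Ane [set: 'I_n]%SET (mixed s us) (colon s) b0) => //.
- move=> i k b m bB hm c cA; rewrite (_ : c +m _ = b +m (c +m m)).
    by apply: dil_step bB _; apply: hm.
  by apply/mnmP => l; rewrite !mnmDE; lia.
- move=> i k m c; rewrite size_mixed// => il hm hc; apply: hm.
  rewrite (mixed_suppE A s (Ordinal il)); move: hc.
  by rewrite (nth_mixed d N A s (Ordinal il) su) => /supp_spec_curve.
- move=> k c L.
  apply: (@deep_colon R K n d t0 N ncK N1 n0 A Ad Ane [set: 'I_n]%SET (mixed_supp s)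
    (flatten [seq enum_fset (A j) | j <- enum 'I_n]) b0 k c L) => // i x.
  rewrite /mixed_supp; case: insubP => //= o _ _ xA; apply/flatten_mapP.
  by exists (s o); rewrite ?mem_enum.
move=> b bB; have [k1 h] := red b bB; exists k1 => k hk m Sm.
have [u [w [Tu Sw e]]] := h k hk m Sm.
have [v Sv ev] := supp_translates Tu; exists v => //.
rewrite e ev addrAC subrr add0r; exact: rows_mixed.
Qed.

End StableMixed.

(** * Semicontinuity along families *)

Section Semicontinuity.
Variables (K : fieldType) (n : nat).
Local Notation P := {mpol K[n]}.
Local Notation M := 'NN^n.

Lemma liftc_neq0 (c : {poly K}) : c != 0 -> liftc n c != 0.
Proof. by move=> c0; rewrite map_poly_eq0_id0// mpolyC_eq0 lead_coef_eq0. Qed.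

(** At [t1] the coefficients of a polynomial relation all vanish, hence are divisible by t - t1.
    Dividing repeatedly shows that the relation is trivial. *)
Lemma spec_independent r t1 (G : 'I_r -> {poly P}) :
  (forall c, comb (fun i => spec t1 (G i)) c = 0 -> forall i, c i = 0) ->
  cocountable (fun t => forall c, comb (fun i => spec t (G i)) c = 0 -> forall i, c i = 0).
Proof.
move=> ind; case: (poly_family G (fun _ : 'I_0 => 0)); last first.
  move=> [D D0 hD]; apply: cocountable_mono (cocountable_root D0) => t Dt c e.
  by apply: (hD t Dt c (fun _ => 0)); rewrite e /comb big_ord0 addr0.
move=> [c [[i ci] [h]]]; rewrite big_ord0 addr0 => e; exfalso; move/eqP: ci; apply.
have key m (x : 'I_r -> {poly K}) : (forall i, (size (x i) <= m)%N) ->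
    \sum_i liftc n (x i) * G i = 0 -> forall i, x i = 0.
  elim: m x => [|m IH] x sx.
    by move=> _ j; apply/eqP; rewrite -size_poly_eq0 -leqn0.
  move=> ex; have x1 : forall j, (x j).[t1] = 0.
    apply: ind; have := congr1 (spec t1) ex; rewrite /spec horner_sum horner0 => <-.
    apply: eq_bigr => j _; rewrite hornerM /liftc horner_map -mul_mpolyC.
    by [].
  have /choice[y yE] j : exists y, x j = y * ('X - t1%:P).
    by apply/factor_theorem/rootP.
  suff y0 : forall j, y j = 0 by move=> j; rewrite yE y0 mul0r.
  apply: IH => [j|].
    have [->|y0] := eqVneq (y j) 0; first by rewrite size_poly0.
    have := sx j; rewrite yE size_Mmonic ?monicXsubC// size_XsubC addn2 /= ltnS.
    by [].
  have := ex; under eq_bigr do rewrite yE /liftc rmorphM /= mulrAC.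
  rewrite -mulr_suml => /eqP; rewrite mulf_eq0 => /orP[/eqP //|].
  by rewrite -[map_poly _ _]/(liftc n ('X - t1%:P)) (negPf (liftc_neq0 _))// polyXsubC_eq0.
exact: (key (\max_i size (c i)) c (fun j => leq_bigmax j)).
Qed.

(* The dimension of W modulo a family of subspaces spanned by polynomial curves can
   only drop at the generic parameter. *)
Lemma dle_generic (W : set P) (w b : nat) (t1 : K) (G : set {poly P}) (N1 : set P) :
  subspace W -> qdim W [set 0] w -> dle W N1 b -> subspace N1 -> N1 `<=` W ->
  (forall v, N1 v -> exists2 g, G g & v = spec t1 g) ->
  cocountable (fun t => forall N d, (forall g, G g -> N (spec t g)) ->
    subspace N -> N `<=` W -> dge W N d -> (d <= b)%N).
Proof.
move=> sW [gw lw] lb sN1 N1W hG; have s0 := @subspace_set0 K n.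
have [r _ [[y Ny iy] lr]] := dim_exists s0 (dle_sub s0 sN1 N1W lw).
have wr : (w <= b + r)%N.
  exact: steinitz s0 gw (dle_trans N1W lb lr).
have /choice[g gE] i : exists g, G g /\ y i = spec t1 g.
  by have [g Gg e] := hG _ (Ny i); exists g.
have : cocountable (fun t => forall c, comb (fun i => spec t (g i)) c = 0 -> forall i, c i = 0).
  apply: (@spec_independent r t1) => c e; apply: iy.
  suff -> : comb y c = 0 by [].
  by rewrite -[RHS]e; apply: eq_bigr => i _; rewrite (gE i).2.
apply: cocountable_mono => t it N d hN sN NW gd.
have gr : dge N [set 0] r.
  by exists (fun i => spec t (g i)) => [i|]; [apply: hN; have [] := gE i|exact: it].
have N0 : [set 0] `<=` N by move=> x ->; apply: sub0.
have := steinitz s0 (dge_trans sN N0 NW gd gr) lw.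
by move=> h; rewrite -(leq_add2r r); apply: leq_trans h wr.
Qed.

(* Deformation from t = 0 and degeneration to t = 1 of the same family. *)
Lemma compare_dimensions (S S' : set P) (phis : seq {poly P}) (V : set M)
    (T : nat -> set M) d b (e : 'I_d -> P) : ~ countable [set: K] ->
  mulset S -> mulset S' ->
  nzd (constS S) (gens [set 0] phis) 'X -> nzd (constS S') (gens [set 0] phis) 'X ->
  (exists w, qdim (supp_in V : set P) [set 0] w) ->
  (forall i, supp_in V (e i)) ->
  (forall c, sat S (gens [set 0] (at0 phis)) (comb e c) ->
     sat S' (gens [set 0] (at0 phis)) (comb e c) -> forall i, c i = 0) ->
  (forall i t v, (i < size phis)%N -> supp_in (T i) v -> supp_in V (spec t phis`_i * v)) ->
  dle (supp_in V : set P) [set r | exists w : nat -> P, (forall i, supp_in (T i) (w i)) /\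
    r = \sum_(i < size phis) spec 1 phis`_i * w i] b ->
  (d <= b)%N.
Proof.
move=> ncK mS mS' nX nX' [w qw] Ve ie TV lb.
pose Nt t : set P := [set r | exists w : nat -> P, (forall i, supp_in (T i) (w i)) /\
  r = \sum_(i < size phis) spec t phis`_i * w i].
have sN t : subspace (Nt t).
  split.
    exists (fun _ => 0); split; first by move=> i; apply: sub0; apply: subspace_supp.
    by rewrite big1// => i _; rewrite mulr0.
  move=> a x y [u [hu ->]] [u' [hu' ->]]; exists (fun i => a *: u i + u' i); split.
    by move=> i; apply: (subspace_supp _ _).2.
  by rewrite scaler_sumr -big_split; apply: eq_bigr => i _; rewrite mulrDr scalerAr.
have NV t : Nt t `<=` supp_in V.
  move=> _ [u [hu ->]]; apply: sub_sum => [|i _]; first exact: subspace_supp.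
  exact: TV.
pose G : set {poly P} := [set g | exists w : nat -> P, (forall i, supp_in (T i) (w i)) /\
  g = \sum_(i < size phis) phis`_i * (w i)%:P].
have specG t (u : nat -> P) : spec t (\sum_(i < size phis) phis`_i * (u i)%:P) =
    \sum_(i < size phis) spec t phis`_i * u i.
  rewrite /spec horner_sum; apply: eq_bigr => i _.
  by rewrite hornerM hornerC.
have h1 := deformation mS mS' nX nX' ie.
have hG v : Nt 1 v -> exists2 g, G g & v = spec 1 g.
  by move=> [u [hu ->]]; exists (\sum_(i < size phis) phis`_i * (u i)%:P); [exists u|].
have h2 := @dle_generic _ w b 1 G (Nt 1) (subspace_supp _ _) qw lb (sN 1) (NV 1) hG.
have [t [ht1 ht2]] := cocountable_ex ncK (cocountable_and h1 h2).
apply: (ht2 (Nt t)) => //.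
  by move=> _ [u [hu ->]]; exists u; split.
exists e => // c [u [hu ec]]; apply: ht1; rewrite ec; apply/gensP.
rewrite size_map; exists (fun i => u i); apply: eq_bigr => i _.
by rewrite mulrC (nth_map 0).
Qed.

Definition segment (f g : 'I_n -> P) : seq {poly P} :=
  [seq (f i)%:P + 'X * (g i - f i)%:P | i <- enum 'I_n].

Lemma size_segment f g : size (segment f g) = n.
Proof. by rewrite size_map size_enum_ord. Qed.

Lemma at0_segment f g : at0 (segment f g) = [seq f i | i <- enum 'I_n].
Proof.
rewrite /at0 /segment -map_comp; apply: eq_map => i /=.
by rewrite hornerD hornerC hornerM hornerX mul0r addr0.
Qed.

Lemma spec_segment f g t (i : 'I_n) : spec t (segment f g)`_i = f i + t *: (g i - f i).
Proof.
have il : (i < size (enum 'I_n))%N by rewrite size_enum_ord.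
rewrite /segment (nth_map i 0 _ il) nth_ord_enum /spec.
by rewrite hornerD hornerC hornerM hornerX hornerC mul_mpolyC.
Qed.

End Semicontinuity.

(** * Bernstein's theorem *)

Section Bernstein.
Variables (R : realType) (K : fieldType) (n d : nat) (t0 : bmultinom n d) (N : nat).
Hypothesis ncK : ~ countable [set: K].
Hypothesis N1 : (1 < N)%N.
Hypothesis n0 : (0 < n)%N.
Variable A : 'I_n -> {fset 'NN^n}.
Hypothesis Ad : forall j a, a \in A j -> (mdeg a < d)%N.
Hypothesis Ane : forall j, exists a, a \in A j.
Local Notation P := {mpol K[n]}.
Local Notation V k := (supp_in (dil R A [set: 'I_n]%SET k) : set P).
Local Notation tori := (@tori K n).
Local Notation mixed := (mixed d N A).
Local Notation colon := (colon R A).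
Implicit Types (us : seq K) (s : {ffun 'I_n -> 'I_n}).

Definition stable us s delta :=
  qdim setT (sat tori (gens [set 0] (mixed s us))) delta /\
  exists k2, forall k, (k2 <= k)%N ->
    qdim (V k) (span_multiples (mixed s us) (colon s) k) delta /\
    forall v, V k v -> sat tori (gens [set 0] (mixed s us)) v ->
      span_multiples (mixed s us) (colon s) k v.

Lemma qdim_dil k : exists w, qdim (V k) [set 0] w.
Proof.
have [l _ le] := dle_count R K Ad [set: 'I_n]%SET k.
have [w _ qw] := dim_exists (@subspace_set0 K n) le.
by exists w.
Qed.

Lemma supp_curve_mul j u i k s v : s i = j -> supp_in (colon s i k) v ->
  V k (spec u (curve K d N A j) * v).
Proof.
move=> sij hv; apply: supp_in_M hv _; first by move=> m hm; apply: supp_spec_curve hm.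
by move=> a b aA hb; apply: hb; rewrite mixed_suppE sij.
Qed.

Lemma mixedE us s : size us = n ->
  mixed s us = [seq spec us`_i (curve K d N A (s i)) | i : 'I_n <- enum 'I_n].
Proof.
move=> su; rewrite famrows_mixed famrowsE//; apply: eq_map => i.
by rewrite ffunE /prodc big_set1.
Qed.

(** Both systems contain the same supports, with permuted parameters. On the segment between them
    regularity at one end and the stable description at the other give an inequality; exchanging the
    ends gives equality. *)
Lemma mixed_le us s s' ds ds' : size us = n -> injective s -> injective s' ->
  reg tori [set 0] (mixed s us) -> stable us s ds -> stable us s' ds' -> (ds <= ds')%N.
Proof.
move=> su injs injs' rg [_ [k2 st]] [_ [k2' st']].
pose k := maxn k2 k2'; have [[ge _] co] := st k (leq_maxl _ _).
have [[_ le'] _] := st' k (leq_maxr _ _).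
have sV : subspace (V k) by apply: subspace_supp.
have {ge} [e Ve ie] := dge_mono sV (fun _ h => h) co ge.
pose p i := invF injs' (s i).
have pE i : s' (p i) = s i by apply: f_invF.
have pinj : injective p by move=> i j e'; apply: injs; rewrite -!pE e'.
pose f (i : 'I_n) := spec us`_i (curve K d N A (s i)).
pose g (i : 'I_n) := spec us`_(p i) (curve K d N A (s i)).
pose phis := segment f g.
have at0E : at0 phis = mixed s us by rewrite /phis at0_segment mixedE.
have szp : size phis = n := size_segment f g.
have specE t (i : 'I_n) : spec t phis`_i = f i + t *: (g i - f i) := spec_segment f g t i.
have mT := @mulset_tori K n.
have nX : nzd (constS tori) (gens [set 0] phis) 'X.
  by apply: nzd_deformation => //; rewrite at0E.
apply: (compare_dimensions (T := fun i => colon s i k) ncK mT mT nX nX (qdim_dil k) Ve).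
- by move=> c; rewrite at0E => h _; apply: ie.
- move=> i t v; rewrite szp => il hv; pose j := Ordinal il.
  rewrite (specE t j) mulrDl -scalerAl mulrBl.
  have fV u : V k (spec u (curve K d N A (s j)) * v).
    exact: (@supp_curve_mul (s j) u j k s v (erefl _) hv).
  by apply: (subD sV); [exact: fV|apply: (subZ sV); apply: (subB sV); exact: fV].
apply: dle_mono le' => x [w [hw ->]]; rewrite size_mixed// szp.
exists (fun i => if insub i is Some j then w (p j) else 0); split.
  move=> i; case: insubP => [j _ ji|_]; last exact: sub0 (subspace_supp _ _).
  have := hw (p j); rewrite /colon /colon_dil -ji.
  by apply: supp_in_sub => m hm c; rewrite mixed_suppE -pE -mixed_suppE; apply: hm.
rewrite (reindex p) /=; last by apply: onW_bij; apply: injF_bij.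
apply: eq_bigr => i _; rewrite valK specE scale1r addrCA subrr addr0.
by rewrite nth_mixed// pE.
Qed.

(* Bernstein's theorem: delta is the number of zeros in the torus. *)
Theorem VG_mixed_volume : VG n (fun us => exists2 delta,
  stable us [ffun i => i] delta & delta%:R = MV R A).
Proof.
have hb : VG n (fun us => forall J : {set 'I_n}, (0 < #|J|)%N -> exists2 del : nat,
    qdim setT (sat tori (gens [set 0] (rows d N A J us))) del
    & del%:R = n`!%:R * fine (Vol (@polytope R n A J))).
  apply: VG_forall => J; have [J0|J0] := boolP (0 < #|J|)%N; last by apply: VGT.
  by apply: VG_mono (bkk_rows R t0 ncK N1 n0 Ad Ane J0) => us _ h _.
have := VG_and (VG_fam_reg K t0 N1 Ad Ane) (VG_and (stable_mixed R t0 ncK N1 n0 Ad Ane) hb).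
apply: VG_mono => us su [rg [st bk]].
have /choice[delta hd] s : exists delta, stable us s delta.
  have [k2 [delta [q h]]] := st s; exists delta; split=> //; by exists k2.
have rgm s : reg tori [set 0] (mixed s us) by rewrite famrows_mixed; apply: rg.
exists (delta [ffun i => i]); first exact: hd.
have eqd s : injective s -> delta s = delta [ffun i => i].
  move=> si; have ii : injective [ffun i : 'I_n => i] by move=> i j; rewrite !ffunE.
  by apply/eqP; rewrite eqn_leq (mixed_le su si ii (rgm _) (hd _) (hd _))
    (mixed_le su ii si (rgm _) (hd _) (hd _)).
(* By symmetry the n! terms of this sum coincide, and the factorials cancel. *)
have := @MV_sum n N N1 A R delta n0 _.
rewrite (eq_bigr (fun _ => delta [ffun i => i])); last by move=> s /injectiveP /eqd.
rewrite sum_nat_const (_ : #|_| = n`!); last first.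
  have := card_inj_ffuns 'I_n 'I_n; rewrite card_ord ffactnn => <-.
  by apply: eq_card => s; rewrite !inE.
rewrite natrM => H; have /mulfI : n`!%:R != 0 :> R by rewrite pnatr_eq0 -lt0n fact_gt0.
apply; apply/esym/H => J J0; have [del q1 <-] := bk J J0; congr _%:R.
have hs s : qdim setT (sat tori (gens [set 0] (mixed s us))) (delta s) by have [] := hd s.
have := fam_dim su rg hs [ffun=> J]; rewrite -famrows_rows.
rewrite (eq_bigl (fun s : {ffun 'I_n -> 'I_n} => [forall i, s i \in J])); last first.
  by move=> s; apply: eq_forallb => i; rewrite ffunE.
move=> q2; apply: qdim_uniq q2 q1; apply/subspace_ideal/ideal_sat.
  exact: mulset_tori.
exact/ideal_gens/ideal0.
Qed.

End Bernstein.

(** * Local algebra at the origin *)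

Lemma det_mem (B : comNzRingType) (I : set B) r (U : 'M[B]_r) (y : 'I_r -> B) : ideal I ->
  (forall i, I (\sum_j U i j * y j)) -> forall j, I (\det U * y j).
Proof.
move=> iI h j; have [_ _ Mul] := iI.
have -> : \det U * y j = \sum_i (\adj U) j i * \sum_k U i k * y k.
  have /matrixP/(_ j) := mul_adj_mx U => e.
  transitivity (\sum_k (\adj U *m U) j k * y k).
    rewrite (bigD1 j)//= e mxE eqxx mulr1n big1 ?addr0// => k kj.
    by rewrite e mxE eq_sym (negPf kj) mulr0n mul0r.
  under eq_bigr do rewrite mxE mulr_suml.
  rewrite exchange_big; apply: eq_bigr => i _ /=; rewrite mulr_sumr.
  by apply: eq_bigr => k _; rewrite mulrA.
by apply: ideal_sum => // i _; apply: (Mul).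
Qed.

Section LocalAlgebra.
Variables (K : fieldType) (n : nat).
Local Notation P := {mpol K[n]}.
Local Notation M := 'NN^n.
Local Notation "'X^' m" := (mpolyX K m) (at level 2, m at level 1).
Local Notation x l := (mpolyX K (mnm1 l) : P).
Local Notation at0 := (@mcoeff n K 0m).
Implicit Types (I : set P).

Definition loc0 : set P := [set q | at0 q != 0].

Lemma at0M p q : at0 (p * q) = at0 p * at0 q.
Proof. exact: rmorphM. Qed.

Lemma mulset_loc0 : mulset loc0.
Proof.
split=> [|p q p0 q0]; first by rewrite /loc0 /= rmorph1 oner_neq0.
by rewrite /loc0 /= at0M mulf_neq0.
Qed.

Lemma at0_X m : m != 0m -> at0 X^m = 0.
Proof. by move=> /negPf m0; rewrite mcoeffX m0. Qed.

Lemma at0_x l : at0 (x l) = 0.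
Proof.
apply: at0_X; apply/eqP => /mnmP/(_ l); by rewrite mnm1E eqxx mnm0E.
Qed.

Lemma divide_power I l m (k : M) : ideal I -> (m <= k l)%N -> I (x l ^+ m) -> I X^k.
Proof.
move=> [_ _ Mul] mk Ix; have <- : X^(mnm_sub k (mnm_muln (mnm1 l) m)) * x l ^+ m = X^k :> P.
  rewrite mpolyXn -mpolyXD; congr mpolyX; apply/mnmP => j.
  by rewrite mnmDE mnmBE mulmnE mnm1E; case: eqVneq => [<-|_]; rewrite ?mul1n ?subnK// mul0n subn0 addn0.
exact: Mul.
Qed.

Lemma high_degree I m (k : M) : ideal I -> (forall l, I (x l ^+ m)) -> (0 < n)%N ->
  (n * m <= mdeg k)%N -> I X^k.
Proof.
move=> iI Ix n0 hk; have [l hl] : exists l, (m <= k l)%N.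
  apply: contrapT => h; suff : (mdeg k < n * m)%N by rewrite ltnNge hk.
  rewrite mdegE -[n in (n * m)%N]card_ord -sum_nat_const.
  have lt l : (k l < m)%N by rewrite ltnNge; apply/negP => hl; apply: h; exists l.
  rewrite (bigD1 (Ordinal n0)) // [ltnRHS](bigD1 (Ordinal n0)) //= -addSn leq_add//.
  by apply: leq_sum => l _; apply: ltnW.
exact: divide_power hl (Ix l).
Qed.

Lemma ideal_expansion I (p : P) : ideal I -> (forall m, mcoeff m p != 0 -> I X^m) -> I p.
Proof.
move=> iI h; have sI := subspace_ideal iI.
by apply: (supp_in_min sI (S := [set m | I X^m])) => // m hm; apply: h.
Qed.

Lemma at0_split (p : P) : exists2 z, at0 z = 0 & p = mpolyC n (at0 p) + z.
Proof.
exists (p - mpolyC n (at0 p)); last by rewrite addrC subrK.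
by rewrite mcoeffB mcoeffC eqxx mulr1 subrr.
Qed.

(** Descending induction on the degree: splitting [q] into q(0) and a part z vanishing at 0, the
    product of z with a monomial has only monomials of higher degree, already in [I]; so the
    monomial itself is in [I]. *)
Lemma unit_mod_powers I m q : (0 < n)%N -> ideal I -> (forall l, I (x l ^+ m)) ->
  I q -> loc0 q -> I 1.
Proof.
move=> n0 iI Ix Iq q0; have sI := subspace_ideal iI; have [_ _ Mul] := iI.
suff h c (k : M) : (n * m - mdeg k <= c)%N -> I X^k.
  by rewrite -(mpolyX0 n K); apply: h (leqnn _).
elim: c k => [|c IH] k hc.
  by apply: (high_degree iI Ix n0); rewrite -subn_eq0 -leqn0.
have [z z0 qE] := at0_split q.
have h1 : I (X^k * z).
  apply: ideal_expansion => // j hj; have [l lE] : exists2 l, l != 0m & j = k +m l.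
    have := @supp_in_M K n [set i | i = k] [set i | i != 0m]
      [set j | exists2 l, l != 0m & j = k +m l] X^k z.
    apply=> //; last by move=> a b -> hb; exists b.
      by apply: supp_inX.
    by move=> i hi; rewrite /mkset; apply: contraNneq hi => ->; rewrite z0.
  move=> ->; apply: IH; rewrite mdegD; move: lE; rewrite -mdeg_eq0.
  case: (mdeg l) => // dl _; move: hc; lia.
have := Mul X^k _ Iq; rewrite {1}qE mulrDr => /(subDr sI) h2.
have {}h2 := h2 h1; rewrite -[X^k]scale1r -(mulVf q0) -scalerA; apply: (subZ sI).
by rewrite -mul_mpolyC mulrC.
Qed.

Lemma ideal_colon I r : ideal I -> ideal [set s | I (s * r)].
Proof.
move=> [I0 D Mul]; split=> [|a b|a b]; rewrite /mkset ?mul0r// ?mulrDl -?mulrA.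
  exact: D.
exact: Mul.
Qed.

(** Modulo powers of all variables the ring is already local at the origin. *)
Lemma sat_local I m : (0 < n)%N -> ideal I -> (forall l, I (x l ^+ m)) -> sat loc0 I `<=` I.
Proof.
move=> n0 iI Ix r [q q0 Iq]; rewrite -[r]mul1r.
apply: (@unit_mod_powers [set s | I (s * r)] m q) => //; first exact: ideal_colon.
by move=> l; rewrite /mkset; apply: idealMr.
Qed.

Lemma det_loc0 r (U : 'M[P]_r) (c : K) : c != 0 ->
  (forall i j, at0 (U i j) = c *+ (i == j)) -> loc0 (\det U).
Proof.
move=> c0 h; rewrite /loc0 /= -det_map_mx.
have -> : map_mx at0 U = c%:M by apply/matrixP => i j; rewrite !mxE h.
by rewrite det_scalar expf_neq0.
Qed.

(** The powers of [z] up to the m-th are dependent modulo [I]; once the lowest occurring power is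
    factored out, the cofactor is nonzero at the origin. *)
Lemma power_relation I m (z : P) : ideal I -> dle setT I m -> at0 z = 0 ->
  exists k q, [/\ (k <= m)%N, loc0 q & I (z ^+ k * q)].
Proof.
move=> iI le z0; have sI := subspace_ideal iI.
have : ~ dge setT I m.+1 by move=> ge; have := steinitz sI ge le; rewrite ltnn.
have [h|] := pselect (forall c, I (comb (fun i : 'I_m.+1 => z ^+ i) c) -> forall i, c i = 0).
  by case; exists (fun i : 'I_m.+1 => z ^+ i).
move=> /existsNP[c /not_implyP[Ic /existsNP[i0 ci0]]] _.
have ex : exists k, (k < m.+1)%N && (c (inord k) != 0).
  by exists i0; rewrite ltn_ord inord_val; apply/eqP.
case: (ex_minnP ex) => k /andP[km ck] kmin.
exists k, (\sum_(i < m.+1 | (k <= i)%N) c i *: z ^+ (i - k)); split=> //.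
  rewrite /loc0 /= raddf_sum (bigD1 (Ordinal km)) //= subnn expr0 mcoeffZ rmorph1 mulr1.
  rewrite big1 ?addr0; first by rewrite (_ : Ordinal km = inord k)//; apply/val_inj; rewrite /= inordK.
  move=> i /andP[ki ik]; rewrite mcoeffZ rmorphXn /= z0 expr0n subn_eq0 leqNgt.
  by rewrite ltn_neqAle ki eq_sym ik mulr0.
move: Ic; congr I; rewrite mulr_sumr /comb (bigID (fun i : 'I_m.+1 => (k <= i)%N)) /=.
rewrite [X in _ + X]big1 ?addr0.
  by apply: eq_bigr => i ki; rewrite -scalerAr -exprD subnKC.
move=> i; rewrite -ltnNge => ik; case: (eqVneq (c i) 0) => [->|ci]; first by rewrite scale0r.
by have := kmin i; rewrite ltn_ord inord_val ci leqNgt ik => /(_ isT).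
Qed.

Lemma power_in_sat I m l : ideal I -> dle setT (sat loc0 I) m -> sat loc0 I (x l ^+ m).
Proof.
move=> iI le; have iS := ideal_sat mulset_loc0 iI.
have [k [q [km q0]]] := power_relation iS le (at0_x l).
rewrite mulrC => /(sat_unit mulset_loc0 iI q0) h.
by rewrite -(subnKC km) exprD; apply: idealMr.
Qed.

Definition powers m : seq P := [seq x l ^+ m | l <- enum 'I_n].

Lemma powersP I m : ideal I -> gens I (powers m) `<=`
  [set r | exists2 j, I j & exists h : 'I_n -> P, r = j + \sum_l h l * x l ^+ m].
Proof.
move=> iI; apply: gens_min.
- split.
  + by exists 0; [case: iI|exists (fun _ => 0); rewrite big1 ?addr0// => l _; rewrite mul0r].
  + move=> _ _ [j Ij [h ->]] [j' Ij' [h' ->]]; exists (j + j'); first by case: iI => _ D _; apply: D.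
    exists (fun l => h l + h' l); rewrite addrACA -big_split; congr (_ + _).
    by apply: eq_bigr => l _; rewrite mulrDl.
  move=> a _ [j Ij [h ->]]; exists (a * j); first by case: iI => _ _; apply.
  exists (fun l => a * h l); rewrite mulrDr mulr_sumr; congr (_ + _).
  by apply: eq_bigr => l _; rewrite mulrA.
- move=> j Ij; exists j => //; exists (fun _ => 0).
  by rewrite big1 ?addr0// => l _; rewrite mul0r.
move=> _ /mapP[l _ ->]; exists 0; first by case: iI.
exists (fun k => (k == l)%:R); rewrite add0r (bigD1 l)//= eqxx mul1r big1 ?addr0//.
by move=> k /negPf ->; rewrite mul0r.
Qed.

(** Nakayama's lemma in matrix form: modulo [I], the vector of m-th powers is annihilated by a
    matrix that is the identity at the origin. *)
Lemma nakayama_powers I m : ideal I -> (forall l, gens I (powers m.+1) (x l ^+ m)) ->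
  forall l, sat loc0 I (x l ^+ m).
Proof.
move=> iI h.
have /choice[H hH] l : exists H : 'I_n -> P, I (x l ^+ m - \sum_k H k * x k ^+ m.+1).
  by have [j Ij [H ->]] := powersP iI (h l); exists H; rewrite addrK.
pose U : 'M[P]_n := \matrix_(i, j) ((i == j)%:R - H i j * x j).
exists (\det U).
  apply: (@det_loc0 _ _ 1); first exact: oner_neq0.
  move=> i j; rewrite mxE mcoeffB at0M at0_x mulr0 subr0.
  by case: (i == j); rewrite ?mcoeff1 ?mcoeff0 ?eqxx.
apply: (@det_mem _ I n U (fun l => x l ^+ m)) => // i; move: (hH i); congr I.
under [RHS]eq_bigr do rewrite mxE mulrBl.
rewrite sumrB; congr (_ - _); last by apply: eq_bigr => j _; rewrite -mulrA -exprS.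
rewrite (bigD1 i)//= eqxx mul1r big1 ?addr0// => j.
by rewrite eq_sym => /negPf ->; rewrite mul0r.
Qed.

Lemma finite_of_powers I m : (0 < n)%N -> ideal I -> (forall l, I (x l ^+ m)) ->
  exists w, qdim setT I w.
Proof.
move=> n0 iI Ix; pose Y : set M := [set k | (n * m <= mdeg k)%N].
have le := @dle_supp K n setT Y [seq bmnm t | t : bmultinom n (n * m)] _.
have {}le : dle setT (supp_in Y : set P) (size [seq bmnm t | t : bmultinom n (n * m)]).
  have -> : setT = supp_in setT :> set P by apply/seteqP; split.
  apply: le => k _ /negP; rewrite -ltnNge => hk.
  by apply/mapP; exists (BMultinom hk); rewrite ?mem_enum.
have YI : supp_in Y `<=` I.
  by apply: supp_in_min => [|k]; [exact: subspace_ideal|exact: high_degree].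
have [w _ qw] := dim_exists (subspace_ideal iI) (dle_mono YI le).
by exists w.
Qed.

(* Here q f' = U f with U = q(0) 1 at the origin, so that U is invertible there. *)
Lemma det_trick (r : nat) (fs fs' : 'I_r -> P) I (q : P) (U : 'M[P]_r) : ideal I ->
  loc0 q -> (forall i, fs' i * q = \sum_j U i j * fs j) ->
  (forall i j, at0 (U i j) = at0 q *+ (i == j)) ->
  (forall i, sat loc0 I (fs' i)) -> forall i, sat loc0 I (fs i).
Proof.
move=> iI q0 e U0 h i; apply: (sat_unit mulset_loc0 iI (det_loc0 q0 U0)).
apply: det_mem => [|j]; first exact: ideal_sat mulset_loc0 iI.
by rewrite -e; apply: idealMr => //; apply: ideal_sat mulset_loc0 iI.
Qed.

End LocalAlgebra.

(** * Finiteness on the coordinate strata *)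

Section Strata.
Variables (R : realType) (K : fieldType) (n d : nat) (t0 : bmultinom n d) (N : nat).
Hypothesis N1 : (1 < N)%N.
Hypothesis n0 : (0 < n)%N.
Variable A : 'I_n -> {fset 'NN^n}.
Hypothesis Ad : forall j a, a \in A j -> (mdeg a < d)%N.
Local Notation P := {mpol K[n]}.
Local Notation M := 'NN^n.
Local Notation "'X^' m" := (mpolyX K m) (at level 2, m at level 1).
Local Notation x l := (mpolyX K (mnm1 l) : P).
Local Notation loc0 := (@loc0 K n).
Implicit Types (I : {set 'I_n}) (us : seq K).

Lemma size_ord_map (T : Type) (F : 'I_n -> T) : size [seq F i | i <- enum 'I_n] = n.
Proof. by rewrite size_map size_enum_ord. Qed.

Definition sys us : seq P := mixed d N A [ffun i => i] us.

Lemma sysE us : size us = n ->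
  sys us = [seq spec us`_i (curve K d N A i) | i : 'I_n <- enum 'I_n].
Proof.
by move=> su; rewrite /sys mixedE//; apply: eq_map => i; rewrite ffunE.
Qed.

Definition coord_ideal I : set P := supp_in [set m | exists2 i, i \in I & (0 < m i)%N].
(** Inverting the monomials with these exponents restricts to points whose coordinates outside [I]
    are nonzero. *)
Definition off I : set M := [set m | forall i, i \in I -> m i = 0%N].

Lemma ideal_coord I : ideal (coord_ideal I).
Proof.
have sI : subspace (coord_ideal I) by apply: subspace_supp.
split; [exact: sub0|exact: subD|move=> a r hr].
have aT : supp_in setT a by [].
apply: supp_in_M aT hr _ => b c _ [i iI ci]; exists i => //.
by rewrite mnmDE addn_gt0 ci orbT.
Qed.

Lemma mulset_off I : mulset (monomials (off I) : set P).
Proof.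
apply: mulset_monomials => [i _|a b ha hb i iI]; first by rewrite mnm0E.
by rewrite mnmDE ha// hb.
Qed.

Lemma coord_idealU I i : coord_ideal (i |: I)%SET `<=` addI (coord_ideal I) (x i).
Proof.
apply: supp_in_min => [|m [j]]; first by apply/subspace_ideal/ideal_addI/ideal_coord.
rewrite in_setU1 => /orP[/eqP ->|jI] mj; last first.
  by apply: sub_addI; apply: supp_inX; exists j.
exists 0, X^(mnm_sub m (mnm1 i)); split; first exact: sub0 (subspace_supp _ _).
rewrite add0r -mpolyXD; congr mpolyX; apply/mnmP => l.
rewrite mnmDE mnmBE mnm1E; case: eqVneq => [<-|_]; last by rewrite subn0 addn0.
by rewrite subnK.
Qed.

Lemma coord_ideal0 : coord_ideal finset.set0 `<=` [set 0].
Proof.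
move=> p hp; apply/mpolyP => m; rewrite mcoeff0; apply/eqP/negP => /negP /hp [k].
by rewrite inE.
Qed.

(** Members outside the mask are skipped but still consume a parameter, so that the same parameters
    serve all strata. *)
Lemma VG_reg_mask (S J : set P) (phis : seq {poly P}) (bs : seq bool) : mulset S -> ideal J ->
  size bs = size phis ->
  (forall i, (i < size phis)%N -> nth false bs i -> exists t, S (phis`_i)`_t) ->
  VG (size phis) (fun us => reg S J (mask bs (specs us phis))).
Proof.
move=> mS; elim: phis bs J => [|phi phis IH] [|b bs] J iJ //= [sb] h.
have h' i : (i < size phis)%N -> nth false bs i -> exists t, S (phis`_i)`_t.
  by move=> il bi; apply: (h i.+1).
case: b h => h; last by apply: cocountableT => u; apply: IH.
have [t St] := h 0%N isT isT.
have : cocountable (fun u => nzd S J (spec u phi)).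
  by apply: (cocountable_nzd (t := t)) => // r; apply: sat_unit.
apply: cocountable_mono => u hu.
have := IH bs (addI J (spec u phi)) (ideal_addI _ iJ) sb h'.
by apply: VG_mono => us _ hus.
Qed.

(** The members with a monomial free of the variables in [I], which is a unit on the stratum; the
    others vanish there. *)
Definition active I us : seq P := mask [seq i \in J_ A I | i <- enum 'I_n] (sys us).

Lemma VG_active : VG n (fun us => forall I, reg (monomials (off I)) (coord_ideal I) (active I us)).
Proof.
apply: VG_forall => I.
have := @VG_reg_mask (monomials (off I)) (coord_ideal I)
  [seq curve K d N A ([ffun i : 'I_n => i] i) | i <- enum 'I_n]
  [seq i \in J_ A I | i <- enum 'I_n] (mulset_off I) (ideal_coord I).
rewrite !size_ord_map; apply=> // i il; pose j := Ordinal il.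
have il' : (j < size (enum 'I_n))%N by rewrite size_enum_ord.
rewrite (nth_map j false _ il') (nth_map j 0 _ il') nth_ord_enum ffunE.
rewrite inE => /existsP[a /forallP h].
have aE : bmnm (insubd t0 (val a)) = val a by apply: bmnm_insubd; apply: (Ad (valP a)).
exists (expo N j (insubd t0 (val a))); rewrite coef_curve// ?aE; last exact: valP.
exists (val a) => // k kI; by have := h k; rewrite kI => /eqP.
Qed.

Lemma sub_active I us : {subset active I us <= sys us}.
Proof. by move=> f /mem_mask. Qed.

Lemma size_active I us : size us = n -> size (active I us) = #|J_ A I|.
Proof.
move=> su; rewrite size_mask; last first.
  by rewrite size_ord_map /sys size_mixed.
rewrite count_map -sum1_count big_enum_cond -sum1_card.
by apply: eq_bigl => i; have -> : (i \in 'I_n) = true by [].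
Qed.

Lemma stratum_count I k : dle (supp_in [set m : M | (mdeg m <= k)%N] : set P) (coord_ideal I)
  (k.+1 ^ #|(~: I)%SET|).
Proof.
pose mk (g : {ffun 'I_n -> 'I_k.+1}) : M := Multinom [tuple (g i : nat) | i < n].
have := @dle_supp K n [set m : M | (mdeg m <= k)%N] [set m | exists2 i, i \in I & (0 < m i)%N]
  [seq mk g | g in pffun_on ord0 (mem (~: I)%SET) predT].
rewrite size_image card_pffun_on card_ord; apply=> m hm nm.
have mk_le i : (m i < k.+1)%N.
  by rewrite ltnS; apply: leq_trans hm; rewrite mdegE (bigD1 i)//= leq_addr.
pose g : {ffun 'I_n -> 'I_k.+1} := [ffun i => inord (m i)].
have -> : m = mk g.
  by apply/mnmP => i; rewrite multinomE tnth_mktuple ffunE inordK.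
apply/fintype.imageP; exists g => //; apply/pffun_onP; split=> [|_ _ //].
apply/supportP => i; rewrite inE negbK => iI; apply/val_inj; rewrite ffunE /= inordK//.
by apply/eqP; rewrite -leqn0 leqNgt; apply/negP => mi; apply: nm; exists i.
Qed.

Lemma sys_V us f k v : size us = n -> f \in sys us ->
  supp_in [set m : M | (mdeg m <= k * d.+1)%N] v ->
  supp_in [set m : M | (mdeg m <= k.+1 * d.+1)%N] (f * v).
Proof.
move=> su; rewrite sysE// => /mapP[i _ ->] hv.
apply: (@supp_in_M _ _ [set m : M | m \in A i]) hv _.
  by move=> m hm; apply: supp_spec_curve hm.
by move=> a b /Ad ha hb; rewrite /mkset mdegD mulSn leq_add// ltnW// ltnW.
Qed.

(** The stratum has dimension n - #I, and at least that many members form a regular sequence on it.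
    By [hilbert_upper], [a] times a binomial of degree p in m is at most of order m^p, which bounds
    [a]. *)
Lemma stratum_finite I us : size us = n -> (n <= #|I| + #|J_ A I|)%N ->
  reg (monomials (off I)) (coord_ideal I) (active I us) ->
  exists w, qdim setT (sat (monomials (off I)) (gens (coord_ideal I) (active I us))) w.
Proof.
move=> su hI rg; set W := sat _ _.
have mS := mulset_off I; have iJ := ideal_coord I.
have sW : subspace W by apply/subspace_ideal/ideal_sat/ideal_gens.
pose p := size (active I us); pose D := d.+1.
pose V k : set P := supp_in [set m : M | (mdeg m <= k * D)%N].
have sV k : subspace (V k) by apply: subspace_supp.
have ep : (#|(~: I)%SET| <= p)%N.
  rewrite /p size_active//; have := cardsC I; rewrite card_ord => e; lia.
suff bound a : dge setT W a -> (a <= p`! * D ^ p)%N.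
  by have [w _ qw] := dge_max sW bound; exists w.
move=> [e _ ie].
have [k0 hk0] : exists k0, forall k i, (k0 <= k)%N -> V k (e i).
  exists (\max_i msize (e i)) => k i hk m; rewrite -mcoeff_msupp => /msize_mdeg_lt lt.
  rewrite /mkset; apply: ltnW; apply: leq_trans lt _.
  apply: (leq_trans (leq_bigmax (F := fun i => msize (e i)) i)); apply: (leq_trans hk).
  by rewrite leq_pmulr.
have ge k : (k0 <= k)%N -> dge (V k) W a by move=> hk; exists e => // i; apply: hk0.
have fV f : f \in active I us -> forall k v, V k v -> V k.+1 (f * v).
  by move=> fs k v; apply: (sys_V su (sub_active fs)).
have up m : (a * 'C(m, p) <= (((k0 + m) * D).+1) ^ #|(~: I)%SET|)%N.
  have g1 := hilbert_upper (V := V) sV mS iJ rg fV ge m.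
  have ss : subspace (sat (monomials (off I)) (coord_ideal I)).
    by apply/subspace_ideal/ideal_sat.
  apply: (steinitz ss g1); apply: dle_mono (stratum_count I _).
  exact: sub_sat.
have up' m : (a * 'C(m, p) <= (D * (k0.+1 + m)) ^ p)%N.
  apply: leq_trans (up m) _.
  have lt : (((k0 + m) * D).+1 <= D * (k0.+1 + m))%N by rewrite /D; nia.
  apply: (@leq_trans ((D * (k0.+1 + m)) ^ #|(~: I)%SET|)).
    by case: #|_| => [|e']; rewrite ?expn0// leq_exp2r.
  by apply: leq_pexp2l => //; rewrite /D; lia.
case: p up' {ep up} => [|p] up'.
  by have := up' 0%N; rewrite bin0 muln1 !expn0 muln1.
rewrite -(ler_nat R) natrM.
apply: (@volume_upper R (D ^ p.+1)%:R 0 p a k0.+1) => // m.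
by rewrite mul0r addr0 -natrX -natrM ler_nat -expnMn.
Qed.

Lemma sat_addI_mul (S J : set P) g h u v : mulset S -> ideal J ->
  sat S (addI J g) u -> sat S (addI J h) v -> sat S (addI J (g * h)) (u * v).
Proof.
move=> mS [J0 D Mul] [q Sq [j [c [Ij e]]]] [q' Sq' [j' [c' [Ij' e']]]].
exists (q * q'); first by case: mS => _; apply.
exists ((q' * v) * j + (c * g) * j'), (c * c'); split.
  by apply: D; apply: Mul.
transitivity ((q * u) * (q' * v)); first by ring.
rewrite e mulrDl -!addrA; congr (_ + _); first exact: mulrC.
by rewrite e'; ring.
Qed.

(** The monomial is taken apart one variable at a time, and powers obtained modulo the factors are
    multiplied. *)
Lemma sat_addI_monomial (S G : set P) I m (b : M) : mulset S -> ideal G ->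
  (forall i, i \notin I -> forall l, sat S (addI G (x i)) (x l ^+ m)) -> off I b ->
  forall l, sat S (addI G X^b) (x l ^+ (m * mdeg b)).
Proof.
move=> mS iG h.
have [k] := ubnP (mdeg b); elim: k b => // k IH b; rewrite ltnS => hb ob l.
have [->|b0] := eqVneq b 0m.
  exists 1; first by case: mS.
  rewrite mpolyX0 mul1r -[x l ^+ _]mulr1; have [_ _ Mul] := ideal_addI 1 iG.
  by apply: (Mul); apply: addI_mem.
have [i bi] : exists i, (0 < b i)%N.
  apply: contrapT => nb; move/eqP: b0; apply; apply/mnmP => i; rewrite mnm0E.
  by apply/eqP; rewrite -leqn0 leqNgt; apply/negP => bi; apply: nb; exists i.
have iI : i \notin I by apply/negP => iI; rewrite ob in bi.
pose b' := mnm_sub b (mnm1 i).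
have bE : b = mnm1 i +m b'.
  apply/mnmP => j; rewrite mnmDE mnmBE mnm1E.
  by case: eqVneq => [<-|_]; rewrite ?add0n ?subn0// subnKC.
rewrite bE mpolyXD mdegD mdeg1 mulnDr muln1 exprD; apply: sat_addI_mul => //; first exact: h.
apply: IH => [|j jI].
  by move: hb; rewrite [in X in X -> _]bE mdegD mdeg1; lia.
by have := ob j jI; rewrite {1}bE mnmDE; lia.
Qed.

(* On each coordinate stratum x_I = 0, x_i <> 0 off I, the generic system has finitely
   many zeros, which are therefore separated from 0 by a polynomial in one variable. *)
Lemma VG_powers : H2 A -> VG n (fun us => exists m, forall l,
  sat loc0 (gens [set 0] (sys us)) (x l ^+ m)).
Proof.
move=> hH2; apply: VG_mono VG_active => us su rg; have mS := @mulset_loc0 K n.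
pose G I := gens (coord_ideal I) (sys us).
have iG I : ideal (G I) by apply/ideal_gens/ideal_coord.
suff h I : exists m, forall l, sat loc0 (G I) (x l ^+ m).
  have [m hm] := h finset.set0; exists m => l; move: (hm l); apply: sat_mono.
  apply: gens_min; first exact/ideal_gens/ideal0.
    by move=> p /coord_ideal0 ->; have [] := ideal_gens (sys us) (ideal0 P).
  by move=> f fs; apply: gens_mem => //; apply: ideal0.
have [k] := ubnP #|(~: I)%SET|; elim: k I => // k IH I; rewrite ltnS => hk.
have [->|] := eqVneq I [set: 'I_n]%SET.
  exists 1%N => l; rewrite expr1; apply: sub_sat => //; apply: sub_gens.
  by apply: supp_inX; exists l; rewrite ?inE// mnm1E eqxx.
rewrite -finset.properT => /properP[_ [i _ iI]].
have [w [_ le]] := stratum_finite su (hH2 I) (rg I).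
have iW : ideal (sat (monomials (off I)) (gens (coord_ideal I) (active I us))).
  by apply/ideal_sat; [exact: mulset_off|apply/ideal_gens/ideal_coord].
(* Here [q] does not vanish at the origin and [x i] is inverted on the stratum, so the ideal
   contains [q] times a monomial in the variables outside [I]. *)
have [k1 [q [_ q0]]] := power_relation iW le (at0_x K i).
move=> /(sat_unit (mulset_off I) (ideal_gens _ (ideal_coord I))) [|_ [b ob <-] hb].
  exists (mnm_muln (mnm1 i) k1); last by rewrite mpolyXn.
  move=> j jI; rewrite mulmnE mnm1E; case: eqVneq => // e.
  by rewrite e jI in iI.
have Gb : sat loc0 (G I) X^b.
  exists q => //; rewrite mulrC; move: hb; apply: gens_min => //.
    exact: sub_gens.
  by move=> f /sub_active fs; apply: gens_mem => //; apply: ideal_coord.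
(* Where this monomial vanishes, one more coordinate is 0: the induction hypothesis covers these
   smaller strata. *)
have /choice[m hm] j : exists m, j \notin I -> forall l, sat loc0 (G (j |: I)%SET) (x l ^+ m).
  have [jI|jI] := boolP (j \in I); first by exists 0%N.
  have [|m hm] := IH (j |: I)%SET; last by exists m.
  apply: leq_trans hk; apply: proper_card; rewrite properC.
  by rewrite properE finset.subsetUr finset.subUset finset.sub1set (negPf jI).
exists ((\max_j m j) * mdeg b)%N => l.
have sub : addI (G I) X^b `<=` sat loc0 (G I).
  by apply: addI_min => //; [exact: ideal_sat|exact: sub_sat].
apply: sat_sat => //; apply: (sat_mono sub).
apply: (@sat_addI_monomial loc0 (G I) I) => // j jI l'.
have := hm j jI l'; rewrite -(subnKC (leq_bigmax j : (m j <= \max_j m j)%N)) exprD => h.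
apply: idealMr; first by apply/ideal_sat/ideal_addI.
move: h; apply: sat_mono; rewrite /G -gens_addI; apply: gens_min.
- exact/ideal_gens/ideal_addI/ideal_coord.
- by move=> p /coord_idealU hp; apply: sub_gens.
by move=> f fs; apply: gens_mem => //; apply/ideal_addI/ideal_coord.
Qed.

End Strata.

(** * Reaching every nonempty open set *)

Section Nonvanishing.
Variable K : fieldType.

Lemma big_behead (s : seq (seq nat)) (F : seq nat -> K) :
  \sum_(e <- s) F e =
  \sum_(e' <- undup [seq behead e | e <- s]) \sum_(e <- s | behead e == e') F e.
Proof.
under [RHS]eq_bigr do rewrite big_mkcond /=.
rewrite exchange_big /=; rewrite big_seq [RHS]big_seq; apply: eq_bigr => e es.
rewrite (bigD1_seq (behead e)) ?undup_uniq ?mem_undup ?map_f//= eqxx big1 ?addr0//.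
by move=> e' /negPf; rewrite eq_sym => ->.
Qed.

(** Exponents are grouped by their tails. For one tail the coefficient is a nonzero polynomial in
    the first parameter; off its roots the induction hypothesis applies to the others. *)
Lemma VG_exponential_sum k (a : seq nat -> K) (s : seq (seq nat)) : uniq s ->
  (forall e, e \in s -> size e = k) -> (exists2 e, e \in s & a e != 0) ->
  VG k (fun us => \sum_(e <- s) a e * \prod_(i < k) us`_i ^+ nth 0%N e i != 0).
Proof.
elim: k a s => [|k IH] a s us hs [e0 e0s ae0] /=.
  rewrite (bigD1_seq e0)//= big_ord0 mulr1 big1_seq ?addr0// => e /andP[/eqP ne es].
  by case: ne; rewrite (size0nil (hs _ es)) (size0nil (hs _ e0s)).
pose h : {poly K} := \sum_(e <- s | behead e == behead e0) (a e)%:P * 'X^(head 0%N e).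
have h0 : h != 0.
  apply: contraNneq ae0 => he; have := congr1 (fun p : {poly K} => p`_(head 0%N e0)) he.
  rewrite coef0 /h coef_sum big_mkcond (bigD1_seq e0)//= eqxx coefCM coefXn eqxx mulr1.
  rewrite big1_seq ?addr0; first by move=> ->.
  move=> e /andP[ne es]; case: ifP => // /eqP be; rewrite coefCM coefXn.
  case: eqP => [he0|_]; last by rewrite mulr0.
  case/eqP: ne; move: (hs _ es) (hs _ e0s) be he0.
  by case: (e) => // x l; case: (e0) => //= y m _ _ -> ->.
apply: cocountable_mono (cocountable_root h0) => u hu.
pose a' e' := \sum_(e <- s | behead e == e') a e * u ^+ head 0%N e.
have E vs : \sum_(e <- s) a e * \prod_(i < k.+1) (u :: vs)`_i ^+ nth 0%N e i =
    \sum_(e' <- undup [seq behead e | e <- s]) a' e' * \prod_(i < k) vs`_i ^+ nth 0%N e' i.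
  rewrite (big_behead s); apply: eq_bigr => e' _; rewrite /a' mulr_suml.
  apply: eq_bigr => e /eqP <-; rewrite big_ord_recl /= -mulrA nth0; congr (_ * (_ * _)).
  by apply: eq_bigr => i _; rewrite nth_behead.
have hE : h.[u] = a' (behead e0).
  by rewrite /h horner_sum; apply: eq_bigr => e _; rewrite hornerM hornerC hornerXn.
have := IH a' (undup [seq behead e | e <- s]) (undup_uniq _) _ _.
move=> H; apply: (VG_mono _ (H _ _)).
- by move=> vs sv; rewrite E.
- by move=> e'; rewrite mem_undup => /mapP[e es ->]; rewrite size_behead (hs e es).
exists (behead e0); first by rewrite mem_undup map_f.
by move: hu; rewrite /root hE.
Qed.

(* Kronecker substitution: exponents that are distinct powers of a large N are
   algebraically independent in bounded degree. *)
Lemma VG_nonvanishing q n Q N (j : 'I_q -> 'I_n) (r : 'I_q -> 'I_Q) (p : {mpol K[q]}) :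
  injective r -> p != 0 -> (msize p <= N)%N ->
  VG n (fun us => meval (fun k => us`_(j k) ^+ (N ^ r k)) p != 0).
Proof.
move=> rinj p0 pN.
pose ex (m : 'NN^q) (i : 'I_n) : nat := (\sum_(k | j k == i) m k * N ^ r k)%N.
pose expv (m : 'NN^q) : seq nat := [seq ex m i | i <- enum 'I_n].
have nthv m (i : 'I_n) : nth 0%N (expv m) i = ex m i.
  by rewrite (nth_map i) ?size_enum_ord// nth_ord_enum.
have digit m (i : 'I_n) : ex m i =
    (\sum_(x < Q) (\sum_(k | (j k == i) && (r k == x)) m k) * N ^ x)%N.
  rewrite /ex (partition_big r predT) //=; apply: eq_bigr => x _.
  by rewrite big_distrl /=; apply: eq_bigr => k /andP[_ /eqP ->].
have small m (i : 'I_n) (x : 'I_Q) : m \in msupp p ->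
    (\sum_(k | (j k == i) && (r k == x)) m k < N)%N.
  move=> /msize_mdeg_lt lt; apply: leq_trans pN; apply: leq_ltn_trans lt.
  rewrite mdegE [X in (_ <= X)%N](bigID (fun k => (j k == i) && (r k == x))) /=.
  exact: leq_addr.
have inj : {in msupp p &, injective expv}.
  move=> m m' hm hm' e; apply/mnmP => k.
  have : ex m (j k) = ex m' (j k) by rewrite -!nthv e.
  rewrite !digit => /(@base_digits N Q _ _ (fun x => small m (j k) x hm)
    (fun x => small m' (j k) x hm')) /(_ (r k)).
  have pk : (fun l => (j l == j k) && (r l == r k)) =1 pred1 k.
    by move=> l /=; rewrite (inj_eq rinj); case: (eqVneq l k) => [->|_]; rewrite ?eqxx ?andbF.
  by rewrite !(big_pred1 k pk).
pose a (e : seq nat) : K := \sum_(m <- msupp p | expv m == e) mcoeff m p.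
have aE m : m \in msupp p -> a (expv m) = mcoeff m p.
  move=> hm; rewrite /a big_mkcond (bigD1_seq m) ?msupp_uniq//= eqxx big1_seq ?addr0//.
  move=> m' /andP[ne hm']; case: ifP => // /eqP e; by case/eqP: ne; apply: inj.
have [m0 m0p] : exists m, m \in msupp p.
  case E: (msupp p) => [|m s]; last by exists m; rewrite inE eqxx.
  by move/eqP: E; rewrite msupp_eq0 (negPf p0).
have E us : meval (fun k => us`_(j k) ^+ (N ^ r k)) p =
    \sum_(e <- [seq expv m | m <- msupp p]) a e * \prod_(i < n) us`_i ^+ nth 0%N e i.
  rewrite big_map mevalE big_seq [RHS]big_seq.
  apply: eq_bigr => m hm; rewrite aE//; congr (_ * _).
  rewrite (partition_big j predT) //=; apply: eq_bigr => i _.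
  rewrite nthv /ex (big_morph _ (exprD us`_i) (expr0 _)) /=.
  by apply: eq_bigr => k /eqP ->; rewrite -exprM mulnC.
have := @VG_exponential_sum n a [seq expv m | m <- msupp p] _ _ _.
move=> H; apply: (VG_mono _ (H _ _ _)).
- by move=> us su; rewrite E.
- by rewrite map_inj_in_uniq ?msupp_uniq.
- by move=> _ /mapP[m _ ->]; rewrite size_map size_enum_ord.
by exists (expv m0); [apply: map_f|rewrite aE// -mcoeff_msupp].
Qed.

End Nonvanishing.

(** * From saturated ideals to the local ring *)

Section Bridge.
Variables (K : numFieldType) (n : nat).
Local Notation P := {mpol K[n]}.
Local Notation F := {fraction P}.
Local Notation "'X^' m" := (mpolyX K m) (at level 2, m at level 1).
Local Notation x l := (mpolyX K (mnm1 l) : P).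
Local Notation at0 := (@mcoeff n K 0m).
Local Notation loc0 := (@loc0 K n).
Local Notation tf := (@FracField.tofrac P).
Implicit Types (f : 'I_n -> P).

Definition sysI f : set P := gens [set 0] [seq f j | j <- enum 'I_n].

Lemma ideal_sysI f : ideal (sysI f).
Proof. exact/ideal_gens/ideal0. Qed.

Lemma sysIP f p : sysI f p <-> exists h : 'I_n -> P, p = \sum_j h j * f j.
Proof.
split=> [|[h ->]].
  suff : sysI f `<=` [set p | exists h : 'I_n -> P, p = \sum_j h j * f j] by apply.
  apply: gens_min; first split.
  - by exists (fun _ => 0); rewrite big1// => j _; rewrite mul0r.
  - move=> _ _ [h ->] [h' ->]; exists (fun j => h j + h' j); rewrite -big_split.
    by apply: eq_bigr => j _; rewrite mulrDl.
  - move=> a _ [h ->]; exists (fun j => a * h j); rewrite mulr_sumr.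
    by apply: eq_bigr => j _; rewrite mulrA.
  - by move=> _ ->; exists (fun _ => 0); rewrite big1// => j _; rewrite mul0r.
  move=> _ /mapP[j _ ->]; exists (fun k => (k == j)%:R).
  by rewrite (bigD1 j)//= eqxx mul1r big1 ?addr0// => k /negPf ->; rewrite mul0r.
apply: ideal_sum; first exact: ideal_sysI.
move=> j _; have [_ _ Mul] := ideal_sysI f; apply: (Mul); apply: gens_mem.
  exact: ideal0.
by apply: map_f; rewrite mem_enum.
Qed.

Lemma max_ideal0 (q : P) : max_ideal 0 q <-> at0 q = 0.
Proof.
split=> [[h _ <-]|q0].
  rewrite raddf_sum big1//= => i _; rewrite at0M mcoeffB at0_x mxE.
  by rewrite mpolyC0 mcoeff0 subrr mulr0.
have sI : subspace (max_ideal (0 : 'rV[K]_n)).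
  split; first by exists (fun _ => 0) => //; rewrite big1// => i _; rewrite mul0r.
  move=> a _ _ [h _ <-] [h' _ <-]; exists (fun i => a *: h i + h' i) => //.
  rewrite scaler_sumr -big_split; apply: eq_bigr => i _ /=.
  by rewrite mulrDl scalerAl.
apply: (supp_in_min sI (S := [set m | m != 0m])); last first.
  by move=> m hm; rewrite /mkset; apply: contraNneq hm => ->; rewrite q0.
move=> m m0; have [i mi] : exists i, (0 < m i)%N.
  apply: contrapT => nb; move/eqP: m0; apply; apply/mnmP => i; rewrite mnm0E.
  by apply/eqP; rewrite -leqn0 leqNgt; apply/negP => bi; apply: nb; exists i.
exists (fun k => if k == i then X^(mnm_sub m (mnm1 i)) else 0) => //.
rewrite (bigD1 i)//= eqxx big1 ?addr0 => [|k /negPf ->]; last by rewrite mul0r.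
rewrite mxE mpolyC0 subr0 -mpolyXD; congr mpolyX; apply/mnmP => l.
rewrite mnmDE mnmBE mnm1E; case: eqVneq => [<-|_]; last by rewrite subn0 addn0.
by rewrite subnK.
Qed.

Lemma tf_inj : injective tf.
Proof. by move=> a b /eqP; rewrite tofrac_eq => /eqP. Qed.

Lemma tf_neq0 q : loc0 q -> tf q != 0.
Proof.
move=> q0; rewrite tofrac_eq0; apply: contraTneq q0 => ->.
by rewrite /loc0 /mkset mcoeff0 eqxx.
Qed.

Lemma local_ringP v : local_ring (0 : 'rV[K]_n) v <->
  exists p q, loc0 q /\ v = tf p / tf q.
Proof.
split=> [[[p q] /= nq <-]|[p [q [q0 ->]]]].
  by exists p, q; split=> //; apply/eqP => /max_ideal0.
by exists (p, q) => //= /max_ideal0/eqP; rewrite (negPf q0).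
Qed.

(** The local ideal, written with one common denominator. *)
Definition Zf f : set F := [set v | exists p q, [/\ sysI f p, loc0 q & v = tf p / tf q]].

Lemma Zf_add f u v : Zf f u -> Zf f v -> Zf f (u + v).
Proof.
move=> [p [q [Ip q0 ->]]] [p' [q' [Ip' q0' ->]]].
have [_ D Mul] := ideal_sysI f.
exists (p * q' + p' * q), (q * q'); split.
- by apply: D; rewrite mulrC; apply: Mul.
- exact: (mulset_loc0 K n).2.
by rewrite addf_div ?tf_neq0// !tofracM tofracD !tofracM.
Qed.

Lemma local_idealP f v : local_ideal f (0 : 'rV[K]_n) v <-> Zf f v.
Proof.
split=> [[h hl <-]|[p [q [/sysIP[h ->] q0 ->]]]].
  elim/big_ind: _; last 1 first.
  - move=> j _; have /local_ringP[p [q [q0 ->]]] := hl j.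
    exists (p * f j), q; split=> //; last by rewrite tofracM mulrAC.
    by apply/sysIP; exists (fun k => if k == j then p else 0); rewrite (bigD1 j)//= eqxx big1
      ?addr0// => k /negPf ->; rewrite mul0r.
  - exists 0, 1; split; [by case: (ideal_sysI f)|exact: (mulset_loc0 K n).1|].
    by rewrite tofrac0 mul0r.
  exact: Zf_add.
exists (fun j => tf (h j) / tf q).
  by move=> j; apply/local_ringP; exists (h j), q.
rewrite rmorph_sum mulr_suml; apply: eq_bigr => j _; by rewrite /= tofracM mulrAC.
Qed.

Lemma Zf_tf f p : Zf f (tf p) <-> sat loc0 (sysI f) p.
Proof.
split=> [[a [b [Ia b0 e]]]|[q q0 Iq]].
  exists b => //; suff -> : b * p = a by [].
  by apply: tf_inj; rewrite tofracM e mulrC divfK// tf_neq0.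
by exists (q * p), q; split=> //; rewrite tofracM mulrC mulKf ?tf_neq0.
Qed.

(** A basis modulo the saturation stays one in the local ring: a denominator acts bijectively on the
    finite-dimensional quotient, so fractions bring no new classes. *)
Lemma has_mult_of f m : qdim setT (sat loc0 (sysI f)) m -> has_mult f 0 m.
Proof.
move=> qd; have iS := ideal_sat (mulset_loc0 K n) (ideal_sysI f).
have sW := subspace_ideal iS; have [e [_ ie se]] := qdim_basis sW qd.
have linE (c : 'I_m -> K) : \sum_i tf (mpolyC n (c i)) * tf (e i) = tf (comb e c).
  by rewrite rmorph_sum; apply: eq_bigr => i _; rewrite /= -mul_mpolyC tofracM.
exists (fun i => tf (e i)); split.
- move=> i; apply/local_ringP; exists (e i), 1; split; first exact: (mulset_loc0 K n).1.
  by rewrite tofrac1 divr1.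
- move=> v /local_ringP[p [q [q0 ->]]].
  have [|v' Wv'] := finite_surj (phi := fun v => q * v) (linear_mul q) sW _ qd p.
    by move=> w; apply: sat_unit => //; [exact: mulset_loc0|exact: ideal_sysI].
  have [c Wc] := se v' Logic.I; exists c; apply/local_idealP; rewrite linE.
  have : sat loc0 (sysI f) (p - q * comb e c).
    rewrite (_ : _ - _ = (p - q * v') + q * (v' - comb e c)); last by ring.
    by have [_ D Mul] := iS; apply: D => //; apply: Mul.
  move=> /Zf_tf[a [b [Ia b0 eab]]]; exists a, (b * q); split=> //.
    exact: (mulset_loc0 K n).2.
  have -> : tf p / tf q - tf (comb e c) = tf (p - q * comb e c) / tf q.
    by rewrite tofracB tofracM mulrBl mulrAC mulfV ?tf_neq0// mul1r.
  by rewrite eab tofracM invfM mulrA.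
by move=> c /local_idealP; rewrite linE => /Zf_tf/ie.
Qed.

Lemma meval_at0 (p : P) : meval (fun i => (0 : 'rV[K]_n) 0 i) p = at0 p.
Proof.
have [z /max_ideal0 [h _ hz] pE] := at0_split p.
rewrite {1}pE mevalD mevalC -hz raddf_sum big1 ?addr0// => i _ /=.
by rewrite mevalM mevalB mevalXU mevalC !mxE subrr mulr0.
Qed.

Lemma continuous_meval (p : P) (z : 'rV[K]_n) :
  {for z, continuous (fun z : 'rV[K]_n => meval (fun i => z 0 i) p)}.
Proof.
pose W : set P := [set p | {for z, continuous (fun z : 'rV[K]_n => meval (fun i => z 0 i) p)}].
have sW : subspace W.
  split.
    rewrite /W /mkset /prop_for /=.
    have -> : (fun z : 'rV[K]_n => meval (fun i => z 0 i) (0 : P)) = (fun=> 0).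
      by apply/funext => y; rewrite raddf0.
    exact: cst_continuous.
  move=> a u v hu hv; rewrite /W /mkset.
  have -> : (fun z : 'rV[K]_n => meval (fun i => z 0 i) (a *: u + v)) =
      (fun=> a) \* (fun z => meval (fun i => z 0 i) u) + (fun z => meval (fun i => z 0 i) v).
    by apply/funext => y; rewrite mevalD mevalZ.
  apply: continuousD => //; apply: continuousM => //; exact: cst_continuous.
apply: (supp_in_min sW (S := setT)) => // m _; rewrite /W /mkset.
have -> : (fun z : 'rV[K]_n => meval (fun i => z 0 i) X^m) =
    (fun z => \prod_i z 0 i ^+ m i) by apply/funext => y; rewrite mevalX.
elim: (index_enum _) => [|i s IH].
  have -> : (fun z : 'rV[K]_n => \prod_(i <- [::]) z 0 i ^+ m i) = (fun=> 1).
    by apply/funext => y; rewrite big_nil.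
  exact: cst_continuous.
have -> : (fun z : 'rV[K]_n => \prod_(i0 <- i :: s) z 0 i0 ^+ m i0) =
    (fun z => z 0 i ^+ m i) \* (fun z => \prod_(i <- s) z 0 i ^+ m i).
  by apply/funext => y; rewrite big_cons.
apply: continuousM => //.
elim: (m i) => [|k IHk].
  have -> : (fun z : 'rV[K]_n => z 0 i ^+ 0) = (fun=> 1) by apply/funext.
  exact: cst_continuous.
have -> : (fun z : 'rV[K]_n => z 0 i ^+ k.+1) = (fun z => z 0 i) \* (fun z => z 0 i ^+ k).
  by apply/funext => y; rewrite exprS.
apply: continuousM => //; exact: coord_continuous.
Qed.

(** Each power x_l^m has a multiplier, nonzero at the origin, that brings it into the ideal. Near
    the origin the product of these multipliers is nonzero, so a common zero there has all
    coordinates 0. *)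
Lemma isolated_of f m : (forall j, at0 (f j) = 0) ->
  (forall l, sat loc0 (sysI f) (x l ^+ m)) -> isolated_zero f 0.
Proof.
move=> f0 h; split; first by apply/mem_set => j; rewrite meval_at0.
have /choice[q hq] l : exists q, loc0 q /\ sysI f (q * x l ^+ m).
  by have [q q0 Iq] := h l; exists q.
pose Q := \prod_l q l.
have Q0 : at0 Q != 0.
  rewrite rmorph_prod; apply/prodf_neq0 => l _; exact: (hq l).1.
exists [set z : 'rV[K]_n | meval (fun i => z 0 i) Q != 0].
  have : (fun z : 'rV[K]_n => meval (fun i => z 0 i) Q) @ (0 : 'rV[K]_n) --> at0 Q.
    by rewrite -(meval_at0 Q); apply: continuous_meval.
  have nb : nbhs (at0 Q) [set y : K | y != 0].
    apply/nbhs_ballP; exists `|at0 Q| => /=; first by rewrite normr_gt0.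
    move=> y; rewrite -ball_normE /= => lt; apply: contraTneq lt => ->.
    by rewrite subr0 ltxx.
  by move=> /(_ _ nb).
apply/seteqP; split=> [z [/= Qz fz]|z -> /=]; last first.
  by split; [rewrite meval_at0|move=> j; rewrite meval_at0].
apply/rowP => l; rewrite mxE.
have [_ /sysIP[c e]] := hq l.
have := congr1 (meval (fun i => z 0 i)) e.
rewrite mevalM rmorphXn /= mevalXU raddf_sum big1 => [|j _]; last first.
  by rewrite /= mevalM fz mulr0.
move=> /eqP; rewrite mulf_eq0 => /orP[/eqP ql|]; last by rewrite expf_eq0 => /andP[_ /eqP].
by move: Qz; rewrite /Q rmorph_prod (bigD1 l)//= ql mul0r eqxx.
Qed.

End Bridge.

(** A countable set has Lebesgue measure 0, whereas the unit interval has measure 1. *)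
Lemma uncountable_complex (R : realType) : ~ countable [set: R[i]].
Proof.
move=> cC; have cR : countable [set: R].
  have -> : [set: R] = (fun z : R[i] => complex.Re z) @` setT.
    by apply/seteqP; split=> // r _; exists (complex.Complex r 0).
  exact: sub_countable (card_image_le _ _) cC.
have := @countable_lebesgue_measure0 R `[0, 1]%classic.
rewrite lebesgue_measure_itv /= lte_fin ltr01 oppr0 adde0 => /(_ _)/eqP.
move=> H; have : (1 : \bar R)%E == 0%E by apply: H; apply: sub_countable cR; apply: subset_card_le.
by rewrite eqe oner_eq0.
Qed.

(** * Adding 0 and powers of the variables *)

Section Filling.
Variables (R : realType) (K : fieldType) (n d : nat) (t0 : bmultinom n d) (N : nat).
Hypothesis ncK : ~ countable [set: K].
Hypothesis N1 : (1 < N)%N.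
Hypothesis n0 : (0 < n)%N.
Local Notation P := {mpol K[n]}.
Local Notation M := 'NN^n.
Local Notation "'X^' m" := (mpolyX K m) (at level 2, m at level 1).
Local Notation x l := (mpolyX K (mnm1 l) : P).
Local Notation full := ([set: 'I_n]%SET).
Implicit Types (B : 'I_n -> {fset M}) (us : seq K).

Lemma add_zero_mem B j : 0m \in add_zero B j.
Proof. by rewrite in_fsetU in_fset1 eqxx orbT. Qed.

Lemma sub_add_zero B j a : a \in B j -> a \in add_zero B j.
Proof. by move=> aB; rewrite in_fsetU aB. Qed.

Lemma add_zero_deg B : (forall j a, a \in B j -> (mdeg a < d)%N) ->
  forall j a, a \in add_zero B j -> (mdeg a < d)%N.
Proof.
move=> Bd j a; rewrite in_fsetU in_fset1 => /orP[/Bd//|/eqP ->].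
by rewrite mdeg0; apply: leq_ltn_trans (bmdeg t0).
Qed.

Lemma dil_zero B k m : dil R (add_zero B) full k m -> dil R (add_zero B) full k.+1 m.
Proof.
move=> h; rewrite -[m]add0m -add1n; apply: dilD => //.
have -> : 0m = msum full (fun=> 0m) :> M.
  by apply/mnmP => i; rewrite msumE big1 ?mnm0E// => j _; rewrite mnm0E.
by apply: dil_msum => j _; apply: add_zero_mem.
Qed.

Lemma dil_zero_le B k l m : (k <= l)%N -> dil R (add_zero B) full k m ->
  dil R (add_zero B) full l m.
Proof. by move=> /subnKC <-; elim: (l - k)%N => [|p IH]; rewrite ?addn0// addnS => /IH/dil_zero. Qed.

Definition axes B := forall i : 'I_n, exists j c, (0 < c)%N /\ mnm_muln (mnm1 i) c \in B j.

(** A summand containing 0 and a multiple of a unit vector contains that unit vector by convexity;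
    so the dilates exhaust all exponents. *)
Lemma dil_exhaust B k m : axes B -> (mdeg m <= k)%N -> dil R (add_zero B) full k m.
Proof.
move=> ax; elim: k m => [|k IH] m hm.
  have -> : m = 0m by apply/eqP; rewrite -mdeg_eq0 -leqn0.
  exact: dil0.
have [->|m0] := eqVneq m 0m.
  by apply: dil_zero_le (dil0 R (add_zero B) full).
have [i mi] : exists i, (0 < m i)%N.
  apply: contrapT => nb; move/eqP: m0; apply; apply/mnmP => i; rewrite mnm0E.
  by apply/eqP; rewrite -leqn0 leqNgt; apply/negP => bi; apply: nb; exists i.
have mE : m = mnm1 i +m mnm_sub m (mnm1 i).
  by apply/mnmP => j; rewrite mnmDE mnmBE mnm1E; case: eqVneq => [<-|_]; rewrite ?add0n ?subn0// subnKC.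
rewrite mE -add1n; apply: dilD; last first.
  by apply: IH; have := congr1 mdeg mE; rewrite mdegD mdeg1 => e; lia.
have [j [c [c0 cB]]] := ax i; rewrite -[mnm1 i]add0m.
apply: (@dil_segment _ _ _ _ _ _ _ c) => //; first exact: dil_zero (dil0 R _ _).
have -> : 0m +m mnm_muln (mnm1 i) c = msum full (fun l => if l == j then mnm_muln (mnm1 i) c else 0m).
  rewrite add0m; apply/mnmP => l; rewrite msumE (bigD1 j) ?inE//= eqxx big1 ?addn0//.
  by move=> l' /andP[_ /negPf ->]; rewrite mnm0E.
by apply: dil_msum => l _; case: eqP => [->|_]; [apply: sub_add_zero|apply: add_zero_mem].
Qed.

Lemma spec_curve_sub B B' j (u : K) : (forall a, a \in B j -> a \in B' j) ->
  (forall a, a \in B' j -> (mdeg a < d)%N) ->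
  spec u (curve K d N B' j) = spec u (curve K d N B j) +
    \sum_(t : bmultinom n d | (bmnm t \in B' j) && (bmnm t \notin B j))
      u ^+ expo N j t *: X^(bmnm t).
Proof.
move=> BB Bd'; have Bd a : a \in B j -> (mdeg a < d)%N by move=> /BB/Bd'.
rewrite !spec_curve//.
rewrite (bigID (fun t : bmultinom n d => bmnm t \in B j)) /=; congr (_ + _).
by apply: eq_bigl => t; case tB: (bmnm t \in B j); rewrite ?andbF// BB.
Qed.

Variables (A : 'I_n -> {fset M}) (e : nat).
Hypothesis Ad : forall j a, a \in A j -> (mdeg a < d)%N.
Hypothesis e0 : (0 < e)%N.
Hypothesis ed : (e < d)%N.
Local Notation A' := (add_Delta e A).

Lemma Delta_mem l j : mnm_muln (mnm1 l) e \in A' j.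
Proof. by rewrite in_fsetU; apply/orP; right; apply/imfsetP; exists l. Qed.

Lemma axes_Delta : axes A'.
Proof. by move=> i; exists i, e; split=> //; apply: Delta_mem. Qed.

Lemma Delta_deg j a : a \in A' j -> (mdeg a < d)%N.
Proof.
rewrite in_fsetU => /orP[/Ad//|/imfsetP[l _ ->]].
by rewrite mdegMn mdeg1 mul1n.
Qed.

Lemma Delta_ne j : exists a, a \in A' j.
Proof. by exists (mnm_muln (mnm1 (Ordinal n0)) e); apply: Delta_mem. Qed.

(** The coefficient [h l] is an empty sum when the exponent of x_l^e already belongs to [A j]. *)
Lemma spec_Delta j (u : K) : exists h : 'I_n -> K,
  spec u (curve K d N A' j) = spec u (curve K d N A j) + \sum_l h l *: x l ^+ e.
Proof.
rewrite (@spec_curve_sub A A'); last first.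
- exact: Delta_deg.
- by move=> a aA; rewrite in_fsetU aA.
exists (fun l => \sum_(t : bmultinom n d | [&& bmnm t \in A' j, bmnm t \notin A j
    & bmnm t == mnm_muln (mnm1 l) e]) u ^+ expo N j t); congr (_ + _).
have /choice[f fE] (t : bmultinom n d) : exists l, (bmnm t \in A' j) && (bmnm t \notin A j) ->
    bmnm t = mnm_muln (mnm1 l) e.
  case tA: ((bmnm t \in A' j) && (bmnm t \notin A j)); last by exists (Ordinal n0).
  case/andP: tA; rewrite in_fsetU => /orP[->//|/imfsetP[l _ ->] _]; by exists l.
rewrite (partition_big f predT) //=; apply: eq_bigr => l _; rewrite scaler_suml.
apply: eq_big => [t|t /andP[/fE -> /eqP ->]]; last by rewrite mpolyXn.
rewrite -andbA; case h1: (bmnm t \in A' j) => //=; case h2: (bmnm t \notin A j) => //=.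
rewrite {1}fE ?h1 ?h2//; apply/eqP/eqP => [->//|h].
have := congr1 (fun m : M => m l) h; rewrite !mulmnE !mnm1E eqxx mul1n.
by case: eqVneq => // _; rewrite mul0n => ee; move: e0; rewrite -ee.
Qed.

Lemma coord_idealU_eq (I : {set 'I_n}) l :
  @coord_ideal K n (l |: I)%SET = addI (@coord_ideal K n I) (x l).
Proof.
apply/seteqP; split; first exact: coord_idealU.
apply: addI_min; first exact: ideal_coord.
  by apply: supp_in_sub => m [i iI mi]; exists i => //; rewrite in_setU1 iI orbT.
by apply: supp_inX; exists l; rewrite ?in_setU1 ?eqxx// mnm1E eqxx.
Qed.

Lemma nzd_coord (I : {set 'I_n}) l : l \notin I -> nzd [set 1] (@coord_ideal K n I) (x l).
Proof.
move=> lI r; rewrite !sat1 => h m hm.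
have [|i iI] := h (mnm1 l +m m); first by rewrite mcoeffXM.
rewrite mnmDE mnm1E; case: eqVneq => [li|_]; first by rewrite li iI in lI.
by rewrite add0n => mi; exists i.
Qed.

Lemma reg_rcons (S J : set P) fs f : reg S J (rcons fs f) <-> reg S J fs /\ nzd S (gens J fs) f.
Proof.
elim: fs J => [|g fs IH] J /=; first by split=> [[h _]|[_ h]].
rewrite IH; split; first by case=> h1 [h2 h3].
by case=> -[h1 h2] h3.
Qed.

(* A pure power of a variable x_l with l outside I remains a nonzerodivisor modulo x_I and
   the first i members, since these are regular modulo x_I and x_l. *)
Lemma VG_Delta_reg : VG n (fun us => reg [set 1] [set 0] (sys d N A' us)).
Proof.
pose phis := [seq curve K d N A' ([ffun i : 'I_n => i] i) | i <- enum 'I_n].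
have sp : size phis = n by rewrite size_ord_map.
have mS : mulset ([set 1] : set P) := mulset1 _.
(* The bound on [I] leaves a variable outside it, to be added to [I] when the next member is
   treated. *)
have h i : (i <= n)%N -> VG i (fun us => forall I : {set 'I_n}, (#|I| + i <= n)%N ->
    reg [set 1] (@coord_ideal K n I) (specs us (take i phis))).
  elim: i => [|i IH] hi; first by move=> I _; rewrite take0.
  apply: VG_rcons; apply: VG_mono (IH (ltnW hi)) => us su rg.
  apply: cocountable_forall => I.
  have [hI|hI] := boolP (#|I| + i.+1 <= n)%N; last by apply: cocountableT.
  have [l lI] : exists l, l \notin I.
    apply: contrapT => nl; have : (#|I| < n)%N by lia.
    rewrite -[X in (_ < X)%N]card_ord -cardsT ltnNge => /negP; apply; apply: subset_leq_card.
    apply/fintype.subsetP => l _; apply: contrapT => /negP lI; by apply: nl; exists l.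
  pose j := Ordinal hi; pose m := mnm_muln (mnm1 l) e.
  have mE : bmnm (insubd t0 m) = m by apply: bmnm_insubd; apply: (Delta_deg (Delta_mem l j)).
  have pE : phis`_i = curve K d N A' j.
    rewrite (nth_map j) ?size_enum_ord// ffunE; congr (curve _ _ _ _ _).
    exact: (nth_ord_enum j j).
  have cE : phis`_i`_(expo N j (insubd t0 m)) = x l ^+ e.
    by rewrite pE coef_curve ?mE ?Delta_mem// mpolyXn.
  have ig : ideal (gens (@coord_ideal K n I) (specs us (take i phis))).
    exact/ideal_gens/ideal_coord.
  have nl : nzd [set 1] (gens (@coord_ideal K n I) (specs us (take i phis))) (x l).
    apply: nzd_gens => //; [exact: ideal_coord|exact: nzd_coord|].
    rewrite -coord_idealU_eq; apply: rg; rewrite cardsU1 lI; lia.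
  have np : nzd [set 1] (gens (@coord_ideal K n I) (specs us (take i phis))) (x l ^+ e).
    elim: (e) => [|p IHp]; first by move=> r; rewrite expr0 mul1r.
    by rewrite exprS; apply: nzdM.
  rewrite -cE in np; apply: cocountable_mono (cocountable_nzd mS ig np) => u hu _.
  have -> : specs (rcons us u) (take i.+1 phis) = rcons (specs us (take i phis)) (spec u phis`_i).
    rewrite (take_nth 0) ?sp// /specs zip_rcons ?map_rcons//.
    by rewrite su size_takel// sp ltnW.
  by apply/reg_rcons; split=> //; apply: rg; lia.
apply: VG_mono (h n (leqnn n)) => us su /(_ finset.set0); rewrite cards0 add0n => /(_ (leqnn n)).
rewrite take_oversize ?sp//.
suff -> : @coord_ideal K n finset.set0 = [set 0] by [].
apply/seteqP; split; first exact: coord_ideal0.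
by move=> _ ->; apply: sub0; apply: subspace_supp.
Qed.

Lemma rows_sys us i : size us = n -> (i < n)%N -> gens [set 0] (sys d N A' us) (rows d N A' full us)`_i.
Proof.
move=> su il; pose j := Ordinal il.
rewrite (@rows_rest K n d N A' [ffun i => i] us j su).
apply: idealMr; first exact/ideal_gens/ideal0.
apply: gens_mem; first exact: ideal0.
by apply: mem_nth; rewrite size_mixed.
Qed.

(* The hyperplanes x_i = 0 meet the zeros of the perturbed system in the origin only. *)
Lemma VG_Delta_powers : VG n (fun us => forall i, exists m, forall l,
  addI (gens [set 0] (sys d N A' us)) (x i) (x l ^+ m)).
Proof.
(* Outside [Y] the exponents have coordinate [i] equal to 0, hence grow with degree n - 1; and [Y]
   vanishes modulo [x i]. *)
apply: VG_forall => i; pose Y k : set M := [set m | dil R A' full k m /\ (0 < m i)%N].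
have := @VG_reduces R K n d t0 N ncK N1 n0 A' Delta_deg Y ((n * d).+1 ^ n.-1)%N full _ _ _.
move=> H; apply: (VG_mono _ (H _ _ _)) => {H}.
- move=> us su [k1 red]; exists (n * e * k1.+1)%N => l.
  have Sm : dil R A' full k1.+1 (mnm_muln (mnm1 l) (n * e * k1.+1)%N).
    have S1 : dil R A' full 1 (mnm_muln (mnm1 l) (n * e)%N).
      have -> : mnm_muln (mnm1 l) (n * e)%N = msum full (fun=> mnm_muln (mnm1 l) e).
        apply/mnmP => p; rewrite msumE !mulmnE sum_nat_const cardsT card_ord; lia.
      by apply: dil_msum => j _; apply: Delta_mem.
    elim: (k1.+1) => [|k IH].
      rewrite muln0 mulm0n; exact: dil0.
    have -> : mnm_muln (mnm1 l) (n * e * k.+1)%N =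
        mnm_muln (mnm1 l) (n * e)%N +m mnm_muln (mnm1 l) (n * e * k)%N.
      by apply/mnmP => p; rewrite mnmDE !mulmnE; lia.
    by rewrite -add1n; apply: dilD.
  have [u [w [Yu Vw eX]]] := red k1 (leqnn _) _ Sm.
  have iA : ideal (addI (gens [set 0] (sys d N A' us)) (x i)).
    exact/ideal_addI/ideal_gens/ideal0.
  rewrite mpolyXn eX; have [_ D Mul] := iA; apply: D; last first.
    apply: ideal_sum => // j _; apply: idealMr => //; apply: sub_addI.
    exact: rows_sys.
  move: u Yu {eX}; apply: supp_in_min; first exact: subspace_ideal.
  move=> m [_ mi]; have -> : X^m = X^(mnm_sub m (mnm1 i)) * x i :> P.
    rewrite -mpolyXD; congr mpolyX; apply/mnmP => p.
    rewrite mnmDE mnmBE mnm1E; case: eqVneq => [<-|_]; last by rewrite subn0 addn0.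
    by rewrite subnK.
  by apply: (Mul); apply: addI_mem; apply/ideal_gens/ideal0.
- move=> k b m bB [Sm mi]; split; first by apply: dil_step bB Sm.
  by rewrite mnmDE addn_gt0 mi orbT.
- by move=> k m [].
move=> k; have [||s ss hs] := @small_growth R n A' d n0 Delta_deg full i
    (fun k => [set m | dil R A' full k m /\ m i = 0%N]) _ _ k.
- by move=> l m [].
- move=> l m m' [_ mi] [_ mi'] h; apply/mnmP => p.
  by have [->|/h//] := eqVneq p i; rewrite mi mi'.
exists s => // m Sm nY; apply/hs; split=> //; apply/eqP; rewrite -leqn0 leqNgt.
by apply/negP => mi; apply: nY.
Qed.

End Filling.

(** * Generation of the dilates with the origin added *)

Section Generation.
Variables (R : realType) (n d : nat) (t0 : bmultinom n d).
Hypothesis n0 : (0 < n)%N.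
Local Notation M := 'NN^n.
Local Notation full := ([set: 'I_n]%SET).
Variables (A : 'I_n -> {fset M}) (e : nat).
Hypothesis Ad : forall j a, a \in A j -> (mdeg a < d)%N.
Hypothesis e0 : (0 < e)%N.
Hypothesis ed : (e < d)%N.
Local Notation A' := (add_Delta e A).
Local Notation B := (add_zero A').
Local Notation base' := (base t0 A' full).
Local Notation S := (dil R B full).
Local Notation ok g := (forall j, g j \in B j).

(** In this decomposition [L] of the summands choose 0 at place [j0]; they are the room used by
    [slack_add]. *)
Fixpoint slack j0 L k (m : M) : Prop :=
  if L is L'.+1 then exists (g : 'I_n -> M) m' k',
    [/\ k = k'.+1, ok g, g j0 = 0m & m = msum full g +m m' /\ slack j0 L' k' m']
  else S k m.

Lemma dil_choice g : ok g -> S 1 (msum full g).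
Proof. by move=> gB; apply: dil_msum. Qed.

(** Each summand with 0 at place [j0] absorbs one unit vector: it could choose e times that vector
    instead, and convexity gives the point between. *)
Lemma slack_add j0 L k m p : slack j0 L k m -> (mdeg p <= L)%N -> S k (m +m p).
Proof.
elim: L k m p => [|L IH] k m p /=.
  move=> Sm hp; have -> : p = 0m by apply/eqP; rewrite -mdeg_eq0 -leqn0.
  by rewrite addm0.
move=> [g [m' [k' [-> gB g0 [-> sl]]]]] hp.
have [->|p0] := eqVneq p 0m.
  rewrite addm0 -add1n; apply: dilD; first exact: dil_choice.
  by rewrite -[m']addm0; apply: (IH _ _ _ sl); rewrite mdeg0.
have [i pi] : exists i, (0 < p i)%N.
  apply: contrapT => nb; move/eqP: p0; apply; apply/mnmP => i; rewrite mnm0E.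
  by apply/eqP; rewrite -leqn0 leqNgt; apply/negP => bi; apply: nb; exists i.
have pE : p = mnm1 i +m mnm_sub p (mnm1 i).
  by apply/mnmP => j; rewrite mnmDE mnmBE mnm1E; case: eqVneq => [<-|_]; rewrite ?add0n ?subn0// subnKC.
rewrite pE (_ : _ +m _ = (msum full g +m mnm1 i) +m (m' +m mnm_sub p (mnm1 i))); last first.
  by apply/mnmP => j; rewrite !mnmDE; lia.
rewrite -add1n; apply: dilD; last first.
  by apply: (IH _ _ _ sl); have := congr1 mdeg pE; rewrite mdegD mdeg1 => he; lia.
apply: (@dil_segment _ _ _ _ _ _ _ e) => //; first exact: dil_choice.
have -> : msum full g +m mnm_muln (mnm1 i) e =
    msum full (fun l => if l == j0 then mnm_muln (mnm1 i) e else g l).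
  apply/mnmP => l; rewrite mnmDE !msumE (bigD1 j0) ?inE//= [in RHS](bigD1 j0) ?inE//= eqxx.
  rewrite g0 mnm0E add0n addnC; congr (_ + _)%N; apply: eq_bigr => l' /andP[_ /negPf ->].
  by [].
apply: dil_choice => j; case: eqP => [->|_]; last exact: gB.
by apply: sub_add_zero; apply: Delta_mem.
Qed.

Lemma slack_shift j0 L k m g : ok g -> slack j0 L k m ->
  slack j0 L k.+1 (msum full g +m m).
Proof.
move=> gB; elim: L k m => [|L IH] k m /=.
  by move=> Sm; rewrite -add1n; apply: dilD => //; apply: dil_choice.
move=> [g' [m' [k' [-> gB' g0' [-> sl]]]]].
exists g', (msum full g +m m'), k'.+1; split=> //; split; last exact: IH.
by apply/mnmP => j; rewrite !mnmDE; lia.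
Qed.

Definition total (gs : seq {ffun 'I_n -> M}) (s : M) : M :=
  foldr (fun (g : {ffun 'I_n -> M}) acc => msum full g +m acc) s gs.

Lemma slack_list j0 (gs : seq {ffun 'I_n -> M}) L k s : (forall g : {ffun 'I_n -> M}, g \in gs -> ok g) ->
  (L <= count (fun g : {ffun 'I_n -> M} => g j0 == 0m) gs)%N -> S k s ->
  slack j0 L (size gs + k) (total gs s).
Proof.
elim: gs L => [|g gs IH] L gsB /=; first by rewrite leqn0 => /eqP ->.
have gB : ok g by apply: gsB; rewrite inE eqxx.
have gsB' h : h \in gs -> ok h by move=> hgs; apply: gsB; rewrite inE hgs orbT.
have [g0|g0] := eqVneq (g j0) 0m; last first.
  by rewrite add0n addSn => hL Ss; apply: slack_shift => //; apply: IH.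
case: L => [|L]; first by move=> _ Ss; rewrite addSn; apply: slack_shift => //; apply: (IH 0%N).
rewrite add1n ltnS => hL Ss; exists g, (total gs s), (size gs + k)%N; split=> //; split=> //.
exact: IH.
Qed.

Lemma base_msum g : (forall j, g j \in A' j) -> msum full g \in base'.
Proof.
move=> gA; have [|h hA hE] := @choices_ex n d t0 A' full g (Delta_deg Ad ed).
  by move=> j _; apply: gA.
apply/baseP; exists h => //; apply/mnmP => i; rewrite /ms !msumE.
by apply: eq_bigr => j jf; rewrite hE.
Qed.

Lemma extract r k m : (forall j, (#|` B j| <= k)%N) -> S (k + r)%N m ->
  (exists b s, [/\ b \in base', S (k + r).-1 s & m = b +m s]) \/
  exists (gs : seq {ffun 'I_n -> M}) s, [/\ size gs = r, forall g : {ffun 'I_n -> M}, g \in gs -> ok g,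
    forall g : {ffun 'I_n -> M}, g \in gs -> exists j, g j = 0m, S k s & m = total gs s].
Proof.
move=> hk; have k0 : (0 < k)%N.
  apply: leq_trans (hk (Ordinal n0)); rewrite cardfs_gt0; apply/fset0Pn; exists 0m.
  exact: add_zero_mem.
elim: r m => [|r IH] m; first by rewrite addn0 => Sm; right; exists [::], m; split.
rewrite addnS => /(dil_generated (fun j _ => leq_trans (hk j) (leq_addr r k))).
move=> [g [s [gB Ss ->]]].
have gB' : ok g by move=> j; apply: gB; rewrite inE.
have [nz|/existsNP[j /contrapT gj]] := pselect (forall j, g j <> 0m).
  left; exists (msum full g), s; split=> //; apply: base_msum => j.
  by have := gB' j; rewrite in_fsetU in_fset1 => /orP[//|/eqP /nz].
have [[b [s' [bB Ss' ->]]]|[gs [s' [sz gsB gs0 Ss' ->]]]] := IH _ Ss.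
  left; exists b, (msum full g +m s'); split=> //.
    rewrite /= -[X in S X](prednK (_ : 0 < k + r)%N) ?addn_gt0 ?k0// -add1n.
    by apply: dilD => //; apply: dil_choice.
  by apply/mnmP => i; rewrite !mnmDE; lia.
right; exists (finfun g :: gs), s'; split=> //=; first by rewrite sz.
- move=> h; rewrite inE => /orP[/eqP -> l|/gsB//]; by rewrite ffunE.
- by move=> h; rewrite inE => /orP[/eqP ->|/gs0//]; exists j; rewrite ffunE.
congr (_ +m _); apply/mnmP => i; rewrite !msumE; apply: eq_bigr => l _; by rewrite ffunE.
Qed.

Lemma count_zeros (gs : seq {ffun 'I_n -> M}) :
  (forall g : {ffun 'I_n -> M}, g \in gs -> exists j, g j = 0m) ->
  (size gs <= \sum_j count (fun g : {ffun 'I_n -> M} => g j == 0m) gs)%N.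
Proof.
elim: gs => [|g gs IH] h //=; rewrite big_split /= -add1n leq_add//; last first.
  by apply: IH => g' hg'; apply: h; rewrite inE hg' orbT.
have [|j gj] := h g; first by rewrite inE eqxx.
by rewrite (bigD1 j)//= gj eqxx.
Qed.

(* If a choice of vertices contains no zero vertex it can be split off; otherwise, after
   many steps, one summand has so many zero vertices that a whole choice can be absorbed
   by them, thanks to the points e e_i. *)
Lemma generation : exists k0, forall k, (k0 <= k)%N -> forall m, S k.+1 m ->
  translates R B full 0m k.+1 m \/ exists b s, [/\ b \in base', S k s & m = b +m s].
Proof.
(* [L] bounds the degree of a choice, and among [r] choices with a zero vertex some place is zero
   more than [L] times; [c] keeps the degrees in the range of [dil_generated]. *)
pose c := (\max_j #|` B j|)%N; pose L := (n * d)%N; pose r := (n * L.+1)%N.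
exists (c + r)%N => k hk m Sm; pose k1 := (k.+1 - r)%N.
have kE : (k1 + r)%N = k.+1 by rewrite /k1; lia.
have hc j : (#|` B j| <= k1)%N.
  by apply: leq_trans (leq_bigmax (F := fun j => #|` B j|) j) _; rewrite /k1 -/c; lia.
rewrite -kE in Sm; have [[b [s [bB Ss ->]]]|[gs [s [sz gsB gs0 Ss mE]]]] := extract hc Sm.
  by right; exists b, s; split=> //; rewrite kE in Ss.
left; have [j0 hj0] : exists j0, (L < count (fun g : {ffun 'I_n -> M} => g j0 == 0m) gs)%N.
  apply: contrapT => nj; have := count_zeros gs0; rewrite sz leqNgt => /negP; apply.
  apply: (@leq_ltn_trans (\sum_(j < n) L)%N).
    by apply: leq_sum => j _; rewrite leqNgt; apply/negP => hj; apply: nj; exists j.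
  by rewrite sum_nat_const card_ord /r ltn_mul2l n0 ltnSn.
have [g [m' [k' [ek gB g0 [eE sl]]]]] := slack_list gsB hj0 Ss.
have {ek} ek : k' = k by move: ek; rewrite sz addnC kE => -[].
rewrite ek in sl; exists m; last by rewrite add0m.
rewrite mE eE addmC; apply: slack_add sl _.
rewrite /msum (big_morph _ (@mdegD n) (@mdeg0 n)) /L.
apply: (@leq_trans (\sum_(j in full) d)%N).
  by apply: leq_sum => j _; apply: ltnW; apply: (add_zero_deg t0 (Delta_deg Ad ed)) (gB j).
by rewrite sum_nat_const cardsT card_ord.
Qed.

End Generation.

(** * The perturbed system in affine space *)

Section Affine.
Variables (R : realType) (K : fieldType) (n d : nat) (t0 : bmultinom n d) (N : nat).
Hypothesis ncK : ~ countable [set: K].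
Hypothesis N1 : (1 < N)%N.
Hypothesis n0 : (0 < n)%N.
Local Notation P := {mpol K[n]}.
Local Notation M := 'NN^n.
Local Notation "'X^' m" := (mpolyX K m) (at level 2, m at level 1).
Local Notation x l := (mpolyX K (mnm1 l) : P).
Local Notation full := ([set: 'I_n]%SET).
Local Notation idf := ([ffun i : 'I_n => i] : {ffun 'I_n -> 'I_n}).
Variables (A : 'I_n -> {fset M}) (e : nat).
Hypothesis Ad : forall j a, a \in A j -> (mdeg a < d)%N.
Hypothesis e0 : (0 < e)%N.
Hypothesis ed : (e < d)%N.
Local Notation A' := (add_Delta e A).
Local Notation B := (add_zero A').
Local Notation V k := (supp_in (dil R B full k) : set P).
Local Notation T := (colon R B idf).
Implicit Types (us : seq K).

Lemma sat_one (J : set P) : sat (monomials [set 0m]) J = J.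
Proof.
apply/seteqP; split=> r; first by case=> _ [_ -> <-]; rewrite mpolyX0 mul1r.
by move=> Jr; exists 1; [exists 0m; rewrite ?mpolyX0|rewrite mul1r].
Qed.

(** The scheme of the torus with [0m] as only base point: the steps of the filtration are
    inclusions, and reduction to the translate by [0m] makes every element of high degree congruent
    to one of the previous degree. *)
Lemma VG_affine : VG n (fun us => exists D, qdim setT (gens [set 0] (sys d N A' us)) D /\
  exists k2, forall k, (k2 <= k)%N ->
    qdim (V k) (span_multiples (sys d N A' us) T k) D).
Proof.
have Bd := add_zero_deg t0 (Delta_deg Ad ed).
have [k0 gen] := generation R t0 n0 Ad e0 ed.
have bS b : b \in base t0 A' full -> dil R B full 1 b.
  move=> /baseP[g gA ->]; apply: dil_msum => j _; apply: sub_add_zero.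
  by apply: choicesP gA _ _; rewrite inE.
have S01 : dil R B full 1 0m by apply: dil_zero; apply: dil0.
have [C hC] := step_growth R n0 Bd full.
have := @monomial_reduction K n (dil R B full) (translates R B full 0m) (base t0 A' full) k0
  C n.-1 (nseq n (prodc K d N A' full)) ncK (undup_uniq _) _ _ _ gen _ _ _.
rewrite size_nseq => H; apply: (VG_mono _ (H _ _ _ _ _ _)) => {H}; last first.
- by move=> phi; rewrite mem_nseq => /andP[_ /eqP ->]; apply: prodc_B_curve.
- by rewrite prednK.
- by move=> k; apply: hC.
- by move=> [//|k] _ [m Sm ->]; rewrite add0m; apply: dil_zero.
- move=> [//|k] b _ bB [m Sm ->]; exists (b +m m).
    by rewrite -add1n; apply: dilD => //; apply: bS.
  by apply/mnmP => i; rewrite !mnmDE; lia.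
- by move=> k b m bB Sm; rewrite -add1n; apply: dilD => //; apply: bS.
move=> us su [k1 red].
have ax : axes B.
  by move=> i; have [j [c [c0 cA]]] := axes_Delta A e0 i; exists j, c; split=> //; apply: sub_add_zero.
have exh k (m : M) : (mdeg m <= k)%N -> dil R B full k m.
  by move=> hm; apply: (@dil_exhaust R K n N ncK N1 n0 A' k m (axes_Delta A e0) hm).
have deg_colon k (m : M) : (d + mdeg m <= k)%N -> forall i, T i k m.
  move=> hk i c; rewrite /mixed_supp; case: insubP => //= j _ _ cB; apply: exh.
  rewrite mdegD; have := Bd _ _ cB; lia.
have [|||||||||||k2 [D [qd st]]] := @monomial_torus_dimension K n (dil R B full) [:: 0m] 0m
  (sys d N A' us) T [set 0m] k1.
- by rewrite inE.
- by move=> k b m; rewrite inE => /eqP ->; rewrite add0m; apply: dil_zero.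
- by move=> k; have [s [_ hs]] := dil_enum R Bd full k; exists s => m /hs.
- move=> i k b m; rewrite inE => /eqP ->; rewrite add0m => hm c cB; apply: dil_zero.
  exact: hm.
- move=> i k m c; rewrite /sys size_mixed// => il hm hc; apply: hm.
  rewrite (mixed_suppE B idf (Ordinal il)); apply: sub_add_zero; move: hc.
  by rewrite (nth_mixed d N A' idf (Ordinal il) su) => /supp_spec_curve.
- by [].
- by move=> a b -> ->; rewrite /= add0m.
- by move=> b; rewrite inE => /eqP.
- move=> k c L ->; exists (nseq (d + \max_(m <- L) mdeg m)%N 0m).
    by move=> b; rewrite mem_nseq inE => /andP[].
  move=> m mL; exists m; split.
    by rewrite add0m; elim: (_ + _)%N => [|p IH] /=; rewrite ?add0m// -addmA IH.
  apply: deg_colon; rewrite size_nseq.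
  apply: leq_trans (leq_addl k _); rewrite leq_add2l.
  exact: (@leq_bigmax_seq _ L predT (fun m => mdeg m) m mL isT).
- move=> L; exists (nseq (\max_(m <- L) mdeg m)%N 0m).
    by move=> b; rewrite mem_nseq inE => /andP[].
  move=> m mL; rewrite size_nseq.
  have -> : sumM (nseq (\max_(m0 <- L) mdeg m0)%N 0m) +m m = m.
    by elim: (\max_(_ <- _) _)%N => [|p IH] /=; rewrite ?add0m// -addmA IH add0m.
  by apply: exh; apply: (@leq_bigmax_seq _ L predT (fun m => mdeg m) m mL isT).
- move=> k hk b; rewrite inE => /eqP -> m Sm.
  have [u [w [Yu Vw eX]]] := red k hk m Sm; exists u.
    by apply: supp_in_sub Yu => _ [m' Sm' ->]; rewrite add0m.
  rewrite mpolyX0 mul1r eX addrAC subrr add0r.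
  exact: (@rows_mixed R K n d t0 N N1 A' B (fun j a => @sub_add_zero n A' j a) idf us k w su Vw).
rewrite sat_one in qd; exists D; split=> //; exists k2 => k hk.
by have [] := st k hk.
Qed.

(* Outside the origin and outside the torus the perturbed system has no zeros. *)
Lemma sat_inter us r : (forall i, exists m, forall l,
    addI (gens [set 0] (sys d N A' us)) (x i) (x l ^+ m)) ->
  sat (@tori K n) (gens [set 0] (sys d N A' us)) r ->
  sat (@loc0 K n) (gens [set 0] (sys d N A' us)) r -> gens [set 0] (sys d N A' us) r.
Proof.
set I := gens _ _; move=> /choice[m hm] [_ [c _ <-] Ic] [q q0 Iq].
have iI : ideal I by apply/ideal_gens/ideal0.
pose N0 := (\max_i m i)%N.
have iC := ideal_colon r iI.
have h i l : sat [set 1] (addI I (x i)) (x l ^+ N0).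
  rewrite sat1 -(subnKC (leq_bigmax i : (m i <= N0)%N)) exprD.
  by apply: idealMr; [exact: ideal_addI|exact: hm].
have h' l : addI I X^c (x l ^+ (N0 * mdeg c)).
  rewrite -[addI _ _]sat1.
  apply: (@sat_addI_monomial K n N N1 n0 [set 1] I finset.set0) => //; first exact: mulset1.
  by move=> i; rewrite inE.
suff : [set s | I (s * r)] 1 by rewrite /mkset mul1r.
apply: (@unit_mod_powers K n [set s | I (s * r)] (N0 * mdeg c) q) => // l.
have [j [a [Ij ->]]] := h' l; rewrite /mkset mulrDl -mulrA.
have [_ D Mul] := iI; apply: D; first exact: idealMr.
exact: Mul.
Qed.

(** By [sat_inter] the global quotient of the perturbed system embeds into the sum of its parts on
    the torus and at the origin. The system with constants degenerates to it at t = 1, so its torus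
    zeros are no more numerous. *)
Lemma torus_le us del del0 m : size us = n ->
  stable R d N A' us idf del -> stable R d N B us idf del0 ->
  reg (@tori K n) [set 0] (sys d N B us) ->
  (exists D, qdim setT (gens [set 0] (sys d N A' us)) D /\
    exists k2, forall k, (k2 <= k)%N ->
    qdim (V k) (span_multiples (sys d N A' us) T k) D) ->
  (forall i, exists m, forall l, addI (gens [set 0] (sys d N A' us)) (x i) (x l ^+ m)) ->
  qdim setT (sat (@loc0 K n) (gens [set 0] (sys d N A' us))) m ->
  (del0 <= del + m)%N.
Proof.
move=> su [[_ ld] _] [_ [k0 st0]] rg [D [[gD _] [k2 st2]]] pw [_ lm].
have Bd := add_zero_deg t0 (Delta_deg Ad ed).
set I := gens [set 0] (sys d N A' us) in ld gD pw lm.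
have iI : ideal I by apply/ideal_gens/ideal0.
have iT : ideal (sat (@tori K n) I) by apply: ideal_sat => //; apply: mulset_tori.
have sL : subspace (sat (@loc0 K n) I).
  by apply/subspace_ideal/ideal_sat => //; apply: mulset_loc0.
have sT := subspace_ideal iT.
have Dle : (D <= del + m)%N.
  apply: (steinitz (subspace_ideal iI) gD).
  apply: dle_trans ld _ => //; have := dle_sub sL sT (@subsetT _ _) lm.
  move=> [b Tb sb]; exists b => // v Tv; have [c Lc] := sb v Tv; exists c.
  apply: sat_inter => //; apply: (subB sT) => //; exact: sub_comb.
apply: leq_trans Dle.
pose k := maxn k0 k2; have [[ge _] co] := st0 k (leq_maxl _ _).
have [_ le] := st2 k (leq_maxr _ _).
have sV : subspace (V k) by apply: subspace_supp.
have {ge} [b Vb ib] := dge_mono sV (fun _ h => h) co ge.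
pose g (i : 'I_n) := spec us`_i (curve K d N B i); pose f (i : 'I_n) := spec us`_i (curve K d N A' i).
have at0E : at0 (segment g f) = sys d N B us by rewrite at0_segment sysE.
have mT := @mulset_tori K n.
have nX : nzd (constS (@tori K n)) (gens [set 0] (segment g f)) 'X.
  by apply: nzd_deformation => //; rewrite at0E.
apply: (compare_dimensions (T := fun i => T i k) ncK mT mT nX nX _ Vb).
- exact: (qdim_dil R K Bd k).
- by move=> c; rewrite at0E => h _; apply: ib.
- move=> i t v; rewrite size_segment => il hv; rewrite (spec_segment g f t (Ordinal il)).
  have gV : V k (g (Ordinal il) * v).
    by apply: (@supp_curve_mul _ _ _ _ _ _ (Ordinal il) _ (Ordinal il) k idf v _ hv); rewrite ffunE.
  have fV : V k (f (Ordinal il) * v).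
    apply: supp_in_M hv _; first by move=> c hc; apply: supp_spec_curve hc.
    move=> a c aA hc; apply: hc; rewrite (mixed_suppE B idf (Ordinal il)) ffunE.
    exact: sub_add_zero.
  rewrite mulrDl -scalerAl mulrBl.
  by apply: (subD sV) => //; apply: (subZ sV); apply: (subB sV).
apply: dle_mono le => z [w [hw ->]]; exists w; split=> //.
rewrite /sys size_mixed// size_segment; apply: eq_bigr => i _.
by rewrite spec_segment scale1r addrCA subrr addr0 nth_mixed// ffunE.
Qed.

End Affine.

(** * Perturbations of high order at the origin *)

Section LocalPath.
Variables (K : numFieldType) (n : nat).
Local Notation P := {mpol K[n]}.
Local Notation x l := (mpolyX K (mnm1 l) : P).
Local Notation at0 := (@mcoeff n K (mnm0)).
Local Notation loc0 := (@loc0 K n).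

(** The factor [q] is a unit after localization. Two ideals with equal saturation are allowed
    because the scaled members generate a different ideal at each step of the induction. *)
Lemma reg_scale (S J J' : set P) q fs : mulset S -> ideal J -> ideal J' -> S q ->
  (forall r, sat S J r <-> sat S J' r) -> reg S J fs -> reg S J' [seq q * f | f <- fs].
Proof.
move=> mS; elim: fs J J' => //= f fs IH J J' iJ iJ' Sq h [nf rf]; split.
  move=> r; rewrite -mulrA => /(sat_unit mS iJ' Sq) /h /nf; exact: (h r).1.
apply: (IH (addI J f)) => //; [exact: ideal_addI|exact: ideal_addI|move=> r; split].
  move=> [p Sp [j [c [Jj e]]]].
  have [q1 Sq1 Jj'] : sat S J' j by apply/h; apply: sub_sat.
  exists (q * q1 * p); first by case: mS => _ SM; apply: (SM) => //; apply: SM.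
  exists (q * (q1 * j)), (q1 * c); split; first by case: iJ' => _ _; apply.
  by rewrite -!mulrA e; ring.
move=> [p Sp [j [c [Jj e]]]].
have [q1 Sq1 Jj'] : sat S J j by apply/h; apply: sub_sat.
exists (q1 * p); first by case: mS => _; apply.
exists (q1 * j), (q1 * c * q); split=> //; rewrite -mulrA e; ring.
Qed.

(** With a denominator, x_l^m is a combination of [f], so x_l^e is one with coefficients divisible
    by x_l^(e - m). These vanish at the origin since m < e, whence [U] is there a scalar matrix. *)
Lemma perturb (f f' : 'I_n -> P) m e (h : 'I_n -> 'I_n -> K) :
  (forall l, sat loc0 (sysI f) (x l ^+ m)) -> (m < e)%N ->
  (forall i, f' i = f i + \sum_l h i l *: x l ^+ e) ->
  exists q (U : 'M[P]_n), [/\ loc0 q, forall i, f' i * q = \sum_j U i j * f j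
    & forall i j, at0 (U i j) = at0 q *+ (i == j)].
Proof.
move=> hs me hf.
have /choice[q0 hq0] l : exists q, loc0 q /\ sysI f (q * x l ^+ m).
  by have [q lq Iq] := hs l; exists q.
pose q := \prod_l q0 l.
have lq : loc0 q.
  rewrite /loc0 /mkset rmorph_prod; apply/prodf_neq0 => l _; exact: (hq0 l).1.
have /choice[c hc] l : exists c : 'I_n -> P, q * x l ^+ m = \sum_j c j * f j.
  apply/sysIP; rewrite /q (bigD1 l)//= mulrAC.
  by apply: idealMr; [exact: ideal_sysI|exact: (hq0 l).2].
pose z l := x l ^+ (e - m).
have z0 l : at0 (z l) = 0.
  by rewrite /z rmorphXn /= at0_x expr0n subn_eq0 leqNgt me.
exists q, (\matrix_(i, j) (q *+ (i == j) + \sum_l h i l *: (z l * c l j))); split=> //.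
  move=> i; rewrite hf mulrDl.
  under [RHS]eq_bigr do rewrite mxE mulrDl.
  rewrite big_split /=; congr (_ + _).
    rewrite (bigD1 i)//= eqxx mulr1n mulrC big1 ?addr0// => j.
    by rewrite eq_sym => /negPf ->; rewrite mulr0n mul0r.
  rewrite mulr_suml; under [RHS]eq_bigr do rewrite mulr_suml.
  rewrite exchange_big /=; apply: eq_bigr => l _.
  transitivity (h i l *: (z l * (q * x l ^+ m))).
    rewrite -scalerAl; congr (_ *: _); rewrite /z -{1}(subnK (ltnW me)) exprD; ring.
  rewrite hc mulr_sumr scaler_sumr; apply: eq_bigr => j _.
  by rewrite -scalerAl mulrA.
move=> i j; rewrite mxE mcoeffD raddfMn raddf_sum /= big1 ?addr0// => l _.
by rewrite mcoeffZ at0M z0 mul0r mulr0.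
Qed.

(** [U] is invertible at the origin, so both systems generate the same local ideal. *)
Lemma sat_perturb (f f' : 'I_n -> P) q (U : 'M[P]_n) : loc0 q ->
  (forall i, f' i * q = \sum_j U i j * f j) ->
  (forall i j, at0 (U i j) = at0 q *+ (i == j)) ->
  sat loc0 (sysI f') = sat loc0 (sysI f).
Proof.
move=> lq e U0; have mS := @mulset_loc0 K n.
have mem (g : 'I_n -> P) i : sysI g (g i).
  by apply: gens_mem; [exact: ideal0|apply: map_f; rewrite mem_enum].
have sub (g g' : 'I_n -> P) : (forall i, sat loc0 (sysI g') (g i)) ->
    sat loc0 (sysI g) `<=` sat loc0 (sysI g').
  move=> h r hr; apply: sat_sat => //; first exact: ideal_sysI.
  move: r hr; apply: sat_mono; apply: gens_min.
  - exact/ideal_sat/ideal_sysI.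
  - by move=> _ ->; have [] := ideal_sat mS (ideal_sysI g').
  by move=> _ /mapP[i _ ->].
apply/seteqP; split; apply: sub => i.
  exists q => //; rewrite mulrC e; apply: ideal_sum; first exact: ideal_sysI.
  by move=> j _; have [_ _ Mul] := ideal_sysI f; apply: Mul.
apply: (det_trick (ideal_sysI f') lq e U0) => j; apply: sub_sat => //.
exact: ideal_sysI.
Qed.

(* Multiplying the family f + s (g - f) by U turns it into a deformation of the regular
   sequence f'. *)
Lemma nzd_path (f g f' : 'I_n -> P) q (U : 'M[P]_n) : loc0 q ->
  (forall i, f' i * q = \sum_j U i j * f j) ->
  (forall i j, at0 (U i j) = at0 q *+ (i == j)) ->
  reg loc0 [set 0] [seq f' i | i <- enum 'I_n] ->
  nzd (constS loc0) (gens [set 0] (segment f g)) 'X.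
Proof.
move=> lq e U0 rg; have mS := @mulset_loc0 K n.
pose g' i := \sum_j U i j * g j; pose psi := segment (fun i => q * f' i) g'.
have nX : nzd (constS loc0) (gens [set 0] psi) 'X.
  apply: nzd_deformation => //; rewrite at0_segment (map_comp (fun y => q * y) f').
  exact: (reg_scale mS (ideal0 _) (ideal0 _) lq _ rg).
pose phi j : {poly P} := (f j)%:P + 'X * (g j - f j)%:P.
have iG (ps : seq {poly P}) : ideal (gens [set 0] ps) by apply/ideal_gens/ideal0.
have psiE i : (q * f' i)%:P + 'X * (g' i - q * f' i)%:P = \sum_j (U i j)%:P * phi j.
  under eq_bigr do rewrite mulrDr mulrCA -!polyCM.
  rewrite big_split /= -rmorph_sum -mulr_sumr -rmorph_sum /=; congr (_%:P + 'X * _%:P).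
    by rewrite mulrC e.
  rewrite /g' [q * _]mulrC e -sumrB; apply: eq_bigr => j _; by rewrite mulrBr.
have psi_mem i : gens [set 0] psi (\sum_j (U i j)%:P * phi j).
  rewrite -psiE; apply: gens_mem; first exact: ideal0.
  by apply/mapP; exists i; rewrite ?mem_enum.
have Dphi j : gens [set 0] psi ((\det U)%:P * phi j).
  have -> : (\det U)%:P = \det (map_mx polyC U) by rewrite det_map_mx.
  apply: (det_mem (iG psi)) => i; under eq_bigr do rewrite mxE.
  exact: psi_mem.
move=> r [_ [p p0 <-] h].
have iC : ideal [set y | gens [set 0] psi ((\det U)%:P * y)].
  have [I0 D Mul] := iG psi; split; rewrite /mkset.
  - by rewrite mulr0.
  - by move=> y y' hy hy'; rewrite mulrDr; apply: D.
  by move=> a y hy; rewrite mulrCA; apply: Mul.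
have sub : gens [set 0] (segment f g) `<=` [set y | gens [set 0] psi ((\det U)%:P * y)].
  apply: gens_min => //; first by move=> _ ->; have [] := iC.
  by move=> _ /mapP[j _ ->]; apply: Dphi.
have [|_ [p' p0' <-] h'] := nX r.
  exists ((\det U * p)%:P); last by rewrite polyCM -mulrA; apply: sub.
  exists (\det U * p) => //; case: mS => _; apply => //; exact: (det_loc0 lq U0).
exists p'%:P; first by exists p'.
suff sub2 : gens [set 0] psi `<=` gens [set 0] (segment f g) by apply: sub2.
apply: gens_min; [exact: iG|by move=> _ ->; have [] := iG (segment f g)|].
move=> _ /mapP[i _ ->]; rewrite psiE.
apply: (ideal_sum (I := 'I_n)) => [|j _]; first exact: iG.
have [_ _ Mul] := iG (segment f g); apply: (Mul); apply: gens_mem; first exact: ideal0.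
by apply/mapP; exists j; rewrite ?mem_enum.
Qed.

End LocalPath.

(** * Multiplicity and mixed volumes compared *)

Section Lower.
Variables (R : realType) (K : numFieldType) (n d : nat) (t0 : bmultinom n d) (N : nat).
Hypothesis ncK : ~ countable [set: K].
Hypothesis N1 : (1 < N)%N.
Hypothesis n0 : (0 < n)%N.
Local Notation P := {mpol K[n]}.
Local Notation M := 'NN^n.
Local Notation x l := (mpolyX K (mnm1 l) : P).
Local Notation full := ([set: 'I_n]%SET).
Local Notation idf := ([ffun i : 'I_n => i] : {ffun 'I_n -> 'I_n}).
Local Notation loc0 := (@loc0 K n).
Implicit Types (us : seq K) (A : 'I_n -> {fset M}).

Definition member A us (i : 'I_n) : P := spec us`_i (curve K d N A i).

Lemma sys_member A us : size us = n -> sys d N A us = [seq member A us i | i <- enum 'I_n].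
Proof. exact: sysE. Qed.

(** The quotients on the torus and at the origin are independent, so [del + m] classes survive
    modulo the intersection of both saturations; adding constants deforms all of them into classes
    on the torus. *)
Lemma local_le A us del del0 m : (forall j a, a \in A j -> (mdeg a < d)%N) -> axes A ->
  size us = n -> stable R d N A us idf del -> stable R d N (add_zero A) us idf del0 ->
  reg (@tori K n) [set 0] (sys d N A us) ->
  nzd (constS loc0) (gens [set 0] (segment (member A us) (member (add_zero A) us))) 'X ->
  qdim setT (sat loc0 (gens [set 0] (sys d N A us))) m ->
  (del + m <= del0)%N.
Proof.
move=> Ad ax su [qd _] [_ [k0 st0]] rg nX0 qm.
have Bd := add_zero_deg t0 Ad.
set I := gens [set 0] (sys d N A us) in qd qm.
have iI : ideal I by apply/ideal_gens/ideal0.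
have iT : ideal (sat (@tori K n) I) by apply: ideal_sat => //; apply: mulset_tori.
have iL : ideal (sat loc0 I) by apply: ideal_sat => //; apply: mulset_loc0.
have sT := subspace_ideal iT; have sL := subspace_ideal iL.
pose l0 := Ordinal n0.
(* Chinese remainders: [x l0 ^+ m] is invertible on the torus and lies in the local ideal at the
   origin. *)
have split_ r : exists2 w, sat (@tori K n) I w & sat loc0 I (r - w).
  have [|v Tv] := finite_surj (linear_mul (x l0 ^+ m)) sT _ qd r.
    move=> v; apply: sat_unit => //; first exact: mulset_tori.
    by exists (mnm_muln (mnm1 l0) m) => //; rewrite mpolyXn.
  exists (r - x l0 ^+ m * v) => //; rewrite opprB addrCA subrr addr0.
  by apply: idealMr => //; apply: power_in_sat => //; case: qm.
have gL : dge (sat (@tori K n) I) (sat (@tori K n) I `&` sat loc0 I) m.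
  have [[b _ ib] _] := qm; have /choice[w hw] i : exists w, sat (@tori K n) I w /\ sat loc0 I (b i - w).
    by have [w Tw Lw] := split_ (b i); exists w.
  exists w => [i|c [_ Lc]]; first exact: (hw i).1.
  apply: ib; apply: (subC sL) Lc; rewrite /comb -sumrB.
  by apply: sub_sum => // i _; rewrite -scalerBr; apply: (subZ sL); apply: (hw i).2.
have [b _ ib] := dge_trans sT (fun v => @proj1 _ _) (@subsetT _ _) qd.1 gL.
have [k0' hk0'] : exists k0, forall k, (k0 <= k)%N ->
    forall i, supp_in (dil R (add_zero A) full k) (b i).
  exists (\max_i msize (b i)) => k hk i m'; rewrite -mcoeff_msupp => /msize_mdeg_lt lt.
  apply: (@dil_exhaust R K n N ncK N1 n0 A k m' ax); apply: ltnW; apply: leq_trans lt _.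
  exact: leq_trans (leq_bigmax (F := fun i => msize (b i)) i) hk.
pose k := maxn k0 k0'; have [[_ le] _] := st0 k (leq_maxl _ _).
have sV : subspace (supp_in (dil R (add_zero A) full k) : set P) by apply: subspace_supp.
have mT := @mulset_tori K n.
have at0E : at0 (segment (member A us) (member (add_zero A) us)) = sys d N A us.
  by rewrite at0_segment sys_member.
have nX : nzd (constS (@tori K n)) (gens [set 0] (segment (member A us) (member (add_zero A) us))) 'X.
  by apply: nzd_deformation => //; rewrite at0E.
apply: (compare_dimensions (T := fun i => colon R (add_zero A) idf i k) ncK mT
  (@mulset_loc0 K n) nX nX0 (qdim_dil R K Bd k) (hk0' k (leq_maxr _ _))).
- by move=> c; rewrite at0E => h1 h2; apply: ib.
- move=> i t v; rewrite size_segment => il hv; rewrite (spec_segment _ _ t (Ordinal il)).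
  have gV : supp_in (dil R (add_zero A) full k) (member (add_zero A) us (Ordinal il) * v).
    by apply: (@supp_curve_mul _ _ _ _ _ _ (Ordinal il) _ (Ordinal il) k idf v _ hv); rewrite ffunE.
  have fV : supp_in (dil R (add_zero A) full k) (member A us (Ordinal il) * v).
    apply: supp_in_M hv _; first by move=> c hc; apply: supp_spec_curve hc.
    move=> a c aA hc; apply: hc; rewrite (mixed_suppE (add_zero A) idf (Ordinal il)) ffunE.
    exact: sub_add_zero.
  rewrite mulrDl -scalerAl mulrBl.
  by apply: (subD sV) => //; apply: (subZ sV); apply: (subB sV).
apply: dle_mono le => z [w [hw ->]]; exists w; split=> //.
rewrite size_mixed// size_segment; apply: eq_bigr => i _.
by rewrite spec_segment scale1r addrCA subrr addr0 nth_mixed// ffunE.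
Qed.

Variables (A : 'I_n -> {fset M}) (e m : nat).
Hypothesis Ad : forall j a, a \in A j -> (mdeg a < d)%N.
Hypothesis Ane : forall j, exists a, a \in A j.
Hypothesis axA : axes A.
Hypothesis me : (m < e)%N.
Hypothesis ed : (e < d)%N.
Local Notation A' := (add_Delta e A).

Lemma VG_reg_sys B : (forall j a, a \in B j -> (mdeg a < d)%N) ->
  (forall j, exists a, a \in B j) -> VG n (fun us => reg (@tori K n) [set 0] (sys d N B us)).
Proof.
move=> Bd Bne; apply: VG_mono (VG_fam_reg K t0 N1 Bd Bne) => us su rg.
by rewrite /sys famrows_mixed; apply: rg.
Qed.

(** The multiplicity is the same before and after perturbation. For the perturbed supports
    [local_le] and [torus_le] give equality; for the original ones [local_le] alone gives an
    inequality, whose defect is [k]. *)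
Theorem VG_multiplicity : VG n (fun us =>
  qdim setT (sat loc0 (gens [set 0] (sys d N A us))) m ->
  m%:R = MV R (add_zero A') - MV R A' /\
  exists k : nat, MV R (add_zero A) - MV R A = (m + k)%:R).
Proof.
have e0 : (0 < e)%N by apply: leq_ltn_trans me.
have A'd := Delta_deg Ad ed; have A'ne := Delta_ne n0 A e.
have Bd := add_zero_deg t0 Ad; have B'd := add_zero_deg t0 A'd.
have zne (B : 'I_n -> {fset M}) j : exists a, a \in add_zero B j by exists mnm0; apply: add_zero_mem.
have mv B : (forall j a, a \in B j -> (mdeg a < d)%N) -> (forall j, exists a, a \in B j) ->
    VG n (fun us => exists2 delta, stable R d N B us idf delta & delta%:R = MV R B).
  by move=> Bd' Bne; apply: (VG_mixed_volume R t0 ncK N1 n0 Bd' Bne).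
have v1 := VG_and (mv A Ad Ane) (mv (add_zero A) Bd (zne A)).
have v2 := VG_and (mv A' A'd A'ne) (mv (add_zero A') B'd (zne A')).
have v3 := VG_and (VG_reg_sys Ad Ane) (VG_and (VG_reg_sys A'd A'ne) (VG_reg_sys B'd (zne A'))).
have v4 := VG_and (VG_Delta_reg t0 ncK N1 n0 Ad e0 ed)
  (VG_and (VG_affine R t0 ncK N1 n0 Ad e0 ed) (VG_Delta_powers R t0 ncK N1 n0 Ad e0 ed)).
have := VG_and (VG_and v1 v2) (VG_and v3 v4).
apply: VG_mono => us su [[[[del sd <-] [del0 sd0 <-]] [[del' sd' <-] [del0' sd0' <-]]]
  [[rA [rA' rB']] [rD [aff pw]]]] qm.
have sysm B : gens [set 0] (sys d N B us) = sysI (member B us) by rewrite sys_member.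
have /choice[h hh] (i : 'I_n) : exists h : 'I_n -> K,
    member A' us i = member A us i + \sum_l h l *: x l ^+ e.
  have [h hE] := spec_Delta N n0 Ad e0 ed i us`_i.
  by exists h; rewrite /member hE.
have pm l : sat loc0 (sysI (member A us)) (x l ^+ m).
  by rewrite -sysm; apply: power_in_sat; [apply/ideal_gens/ideal0|case: qm].
have [q [U [lq eU U0]]] := perturb pm me hh.
have rD' : reg loc0 [set 0] [seq member A' us i | i <- enum 'I_n].
  by rewrite -sys_member//; apply: reg1.
have nX := @nzd_path _ _ _ (member (add_zero A) us) _ q U lq eU U0 rD'.
have nX' : nzd (constS loc0) (gens [set 0] (segment (member A' us) (member (add_zero A') us))) 'X.
  by apply: nzd_deformation; [exact: mulset_loc0|rewrite at0_segment].
have qm' : qdim setT (sat loc0 (gens [set 0] (sys d N A' us))) m.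
  by rewrite sysm (sat_perturb lq eU U0) -sysm.
have l1 := local_le Ad axA su sd sd0 rA nX qm.
have l2 := local_le A'd (axes_Delta A e0) su sd' sd0' rA' nX' qm'.
have l3 := torus_le t0 ncK N1 n0 Ad ed su sd' sd0' rB' aff pw qm'.
split.
  have -> : del0' = (del' + m)%N by apply/eqP; rewrite eqn_leq l3.
  by rewrite natrD addrAC subrr add0r.
exists (del0 - (del + m))%N; rewrite -natrB; last by apply: leq_trans l1; apply: leq_addr.
congr _%:R; lia.
Qed.

End Lower.

(** * Semicontinuity of the multiplicity *)

Section ZariskiOpen.
Variables (K : numFieldType) (n : nat) (A : 'I_n -> {fset 'NN^n}).
Hypothesis n0 : (0 < n)%N.
Local Notation P := {mpol K[n]}.
Local Notation M := 'NN^n.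
Local Notation "'X^' m" := (mpolyX K m) (at level 2, m at level 1).
Local Notation x l := (mpolyX K (mnm1 l) : P).
Local Notation loc0 := (@loc0 K n).
Local Notation T := (coef_index A).
Local Notation Q := {mpol K[#|T|]}.
Implicit Types (c : T -> K).

Definition high N : set P := supp_in [set m | exists l, (N <= m l)%N].

Lemma ideal_high N : ideal (high N).
Proof.
have sI : subspace (high N) by apply: subspace_supp.
split; [exact: sub0|exact: subD|move=> a r hr].
have aT : supp_in setT a by [].
apply: supp_in_M aT hr _ => b c _ [l hl]; exists l.
by rewrite mnmDE; apply: leq_trans hl (leq_addl _ _).
Qed.

Lemma high_x N l : high N (x l ^+ N).
Proof. by rewrite mpolyXn; apply: supp_inX; exists l; rewrite mulmnE mnm1E eqxx mul1n. Qed.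

Lemma high_min N (I : set P) : ideal I -> (forall l, I (x l ^+ N)) -> high N `<=` I.
Proof.
move=> iI h; apply: supp_in_min; first exact: subspace_ideal.
by move=> m [l hl]; apply: divide_power hl (h l).
Qed.

Definition low N (b : {ffun 'I_n -> 'I_N}) : M := Multinom [tuple (b i : nat) | i < n].

Lemma high_low N r : (forall b : {ffun 'I_n -> 'I_N}, mcoeff (low b) r = 0) -> high N r.
Proof.
move=> h m hm; apply: contrapT => nl.
have lt i : (m i < N)%N by rewrite ltnNge; apply/negP => hi; apply: nl; exists i.
have mE : m = low [ffun i => Ordinal (lt i)].
  by apply/mnmP => i; rewrite multinomE tnth_mktuple ffunE.
by rewrite mE h eqxx in hm.
Qed.

Lemma low_high N r (b : {ffun 'I_n -> 'I_N}) : high N r -> mcoeff (low b) r = 0.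
Proof.
move=> h; apply/eqP/negP => /negP /h [l]; rewrite multinomE tnth_mktuple leqNgt.
by rewrite ltn_ord.
Qed.

(** Adding the N-th powers of the variables makes the local problem finite-dimensional, with data
    polynomial in the coefficients [c]. *)
Definition truncated c N := gens (sysI (sparse_system c)) (@powers K n N).

Lemma ideal_truncated c N : ideal (truncated c N).
Proof. exact/ideal_gens/ideal_sysI. Qed.

Lemma truncated_x c N l : truncated c N (x l ^+ N).
Proof.
by apply: gens_mem; [exact: ideal_sysI|apply: map_f; rewrite mem_enum].
Qed.

Lemma truncatedP c N r : truncated c N r -> exists h : 'I_n -> P,
  high N (r - \sum_j h j * sparse_system c j).
Proof.
move=> /(powersP (ideal_sysI _)) [_ /sysIP[h ->] [g ->]]; exists h.
rewrite addrAC subrr add0r; apply: ideal_sum; first exact: ideal_high.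
by move=> l _; have [_ _ Mul] := ideal_high N; apply: Mul; apply: high_x.
Qed.

(** A quotient of dimension at most m kills the m-th powers although only those of order m + 1 were
    imposed; by Nakayama they already lie in the local ideal, and the truncation changes nothing. *)
Lemma local_of_truncated c m : dle setT (truncated c m.+1) m ->
  dle setT (sat loc0 (sysI (sparse_system c))) m.
Proof.
move=> le; have iT := ideal_truncated c m.+1; have mS := @mulset_loc0 K n.
have sub := sat_local n0 iT (truncated_x c m.+1).
have pw l : truncated c m.+1 (x l ^+ m).
  apply: sub; apply: power_in_sat => //; apply: dle_mono le; exact: sub_sat.
have hs := nakayama_powers (ideal_sysI _) pw.
apply: dle_mono le; apply: gens_min.
- exact/ideal_sat/ideal_sysI.
- exact/sub_sat/ideal_sysI.
move=> _ /mapP[l _ ->]; rewrite exprS; have [_ _ Mul] := ideal_sat mS (ideal_sysI (sparse_system c)).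
exact: Mul.
Qed.

Lemma truncated_of_local c m : dle setT (sat loc0 (sysI (sparse_system c))) m ->
  dle setT (truncated c m.+1) m.
Proof.
move=> le; apply: dle_mono le => r [q q0 hq].
apply: (sat_local n0 (ideal_truncated c m.+1) (truncated_x c m.+1)).
by exists q => //; apply: sub_gens.
Qed.

(** A coefficient of the combination of the system with multipliers [h], as a linear form in the
    unknown coefficients of the system. *)
Definition generic_coef (h : 'I_n -> P) (m : M) : Q :=
  \sum_(t : T) mcoeff m (h (tag t) * X^(val (tagged t))) *: mpolyX K (mnm1 (enum_rank t)).

Lemma generic_coefE h m c : meval (fun k => c (enum_val k)) (generic_coef h m) =
  mcoeff m (\sum_j h j * sparse_system c j).
Proof.
rewrite /generic_coef raddf_sum /= [RHS]raddf_sum /=.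
transitivity (\sum_(t : T) c t * mcoeff m (h (tag t) * X^(val (tagged t)))).
  by apply: eq_bigr => t _; rewrite mevalZ mevalXU enum_rankK mulrC.
pose F j (a : A j) : K := c (Tagged (fun j => A j) a) * mcoeff m (h j * X^(val a)).
transitivity (\sum_(t : T | predT (tag t) && predT (tagged t)) F (tag t) (tagged t)).
  by apply: eq_big => [//|[j a] _].
rewrite -(sig_big_dep predT (fun j => predT) F).
apply: eq_bigr => j _; rewrite /sparse_system mulr_sumr raddf_sum /=.
by apply: eq_bigr => a _; rewrite -scalerAr mcoeffZ.
Qed.

(* Near a given system the local multiplicity does not increase: it is bounded by the
   nonvanishing of a minor that expresses dim K[x] / ((f) + (x_l^(m+1))) <= m. *)
Lemma mult_open c0 m : dle setT (sat loc0 (sysI (sparse_system c0))) m ->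
  exists2 p : Q, meval (fun k => c0 (enum_val k)) p != 0 & forall c,
    meval (fun k => c (enum_val k)) p != 0 ->
    dle setT (sat loc0 (sysI (sparse_system c))) m.
Proof.
move=> /truncated_of_local le; set N := m.+1 in le.
have iH := ideal_high N; have sH := subspace_ideal iH.
have [w [gw lw]] := finite_of_powers n0 iH (fun l => @high_x N l).
have sJ c := subspace_ideal (ideal_truncated c N).
have HJ c : high N `<=` truncated c N.
  by apply: high_min (ideal_truncated c N) _ => l; apply: truncated_x.
have [r _ [gr lr]] := dim_exists sH (dle_sub sH (sJ c0) (@subsetT _ _) lw).
(* [w] is the dimension modulo the N-th powers and [r] that of the truncated ideal in it; as long as
   [r] of its elements stay independent, the quotient has dimension at most w - r <= m. *)
have wr : (w <= m + r)%N by apply: steinitz sH gw (dle_trans (@subsetT _ _) le lr).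
have [v Jv iv] := gr.
have /choice[h hh] i : exists h : 'I_n -> P, high N (v i - \sum_j h j * sparse_system c0 j).
  exact: truncatedP (Jv i).
pose L := #|{: {ffun 'I_n -> 'I_N}}|.
pose G : 'M[Q]_(r, L) := \matrix_(i, k) generic_coef (h i) (low (enum_val k)).
pose ev c : 'M[K]_(r, L) := map_mx (meval (fun k => c (enum_val k))) G.
pose u c i := \sum_j h i j * sparse_system c j.
have evE c i k : ev c i k = mcoeff (low (enum_val k)) (u c i).
  by rewrite !mxE generic_coefE.
have combE c (g : 'I_r -> K) k : ((\row_i g i) *m ev c) 0 k = mcoeff (low (enum_val k)) (comb (u c) g).
  rewrite mxE /comb raddf_sum; apply: eq_bigr => i _.
  by rewrite mxE evE /= mcoeffZ.
have indep c (g : 'I_r -> K) : high N (comb (u c) g) -> (\row_i g i) *m ev c = 0.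
  by move=> hg; apply/rowP => k; rewrite combE mxE low_high.
have row_val (y : 'rV[K]_r) : \row_i y 0 i = y by apply/rowP => i; rewrite mxE.
have free0 : row_free (ev c0).
  apply: inj_row_free => y y0; apply/rowP => i; rewrite [RHS]mxE.
  apply: (iv (fun i => y 0 i)).
  have hu : high N (comb (u c0) (fun i => y 0 i)).
    apply: high_low => b; have := combE c0 (fun i => y 0 i) (enum_rank b).
    by rewrite row_val y0 mxE enum_rankK => <-.
  apply: (subC sH) hu; rewrite /comb -sumrB; apply: sub_sum => // k _.
  by rewrite -scalerBr; apply: (subZ sH); apply: hh.
have [f [g fg]] := minor_exists (ev c0).
have detE c : meval (fun k => c (enum_val k)) (\det (mxsub f g G)) = \det (mxsub f g (ev c)).
  by rewrite -det_map_mx; congr (\det _); apply/matrixP => i k; rewrite !mxE.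
exists (\det (mxsub f g G)); first by rewrite detE.
move=> c; rewrite detE => /rank_minor rk; apply: local_of_truncated.
have freec : row_free (ev c).
  rewrite /row_free eqn_leq rank_leq_row /=; apply: leq_trans rk.
  by move: free0; rewrite /row_free => /eqP ->.
have gc : dge (truncated c N) (high N) r.
  exists (u c) => [i|y hy].
    by apply: sub_gens; apply/sysIP; exists (h i).
  have /(row_free_inj freec) e : (\row_i y i) *m ev c = 0 *m ev c by rewrite mul0mx; apply: indep.
  by move=> i; have /rowP/(_ i) := e; rewrite !mxE.
have bound a : dge setT (truncated c N) a -> (a <= m)%N.
  move=> ga; have := steinitz sH (dge_trans (sJ c) (HJ c) (@subsetT _ _) ga gc) lw.
  by move=> h'; rewrite -(leq_add2r r); apply: leq_trans h' wr.
have [a am [_ la]] := dge_max (sJ c) bound.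
by apply: dle_le la.
Qed.

End ZariskiOpen.

(** * Systems with coefficients on the curves *)

Section Special.
Variables (K : numFieldType) (n d : nat) (t0 : bmultinom n d) (A : 'I_n -> {fset 'NN^n}).
Hypothesis Ad : forall j a, a \in A j -> (mdeg a < d)%N.
Local Notation M := 'NN^n.
Local Notation T := (coef_index A).

Definition coef_rank (t : T) : 'I_#|{: 'I_n * bmultinom n d}| :=
  enum_rank (tag t, insubd t0 (val (tagged t))).

Definition special N (us : seq K) (t : T) : K := us`_(tag t) ^+ (N ^ coef_rank t).

Lemma coef_rank_inj : injective coef_rank.
Proof.
move=> [i a] [j b] /enum_rank_inj [/= ij]; move: b; rewrite -ij => b e.
have := congr1 (@bmnm n d) e.
rewrite !bmnm_insubd; [|exact: Ad (valP b)|exact: Ad (valP a)].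
by move=> /val_inj ->.
Qed.

Lemma VG_special (p : {mpol K[#|T|]}) N : p != 0 -> (msize p <= N)%N ->
  VG n (fun us => meval (fun k => special N us (enum_val k)) p != 0).
Proof.
move=> p0 pN.
apply: (@VG_nonvanishing K _ n _ N (fun k : 'I_#|T| => tag (enum_val k))
  (fun k => coef_rank (enum_val k)) p) => // k l /coef_rank_inj.
exact: enum_val_inj.
Qed.

Lemma sparse_special N us : sparse_system (special N us) = member d N A us.
Proof.
apply/funext => j; rewrite /member spec_curve; last by move=> a; apply: Ad.
pose G (a : M) : {mpol K[n]} := us`_j ^+ expo N j (insubd t0 a) *: mpolyX K a.
transitivity (\sum_(a <- A j) G a); first by rewrite big_seq_fsetE.
transitivity (\sum_(t : bmultinom n d | bmnm t \in A j) G (bmnm t)); last first.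
  apply: eq_bigr => t tA; rewrite /G; congr (_ ^+ expo N j _ *: _).
  by apply/val_inj; apply: bmnm_insubd; apply: Ad tA.
rewrite -[RHS]big_filter -[RHS](big_map (@bmnm n d) predT G).
apply: perm_big; apply: uniq_perm; first exact: fset_uniq.
  rewrite map_inj_uniq; first by rewrite filter_uniq// index_enum_uniq.
  by move=> a b /val_inj.
move=> a; apply/idP/mapP => [aA|[t]].
  exists (insubd t0 a); last by rewrite bmnm_insubd//; apply: Ad aA.
  by rewrite mem_filter mem_index_enum bmnm_insubd ?aA//; apply: Ad aA.
by rewrite mem_filter => /andP[tA _] ->.
Qed.

End Special.

(** * Consequences of the hypotheses on the supports *)

Section Degrees.
Variables (n : nat) (A : 'I_n -> {fset 'NN^n}).
Hypothesis n0 : (0 < n)%N.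

Lemma degree_bound : exists d, forall j a, a \in A j -> (mdeg a < d)%N.
Proof.
exists (\max_j \max_(a <- A j) mdeg a).+1 => j a aA; rewrite ltnS.
apply: leq_trans (leq_bigmax (F := fun j => \max_(a <- A j) mdeg a) j)%N.
by rewrite (big_rem a aA) leq_maxl.
Qed.

(** (H2) for the empty [I], where [J_] lists the nonempty supports. *)
Lemma H2_nonempty : H2 A -> forall j, exists a, a \in A j.
Proof.
move=> h j; have := h finset.set0; rewrite cards0 add0n => le.
have e : J_ A finset.set0 = [set: 'I_n]%SET.
  by apply/eqP; rewrite eqEcard finset.subsetT cardsT card_ord.
have : j \in J_ A finset.set0 by rewrite e inE.
by rewrite inE => /existsP[a _]; exists (val a); apply: valP.
Qed.

(** (H2) for the complement of {i} provides a point on the i-th axis, and (H1) makes it nonzero. *)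
Lemma H2_axes : H1 A -> H2 A -> axes A.
Proof.
move=> h1 h2 i; have := h2 (~: [set i])%SET; rewrite cardsCs finset.setCK cards1 card_ord.
move=> le; have : (0 < #|J_ A (~: [set i])%SET|)%N by lia.
rewrite card_gt0 => /set0Pn[j]; rewrite inE => /existsP[a /forallP ha].
exists j, (val a i).
have aE : mnm_muln (mnm1 i) (val a i) = val a.
  apply/mnmP => k; rewrite mulmnE mnm1E; case: eqVneq => [<-|ne]; first by rewrite mul1n.
  have := ha k; rewrite !inE eq_sym ne /= => /eqP ->; by rewrite mul0n.
split; last by rewrite aE; apply: valP.
rewrite lt0n; apply/eqP => a0; have := h1 j; rewrite -(_ : val a = mnm0) ?(valP a)//.
by rewrite -aE a0 mulm0n.
Qed.

Lemma sparse_at0 (K : numFieldType) (c : coef_index A -> K) j : H1 A ->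
  mcoeff mnm0 (sparse_system c j) = 0.
Proof.
move=> h1; rewrite /sparse_system raddf_sum big1//= => a _; rewrite mcoeffZ mcoeffX.
case: eqP => [a0|_]; last by rewrite mulr0.
by have := h1 j; rewrite -a0 (valP a).
Qed.

End Degrees.

(** * The generic multiplicity and its value *)

Section Main.
Variables (R : realType) (n : nat) (A : 'I_n -> {fset 'NN^n}).
Hypothesis n0 : (0 < n)%N.
Hypothesis A_H1 : H1 A.
Hypothesis A_H2 : H2 A.
Local Notation K := R[i].
Local Notation P := {mpol K[n]}.
Local Notation T := (coef_index A).
Local Notation loc0 := (@loc0 K n).
Local Notation mult c m := (qdim setT (sat loc0 (sysI (@sparse_system K n A c))) m).

Let ncK := @uncountable_complex R.

Lemma zero_mnm d : (0 < d)%N -> inhabited (bmultinom n d).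
Proof. by move=> d0; constructor; apply: (@BMultinom n d mnm0); rewrite mdeg0. Qed.

(** [N] is at least the size of [p], as Kronecker substitution requires; [b] makes room in [d] for
    the exponent of [Delta]. *)
Lemma choose_special (p : {mpol K[#|T|]}) (b : nat) : p != 0 ->
  exists d (t0 : bmultinom n d) N, [/\ (1 < N)%N, (b < d)%N,
    forall j a, a \in A j -> (mdeg a < d)%N
  & VG n (fun us => meval (fun k => special t0 N us (enum_val k : T)) p != 0)].
Proof.
move=> p0; have [D hD] := degree_bound A.
pose d := (maxn D b.+1)%N.
have hd j a : a \in A j -> (mdeg a < d)%N.
  by move=> aA; apply: leq_trans (hD j a aA) (leq_maxl _ _).
have bd : (b < d)%N by apply: leq_maxr.
have [t0] : inhabited (bmultinom n d) by apply: zero_mnm; apply: leq_ltn_trans bd.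
exists d, t0, (maxn 2 (msize p)); split=> //; first exact: leq_maxl.
by apply: VG_special => //; apply: leq_maxr.
Qed.

Lemma exists_mult (p : {mpol K[#|T|]}) : p != 0 -> exists c m,
  meval (fun k => c (enum_val k)) p != 0 /\ mult c m.
Proof.
move=> p0; have [d [t0 [N [N1 _ hd vg]]]] := choose_special 0 p0.
have [us su [pus [m hm]]] := VG_ex ncK (VG_and vg (VG_powers R K t0 N1 n0 hd A_H2)).
pose c : T -> K := special t0 N us.
have iS : ideal (sat loc0 (sysI (sparse_system c))).
  by apply: ideal_sat; [exact: mulset_loc0|exact: ideal_sysI].
have [|w qw] := @finite_of_powers K n _ m n0 iS.
  by move=> l; have := hm l; rewrite /c sparse_special// sys_member.
by exists c, w.
Qed.

Lemma nonzero_coefs : exists2 p : {mpol K[#|T|]}, p != 0 &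
  forall c : T -> K, meval (fun k => c (enum_val k)) p != 0 -> forall t, c t != 0.
Proof.
exists (mpolyX K (Multinom [tuple 1%N | k < #|T|])).
  by rewrite -msupp_eq0 msuppX.
move=> c; rewrite mevalX => /prodf_neq0 h t; have := h (enum_rank t) isT.
by rewrite enum_rankK multinomE tnth_mktuple expr1.
Qed.

Lemma minimal_mult : exists m, (exists c, mult c m) /\ forall c k, mult c k -> (m <= k)%N.
Proof.
have [p p0 _] := nonzero_coefs; have [c [m [_ hm]]] := exists_mult p0.
have ex : exists m, `[< exists c, mult c m >] by exists m; apply/asboolP; exists c.
case: (ex_minnP ex) => m' /asboolP hm' min; exists m'; split=> // c' k hk.
by apply: min; apply/asboolP; exists c'.
Qed.

(** Take a system of least multiplicity: by [mult_open] the multiplicity does not increase on an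
    open set around it, and by minimality it does not decrease. *)
Lemma generic_mult : exists m (p : {mpol K[#|T|]}), p != 0 /\ forall c : T -> K,
  meval (fun k => c (enum_val k)) p != 0 -> (forall t, c t != 0) /\ mult c m.
Proof.
have [m [[c0 [_ le]] min]] := minimal_mult.
have [p hp0 hp] := mult_open n0 le; have [q q0 hq] := nonzero_coefs.
exists m, (p * q); split.
  by rewrite mulf_neq0//; apply: contraNneq hp0 => ->; rewrite raddf0.
move=> c; rewrite mevalM mulf_eq0 negb_or => /andP[/hp lc /hq nz]; split=> //.
have sS : subspace (sat loc0 (sysI (sparse_system c))).
  by apply/subspace_ideal/ideal_sat; [exact: mulset_loc0|exact: ideal_sysI].
have [k km qk] := dim_exists sS lc.
by have := min c k qk => mk; rewrite (_ : m = k)//; apply/eqP; rewrite eqn_leq km mk.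
Qed.

(** The conclusion concerns numbers only, so a single very generic system on the curves inside the
    open set proves it. *)
Lemma mixed_volumes m e (p : {mpol K[#|T|]}) : p != 0 ->
  (forall c : T -> K, meval (fun k => c (enum_val k)) p != 0 -> mult c m) -> (m < e)%N ->
  m%:R = MV R (add_zero (add_Delta e A)) - MV R (add_Delta e A) /\
  exists k : nat, MV R (add_zero A) - MV R A = (m + k)%:R.
Proof.
move=> p0 hp me; have [d [t0 [N [N1 ed hd vg]]]] := choose_special e p0.
have := VG_and vg (VG_multiplicity R t0 ncK N1 n0 hd (H2_nonempty A_H2)
  (H2_axes n0 A_H1 A_H2) me ed).
move=> /(VG_ex ncK)[us su [pus h]]; apply: h.
by have := hp _ pus; rewrite sparse_special// sys_member.
Qed.

End Main.

Theorem proposition12 (R : realType) (n : nat) (A : 'I_n -> {fset 'NN^n})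
    (n_gt0 : (0 < n)%N) (A_H1 : H1 A) (A_H2 : H2 A) :
  for_generic_system A (fun f : 'I_n -> {mpol R[i][n]} =>
    isolated_zero f 0 /\
    exists2 mult : nat, has_mult f 0 mult &
      let holds_at (M : nat) :=
        mult%:R = MV R (add_zero (add_Delta M A)) - MV R (add_Delta M A) in
      [/\ exists M0 : nat, forall M : nat,
            (0 < M)%N -> (M0 <= M)%N -> holds_at M,
          forall M : nat, (mult < M)%N -> holds_at M
        & exists M : nat,
            [/\ (0 < M)%N, M%:R = MV R (add_zero A) - MV R A + 1
              & holds_at M]]).
Proof.
have [m [p [p0 hp]]] := generic_mult R n_gt0 A_H2.
have mv e : (m < e)%N -> m%:R = MV R (add_zero (add_Delta e A)) - MV R (add_Delta e A) /\
    exists k : nat, MV R (add_zero A) - MV R A = (m + k)%:R.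
  move=> me; apply: (mixed_volumes n_gt0 A_H1 A_H2 p0 _ me) => c /hp[_].
  exact.
pose U : set (coef_index A -> R[i]) := [set c | meval (fun k => c (enum_val k)) p != 0].
exists U; split.
- exists [set p]; apply/seteqP; split=> c.
    by move=> /= cp h; move/eqP: cp; apply; apply: h.
  move=> /= h; apply/negP => /eqP e; apply: h => q ->; exact: e.
- have [c [k [cp _]]] := exists_mult n_gt0 A_H2 p0; by exists c.
move=> c /hp[nz qm]; split=> //.
have iI := ideal_sysI (sparse_system c).
have pw l := power_in_sat l iI qm.2.
split; first by apply: (isolated_of (m := m)) pw => j; apply: sparse_at0.
exists m; first exact: has_mult_of.
split.
- by exists m.+1 => M _ hM; apply: (mv M hM).1.
- by move=> M hM; apply: (mv M hM).1.
(* The difference of mixed volumes is the natural number m + k, so one more exceeds the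
   multiplicity. *)
have [_ [k hk]] := mv m.+1 (leqnn _); exists (m + k).+1; split=> //.
  by rewrite hk natr1.
by apply: (mv _ _).1; rewrite ltnS leq_addr.
Qed.
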